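(* Let $d\ge 1$ be an integer and fix a real number $\lambda>0$. Then for each $\phi\in L^{1}(\mathbb{B}^{d},\tau)$ there exists a unique Hilbert--Schmidt operator on $H(\mathbb{B}^{d},\lambda)$, denoted $T_{\phi}$, with the property that $$\left\langle f,T_{\phi}g\right\rangle_{\lambda}=c_{\lambda}\int_{\mathbb{B}^{d}}\overline{f(z)}\,\phi(z)\,g(z)\,(1-|z|^{2})^{\lambda}\,d\tau(z)$$ for all bounded holomorphic functions $f$ and $g$ in $H(\mathbb{B}^{d},\lambda)$. The Hilbert--Schmidt norm of $T_{\phi}$ satisfies $$\left\Vert T_{\phi}\right\Vert_{HS}\leq |c_{\lambda}|\,\left\Vert \phi\right\Vert_{L^{1}(\mathbb{B}^{d},\tau)}.$$
   Context: $\mathbb{B}^{d}$ is the open unit ball in $\mathbb{C}^{d}$, $dz$ is $2d$-dimensional Lebesgue measure, and $d\tau(z)=(1-|z|^{2})^{-(d+1)}\,dz$ is the hyperbolic volume measure. For $\lambda>0$ put $c_{\lambda}=\Gamma(\lambda)/(\pi^{d}\Gamma(\lambda-d))$, interpreted as $0$ if $\lambda$ is an integer with $\lambda\le d$. For $\sigma>d$, $\mu_\sigma$ is the probability measure $d\mu_{\sigma}(z)=c_{\sigma}(1-|z|^{2})^{\sigma}\,d\tau(z)$, and $\mathcal{H}L^{2}(\mathbb{B}^{d},\mu_{\sigma})$ is the space of holomorphic functions on $\mathbb{B}^d$ that are square-integrable with respect to $\mu_\sigma$, with the $L^2$ inner product. All inner products are conjugate-linear in the first variable. Let $N=\sum_{j=1}^{d}z_{j}\,\partial/\partial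 z_{j}$. The generalized Bergman space $H(\mathbb{B}^{d},\lambda)$, $\lambda>0$: choose a non-negative integer $n$ with $\lambda+2n>d$; then $H(\mathbb{B}^{d},\lambda)$ is the set of holomorphic $f$ on $\mathbb{B}^d$ with $N^{k}f\in\mathcal{H}L^{2}(\mathbb{B}^{d},\mu_{\lambda+2n})$ for $0\le k\le n$, with the inner product $\langle f,g\rangle_{\lambda}=\langle Af,Bg\rangle_{\mathcal{H}L^{2}(\mathbb{B}^{d},\mu_{\lambda+2n})}$, where $A=(I+\frac{N}{\lambda+n})(I+\frac{N}{\lambda+n+1})\cdots(I+\frac{N}{\lambda+2n-1})$ and $B=(I+\frac{N}{\lambda})(I+\frac{N}{\lambda+1})\cdots(I+\frac{N}{\lambda+n-1})$. This is a Hilbert space which, together with its inner product, does not depend on the choice of $n$. *)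

(* Defs.v *)
From HB Require Import structures.
From mathcomp Require Import all_boot all_order all_algebra.
From mathcomp Require Import complex.
From mathcomp Require Import all_classical all_reals all_analysis.
From mathcomp Require Import measurable_realfun.
From mathcomp Require Import ring lra.

Set Implicit Arguments.
Unset Strict Implicit.
Unset Printing Implicit Defensive.

Import Order.TTheory GRing.Theory Num.Theory.
Import ComplexField.
Import numFieldNormedType.Exports.

Local Open Scope classical_set_scope.
Local Open Scope ring_scope.

(* The library's canonical sigma-finite structure on [m1 \x m2] is only
   inferred for subprobabilities, hence this wrapper. *)
Section SigmaFiniteProduct.
Local Open Scope ereal_scope.
Context d1 d2 (T1 : measurableType d1) (T2 : measurableType d2) (R : realType).
Variable m1 : {sigma_finite_measure set T1 -> \bar R}.
Variable m2 : {sigma_finite_measure set T2 -> \bar R}.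

Definition sfprod : set (T1 * T2) -> \bar R := m1 \x m2.

HB.instance Definition _ := Measure.on sfprod.

Let sfprod_sigma_finite : sigma_finite setT sfprod.
Proof.
have /sigma_finiteP[F [TF ndF Foo]] := sigma_finiteT m1.
have /sigma_finiteP[G [TG ndG Goo]] := sigma_finiteT m2.
exists (fun n => F n `*` G n).
  rewrite -setXTT TF TG predeqE => -[x y]; split.
    move=> [/= [n _ Fnx] [k _ Gky]]; exists (maxn n k) => //; split.
    - by move: x Fnx; exact/subsetPset/ndF/leq_maxl.
    - by move: y Gky; exact/subsetPset/ndG/leq_maxr.
  by move=> [n _ []/= ? ?]; split; exists n.
move=> k; have [? ?] := Foo k; have [? ?] := Goo k.
split; first exact: measurableX.
by rewrite /sfprod product_measure1E// lte_mul_pinfty// ge0_fin_numE.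
Qed.

HB.instance Definition _ := Measure_isSigmaFinite.Build _ _ _ sfprod
  sfprod_sigma_finite.

End SigmaFiniteProduct.

(* The n-fold product of a measure, on n-tuples. *)
Section MeasurePower.
Context {disp : measure_display} {T : measurableType disp} {R : realType}.
Local Open Scope ereal_scope.

Definition tcons (n : nat) (x : T * n.-tuple T) : n.+1.-tuple T :=
  [tuple of x.1 :: x.2].

Lemma measurable_tcons n : measurable_fun [set: T * n.-tuple T] (@tcons n).
Proof. exact: measurable_cons. Qed.

Section Step.
Variables (mu : {sigma_finite_measure set T -> \bar R}) (n : nat).
Variable nu : {sigma_finite_measure set (n.-tuple T) -> \bar R}.

Definition mpow_step : set (n.+1.-tuple T) -> \bar R :=
  pushforward (sfprod mu nu) (@tcons n).

Let mpow_step0 : mpow_step set0 = 0.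
Proof. by rewrite /mpow_step /pushforward preimage_set0 measure0. Qed.

Let mpow_step_ge0 A : 0 <= mpow_step A.
Proof. exact: (@measure_ge0 _ _ _ (sfprod mu nu)). Qed.

Let mpow_step_sigma_additive : semi_sigma_additive mpow_step.
Proof.
move=> F mF tF mUF; rewrite /mpow_step /pushforward preimage_bigcup.
have mpre B : measurable B -> measurable (@tcons n @^-1` B).
  by move=> mB; rewrite -[X in measurable X]setTI; exact: measurable_tcons.
apply: (@measure_semi_sigma_additive _ _ _ (sfprod mu nu)).
- by move=> k; exact: mpre.
- apply/trivIsetP => /= i j _ _ ij; rewrite -preimage_setI.
  by move/trivIsetP : tF => /(_ _ _ _ _ ij) ->//; rewrite preimage_set0.
- by rewrite -preimage_bigcup; exact: mpre.
Qed.

HB.instance Definition _ := isMeasure.Build _ _ _ mpow_step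
  mpow_step0 mpow_step_ge0 mpow_step_sigma_additive.

Let mpow_step_sigma_finite : sigma_finite setT mpow_step.
Proof.
have [F FT Foo] := sigma_finiteT (sfprod mu nu).
pose g (t : n.+1.-tuple T) : T * n.-tuple T := (thead t, [tuple of behead t]).
have mg : measurable_fun setT g.
  apply/measurable_fun_pairP; split; first exact: measurable_tnth.
  exact: measurable_behead.
have gK x : g (tcons x) = x.
  by case: x => a b; rewrite /g /tcons theadE; congr pair; exact: val_inj.
exists (fun k => g @^-1` F k).
  by rewrite -preimage_bigcup -FT preimage_setT.
move=> k; have [mF Fk] := Foo k; split.
  by rewrite -[X in measurable X]setTI; exact: mg.
rewrite /mpow_step /pushforward -comp_preimage.
by rewrite (_ : g \o @tcons n = id)//; apply/funext => x /=; exact: gK.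
Qed.

HB.instance Definition _ := Measure_isSigmaFinite.Build _ _ _ mpow_step
  mpow_step_sigma_finite.

End Step.

Fixpoint mpow (mu : {sigma_finite_measure set T -> \bar R}) (n : nat) :
    {sigma_finite_measure set (n.-tuple T) -> \bar R} :=
  match n with
  | 0 => \d_ ([tuple] : 0.-tuple T)
  | m.+1 => mpow_step mu (mpow mu m)
  end.

End MeasurePower.

(* R[i] seen as a numFieldType: the topology of R[i] and of row vectors over it
   is only inferred through this structure. *)
Notation Cplx R := (Num.NumField.sort (complex R)).

Section UnitBall.
Variables (R : realType) (d : nat).

Definition sqnorm (z : 'rV[Cplx R]_d) : R := \sum_j Normc.normc (z 0 j) ^+ 2.

Definition unit_ball : set 'rV[Cplx R]_d := [set z | sqnorm z < 1].

(* Real coordinates on C^d: z_j = x_j + i y_j is stored as the pair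
   (x_j, y_j). *)
Definition coords := d.-tuple (measurableTypeR R * measurableTypeR R)%type.

Definition cvec (u : coords) : 'rV[Cplx R]_d :=
  \row_j ((tnth u j).1 +i* (tnth u j).2)%C.

Definition cball : set coords := cvec @^-1` unit_ball.

(* 2d-dimensional Lebesgue measure dz. *)
Definition leb2d : {sigma_finite_measure set coords -> \bar R} :=
  mpow (sfprod (@lebesgue_measure R) (@lebesgue_measure R)) d.

Lemma sqnorm_cvec (u : coords) :
  sqnorm (cvec u) = \sum_j ((tnth u j).1 ^+ 2 + (tnth u j).2 ^+ 2).
Proof.
apply: eq_bigr => j _; rewrite mxE /= sqr_sqrtr//.
by rewrite addr_ge0// sqr_ge0.
Qed.

Lemma measurable_sqnorm_cvec :
  measurable_fun setT (fun u : coords => sqnorm (cvec u)).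
Proof.
under eq_fun do rewrite sqnorm_cvec.
apply: measurable_sum => j; apply: measurable_funD; apply: measurable_funX.
  by apply: (measurableT_comp measurable_fst); exact: measurable_tnth.
by apply: (measurableT_comp measurable_snd); exact: measurable_tnth.
Qed.

Lemma measurable_cball : measurable cball.
Proof.
rewrite -[X in measurable X]setTI.
have -> : [set: coords] `&` cball =
    setT `&` (fun u : coords => sqnorm (cvec u)) @^-1` `]-oo, 1[%classic.
  by congr (_ `&` _); apply/seteqP; split => u /=; rewrite in_itv.
by apply: measurable_sqnorm_cvec => //; exact: measurable_itv.
Qed.

Lemma measurable_weight (a : R) :
  measurable_fun setT (fun u : coords => (1 - sqnorm (cvec u)) `^ a).
Proof.
apply: (measurableT_comp (measurable_powR a)).
by apply: measurable_funB => //; exact: measurable_sqnorm_cvec.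
Qed.

Definition tau (A : set coords) : \bar R :=
  (\int[leb2d]_(u in A `&` cball)
     ((1 - sqnorm (cvec u)) `^ (- d.+1%:R))%:E)%E.

Let tau0 : tau set0 = 0%E.
Proof. by rewrite /tau set0I integral_set0. Qed.

Let tau_ge0 A : (0 <= tau A)%E.
Proof. by apply: integral_ge0 => u _; rewrite lee_fin powR_ge0. Qed.

Let tau_sigma_additive : semi_sigma_additive tau.
Proof.
move=> A mA tA mUA; rewrite /tau setI_bigcupl ge0_integral_bigcup.
- by apply: is_cvg_ereal_nneg_natsum_cond => n _ _; exact: tau_ge0.
- by move=> i; apply: measurableI => //; exact: measurable_cball.
- apply/measurable_EFinP/measurable_funTS; exact: measurable_weight.
- by move=> u _; rewrite lee_fin powR_ge0.
- exact: trivIset_setIr.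
Qed.

HB.instance Definition _ := isMeasure.Build _ _ _ tau
  tau0 tau_ge0 tau_sigma_additive.

Definition Cintegral (m : {measure set coords -> \bar R}) (A : set coords)
    (h : coords -> Cplx R) : Cplx R :=
  ((\int[m]_(u in A) complex.Re (h u)) +i*
   (\int[m]_(u in A) complex.Im (h u)))%C.

End UnitBall.

Section GammaConstant.
Context {R : realType}.

Definition Gamma_int (x : R) : R :=
  \int[lebesgue_measure]_(t in `]0, +oo[) (t `^ (x - 1) * expR (- t)).

(* Euler's integral, extended to x <= 0 by the functional equation
   Gamma (x + 1) = x * Gamma x; at the poles 0, -1, -2, ... the value is the
   conventional 0. *)
Definition Gamma (x : R) : R :=
  let m := if 0 < x then 0%N else (Num.truncn (- x)).+1 in
  Gamma_int (x + m%:R) / \prod_(i < m) (x + i%:R).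

Definition clam (d : nat) (lam : R) : R :=
  if (lam \is a Num.int) && (lam <= d%:R) then 0
  else Gamma lam / (pi ^+ d * Gamma (lam - d%:R)).

End GammaConstant.


Section LocalDifferentiability.
Context {K : numFieldType} {V W : normedModType K}.

Lemma near0_differentiable (f : V -> W) (z : V) :
  (\near z, f z = 0) -> differentiable f z.
Proof.
move=> f0; have fz : f z = 0 by exact: nbhs_singleton f0.
have fo : f \o shift z = cst (f z) + (\0 : V -> W) +o_ 0 id.
  apply/eqaddoP => _/posnumP[eps].
  have : \forall h \near 0, f (h + z) = 0.
    by move: f0; rewrite (near_shift 0) subr0; apply: filterS => h.
  apply: filterS => h fh.
  by rewrite !fctE /= fh fz addr0 subr0 normr0 mulr_ge0.
have df : 'd f z = \0 :> (V -> W).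
  by apply: (@diff_unique _ _ _ _ \0) fo => //; exact: cst_continuous.
apply/diff_locallyP; rewrite df; split=> //; exact: cst_continuous.
Qed.

Lemma near_eq_differentiable (f g : V -> W) (z : V) :
  (\near z, f z = g z) -> differentiable f z -> differentiable g z.
Proof.
move=> fg df; rewrite -[g](subrK f); apply: differentiableD => //.
by apply: near0_differentiable; apply: filterS fg => w fgw; rewrite !fctE fgw subrr.
Qed.
End LocalDifferentiability.

Section HolomorphicL2.
Variables (R : realType) (d : nat).
Local Notation Cd := 'rV[Cplx R]_d.
Local Notation fct := (Cd -> Cplx R).
Implicit Types f g : fct.

Definition holomorphic f : Prop :=
  forall z, unit_ball z -> differentiable f z.

Definition bounded_on_ball f : Prop :=
  exists M : R, forall z, unit_ball z -> Normc.normc (f z) <= M.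

Definition eulerN f : fct := fun z => \sum_j z 0 j * 'D_'e_j f z.

(* The density of mu_sigma with respect to tau. *)
Definition mu_density (sigma : R) (u : coords R d) : R :=
  clam d sigma * (1 - sqnorm (cvec u)) `^ sigma.

(* The two measurability clauses are part of what square-integrability of a
   complex function means; integrability of |f|^2 alone does not imply them. *)
Definition HL2 (sigma : R) f : Prop :=
  [/\ holomorphic f,
      measurable_fun (@cball R d) (fun u => complex.Re (f (cvec u))),
      measurable_fun (@cball R d) (fun u => complex.Im (f (cvec u))) &
      (@tau R d).-integrable (@cball R d)
        (fun u => (mu_density sigma u * Normc.normc (f (cvec u)) ^+ 2)%:E)].

Definition HL2_inner (sigma : R) f g : Cplx R :=
  Cintegral (@tau R d) (@cball R d)
    (fun u => (mu_density sigma u)%:C%C * ((f (cvec u))^*%C * g (cvec u))).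

(* The operator I + N / a. *)
Definition shiftN (a : R) f : fct := f + (a^-1)%:C%C *: eulerN f.

Definition opA (lam : R) (n : nat) : fct -> fct :=
  \big[(fun F G => F \o G)/idfun]_(i < n) shiftN (lam + n%:R + i%:R).

Definition opB (lam : R) (n : nat) : fct -> fct :=
  \big[(fun F G => F \o G)/idfun]_(i < n) shiftN (lam + i%:R).

(* N^k f lies in HL2(mu_(lam + 2n)) for all k <= n.
   Elements are represented by functions on C^d vanishing off the ball, so that
   equality of representatives is equality of functions on the ball. *)
Definition bergman_pred (lam : R) (n : nat) : {pred fct} := fun f =>
  `[< (forall z, ~ unit_ball z -> f z = 0) /\
      (forall k, (k <= n)%N -> HL2 (lam + (2 * n)%:R) (iter k eulerN f)) >].

Lemma normc_ge0 (x : R[i]) : 0 <= Normc.normc x.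
Proof. by case: x => a b; exact: sqrtr_ge0. Qed.

Lemma unit_ball_open : open (@unit_ball R d).
Proof.
rewrite openE => z zB.
pose e : R := (1 - sqnorm z) / (3 * d%:R + 1).
have d0 : 0 <= 3 * d%:R :> R by rewrite mulr_ge0.
have d3 : 0 < 3 * d%:R + 1 :> R by rewrite ltr_wpDl.
have e0 : 0 < e by rewrite divr_gt0// subr_gt0.
have s0 j : Normc.normc (z 0 j) ^+ 2 <= sqnorm z.
  rewrite /sqnorm (bigD1 j)//= lerDl; apply: sumr_ge0 => k _; exact: sqr_ge0.
have e1 : e <= 1.
  rewrite ler_pdivrMr// mul1r lerBlDr.
  have : 0 <= sqnorm z by apply: sumr_ge0 => j _; exact: sqr_ge0.
  lra.
have ed : sqnorm z + d%:R * (3 * e) < 1.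
  have : e * (3 * d%:R + 1) = 1 - sqnorm z by rewrite divfK ?gt_eqF.
  nra.
apply/nbhs_ballP; exists (e%:C)%C; first by rewrite /= ltcR.
move=> w [_ zw]; rewrite /unit_ball /=; apply: le_lt_trans ed.
have -> : d%:R * (3 * e) = \sum_(j < d) (3 * e).
  by rewrite sumr_const card_ord mulr_natl.
rewrite -big_split/=; apply: ler_sum => j _.
move: (zw 0 j); rewrite -ball_normE /ball_/= => zwj.
have {}zwj : Normc.normc (z 0 j - w 0 j) < e by rewrite -ltcR.
have z1 : Normc.normc (z 0 j) < 1.
  rewrite -(@ltr_pXn2r _ 2)// ?nnegrE ?normc_ge0// expr1n.
  exact: le_lt_trans (s0 j) zB.
have wz : Normc.normc (w 0 j) <= Normc.normc (z 0 j) + e.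
  rewrite -[w 0 j](subKr (z 0 j)); apply: le_trans (le_normcD _ _) _.
  by rewrite normcN lerD2l ltW.
have := normc_ge0 (w 0 j); have := normc_ge0 (z 0 j); nra.
Qed.

Lemma near_ball f g (z : Cd) :
  (forall w, unit_ball w -> f w = g w) -> unit_ball z -> \near z, f z = g z.
Proof.
by move=> fg zB; apply: filterS fg _; apply: open_nbhs_nbhs; split;
  [exact: unit_ball_open|].
Qed.

Lemma eq_eulerN f g : (forall z, unit_ball z -> f z = g z) ->
  forall z, unit_ball z -> eulerN f z = eulerN g z.
Proof.
move=> fg z zB; apply: eq_bigr => j _.
by rewrite (near_eq_derive 'e_j (near_ball fg zB)).
Qed.

Lemma eulerN_linear (a : Cplx R) f g : holomorphic f -> holomorphic g ->
  forall z, unit_ball z ->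
    eulerN (a *: f + g) z = a * eulerN f z + eulerN g z.
Proof.
move=> hf hg z zB.
have df j : derivable f z 'e_j by apply: diff_derivable; exact: hf.
have dg j : derivable g z 'e_j by apply: diff_derivable; exact: hg.
rewrite /eulerN mulr_sumr -big_split/=; apply: eq_bigr => j _.
rewrite deriveD//; last exact: derivableZ.
by rewrite deriveZ// mulrDr mulrCA.
Qed.

Lemma iter_eulerN_linear (a : Cplx R) f g (k : nat) :
  (forall i, (i < k)%N -> holomorphic (iter i eulerN f)) ->
  (forall i, (i < k)%N -> holomorphic (iter i eulerN g)) ->
  forall z, unit_ball z ->
    iter k eulerN (a *: f + g) z =
    a * iter k eulerN f z + iter k eulerN g z.
Proof.
elim: k => // k IH hf hg z zB /=.
have := eulerN_linear a (hf k (ltnSn k)) (hg k (ltnSn k)) zB.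
apply: eq_trans; apply: eq_eulerN zB => w wB; apply: IH wB => i ik.
  exact/hf/ltnW.
exact/hg/ltnW.
Qed.

Lemma eq_HL2 (sigma : R) f g : (forall z, unit_ball z -> f z = g z) ->
  HL2 sigma f -> HL2 sigma g.
Proof.
move=> fg [hf mRe mIm intf].
have fgu u : u \in @cball R d -> f (cvec u) = g (cvec u).
  by move=> /set_mem uB; exact: fg.
split.
- move=> z zB; apply: near_eq_differentiable (hf z zB); exact: near_ball.
- by apply: eq_measurable_fun mRe => u uB /=; rewrite fgu.
- by apply: eq_measurable_fun mIm => u uB /=; rewrite fgu.
- by apply: eq_integrable intf => //=; [exact: measurable_cball
    | move=> u uB; rewrite fgu].
Qed.

Lemma normc_sq (x : R[i]) :
  Normc.normc x ^+ 2 = complex.Re x ^+ 2 + complex.Im x ^+ 2.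
Proof. by case: x => a b /=; rewrite sqr_sqrtr// addr_ge0// sqr_ge0. Qed.

Lemma normc_lin_sq (a x y : R[i]) :
  Normc.normc (a * x + y) ^+ 2 <=
  2 * Normc.normc a ^+ 2 * Normc.normc x ^+ 2 + 2 * Normc.normc y ^+ 2.
Proof.
rewrite -mulrA -exprMn -Normc.normcM; move: (a * x) => {a}x.
rewrite !normc_sq; case: x y => [a b] [c e] /=; rewrite -subr_ge0.
suff -> : 2 * (a ^+ 2 + b ^+ 2) + 2 * (c ^+ 2 + e ^+ 2) -
  ((a + c) ^+ 2 + (b + e) ^+ 2) = (a - c) ^+ 2 + (b - e) ^+ 2.
  by rewrite addr_ge0// sqr_ge0.
by ring.
Qed.

Lemma HL2_linear (sigma : R) (a : Cplx R) f g :
  HL2 sigma f -> HL2 sigma g -> HL2 sigma (a *: f + g).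
Proof.
move=> [hf mRf mIf intf] [hg mRg mIg intg].
have mRe : measurable_fun (@cball R d)
    (fun u => complex.Re ((a *: f + g) (cvec u))).
  apply: (eq_measurable_fun (fun u => complex.Re a * complex.Re (f (cvec u)) -
    complex.Im a * complex.Im (f (cvec u)) + complex.Re (g (cvec u)))).
    by move=> u _; rewrite !fctE; case: (a) (f _) (g _) => [? ?] [? ?] [? ?].
  by apply: measurable_funD => //; apply: measurable_funB; exact: measurable_funM.
have mIm : measurable_fun (@cball R d)
    (fun u => complex.Im ((a *: f + g) (cvec u))).
  apply: (eq_measurable_fun (fun u => complex.Re a * complex.Im (f (cvec u)) +
    complex.Im a * complex.Re (f (cvec u)) + complex.Im (g (cvec u)))).
    by move=> u _; rewrite !fctE; case: (a) (f _) (g _) => [? ?] [? ?] [? ?].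
  by apply: measurable_funD => //; apply: measurable_funD; exact: measurable_funM.
split; [|exact: mRe|exact: mIm|].
  move=> z zB; apply: differentiableD; last exact: hg zB.
  by apply: differentiableZ; exact: hf zB.
have mB := @measurable_cball R d.
pose F u := (mu_density sigma u * Normc.normc (f (cvec u)) ^+ 2)%:E.
pose G u := (mu_density sigma u * Normc.normc (g (cvec u)) ^+ 2)%:E.
have intFG : (@tau R d).-integrable (@cball R d)
    (fun u => (2 * Normc.normc a ^+ 2)%:E * `|F u| + 2%:E * `|G u|)%E.
  by apply: integrableD => //; apply: integrableZl => //; exact: integrable_abse.
apply: le_integrable intFG => //.
  apply/measurable_EFinP.
  apply: (eq_measurable_fun (fun u => mu_density sigma u *
    (complex.Re ((a *: f + g) (cvec u)) ^+ 2 +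
     complex.Im ((a *: f + g) (cvec u)) ^+ 2))).
    by move=> u _; rewrite normc_sq.
  apply: measurable_funM; last by apply: measurable_funD; exact: measurable_funX.
  apply: measurable_funM => //; apply: measurable_funTS.
  exact: measurable_weight.
move=> u _; rewrite /F /G /= lee_fin.
apply: le_trans (ler_norm _); rewrite !normrM.
set D := `|clam d sigma| * _; have D0 : 0 <= D by rewrite mulr_ge0.
set x := f (cvec u); set y := g (cvec u).
rewrite -!expr2 !real_normK ?num_real//.
apply: le_trans (ler_wpM2l D0 (normc_lin_sq a x y)) _.
by rewrite mulrDr !(mulrCA D).
Qed.

Lemma bergman_submod_closed (lam : R) (n : nat) :
  submod_closed (bergman_pred lam n).
Proof.
have pred0 : (0 : fct) \in bergman_pred lam n.
  apply/asboolP; split=> // k _.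
  have it0 : forall z, unit_ball z -> iter k eulerN (0 : fct) z = 0.
    elim: k => // k IH z zB /=.
    rewrite (eq_eulerN (g := 0) IH zB) /eulerN big1// => j _.
    by rewrite derive_cst mulr0.
  apply: (@eq_HL2 _ 0) => [z zB|]; first by rewrite it0.
  split; [by move=> z _; exact: differentiable_cst|exact: measurable_cst..|].
  apply: (eq_integrable _ (cst 0%E)) => //; first exact: measurable_cball.
    by move=> u _; rewrite normc_sq /= expr0n/= addr0 mulr0.
  exact: integrable0.
split=> // a f g /asboolP[f0 Hf] /asboolP[g0 Hg]; apply/asboolP; split.
  by move=> z zB; rewrite !fctE f0// g0// scaler0 addr0.
move=> k kn.
apply: eq_HL2 (HL2_linear a (Hf k kn) (Hg k kn)) => z zB.
rewrite iter_eulerN_linear// => i ik.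
  by have [] := Hf i (leq_trans (ltnW ik) kn).
by have [] := Hg i (leq_trans (ltnW ik) kn).
Qed.

End HolomorphicL2.

Section HilbertSchmidt.
Context {R : realType} {H : lmodType (Cplx R)}.
Variable ip : H -> H -> Cplx R.

Definition ip_norm (x : H) : R := Num.sqrt (complex.Re (ip x x)).

(* Bases are indexed by nat: the spaces considered here are separable and
   infinite-dimensional. *)
Definition orthonormal_basis (e : nat -> H) : Prop :=
  (forall i j, ip (e i) (e j) = (i == j)%:R) /\
  (forall (x : H) (eps : R), 0 < eps ->
     exists (m : nat) (a : nat -> Cplx R),
       ip_norm (x - \sum_(i < m) a i *: e i) < eps).

Definition bounded_operator (T : H -> H) : Prop :=
  (forall (a : Cplx R) (x y : H), T (a *: x + y) = a *: T x + T y) /\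
  (exists M : R, forall x, ip_norm (T x) <= M * ip_norm x).

Definition hs_norm (e : nat -> H) (T : H -> H) : \bar R :=
  ((\sum_(0 <= i <oo) (ip_norm (T (e i)) ^+ 2)%:E) `^ (2^-1))%E.

Definition hilbert_schmidt (T : H -> H) : Prop :=
  bounded_operator T /\
  (exists2 e : nat -> H, orthonormal_basis e & (hs_norm e T < +oo)%E).

End HilbertSchmidt.

Section Bergman.
Variables (R : realType) (d : nat) (lam : R) (n : nat).

(* The space H(B^d, lam), for a choice of n with lam + 2n > d. *)
Record bergman := Bergman {
  bergman_fun :> 'rV[Cplx R]_d -> Cplx R;
  _ : bergman_fun \in bergman_pred lam n }.

HB.instance Definition _ := [isSub for bergman_fun].
HB.instance Definition _ := [Choice of bergman by <:].
HB.instance Definition _ := GRing.isSubmodClosed.Build _ _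
  (@bergman_pred R d lam n) (@bergman_submod_closed R d lam n).
HB.instance Definition _ := [SubChoice_isSubLmodule of bergman by <:].

Definition bergman_ip (f g : bergman) : Cplx R :=
  HL2_inner (lam + (2 * n)%:R) (opA lam n f) (opB lam n g).

End Bergman.

Section Symbol.
Variables (R : realType) (d : nat).
Implicit Types phi f g : 'rV[Cplx R]_d -> Cplx R.

Definition in_L1_tau phi : Prop :=
  (@tau R d).-integrable (@cball R d)
    (fun u => (complex.Re (phi (cvec u)))%:E) /\
  (@tau R d).-integrable (@cball R d)
    (fun u => (complex.Im (phi (cvec u)))%:E).

Definition L1_norm_tau phi : \bar R :=
  (\int[@tau R d]_(u in @cball R d) (Normc.normc (phi (cvec u)))%:E)%E.

Definition toeplitz_form (lam : R) phi f g : Cplx R :=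
  (clam d lam)%:C%C *
  Cintegral (@tau R d) (@cball R d) (fun u =>
    (f (cvec u))^*%C * phi (cvec u) * g (cvec u)
    * ((1 - sqnorm (cvec u)) `^ lam)%:C%C).

End Symbol.

(* Main.v *)
Require Import Defs.
From HB Require Import structures.
From mathcomp Require Import all_boot all_order all_algebra.
From mathcomp Require Import complex.
From mathcomp Require Import all_classical all_reals all_analysis.
From mathcomp Require Import measurable_realfun.
From mathcomp Require Import ring lra zify.

Set Implicit Arguments.
Unset Strict Implicit.
Unset Printing Implicit Defensive.

Import Order.TTheory GRing.Theory Num.Theory.
Import ComplexField.
Import numFieldNormedType.Exports.

Local Open Scope classical_set_scope.
Local Open Scope ring_scope.

(* Every holomorphic f on the ball is the sum of a power series sum_i a_i z^(al_i),
   and rotation invariance together with the moments of (1 - |z|^2)^sigma makes the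
   monomials orthogonal, so that <f, g>_lambda = sum_i conj(a_i) b_i / kappa_i with
   kappa_i = (lambda)_|al_i| / al_i!: the factors of A and B turn the norm of z^al
   for lambda + 2n into its norm for lambda.  Since sum_i kappa_i |z^(al_i)|^2 is at
   most (1 - |z|^2)^(-lambda), every orthonormal system satisfies
   sum_j |e_j(z)|^2 <= (1 - |z|^2)^(-lambda).  Let Q(f, g) be the integral form.
   T g is the function with coefficients kappa_i Q(z^(al_i), g).  A finite partial
   sum S of sum_(i,j) kappa_i |Q(z^(al_i), e_j)|^2 is |c_lambda int F phi
   (1 - |z|^2)^lambda dtau| for F = sum kappa_i conj(Q(z^(al_i), e_j)) conj(z^(al_i)) e_j,
   and Cauchy-Schwarz with the two kernel bounds gives
   |F(z)| <= sqrt(S) (1 - |z|^2)^(-lambda), hence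
   sqrt(S) <= |c_lambda| ||phi||_1. *)

(** A series is treated as an integral against the counting measure, so that one dominated
    convergence theorem serves circle means, power series and the ball. Holomorphy is bare complex
    differentiability, without continuity of the derivative; hence Goursat's bisection and an
    iterated one-variable Cauchy formula before any expansion exists. Orthogonality of the monomials
    avoids polar coordinates: rotating one coordinate by pi / m is a product of shears. The obstacle
    in the Parseval formula is that the partial sums of a square-integrable series have no evident
    integrable majorant. The density is therefore cut off to the set where the absolute series is at
    most M; that set depends only on the moduli |z_j|, so the monomials stay orthogonal, and M tends
    to infinity afterwards. The operator is built directly from its coefficients, which bypasses
    completeness and Riesz representation. For uniqueness only bounded functions may be tested:
    monomials are bounded, polynomials are dense, and boundedness of the operators and of point
    evaluations does the rest. *)

Notation normc := Normc.normc.
Notation cRe := complex.Re.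
Notation cIm := complex.Im.

(** * Complex integrals *)

Section Modulus.
Variable R : realType.
Implicit Types x y z : R[i].

Lemma normc_re_le x : `|cRe x| <= normc x.
Proof. by case: x => a b /=; rewrite -sqrtr_sqr ler_wsqrtr// lerDl sqr_ge0. Qed.

Lemma normc_im_le x : `|cIm x| <= normc x.
Proof. by case: x => a b /=; rewrite -sqrtr_sqr ler_wsqrtr// lerDr sqr_ge0. Qed.

Lemma normc_le_add x : normc x <= `|cRe x| + `|cIm x|.
Proof.
case: x => a b /=; rewrite -[leRHS]ger0_norm ?addr_ge0// -sqrtr_sqr ler_wsqrtr//.
by rewrite sqrrD !real_normK ?num_real// -addrA [leRHS]addrCA -[leRHS]addrCA lerD2l lerDr
  mulrn_wge0// mulr_ge0.
Qed.

Lemma normc_conj x : normc (x^*)%C = normc x.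
Proof. by case: x => a b /=; rewrite sqrrN. Qed.

Lemma normc_real (a : R) : normc (a%:C)%C = `|a|.
Proof. by rewrite /= expr0n addr0 sqrtr_sqr. Qed.

Lemma normcX x n : normc (x ^+ n) = normc x ^+ n.
Proof. by elim: n => [|n IH]; rewrite ?Normc.normc1// !exprS Normc.normcM IH. Qed.

Lemma normc_eq0E x : (normc x == 0) = (x == 0).
Proof.
by apply/eqP/eqP => [/Normc.eq0_normc//|->]; rewrite Normc.normc0.
Qed.

Lemma normc_gt0 x : (0 < normc x) = (x != 0).
Proof. by rewrite lt_def normc_ge0 andbT normc_eq0E. Qed.

Lemma normc_sum I (s : seq I) (P : pred I) (F : I -> R[i]) :
  normc (\sum_(i <- s | P i) F i) <= \sum_(i <- s | P i) normc (F i).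
Proof.
elim/big_ind2 : _ => [|a b c e ab ce|//]; first by rewrite Normc.normc0.
by apply: le_trans (le_normcD _ _) _; exact: lerD.
Qed.

Lemma normc_prod I (s : seq I) (P : pred I) (F : I -> R[i]) :
  normc (\prod_(i <- s | P i) F i) = \prod_(i <- s | P i) normc (F i).
Proof.
by elim/big_ind2 : _ => [|a b c e <- <-|//]; rewrite ?Normc.normc1// Normc.normcM.
Qed.

Lemma mulc_conj x : ((x^*)%C * x) = ((normc x ^+ 2)%:C)%C.
Proof.
rewrite normc_sq; case: x => a b /=; apply/eqP; rewrite eq_complex /=.
by apply/andP; split; apply/eqP; ring.
Qed.

Lemma ReD x y : cRe (x + y) = cRe x + cRe y. Proof. by case: x y => [? ?] []. Qed.
Lemma ImD x y : cIm (x + y) = cIm x + cIm y. Proof. by case: x y => [? ?] []. Qed.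
Lemma ReM x y : cRe (x * y) = cRe x * cRe y - cIm x * cIm y.
Proof. by case: x y => [? ?] []. Qed.
Lemma ImM x y : cIm (x * y) = cRe x * cIm y + cIm x * cRe y.
Proof. by case: x y => [? ?] []. Qed.
Lemma ReN x : cRe (- x) = - cRe x. Proof. by case: x. Qed.
Lemma ImN x : cIm (- x) = - cIm x. Proof. by case: x. Qed.
Lemma ReJ x : cRe (x^*)%C = cRe x. Proof. by case: x. Qed.
Lemma ImJ x : cIm (x^*)%C = - cIm x. Proof. by case: x. Qed.

Lemma complexP x y : cRe x = cRe y -> cIm x = cIm y -> x = y.
Proof. by case: x y => [? ?] [? ?] /= -> ->. Qed.

Lemma realcM (a : R) x : ((a%:C)%C * x) = (a * cRe x +i* (a * cIm x))%C.
Proof. by case: x => u v; apply: complexP; rewrite /= ?ReM ?ImM /= mul0r ?subr0 ?addr0. Qed.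

End Modulus.

Section ComplexLimit.
Variable R : realType.
Implicit Types (x y : nat -> R[i]) (l m : R[i]).

(** Componentwise, so that limit and integration results over the reals apply directly; [ccvg_norm0]
    is the equivalence with convergence in modulus. *)
Definition ccvg x l := (cRe (x n) @[n --> \oo] --> cRe l) /\
                       (cIm (x n) @[n --> \oo] --> cIm l).

Lemma ccvg_cst l : ccvg (fun=> l) l.
Proof. by split; exact: cvg_cst. Qed.

Lemma ccvgD x y l m : ccvg x l -> ccvg y m -> ccvg (fun n => x n + y n) (l + m).
Proof.
move=> [xr xi] [yr yi]; split.
  by under eq_fun do rewrite ReD; rewrite ReD; exact: cvgD.
by under eq_fun do rewrite ImD; rewrite ImD; exact: cvgD.
Qed.

Lemma ccvgM x y l m : ccvg x l -> ccvg y m -> ccvg (fun n => x n * y n) (l * m).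
Proof.
move=> [xr xi] [yr yi]; split.
  by under eq_fun do rewrite ReM; rewrite ReM; apply: cvgB; exact: cvgM.
by under eq_fun do rewrite ImM; rewrite ImM; apply: cvgD; exact: cvgM.
Qed.

Lemma ccvgJ x l : ccvg x l -> ccvg (fun n => (x n)^*%C) (l^*)%C.
Proof.
move=> [xr xi]; split.
  by under eq_fun do rewrite ReJ; rewrite ReJ.
by under eq_fun do rewrite ImJ; rewrite ImJ; exact: cvgN.
Qed.

Lemma ccvgX x l k : ccvg x l -> ccvg (fun n => x n ^+ k) (l ^+ k).
Proof.
move=> xl; elim: k => [|k IH]; first exact: ccvg_cst.
by under eq_fun do rewrite exprS; rewrite exprS; exact: ccvgM.
Qed.

Lemma ccvg_sum I (s : seq I) (F : I -> nat -> R[i]) (l : I -> R[i]) :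
  (forall i, ccvg (F i) (l i)) ->
  ccvg (fun n => \sum_(i <- s) F i n) (\sum_(i <- s) l i).
Proof.
move=> Fl; elim: s => [|i s IH].
  by under eq_fun do rewrite big_nil; rewrite big_nil; exact: ccvg_cst.
by under eq_fun do rewrite big_cons; rewrite big_cons; exact: ccvgD.
Qed.

Lemma ccvg_unique x l m : ccvg x l -> ccvg x m -> l = m.
Proof.
by move=> [xr xi] [yr yi]; apply: complexP; [exact: cvg_unique xr yr|exact: cvg_unique xi yi].
Qed.

Lemma ccvg_norm0 x l : ccvg x l <-> (normc (x n - l) @[n --> \oo] --> (0 : R)).
Proof.
split=> [[xr xi]|xl].
  have s0 : `|cRe (x n) - cRe l| + `|cIm (x n) - cIm l| @[n --> \oo] --> (0 : R).
    rewrite -[X in _ --> X](addr0 0) -(normr0 R); apply: cvgD; apply: cvg_norm.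
      by rewrite -(subrr (cRe l)); apply: cvgB => //; exact: cvg_cst.
    by rewrite -(subrr (cIm l)); apply: cvgB => //; exact: cvg_cst.
  apply: squeeze_cvgr s0; last exact: (@cvg_cst _ (0 : R)).
  apply: nearW => n; rewrite normc_ge0/= -ReN -ReD -ImN -ImD; exact: normc_le_add.
have h (p : R[i] -> R) : (forall u, `|p u| <= normc u) ->
    (forall u v, p (u - v) = p u - p v) -> p (x n) @[n --> \oo] --> p l.
  move=> pn pB; apply/cvgrPdist_le => e e0.
  have /cvgrPdist_le/(_ e e0) := xl; apply: filterS => n.
  rewrite sub0r normrN ger0_norm ?normc_ge0// => H.
  by rewrite distrC -pB; exact: le_trans (pn _) H.
split; apply: h.
- exact: normc_re_le.
- by move=> u v; rewrite ReD ReN.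
- exact: normc_im_le.
- by move=> u v; rewrite ImD ImN.
Qed.

Lemma ccvg_normc x l : ccvg x l -> normc (x n) @[n --> \oo] --> normc l.
Proof.
move=> /ccvg_norm0 xl; apply/cvgrPdist_le => e e0.
have /cvgrPdist_le/(_ e e0) := xl; apply: filterS => n.
rewrite sub0r normrN ger0_norm ?normc_ge0//; apply: le_trans.
have t (a b : R[i]) : normc a - normc b <= normc (b - a).
  rewrite lerBlDr -{1}[a](subrK b); apply: le_trans (le_normcD _ _) _.
  by rewrite lerD2r -normcN opprB.
rewrite ler_norml t andbT lerNl opprB -(normcN (x n - l)) opprB; exact: t.
Qed.

Lemma normc_lim_le x l M : ccvg x l -> (forall n, normc (x n) <= M) -> normc l <= M.
Proof.
move=> /ccvg_normc xl xM; rewrite -(cvg_lim _ xl)//.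
by apply: limr_le; [apply/cvg_ex; exists (normc l)|exact: nearW].
Qed.

End ComplexLimit.

Section ComplexIntegral.
Context {disp : measure_display} {T : measurableType disp} {R : realType}.
Variables (mu : {measure set T -> \bar R}) (D : set T).
Hypothesis mD : measurable D.
Implicit Types h k : T -> R[i].

Definition cmeas h := measurable_fun D (fun t => cRe (h t)) /\
                      measurable_fun D (fun t => cIm (h t)).

Lemma cmeas_cst c : cmeas (fun=> c).
Proof. by split; exact: measurable_cst. Qed.

Lemma cmeasD h k : cmeas h -> cmeas k -> cmeas (fun t => h t + k t).
Proof.
move=> [hr hi] [kr ki]; split.
  by under eq_fun do rewrite ReD; exact: measurable_funD.
by under eq_fun do rewrite ImD; exact: measurable_funD.
Qed.

Lemma cmeasM h k : cmeas h -> cmeas k -> cmeas (fun t => h t * k t).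
Proof.
move=> [hr hi] [kr ki]; split.
  by under eq_fun do rewrite ReM; apply: measurable_funB; exact: measurable_funM.
by under eq_fun do rewrite ImM; apply: measurable_funD; exact: measurable_funM.
Qed.

Lemma cmeasJ h : cmeas h -> cmeas (fun t => (h t)^*%C).
Proof.
move=> [hr hi]; split; first by under eq_fun do rewrite ReJ.
by under eq_fun do rewrite ImJ; exact: measurableT_comp.
Qed.

Lemma cmeasX h n : cmeas h -> cmeas (fun t => h t ^+ n).
Proof.
move=> mh; elim: n => [|n IH]; first exact: cmeas_cst.
by under eq_fun do rewrite exprS; exact: cmeasM.
Qed.

Lemma cmeas_sum I (s : seq I) (F : I -> T -> R[i]) :
  (forall i, cmeas (F i)) -> cmeas (fun t => \sum_(i <- s) F i t).
Proof.
move=> mF; elim: s => [|i s IH].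
  by under eq_fun do rewrite big_nil; exact: cmeas_cst.
by under eq_fun do rewrite big_cons; exact: cmeasD.
Qed.

Lemma cmeas_prod I (s : seq I) (F : I -> T -> R[i]) :
  (forall i, cmeas (F i)) -> cmeas (fun t => \prod_(i <- s) F i t).
Proof.
move=> mF; elim: s => [|i s IH].
  by under eq_fun do rewrite big_nil; exact: cmeas_cst.
by under eq_fun do rewrite big_cons; exact: cmeasM.
Qed.

Lemma cmeas_real (f : T -> R) : measurable_fun D f -> cmeas (fun t => ((f t)%:C)%C).
Proof. by move=> mf; split => //; exact: measurable_cst. Qed.

Lemma cmeas_cvg (h_ : nat -> T -> R[i]) h : (forall n, cmeas (h_ n)) ->
  (forall t, D t -> ccvg (h_ ^~ t) (h t)) -> cmeas h.
Proof.
move=> mh hh; split.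
  apply: (measurable_fun_cvg (h := fun n t => cRe (h_ n t))) => [n|t /hh[]//].
  by have [] := mh n.
apply: (measurable_fun_cvg (h := fun n t => cIm (h_ n t))) => [n|t /hh[]//].
by have [] := mh n.
Qed.

Lemma eq_cmeas h k : {in D, h =1 k} -> cmeas h -> cmeas k.
Proof.
move=> hk [hr hi]; split.
  by apply: eq_measurable_fun hr => t tD /=; rewrite hk.
by apply: eq_measurable_fun hi => t tD /=; rewrite hk.
Qed.

Lemma measurable_normc h : cmeas h -> measurable_fun D (fun t => normc (h t)).
Proof.
move=> [hr hi].
have -> : (fun t => normc (h t)) = (@Num.sqrt R) \o
    (fun t => cRe (h t) ^+ 2 + cIm (h t) ^+ 2).
  by apply/funext => t /=; case: (h t).
apply: measurableT_comp.
  by apply: continuous_measurable_fun; exact: sqrt_continuous.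
by apply: measurable_funD; exact: measurable_funX.
Qed.

Definition cintegrable h := mu.-integrable D (fun t => (cRe (h t))%:E) /\
                            mu.-integrable D (fun t => (cIm (h t))%:E).

(** Same body as [Cintegral], but over any measurable space: it also serves for circle means and,
    with the counting measure, for series. *)
Definition cint h : R[i] := ((\int[mu]_(t in D) cRe (h t)) +i*
                             (\int[mu]_(t in D) cIm (h t)))%C.

Lemma cintegrable_meas h : cintegrable h -> cmeas h.
Proof. by move=> [/measurable_int/measurable_EFinP ? /measurable_int/measurable_EFinP ?]. Qed.

Lemma eq_cint h k : {in D, h =1 k} -> cint h = cint k.
Proof.
by move=> hk; congr (_ +i* _)%C; apply: eq_Rintegral => t tD; rewrite hk.
Qed.

Lemma eq_cintegrable h k : {in D, h =1 k} -> cintegrable h -> cintegrable k.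
Proof.
move=> hk [hr hi]; split.
  by apply: eq_integrable hr => // t tD; rewrite hk.
by apply: eq_integrable hi => // t tD; rewrite hk.
Qed.

Lemma le_cintegrable h (g : T -> R) : cmeas h -> mu.-integrable D (EFin \o g) ->
  (forall t, D t -> normc (h t) <= g t) -> cintegrable h.
Proof.
move=> [hr hi] ig hg; split.
  apply: le_integrable ig => //; first exact/measurable_EFinP.
  move=> t Dt; rewrite /= lee_fin (le_trans (normc_re_le _))// (le_trans (hg _ Dt))//.
  exact: ler_norm.
apply: le_integrable ig => //; first exact/measurable_EFinP.
move=> t Dt; rewrite /= lee_fin (le_trans (normc_im_le _))// (le_trans (hg _ Dt))//.
exact: ler_norm.
Qed.

Lemma integrable_normc h : cintegrable h ->
  mu.-integrable D (fun t => (normc (h t))%:E).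
Proof.
move=> hh; have [hr hi] := hh.
have := integrableD mD (integrable_abse hr) (integrable_abse hi).
apply: le_integrable => //.
  exact/measurable_EFinP/measurable_normc/cintegrable_meas.
move=> t Dt; rewrite /= lee_fin ger0_norm ?normc_ge0// ger0_norm ?addr_ge0//.
exact: normc_le_add.
Qed.

Lemma cintegrable0 : cintegrable (fun=> 0).
Proof. by split; exact: integrable0. Qed.

Lemma cintegrableD h k : cintegrable h -> cintegrable k ->
  cintegrable (fun t => h t + k t).
Proof.
move=> [hr hi] [kr ki]; split.
  by under eq_fun do rewrite ReD; exact: (integrableD mD hr kr).
by under eq_fun do rewrite ImD; exact: (integrableD mD hi ki).
Qed.

Lemma cintD h k : cintegrable h -> cintegrable k ->
  cint (fun t => h t + k t) = cint h + cint k.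
Proof.
move=> [hr hi] [kr ki]; apply: complexP => /=.
  by under eq_Rintegral do rewrite ReD; rewrite RintegralD.
by under eq_Rintegral do rewrite ImD; rewrite RintegralD.
Qed.

Lemma cintegrableZ c h : cintegrable h -> cintegrable (fun t => c * h t).
Proof.
move=> [hr hi]; split.
  under eq_fun do rewrite ReM.
  by apply: (integrableB mD (integrableZl mD _ hr) (integrableZl mD _ hi)).
under eq_fun do rewrite ImM.
by apply: (integrableD mD (integrableZl mD _ hi) (integrableZl mD _ hr)).
Qed.

Lemma cintZ c h : cintegrable h -> cint (fun t => c * h t) = c * cint h.
Proof.
move=> [hr hi]; have Z r f : mu.-integrable D (EFin \o f) ->
    mu.-integrable D (EFin \o (fun t => r * f t)).
  by move=> i; exact: (integrableZl mD r i).
apply: complexP; rewrite /cint ?ReM ?ImM /=.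
  under eq_Rintegral do rewrite ReM.
  by rewrite RintegralB ?RintegralZl//; exact: Z.
under eq_Rintegral do rewrite ImM.
by rewrite RintegralD ?RintegralZl//; exact: Z.
Qed.

Lemma cintegrable_sum I (s : seq I) (F : I -> T -> R[i]) :
  (forall i, cintegrable (F i)) -> cintegrable (fun t => \sum_(i <- s) F i t).
Proof.
move=> iF; elim: s => [|i s IH].
  by under eq_fun do rewrite big_nil; exact: cintegrable0.
by under eq_fun do rewrite big_cons; exact: cintegrableD.
Qed.

Lemma cint0 : cint (fun=> 0) = 0.
Proof. by apply: complexP; rewrite /= Rintegral_cst// mul0r. Qed.

Lemma cint_sum I (s : seq I) (F : I -> T -> R[i]) :
  (forall i, cintegrable (F i)) ->
  cint (fun t => \sum_(i <- s) F i t) = \sum_(i <- s) cint (F i).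
Proof.
move=> iF; elim: s => [|i s IH].
  by rewrite big_nil; under [cint _]eq_cint do rewrite big_nil; exact: cint0.
rewrite big_cons -IH -cintD//; last exact: cintegrable_sum.
by apply: eq_cint => t _; rewrite big_cons.
Qed.

Lemma cintJ h : cintegrable h -> cint (fun t => (h t)^*%C) = (cint h)^*%C.
Proof.
move=> [hr hi]; apply: complexP => /=; first by apply: eq_Rintegral => t _; rewrite ReJ.
rewrite -mulN1r -RintegralZl//; apply: eq_Rintegral => t _.
by rewrite ImJ mulN1r.
Qed.

Lemma normc_cint h : cintegrable h -> normc (cint h) <= \int[mu]_(t in D) normc (h t).
Proof.
move=> hh; have [z0|z0] := eqVneq (cint h) 0.
  by rewrite z0 Normc.normc0; apply: Rintegral_ge0 => t _; exact: normc_ge0.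
(* Multiplication by this unimodular number turns the integral into its own modulus, and a real part
   never exceeds a modulus. *)
pose c : R[i] := (((normc (cint h))^-1)%:C)%C * ((cint h)^*)%C.
have n0 : 0 < normc (cint h) by rewrite normc_gt0.
have c1 : normc c = 1.
  by rewrite Normc.normcM normc_real normc_conj ger0_norm ?invr_ge0 ?normc_ge0// mulVf ?gt_eqF.
have -> : normc (cint h) = cRe (cint (fun t => c * h t)).
  rewrite cintZ// /c -mulrA mulc_conj realcM /= expr2 mulrA mulVf ?gt_eqF//.
  by rewrite mul1r.
have [ir _] := cintegrableZ c hh.
apply: le_Rintegral => //; first exact: integrable_normc.
move=> t Dt; apply: le_trans (ler_norm _) _; apply: le_trans (normc_re_le _) _.
by rewrite Normc.normcM c1 mul1r.
Qed.

Lemma normc_cint_le h (g : T -> R) : cintegrable h -> mu.-integrable D (EFin \o g) ->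
  (forall t, D t -> normc (h t) <= g t) ->
  normc (cint h) <= \int[mu]_(t in D) g t.
Proof.
move=> hh ig hg; apply: le_trans (normc_cint hh) _.
by apply: le_Rintegral => //; exact: integrable_normc.
Qed.

Lemma cdominated (h_ : nat -> T -> R[i]) h (g : T -> R) :
  (forall n, cmeas (h_ n)) -> (forall t, D t -> ccvg (h_ ^~ t) (h t)) ->
  mu.-integrable D (EFin \o g) -> (forall n t, D t -> normc (h_ n t) <= g t) ->
  cintegrable h /\ ccvg (fun n => cint (h_ n)) (cint h).
Proof.
move=> mh hh ig hg.
have key (p : R[i] -> R) : (forall z, `|p z| <= normc z) ->
    (forall n, measurable_fun D (fun t => p (h_ n t))) ->
    (forall t, D t -> p (h_ n t) @[n --> \oo] --> p (h t)) ->
    mu.-integrable D (fun t => (p (h t))%:E) /\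
    (\int[mu]_(t in D) p (h_ n t)) @[n --> \oo] --> \int[mu]_(t in D) p (h t).
  move=> pn mp cp.
  have [| | | | |ip _ cv] := @dominated_convergence _ _ _ mu D mD
      (fun n t => (p (h_ n t))%:E) (fun t => (p (h t))%:E) (EFin \o g).
  - by move=> n; exact/measurable_EFinP.
  - apply/measurable_EFinP; apply: (measurable_fun_cvg (h := fun n t => p (h_ n t))) => //.
  - by apply: aeW => t Dt; apply/fine_cvgP; split; [exact: nearW|exact: cp].
  - exact: ig.
  - by apply: aeW => t n Dt; rewrite /= lee_fin (le_trans (pn _))// hg.
  split=> //; rewrite /Rintegral; apply: fine_cvg.
  rewrite fineK//; exact: integrable_fin_num.
have [||ir cr] := key (@complex.Re R) (@normc_re_le R).
- by move=> n; have [] := mh n.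
- by move=> t /hh[].
have [||ii ci] := key (@complex.Im R) (@normc_im_le R).
- by move=> n; have [] := mh n.
- by move=> t /hh[].
by split.
Qed.

End ComplexIntegral.

(** * Absolutely convergent series as integrals against the counting measure *)

Section Counting.
Variable R : realType.
Implicit Types (g : nat -> R) (x y : nat -> R[i]).
Local Notation cnt := (@counting nat R).

Lemma measurable_nat (D : set nat) (f : nat -> R) : measurable_fun D f.
Proof. by move=> _ Y _. Qed.

Lemma cmeas_nat (D : set nat) x : cmeas D x.
Proof. by split; exact: measurable_nat. Qed.

Lemma integrable_counting g B : (forall i, 0 <= g i) ->
  (forall n, \sum_(i < n) g i <= B) -> cnt.-integrable setT (EFin \o g).
Proof.
move=> g0 gB; apply/integrableP; split; first exact/measurable_EFinP/measurable_nat.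
under eq_integral do rewrite /= ger0_norm//.
rewrite ge0_integral_count//; apply: (@le_lt_trans _ _ B%:E); last exact: ltry.
apply: lime_le; first by apply: is_cvg_nneseries => k _ _; rewrite lee_fin ?normr_ge0//; exact: g0.
apply: nearW => n; rewrite big_mkord sumEFin lee_fin; exact: gB.
Qed.

(** Summation is unordered in this form: linearity and dominated convergence are inherited from
    [cint], and the sum may be computed along any exhaustion by finite sets. *)
Definition csum x : R[i] := cint cnt setT x.
Definition csummable x := cintegrable cnt setT x.

Lemma csummable_le x g B : (forall i, normc (x i) <= g i) ->
  (forall n, \sum_(i < n) g i <= B) -> csummable x.
Proof.
move=> xg gB; apply: (@le_cintegrable _ _ _ cnt setT _ _ g) => //.
- by apply: (integrable_counting _ gB) => i; apply: le_trans (xg i); exact: normc_ge0.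
Qed.

Lemma csum_single x j :
  csummable (fun i => if i == j then x i else 0) /\
  csum (fun i => if i == j then x i else 0) = x j.
Proof.
have fin : forall f : nat -> R, (forall i, i != j -> f i = 0) ->
    \int[cnt]_(i in setT) f i = f j.
  move=> f f0.
  rewrite (@eq_Rintegral _ _ _ _ _ ((fun=> f j) \_ [set j])); last first.
    move=> i _; rewrite patchE; case: ifPn => [/set_mem -> //|].
    by move=> ij; rewrite f0//; apply: contra ij => /eqP ->; rewrite inE.
  rewrite -Rintegral_mkcond Rintegral_cst//.
  rewrite (_ : fine _ = 1) ?mulr1//.
  by rewrite /= /counting asboolT//= fset_set1 finmap.cardfs1.
split.
  apply: (@csummable_le _ (fun i => if i == j then normc (x j) else 0) (normc (x j))).
    by move=> i; case: eqP => [->//|_]; rewrite Normc.normc0.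
  move=> n; rewrite -big_mkcond/=.
  case: (ltnP j n) => jn.
    by rewrite (big_pred1 (Ordinal jn)).
  rewrite big1 ?normc_ge0// => i /eqP ij; exfalso; move: (ltn_ord i); rewrite ij.
  by rewrite ltnNge jn.
by apply: complexP; rewrite /= fin ?eqxx// => i /negbTE ->.
Qed.

Lemma csum_seq (s : seq nat) x : uniq s ->
  csummable (fun i => if i \in s then x i else 0) /\
  csum (fun i => if i \in s then x i else 0) = \sum_(i <- s) x i.
Proof.
move=> us.
have E : (fun i => if i \in s then x i else 0) =
    (fun i => \sum_(j <- s) (if i == j then x i else 0)).
  apply/funext => i; case: ifPn => si.
    rewrite (bigD1_seq i)//= eqxx big1 ?addr0// => j; rewrite eq_sym.
    by move/negbTE ->.
  by rewrite big_seq big1// => j js; case: eqP => // ij; rewrite ij js in si.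
rewrite E; split.
  by apply: cintegrable_sum => // j; have [] := csum_single x j.
rewrite /csum cint_sum//; last by move=> j; have [] := csum_single x j.
by apply: eq_bigr => j _; have [_ <-] := csum_single x j.
Qed.

(** Dominated convergence for the restrictions of x to the sets s K, with majorant |x|. It covers
    initial segments as well as the images of boxes of multi-indices under an enumeration. *)
Lemma csum_cvg (s : nat -> seq nat) x : csummable x ->
  (forall K, uniq (s K)) -> (forall i, \forall K \near \oo, i \in s K) ->
  ccvg (fun K => \sum_(i <- s K) x i) (csum x).
Proof.
move=> xs us sK.
have [||_] := @cdominated _ _ _ cnt setT measurableT
   (fun K i => if i \in s K then x i else 0) x (fun i => normc (x i))
   (fun n => cmeas_nat _ _) _ (integrable_normc measurableT xs).
- move=> t _; apply/ccvg_norm0; apply: cvg_near_cst.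
  by apply: filterS (sK t) => K ->; rewrite subrr Normc.normc0.
- by move=> n t _; case: ifP => //; rewrite Normc.normc0 normc_ge0.
have -> // : (fun n => cint cnt setT (fun i => if i \in s n then x i else 0)) =
   (fun K => \sum_(i <- s K) x i).
by apply/funext => K; have [_] := csum_seq x (us K).
Qed.

Lemma csum_partial x : csummable x -> ccvg (fun n => \sum_(i < n) x i) (csum x).
Proof.
move=> xs; have := @csum_cvg (iota 0) x xs (fun K => iota_uniq 0 K).
under eq_fun do rewrite -/(index_iota 0 _).
have -> : (fun n => \sum_(i < n) x i) = (fun K => \sum_(i <- iota 0 K) x i).
  by apply/funext => n; rewrite -(big_mkord xpredT x) /index_iota subn0.
apply => i; exists i.+1 => // K /= iK; by rewrite mem_iota.
Qed.

Lemma eq_csum x y : x =1 y -> csum x = csum y.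
Proof. by move=> xy; apply: eq_cint => i _; exact: xy. Qed.

Lemma csum_norm_le x B : csummable x -> (forall n, normc (\sum_(i < n) x i) <= B) ->
  normc (csum x) <= B.
Proof. by move=> /csum_partial; exact: normc_lim_le. Qed.

Lemma csum_dominated (x_ : nat -> nat -> R[i]) x g B :
  (forall i, ccvg (x_ ^~ i) (x i)) -> (forall n i, normc (x_ n i) <= g i) ->
  (forall n, \sum_(i < n) g i <= B) ->
  csummable x /\ ccvg (fun n => csum (x_ n)) (csum x).
Proof.
move=> xx xg gB; apply: (@cdominated _ _ _ cnt setT measurableT x_ x g) => //.
- by apply: (integrable_counting _ gB) => i; apply: le_trans (xg 0%N i); exact: normc_ge0.
Qed.

End Counting.

(** * Multi-indices, and the binomial series bounding the reproducing kernel *)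

Section MultiIndex.
Variable R : realType.

Definition msize d (al : d.-tuple nat) : nat := \sum_j tnth al j.
Definition mfact d (al : d.-tuple nat) : nat := \prod_j (tnth al j)`!.
Definition mon (F : comNzRingType) d (al : d.-tuple nat) (s : d.-tuple F) : F :=
  \prod_j tnth s j ^+ tnth al j.

Lemma prod_cons (F : comNzRingType) (A B : Type) d (f : A -> B -> F) (a : A) (b : B)
    (al : d.-tuple A) (s : d.-tuple B) :
  \prod_j f (tnth [tuple of a :: al] j) (tnth [tuple of b :: s] j) =
  f a b * \prod_j f (tnth al j) (tnth s j).
Proof.
rewrite big_ord_recl !tnth0; congr (_ * _).
by apply: eq_bigr => j _; rewrite !tnthS.
Qed.

Lemma mon_cons (F : comNzRingType) d k (al : d.-tuple nat) x (s : d.-tuple F) :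
  mon [tuple of k :: al] [tuple of x :: s] = x ^+ k * mon al s.
Proof. exact: (prod_cons (fun k x => x ^+ k)). Qed.

Lemma msize_cons d k (al : d.-tuple nat) : msize [tuple of k :: al] = (k + msize al)%N.
Proof.
rewrite /msize big_ord_recl tnth0; congr addn.
by apply: eq_bigr => j _; rewrite tnthS.
Qed.

Lemma mfact_cons d k (al : d.-tuple nat) : mfact [tuple of k :: al] = (k`! * mfact al)%N.
Proof.
rewrite /mfact big_ord_recl tnth0; congr muln.
by apply: eq_bigr => j _; rewrite tnthS.
Qed.

Lemma mfact_gt0 d (al : d.-tuple nat) : (0 < mfact al)%N.
Proof. by apply: prodn_gt0 => j; exact: fact_gt0. Qed.

(** The multi-indices with all entries below K. As a product set it lets sums factor over the first
    coordinate, which is the shape of every induction on d below. *)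
Fixpoint box (d K : nat) : seq (d.-tuple nat) :=
  match d with
  | 0 => [:: [tuple]]
  | d'.+1 => [seq [tuple of k :: tval al] | k <- iota 0 K, al <- box d' K]
  end.

Lemma cons_tuple_inj (A : Type) d (a b : A) (al be : d.-tuple A) :
  [tuple of a :: al] = [tuple of b :: be] -> a = b /\ al = be.
Proof. by move=> /(congr1 val)/= [-> /val_inj ->]. Qed.

Lemma box_uniq d K : uniq (box d K).
Proof.
elim: d => //= d IH; apply: allpairs_uniq => //; first exact: iota_uniq.
by move=> [a al] [b be] _ _ /= H; have [-> ->] := cons_tuple_inj H.
Qed.

Lemma mem_box d K (al : d.-tuple nat) : (al \in box d K) = [forall j, tnth al j < K]%N.
Proof.
elim: d al => [|d IH] al /=.
  by rewrite (tuple0 al) inE; apply/esym/forallP => -[].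
case/tupleP: al => k al; apply/allpairsP/forallP => [[[a be]/= [aK bK]]|].
  move=> H; have [-> ->] := cons_tuple_inj H => j.
  case: (unliftP ord0 j) => [i|] ->; rewrite ?tnthS ?tnth0; last by rewrite mem_iota in aK.
  by rewrite IH in bK; exact: (forallP bK).
move=> H; exists (k, al); split => //=.
  by have := H ord0; rewrite tnth0 mem_iota.
by rewrite IH; apply/forallP => j; have := H (lift ord0 j); rewrite tnthS.
Qed.

Lemma box_big d (al : d.-tuple nat) : \forall K \near \oo, al \in box d K.
Proof.
exists (\max_j tnth al j).+1 => // K /= aK; rewrite mem_box; apply/forallP => j.
by apply: leq_trans aK; rewrite ltnS; exact: leq_bigmax.
Qed.

Lemma box_sum_cons d K (f : d.+1.-tuple nat -> R) :
  \sum_(al <- box d.+1 K) f al =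
  \sum_(k <- iota 0 K) \sum_(al <- box d K) f [tuple of k :: al].
Proof. by rewrite /= big_allpairs_dep. Qed.

(** Transfers bounds proved on boxes, by induction on d, to partial sums along an arbitrary
    enumeration of the multi-indices. *)
Lemma sum_le_box d (nu : nat -> d.-tuple nat) (f : d.-tuple nat -> R) n :
  injective nu -> (forall al, 0 <= f al) ->
  exists K, \sum_(i < n) f (nu i) <= \sum_(al <- box d K) f al.
Proof.
move=> nui f0; pose K := (\max_(i < n) \max_j tnth (nu i) j).+1; exists K.
rewrite -(big_mkord xpredT (f \o nu)) /index_iota subn0 -(big_map nu xpredT f).
apply: (@le_trans _ _ (\sum_(al <- box d K | al \in map nu (iota 0 n)) f al)); last first.
  by rewrite [leRHS](bigID (fun al => al \in map nu (iota 0 n)))/= lerDl sumr_ge0.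
rewrite -[leRHS]big_filter le_eqVlt; apply/orP; left; apply/eqP; apply: perm_big.
apply: uniq_perm.
- by rewrite map_inj_uniq ?iota_uniq.
- exact/filter_uniq/box_uniq.
move=> al; rewrite mem_filter; case: (boolP (al \in _)) => //= H.
have [k] := seq.mapP H; rewrite mem_iota => /andP[_ nk] ->; rewrite mem_box;
  apply/esym/forallP => j.
rewrite ltnS (leq_trans (leq_bigmax j))//.
exact: (leq_bigmax (Ordinal nk) (F := fun i : 'I_n => \max_j tnth (nu i) j)).
Qed.

Lemma geo_sum_le (q : R) K : 0 <= q < 1 -> \sum_(k <- iota 0 K) q ^+ k <= (1 - q)^-1.
Proof.
move=> /andP[q0 q1]; have q1' : 0 < 1 - q by rewrite subr_gt0.
rewrite -[leRHS]mul1r ler_pdivlMr// mulrC.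
have -> : \sum_(k <- iota 0 K) q ^+ k = \sum_(i < K) q ^+ i.
  by rewrite -(big_mkord xpredT (fun i => q ^+ i)) /index_iota subn0.
by rewrite -opprB mulNr -subrX1 opprB gerBl exprn_ge0.
Qed.

Lemma box_mon_le d K (q : d.-tuple R) : (forall j, 0 <= tnth q j < 1) ->
  \sum_(al <- box d K) mon al q <= \prod_j (1 - tnth q j)^-1.
Proof.
elim: d q => [|d IH] q q01.
  by rewrite /= big_seq1 /mon !big_ord0.
case/tupleP: q q01 => q0 q q01; rewrite box_sum_cons big_ord_recl tnth0.
under eq_bigr do under eq_bigr do rewrite mon_cons.
under eq_bigr do rewrite -mulr_sumr.
rewrite -mulr_suml.
under [X in _ <= _ * X]eq_bigr do rewrite tnthS.
have q0' := q01 ord0; rewrite tnth0 in q0'.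
apply: ler_pM.
- by apply: sumr_ge0 => k _; rewrite exprn_ge0//; case/andP: q0'.
- apply: sumr_ge0 => al _; apply: prodr_ge0 => j _; rewrite exprn_ge0//.
  by have := q01 (lift ord0 j); rewrite tnthS => /andP[].
- exact: geo_sum_le.
- by apply: IH => j; have := q01 (lift ord0 j); rewrite tnthS.
Qed.

(** The rising factorial (lam)_m. *)
Definition poch (lam : R) m : R := \prod_(i < m) (lam + i%:R).

Lemma poch_gt0 lam m : 0 < lam -> 0 < poch lam m.
Proof. by move=> l0; apply: prodr_gt0 => i _; rewrite ltr_wpDr. Qed.

Lemma pochS lam m : poch lam m.+1 = lam * poch (lam + 1) m.
Proof.
rewrite /poch big_ord_recl addr0; congr (_ * _); apply: eq_bigr => i _.
by rewrite -addrA -natr1 [1 + _]addrC.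
Qed.

Lemma pochD lam m n : poch lam (m + n) = poch lam m * poch (lam + m%:R) n.
Proof.
rewrite /poch big_split_ord/=; congr (_ * _); apply: eq_bigr => i _.
by rewrite natrD addrA.
Qed.

(* The squared norm of z^al in H(B^d, lam) is the inverse of this. *)
Definition kappa (lam : R) d (al : d.-tuple nat) : R := poch lam (msize al) / (mfact al)%:R.

Lemma kappa_gt0 (lam : R) d (al : d.-tuple nat) : 0 < lam -> 0 < kappa lam al.
Proof. by move=> l0; rewrite divr_gt0 ?poch_gt0// ltr0n mfact_gt0. Qed.

(** The difference of the two sides vanishes at 0, and its derivative is lam times the same
    difference for lam + 1 and one term less. Induction on K for all lam and the mean value theorem
    conclude. *)
Lemma binomial_sum_le (lam x : R) K : 0 < lam -> 0 <= x < 1 ->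
  \sum_(k < K) poch lam k / k`!%:R * x ^+ k <= (1 - x) `^ (- lam).
Proof.
elim: K lam x => [|K IH] lam x l0 /andP[x0 x1].
  by rewrite big_ord0 powR_ge0.
pose f (y : R) := (1 - y) `^ (- lam) - \sum_(k < K.+1) poch lam k / k`!%:R * y ^+ k.
pose df (y : R) := lam * ((1 - y) `^ (- (lam + 1)) -
  \sum_(k < K) poch (lam + 1) k / k`!%:R * y ^+ k).
have dfE (y : R) : y < 1 -> is_derive y (1 : R) f (df y).
  move=> y1; have dp : is_derive y (1 : R) (fun y : R => (1 - y) `^ (- lam))
      (lam * (1 - y) `^ (- (lam + 1))).
    have y0 : 0 < 1 - y by rewrite subr_gt0.
    have d1 : is_derive y (1 : R) (fun y : R => 1 - y) (- 1).
      rewrite -[X in is_derive _ _ _ X]sub0r;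
        exact: is_deriveB (is_derive_cst _ _ _) (is_derive_id _ _).
    have := @is_derive1_comp R (fun u : R => u `^ (- lam)) (fun y : R => 1 - y) y _ _
      (is_derive1_powR (- lam) y0) d1.
    by rewrite mulrN1 mulNr opprK opprD.
  have ds : is_derive y (1 : R) (\sum_(k < K.+1) (fun y : R => poch lam k / k`!%:R * y ^+ k))
      (\sum_(k < K.+1) (poch lam k / k`!%:R * (k%:R * y ^+ k.-1))).
    apply: is_derive_sum => k.
    have := @is_deriveZ _ _ _ ((id : R -> R) ^+ k) (poch lam k / k`!%:R) y 1 _
      (@is_deriveX _ _ id k y 1 1 _).
    have -> : poch lam k / k`!%:R \*: (id : R -> R) ^+ k =
        (fun y : R => poch lam k / k`!%:R * y ^+ k).
      by apply/funext => z; rewrite /= exprfctE.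
    move=> /(_ (is_derive_id _ _)) H; apply: is_derive_eq H _.
    by rewrite /GRing.scale /= mulr1.
  have := is_deriveB dp ds.
  have -> : (fun y : R => (1 - y) `^ (- lam)) -
    \sum_(k < K.+1) (fun y : R => poch lam k / k`!%:R * y ^+ k) = f.
    by apply/funext => z; rewrite !fctE fct_sumE.
  rewrite /df mulrBr mulr_sumr big_ord_recl /= mul0r mulr0 add0r.
  congr (is_derive _ _ _ (_ - _)); apply: eq_bigr => k _.
  rewrite pochS factS natrM invfM.
  have k0 : k.+1%:R != 0 :> R by rewrite pnatr_eq0.
  rewrite -[bump 0 k]/(k.+1) /=.
  have f0 : k`!%:R != 0 :> R by rewrite pnatr_eq0 -lt0n fact_gt0.
  move: (k.+1%:R : R) (k`!%:R : R) k0 f0 => u v u0 v0.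
  by field; rewrite u0 v0.
have [||c c01 E] := @MVT_segment R f df 0 x x0.
- by move=> y /itvP yx; apply: dfE; rewrite (lt_trans _ x1)// yx.
- apply: derivable_within_continuous => y; rewrite in_itv/= => /andP[_ yx].
  by have [] := dfE y (le_lt_trans yx x1).
have f0 : f 0 = 0.
  rewrite /f subr0 powR1 big_ord_recl big1 ?addr0.
    by rewrite /poch big_ord0 divr1 mulr1 subrr.
  by move=> i _; rewrite expr0n/= mulr0.
rewrite f0 !subr0 in E; rewrite -subr_ge0 -[leRHS]/(f x) E mulr_ge0//.
rewrite mulr_ge0 ?(ltW l0)// subr_ge0; move: c01; rewrite in_itv/= => /andP[c0 cx].
by apply: IH; rewrite ?addr_gt0// c0 (le_lt_trans cx).
Qed.

(** Let s be the sum of the last variables. Since (lam)_(k+m) = (lam)_k (lam + k)_m, the inner sum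
    is the case d for the parameter lam + k, at most (1 - s)^(-lam-k). What remains is the binomial
    series in x0 / (1 - s), and (1 - s)(1 - x0 / (1 - s)) = 1 - s - x0. *)
Lemma box_kappa_le (lam : R) d K (x : d.-tuple R) : 0 < lam ->
  (forall j, 0 <= tnth x j) -> \sum_j tnth x j < 1 ->
  \sum_(al <- box d K) kappa lam al * mon al x <= (1 - \sum_j tnth x j) `^ (- lam).
Proof.
elim: d lam x => [|d IH] lam x l0 x0 x1.
  rewrite /= big_seq1 /mon /kappa /msize /mfact !big_ord0 /poch big_ord0.
  by rewrite subr0 powR1 divr1 mulr1.
case/tupleP: x x0 x1 => x0 x xge0; rewrite big_ord_recl tnth0 box_sum_cons.
under [X in _ + X < _ -> _]eq_bigr do rewrite tnthS.
under [X in _ -> _ <= (1 - (_ + X)) `^ _]eq_bigr do rewrite tnthS.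
set s := \sum_j tnth x j => xs1.
have x00 : 0 <= x0 by have := xge0 ord0; rewrite tnth0.
have xx0 j : 0 <= tnth x j by have := xge0 (lift ord0 j); rewrite tnthS.
have s0 : 0 <= s by apply: sumr_ge0.
have s1 : s < 1 by lra.
have ss : 0 < 1 - s by lra.
apply: (@le_trans _ _ (\sum_(k <- iota 0 K) poch lam k / k`!%:R * x0 ^+ k *
   (1 - s) `^ (- (lam + k%:R)))).
  apply: ler_sum => k _.
  apply: le_trans (ler_wpM2l _ (IH (lam + k%:R) x _ _ _)) => //; last first.
  - by rewrite ltr_wpDr.
  - by rewrite mulr_ge0 ?exprn_ge0// divr_ge0// ltW// poch_gt0.
  rewrite mulr_sumr; apply: ler_sum => al _.
  rewrite mon_cons /kappa msize_cons mfact_cons pochD natrM invfM.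
  by rewrite le_eqVlt; apply/orP; left; apply/eqP; ring.
have E k : (1 - s) `^ (- (lam + k%:R)) = (1 - s) `^ (- lam) / (1 - s) ^+ k.
  rewrite opprD powRD; last by rewrite (gt_eqF ss) implybT.
  by rewrite powR_invn// ltW.
under eq_bigr do rewrite E.
have -> : \sum_(k <- iota 0 K) poch lam k / k`!%:R * x0 ^+ k * ((1 - s) `^ (- lam) / (1 - s) ^+ k) =
   (1 - s) `^ (- lam) * \sum_(k < K) poch lam k / k`!%:R * (x0 / (1 - s)) ^+ k.
  rewrite -(big_mkord xpredT (fun k => poch lam k / k`!%:R * (x0 / (1 - s)) ^+ k)).
  rewrite /index_iota subn0 mulr_sumr; apply: eq_bigr => k _.
  by rewrite expr_div_n; ring.
apply: le_trans (ler_wpM2l (powR_ge0 _ _) (binomial_sum_le K l0 _)) _.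
  by rewrite divr_ge0 ?(ltW ss)//= ltr_pdivrMr// mul1r; lra.
rewrite -powRM ?(ltW ss)//; last first.
  by rewrite subr_ge0 ler_pdivrMr// mul1r; lra.
by rewrite mulrBr mulr1 mulrCA divff ?gt_eqF// mulr1 addrAC opprD addrA.
Qed.

Lemma sum_kappa_le (lam : R) d (nu : nat -> d.-tuple nat) (x : d.-tuple R) n :
  injective nu -> 0 < lam -> (forall j, 0 <= tnth x j) -> \sum_j tnth x j < 1 ->
  \sum_(i < n) kappa lam (nu i) * mon (nu i) x <= (1 - \sum_j tnth x j) `^ (- lam).
Proof.
move=> nui l0 x0 x1; have [|K] := @sum_le_box d nu (fun al => kappa lam al * mon al x) n nui.
  move=> al; rewrite mulr_ge0 ?(ltW (kappa_gt0 _ _))//; apply: prodr_ge0 => j _.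
  by rewrite exprn_ge0.
by move=> /le_trans; apply; exact: box_kappa_le.
Qed.

(** Orthonormal bases are indexed by [nat], so the multi-indices are enumerated once for all. This
    is where d >= 1 enters: for d = 0 there is only one multi-index. *)
Lemma multi_index_enum d : (0 < d)%N ->
  exists nu : nat -> d.-tuple nat, bijective nu.
Proof.
case: d => // d _; pose T := d.+1.-tuple nat.
have inf : ([set: nat] #<= [set: T])%card.
  apply/pcard_injP; exists (fun k => [tuple k | _ < d.+1]).
  by move=> k l _ _ /(congr1 (fun t => tnth t ord0)); rewrite !tnth_mktuple.
have /pcard_eqP[f] : ([set: T] #= [set: nat])%card.
  by apply: Cantor_Bernstein inf; exact: countableP.
have [g fg gf] : bijective f by exact: bijTT.
by exists g; exists f.
Qed.

End MultiIndex.

(** * Cauchy formula *)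

Section Green.
Variable R : realType.
Local Notation mu := (@lebesgue_measure R).
Implicit Types (f : R -> R) (P Q : R -> R -> R).

Definition rint (a b : R) f : R := \int[mu]_(t in `[a, b]) f t.

Definition cont_on (a b : R) f := {in `[a, b], continuous f}.

Lemma cont_on_integrable a b f : cont_on a b f ->
  mu.-integrable `[a, b] (EFin \o f).
Proof.
move=> cf; apply: continuous_compact_integrable; first exact: segment_compact.
by apply: continuous_in_subspaceT => x /set_mem; exact: cf.
Qed.

Lemma cont_onW a b a' b' f : a <= a' -> b' <= b -> cont_on a b f -> cont_on a' b' f.
Proof.
move=> aa bb cf x; rewrite in_itv/= => /andP[ax xb]; apply: cf.
by rewrite in_itv/= (le_trans aa)// (le_trans xb).
Qed.

Lemma rint_split a m b f : a <= m -> m <= b -> cont_on a b f ->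
  rint a b f = rint a m f + rint m b f.
Proof.
move=> am mb cf; have fi := cont_on_integrable cf.
have := @Rintegral_itvB R f (BLeft a) (BRight b) m fi.
rewrite !bnd_simp => /(_ am mb) E; rewrite /rint -(@Rintegral_itv_obnd_cbnd _ m).
  by rewrite -E addrC subrK.
by apply: integrableS fi => // x; rewrite /= !in_itv/= => /andP[? ->];
  rewrite andbT (le_trans am)// ltW.
Qed.

Lemma rint_cst a b (k : R) : a <= b -> rint a b (fun=> k) = k * (b - a).
Proof.
move=> ab; rewrite /rint Rintegral_cst//= lebesgue_measure_itv/= lte_fin.
by move: ab; rewrite le_eqVlt => /predU1P[->|->//]; rewrite ltxx subrr.
Qed.

Lemma rintB a b f g : cont_on a b f -> cont_on a b g ->
  rint a b (fun x => f x - g x) = rint a b f - rint a b g.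
Proof. by move=> cf cg; rewrite /rint RintegralB//; exact: cont_on_integrable. Qed.

Lemma rint_le_cst a b f k M : a <= b -> cont_on a b f ->
  (forall x, a <= x <= b -> `|f x - k| <= M) ->
  `|rint a b f - k * (b - a)| <= M * (b - a).
Proof.
move=> ab cf fM; rewrite -!rint_cst//.
have cc (c : R) : cont_on a b (fun=> c) by move=> x _; exact: cvg_cst.
rewrite -rintB//; apply: le_trans (le_normr_Rintegral _ _) _ => //.
  by apply: cont_on_integrable => x xab; apply: cvgB; [exact: cf|exact: cvg_cst].
apply: le_Rintegral => //.
- apply: (@integrable_norm _ _ _ mu `[a, b] (fun x => f x - k)).
  by apply: cont_on_integrable => x xab; apply: cvgB; [exact: cf|exact: cvg_cst].
- by apply: cont_on_integrable; exact: cc.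
Qed.

Lemma nested_point (a b : nat -> R) : (forall n, a n <= a n.+1) ->
  (forall n, b n.+1 <= b n) -> (forall n, a n <= b n) ->
  exists x, forall n, a n <= x <= b n.
Proof.
move=> aS bS ab; exists (sup (range a)).
have amono m n : (m <= n)%N -> a m <= a n.
  by move=> mn; apply: (homo_leq (r := fun x y : R => x <= y)) => //; exact: le_trans.
have bmono m n : (m <= n)%N -> b n <= b m.
  by move=> mn; apply: (homo_leq (r := fun x y : R => y <= x)) => // x y z xy yz;
    exact: le_trans yz xy.
have am n m : a m <= b n.
  by apply: le_trans (amono _ _ (leq_maxl m n)) (le_trans (ab _) (bmono _ _ (leq_maxr _ _))).
move=> n; apply/andP; split.
  by apply: ub_le_sup; [exists (b 0%N) => _ [m _ <-]|exists n].
by apply: ge_sup; [exists (a 0%N); exists 0%N|move=> _ [m _ <-]].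
Qed.

(** Total differentiability of P at (x, y) with partial derivatives px and py, at a single point. *)
Definition rdiff2 P (x y px py : R) := forall e, 0 < e -> exists2 d, 0 < d &
  forall x' y', `|x' - x| <= d -> `|y' - y| <= d ->
    `|P x' y' - P x y - px * (x' - x) - py * (y' - y)| <= e * (`|x' - x| + `|y' - y|).

Lemma lip_continuous f (x K d : R) : 0 < d ->
  (forall y, `|y - x| <= d -> `|f y - f x| <= K * `|y - x|) -> {for x, continuous f}.
Proof.
move=> d0 H; have K1 : 0 < `|K| + 1 by rewrite ltr_wpDl.
apply/cvgrPdist_le => e e0.
near=> y; rewrite distrC; apply: le_trans (H y _) _.
  by rewrite distrC; near: y; apply: cvgr_dist_le.
apply: (@le_trans _ _ ((`|K| + 1) * `|y - x|)).
  by rewrite ler_wpM2r// (le_trans (ler_norm K))// lerDl.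
rewrite -ler_pdivlMl// distrC; near: y; apply: cvgr_dist_le => //.
by rewrite mulr_gt0// invr_gt0.
Unshelve. all: by end_near. Qed.

Lemma rdiff2_cont1 P x y px py : rdiff2 P x y px py -> {for x, continuous (P ^~ y)}.
Proof.
move=> /(_ 1 ltr01)[d d0 H]; apply: (@lip_continuous _ _ (1 + `|px|) d d0) => x' xd.
have := H x' y xd; rewrite subrr normr0 mulr0 subr0 addr0 => /(_ (ltW d0)) H'.
rewrite -[P x' y - P x y](subrK (px * (x' - x))) (le_trans (ler_normD _ _))//.
by rewrite mulrDl lerD// normrM.
Qed.

Lemma rdiff2_cont2 P x y px py : rdiff2 P x y px py -> {for y, continuous (P x)}.
Proof.
move=> /(_ 1 ltr01)[d d0 H]; apply: (@lip_continuous _ _ (1 + `|py|) d d0) => y' yd.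
have := H x y'; rewrite subrr normr0 mulr0 subr0 add0r => /(_ (ltW d0) yd) H'.
rewrite -[P x y' - P x y](subrK (py * (y' - y))) (le_trans (ler_normD _ _))//.
by rewrite mulrDl lerD// normrM.
Qed.

(** The counterclockwise integral of Q dx + P dy over the boundary of the rectangle [a, b] x [c, e].
    The hypothesis [PQ] says that this form is closed: the x-derivative of P equals the y-derivative
    of Q. *)
Definition flux P Q (r : (R * R) * (R * R)) : R :=
  let: ((a, b), (c, e)) := r in
  rint c e (P b) - rint c e (P a) - (rint a b (Q ^~ e) - rint a b (Q ^~ c)).

Let perim (r : (R * R) * (R * R)) : R := (r.1.2 - r.1.1) + (r.2.2 - r.2.1).

Variables (P Q : R -> R -> R) (a b c e : R).
Hypotheses (ab : a <= b) (ce : c <= e).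
Hypothesis PQ : forall x y, a <= x <= b -> c <= y <= e ->
  exists px py qx, rdiff2 P x y px py /\ rdiff2 Q x y qx px.

Let inside (r : (R * R) * (R * R)) :=
  [/\ a <= r.1.1, r.1.1 <= r.1.2, r.1.2 <= b & [/\ c <= r.2.1, r.2.1 <= r.2.2 & r.2.2 <= e]].

Let contP x : a <= x <= b -> cont_on c e (P x).
Proof.
move=> xab y yce; have [px [py [qx [H _]]]] := PQ xab yce.
exact: rdiff2_cont2 H.
Qed.

Let contQ y : c <= y <= e -> cont_on a b (Q ^~ y).
Proof.
move=> yce x xab; have [px [py [qx [_ H]]]] := PQ xab yce.
exact: rdiff2_cont1 H.
Qed.

Let contPi r x : inside r -> r.1.1 <= x <= r.1.2 -> cont_on r.2.1 r.2.2 (P x).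
Proof.
move=> [ar _ rb [cr _ re]] /andP[rx xr]; apply: (cont_onW cr re); apply: contP.
by rewrite (le_trans ar)// (le_trans xr).
Qed.

Let contQi r y : inside r -> r.2.1 <= y <= r.2.2 -> cont_on r.1.1 r.1.2 (Q ^~ y).
Proof.
move=> [ar _ rb [cr _ re]] /andP[rx xr]; apply: (cont_onW ar rb); apply: contQ.
by rewrite (le_trans cr)// (le_trans xr).
Qed.

Let quarter r (i j : bool) : (R * R) * (R * R) :=
  let m := (r.1.1 + r.1.2) / 2 in let k := (r.2.1 + r.2.2) / 2 in
  ((if i then (m, r.1.2) else (r.1.1, m)), (if j then (k, r.2.2) else (r.2.1, k))).

Let quarter_inside r i j : inside r -> inside (quarter r i j).
Proof.
by move: r => [[a' b'] [c' e']] [/= ? ? ? [? ? ?]]; case: i; case: j; split=> /=; try split; lra.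
Qed.

Let flux_quarter r : inside r -> flux P Q r =
  flux P Q (quarter r false false) + flux P Q (quarter r true false) +
  (flux P Q (quarter r false true) + flux P Q (quarter r true true)).
Proof.
move=> ir; have := contPi ir; have := contQi ir.
case: r ir => -[a' b'] [c' e'] [/= aa ab' bb [cc ce' ee]] cQ cP.
set m := (a' + b') / 2; set k := (c' + e') / 2.
have am : a' <= m by rewrite /m; lra.
have mb : m <= b' by rewrite /m; lra.
have ck : c' <= k by rewrite /k; lra.
have ke : k <= e' by rewrite /k; lra.
have sP x : a' <= x <= b' -> rint c' e' (P x) = rint c' k (P x) + rint k e' (P x).
  by move=> xab; apply: rint_split => //; exact: cP.
have sQ y : c' <= y <= e' -> rint a' b' (Q ^~ y) = rint a' m (Q ^~ y) + rint m b' (Q ^~ y).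
  by move=> yce; apply: rint_split => //; exact: cQ.
rewrite (sP a') ?lexx// (sP b') ?lexx ?andbT// (sQ c') ?lexx// (sQ e') ?lexx ?andbT//.
ring.
Qed.

(** The affine parts of P and Q contribute px w h - px h w = 0, where w and h are the side lengths.
    Only the remainders count, each at most eps (w + h) along an edge. *)
Let flux_local r px py qx x y eps d : inside r ->
  r.1.1 <= x <= r.1.2 -> r.2.1 <= y <= r.2.2 -> 0 < eps ->
  (forall x' y', `|x' - x| <= d -> `|y' - y| <= d ->
    `|P x' y' - P x y - px * (x' - x) - py * (y' - y)| <= eps * (`|x' - x| + `|y' - y|)) ->
  (forall x' y', `|x' - x| <= d -> `|y' - y| <= d ->
    `|Q x' y' - Q x y - qx * (x' - x) - px * (y' - y)| <= eps * (`|x' - x| + `|y' - y|)) ->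
  perim r <= d -> `|flux P Q r| <= 2 * eps * perim r ^+ 2.
Proof.
move=> ir; have := contPi ir; have := contQi ir.
case: r ir => -[a' b'] [c' e'] [/= aa ab' bb [cc ce' ee]] cQ cP.
move=> /andP[ax xb] /andP[cy ye] eps0 HP HQ; rewrite /perim/=.
set w := b' - a'; set h := e' - c' => whd.
have w0 : 0 <= w by rewrite subr_ge0.
have h0 : 0 <= h by rewrite subr_ge0.
have nx x' : a' <= x' <= b' -> `|x' - x| <= w.
  by move=> /andP[? ?]; rewrite ler_norml; apply/andP; split; rewrite /w; lra.
have ny y' : c' <= y' <= e' -> `|y' - y| <= h.
  by move=> /andP[? ?]; rewrite ler_norml; apply/andP; split; rewrite /h; lra.
have eP x' y' : a' <= x' <= b' -> c' <= y' <= e' ->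
    `|P x' y' - P x y - px * (x' - x) - py * (y' - y)| <= eps * (w + h).
  move=> /nx hx /ny hy; apply: le_trans (HP _ _ _ _) _; [lra|lra|].
  by rewrite ler_pM2l// lerD.
have eQ x' y' : a' <= x' <= b' -> c' <= y' <= e' ->
    `|Q x' y' - Q x y - qx * (x' - x) - px * (y' - y)| <= eps * (w + h).
  move=> /nx hx /ny hy; apply: le_trans (HQ _ _ _ _) _; [lra|lra|].
  by rewrite ler_pM2l// lerD.
have A : `|(rint c' e' (P b') - rint c' e' (P a')) - px * w * h| <= 2 * eps * (w + h) * h.
  rewrite -rintB; [|by apply: cP; rewrite ab' lexx|by apply: cP; rewrite ab' lexx].
  apply: rint_le_cst => //.
    by move=> t tce; apply: cvgB; apply: cP; rewrite ?ab' ?lexx.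
  move=> t tce.
  have := eP b' t _ tce; rewrite ab' lexx => /(_ isT); rewrite ler_norml.
  have := eP a' t _ tce; rewrite ab' lexx => /(_ isT); rewrite !ler_norml /w.
  by move=> /andP[? ?] /andP[? ?]; apply/andP; split; lra.
have B : `|(rint a' b' (Q ^~ e') - rint a' b' (Q ^~ c')) - px * h * w| <= 2 * eps * (w + h) * w.
  rewrite -rintB; [|by apply: cQ; rewrite ce' lexx|by apply: cQ; rewrite ce' lexx].
  apply: rint_le_cst => //.
    by move=> t tce; apply: cvgB; apply: cQ; rewrite ?ce' ?lexx.
  move=> t tce.
  have := eQ t e' tce; rewrite ce' lexx => /(_ isT); rewrite ler_norml.
  have := eQ t c' tce; rewrite ce' lexx => /(_ isT); rewrite !ler_norml /h.
  by move=> /andP[? ?] /andP[? ?]; apply/andP; split; lra.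
move: A B; rewrite !ler_norml; set X := _ - rint c' e' _; set Y := _ - rint a' b' _.
move=> /andP[? ?] /andP[? ?]; apply/andP; split; lra.
Qed.

(* Goursat's bisection: no continuity of the partial derivatives is assumed. *)
Lemma green_goursat :
  rint c e (P b) - rint c e (P a) = rint a b (Q ^~ e) - rint a b (Q ^~ c).
Proof.
apply/eqP; rewrite -subr_eq0 -normr_le0 -[X in `|X|]/(flux P Q ((a, b), (c, e))).
rewrite leNgt; apply/negP => F0; set r0 := ((a, b), (c, e)) in F0.
have ir0 : inside r0 by split=> //=; split.
pose s r := perim r ^+ 2.
(* The summand 1 makes the inequality in [bad0] strict, also for a degenerate rectangle. *)
pose eps := `|flux P Q r0| / (s r0 + 1).
have s0 r : 0 <= s r by exact: sqr_ge0.
have eps0 : 0 < eps by rewrite divr_gt0// ltr_wpDl.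
pose bad r := inside r /\ eps * s r < `|flux P Q r|.
have bad0 : bad r0.
  split=> //; rewrite /eps mulrAC ltr_pdivrMr ?ltr_wpDl//.
  by rewrite mulrDr mulr1 ltrDl.
have step r : exists r', bad r -> bad r' /\ exists i j, r' = quarter r i j.
  have [br|] := pselect (bad r); last by exists r.
  have [ir Hr] := br; apply: contrapT => /forallNP H; move: Hr; apply/negP; rewrite -leNgt.
  (* Halving both sides divides [s] by 4. If no quarter were bad, the four fluxes would add up to at
     most eps * s r, against the badness of r. *)
  have q i j : `|flux P Q (quarter r i j)| <= eps * s r / 4.
    have := H (quarter r i j); move/not_implyP => [_ /not_andP[|[]]]; last by exists i, j.
    move=> /not_andP[|/negP]; first by move/(_ (quarter_inside i j ir)).
    rewrite -leNgt => /le_trans; apply; rewrite le_eqVlt; apply/orP; left; apply/eqP.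
    by rewrite /s /perim; case: i; case: j => /=; field.
  rewrite flux_quarter//; move: (q false false) (q true false) (q false true) (q true true).
  rewrite !ler_norml => /andP[? ?] /andP[? ?] /andP[? ?] /andP[? ?].
  by apply/andP; split; lra.
have [f fP] := choice step.
pose r n := iter n f r0.
have br n : bad (r n) by elim: n => //= n IH; have [] := fP _ IH.
have rS n : exists i j, r n.+1 = quarter (r n) i j by have [_] := fP _ (br n).
have ir n : inside (r n) by have [] := br n.
have [x xP] : exists x, forall n, (r n).1.1 <= x <= (r n).1.2.
  apply: nested_point => n; have [? ? ? [? ? ?]] := ir n => //.
  - by have [i [j ->]] := rS n; rewrite /quarter; case: i => //=; lra.
  - by have [i [j ->]] := rS n; rewrite /quarter; case: i => //=; lra.
have [y yP] : exists y, forall n, (r n).2.1 <= y <= (r n).2.2.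
  apply: nested_point => n; have [? ? ? [? ? ?]] := ir n => //.
  - by have [i [j ->]] := rS n; rewrite /quarter; case: j => //=; lra.
  - by have [i [j ->]] := rS n; rewrite /quarter; case: j => //=; lra.
have pr n : perim (r n) = perim r0 / 2 ^+ n.
  elim: n => [|n IH]; first by rewrite divr1.
  have -> : perim (r n.+1) = perim (r n) / 2.
    by have [i [j ->]] := rS n; rewrite /quarter /perim; case: i; case: j => /=; field.
  by rewrite IH exprSr invfM mulrA.
have xab : a <= x <= b by exact: (xP 0%N).
have yce : c <= y <= e by exact: (yP 0%N).
have [px [py [qx [HP HQ]]]] := PQ xab yce.
(* [flux_local] returns twice its constant, and eps * s (r n) is the bound that contradicts
   badness. *)
have e2 : 0 < eps / 2 by lra.
have [d1 d10 H1] := HP _ e2; have [d2 d20 H2] := HQ _ e2.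
pose d := Num.min d1 d2; have d0 : 0 < d by rewrite lt_min d10.
have [n nd] : exists n, perim (r n) <= d.
  have p0 : 0 <= perim r0 by rewrite /perim/=; lra.
  pose n := Num.truncn (perim r0 / d); exists n.+1; rewrite pr ler_pdivrMr ?exprn_gt0//.
  rewrite mulrC -ler_pdivrMr//; apply: (@le_trans _ _ n.+1%:R).
    by rewrite ltW// truncnS_gt.
  by rewrite -natrX ler_nat ltnW// ltn_expl.
have [_ ] := br n; apply/negP; rewrite -leNgt.
have := @flux_local (r n) px py qx x y (eps / 2) d (ir n) (xP n) (yP n) e2 _ _ nd.
rewrite [2 * _]mulrC divfK//; apply.
- by move=> x' y' xd yd; apply: H1; rewrite (le_trans xd, le_trans yd)// ge_min lexx.
- by move=> x' y' xd yd; apply: H2; rewrite (le_trans xd, le_trans yd)// ge_min lexx orbT.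
Qed.

End Green.

(** * Pointwise complex derivatives *)

Section ComplexDerivative.
Variable R : realType.
Implicit Types (F G : R[i] -> R[i]) (u z : R[i]).

(** Stated with the real-valued modulus, so that estimates stay over the reals; [holomorphic_slice]
    is the passage from [differentiable] on row vectors. *)
Definition cdiff G u c := forall e : R, 0 < e -> exists2 d : R, 0 < d &
  forall h, normc h <= d -> normc (G (u + h) - G u - c * h) <= e * normc h.

Lemma cdiff_lip G u c : cdiff G u c -> exists2 d : R, 0 < d &
  forall h, normc h <= d -> normc (G (u + h) - G u) <= (normc c + 1) * normc h.
Proof.
move=> /(_ 1 ltr01)[d d0 H]; exists d => // h /H; rewrite mul1r => {}H.
rewrite -[G _ - G u](subrK (c * h)) (le_trans (le_normcD _ _))// mulrDl addrC mul1r.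
by rewrite lerD// Normc.normcM.
Qed.

Lemma cdiff_cst k u : cdiff (fun=> k) u 0.
Proof.
move=> e e0; exists 1 => // h _.
by rewrite mul0r subr0 subrr Normc.normc0 mulr_ge0 ?normc_ge0// ltW.
Qed.

Lemma cdiff_id u : cdiff id u 1.
Proof.
move=> e e0; exists 1 => // h _.
have -> : u + h - u - 1 * h = 0 by ring.
by rewrite Normc.normc0 mulr_ge0 ?normc_ge0// ltW.
Qed.

Lemma cdiffB F G u b c : cdiff F u b -> cdiff G u c ->
  cdiff (fun v => F v - G v) u (b - c).
Proof.
move=> HF HG e e0; have e2 : 0 < e / 2 by lra.
have [d1 d10 H1] := HF _ e2; have [d2 d20 H2] := HG _ e2.
exists (Num.min d1 d2) => [|h]; first by rewrite lt_min d10.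
rewrite le_min => /andP[/H1 {}H1 /H2 {}H2].
have -> : F (u + h) - G (u + h) - (F u - G u) - (b - c) * h =
  (F (u + h) - F u - b * h) - (G (u + h) - G u - c * h) by ring.
apply: le_trans (le_normcD _ _) _; rewrite normcN.
by apply: le_trans (lerD H1 H2) _; rewrite -mulrDl; lra.
Qed.

Lemma cdiffM F G u b c : cdiff F u b -> cdiff G u c ->
  cdiff (fun v => F v * G v) u (b * G u + F u * c).
Proof.
move=> HF HG e e0.
(* K - 1 is the total coefficient of e / K * |h| in the three error terms; the step bound |h| <= e /
   K makes the product of the two increments one of them. *)
pose K := normc (F u) + normc (G u) + (normc b + 1) * (normc c + 1) + 1.
have [f0 g0 b0 c0] : [/\ 0 <= normc (F u), 0 <= normc (G u), 0 <= normc b & 0 <= normc c].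
  by split; exact: normc_ge0.
have K0 : 0 < K by rewrite ltr_wpDl// !addr_ge0// mulr_ge0// addr_ge0.
have eK : 0 < e / K by rewrite divr_gt0.
have [d1 d10 H1] := HF _ eK; have [d2 d20 H2] := HG _ eK.
have [d3 d30 H3] := cdiff_lip HF; have [d4 d40 H4] := cdiff_lip HG.
exists (Num.min (Num.min d1 d2) (Num.min (Num.min d3 d4) (e / K))) => [|h].
  by rewrite !lt_min d10 d20 d30 d40 eK.
rewrite !le_min => /andP[/andP[/H1 {}H1 /H2 {}H2] /andP[/andP[/H3 {}H3 /H4 {}H4] he]].
have -> : F (u + h) * G (u + h) - F u * G u - (b * G u + F u * c) * h =
  (F (u + h) - F u - b * h) * G u + F u * (G (u + h) - G u - c * h) +
  (F (u + h) - F u) * (G (u + h) - G u) by ring.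
apply: le_trans (le_normcD _ _) _; apply: le_trans (lerD (le_normcD _ _) (lexx _)) _.
rewrite !Normc.normcM.
have h0 := normc_ge0 h.
apply: (@le_trans _ _ (e / K * normc h * normc (G u) + normc (F u) * (e / K * normc h) +
   ((normc b + 1) * normc h) * ((normc c + 1) * (e / K)))).
  apply: lerD; first by apply: lerD; [exact: ler_wpM2r|exact: ler_wpM2l].
  apply: ler_pM => //; rewrite ?normc_ge0//; apply: le_trans H4 _.
  by rewrite ler_wpM2l// addr_ge0.
have -> : e / K * normc h * normc (G u) + normc (F u) * (e / K * normc h) +
   ((normc b + 1) * normc h) * ((normc c + 1) * (e / K)) = e / K * normc h * (K - 1).
  by rewrite /K; ring.
have -> : e / K * normc h * (K - 1) = e * normc h * ((K - 1) / K) by ring.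
by rewrite -[leRHS]mul1r mulrC ler_wpM2r ?mulr_ge0 ?(ltW e0)// ler_pdivrMr//; lra.
Qed.

Lemma cdiffX G u c n : cdiff G u c -> exists c', cdiff (fun v => G v ^+ n) u c'.
Proof.
move=> HG; elim: n => [|n [c' IH]].
  exists 0; have -> : (fun v => G v ^+ 0) = (fun=> 1) by apply/funext.
  exact: cdiff_cst.
exists (c * G u ^+ n + G u * c').
have -> : (fun v => G v ^+ n.+1) = (fun v => G v * G v ^+ n) by apply/funext => v; rewrite exprS.
exact: cdiffM.
Qed.

Lemma cdiff_inv z u : u != z -> cdiff (fun v => (v - z)^-1) u (- (u - z) ^- 2).
Proof.
move=> uz; have w0 : u - z != 0 by rewrite subr_eq0.
set w := u - z in w0 *; have nw : 0 < normc w by rewrite normc_gt0.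
(* The remainder is h^2 / (w^2 (w + h)). The first bound gives |w + h| >= |w| / 2, the second then
   makes the remainder at most e |h|. *)
move=> e e0; pose d := Num.min (normc w / 2) (e * normc w ^+ 3 / 2).
exists d => [|h]; first by rewrite /d lt_min !divr_gt0// mulr_gt0// exprn_gt0.
rewrite /d le_min => /andP[h1 h2].
have wh : normc w / 2 <= normc (w + h).
  have : normc w <= normc (w + h) + normc h.
    by rewrite -{1}[w](addrK h) -(normcN h); exact: le_normcD.
  by lra.
have wh0 : w + h != 0 by rewrite -normc_gt0; lra.
have -> : u + h - z = w + h by rewrite /w; ring.
have -> : (w + h)^-1 - w^-1 - - w ^- 2 * h = h ^+ 2 / (w ^+ 2 * (w + h)).
  by field; rewrite w0 wh0.
rewrite Normc.normcM Normc.normcV normcX [X in _ / X]Normc.normcM normcX.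
rewrite ler_pdivrMr; last first.
  by rewrite mulr_gt0 ?exprn_gt0// normc_gt0.
have h0 := normc_ge0 h.
rewrite expr2 mulrC -mulrA [e * _]mulrC -mulrA; apply: ler_wpM2l => //.
apply: le_trans h2 _.
have -> : e * normc w ^+ 3 / 2 = normc w ^+ 2 * (normc w / 2) * e by ring.
by rewrite ler_wpM2r ?(ltW e0)// ler_wpM2l ?sqr_ge0.
Qed.

Lemma cdiff_near F G u c d : 0 < d -> (forall h, normc h <= d -> F (u + h) = G (u + h)) ->
  cdiff F u c -> cdiff G u c.
Proof.
move=> d0 FG H e /H[d1 d10 H1]; exists (Num.min d d1) => [|h]; first by rewrite lt_min d0.
rewrite le_min => /andP[hd /H1]; rewrite FG//.
by have := FG 0; rewrite Normc.normc0 addr0 => /(_ (ltW d0)) ->.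
Qed.

(** Sequential continuity, the form that dominated convergence and [scont_cmeas] consume. *)
Definition scont G u := forall v : nat -> R[i], ccvg v u -> ccvg (fun n => G (v n)) (G u).

Lemma cdiff_scont G u c : cdiff G u c -> scont G u.
Proof.
move=> /cdiff_lip[d d0 H] v vu; apply/ccvg_norm0.
have /ccvg_norm0 v0 := vu.
have K0 : (normc c + 1) * normc (v n - u) @[n --> \oo] --> (0 : R).
  by rewrite -(mulr0 (normc c + 1)); apply: cvgM => //; exact: cvg_cst.
apply: (squeeze_cvgr _ (@cvg_cst _ (0 : R) _ _ _) K0).
have /cvgrPdist_le/(_ d d0) := v0; apply: filterS => n.
rewrite sub0r normrN ger0_norm ?normc_ge0// => /H.
by rewrite [u + _]addrC subrK.
Qed.

End ComplexDerivative.

(** * Circle means and the Cauchy integral formula *)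

Section Circle.
Variable R : realType.
Local Notation mu := (@lebesgue_measure R).
Implicit Types (F G : R[i] -> R[i]) (u z : R[i]).

Definition cis (t : R) : R[i] := (cos t +i* sin t)%C.
Definition circ (r t : R) : R[i] := (r * cos t +i* (r * sin t))%C.

Lemma normc_circ r t : normc (circ r t) = `|r|.
Proof.
by rewrite /= !exprMn -mulrDr cos2Dsin2 mulr1 sqrtr_sqr.
Qed.

Lemma circE r t : circ r t = ((r%:C)%C * cis t).
Proof. by rewrite realcM. Qed.

Lemma normc_cis t : normc (cis t) = 1.
Proof. by rewrite /= cos2Dsin2 sqrtr1. Qed.

Lemma is_derive_dist (f : R -> R) l : is_derive (0 : R) (1 : R) f l ->
  forall e, 0 < e -> exists2 d : R, 0 < d & forall h, `|h| <= d ->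
    `|f h - f 0 - l * h| <= e * `|h|.
Proof.
move=> [df fl] e e0.
have : (fun h => h^-1 *: ((f \o shift 0) (h *: (1 : R)) - f 0)) @ 0^' --> l.
  by rewrite -fl; exact: df.
move=> /cvgrPdist_le /(_ e e0)[/= d d0 H]; exists (d / 2); first by rewrite divr_gt0.
move=> h hd; have [->|h0] := eqVneq h 0.
  by rewrite subrr mulr0 subr0 normr0 mulr0.
have := H h; rewrite /= sub0r normrN => /(_ (le_lt_trans hd _) h0).
rewrite -[h *: 1]/(h * 1) -[_ *: (_ - _)]/(_ * (_ - _)) mulr1 addr0 => H'.
have -> : f h - f 0 - l * h = - ((l - h^-1 * (f h - f 0)) * h) by field.
rewrite normrN normrM ler_wpM2r// H'// ltr_pdivrMr// ltr_pMr// ltr1n//.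
Qed.

(** The complex exponential of s + i t. In these coordinates the annulus between radii a and b
    becomes the rectangle [ln a, ln b] x [0, 2 pi], to which Green's formula applies. *)
Definition zexp (s t : R) : R[i] := circ (expR s) t.

Lemma normc_zexp s t : normc (zexp s t) = expR s.
Proof. by rewrite normc_circ ger0_norm ?expR_ge0. Qed.

Lemma zexpD s s' t t' : zexp (s + s') (t + t') = zexp s t * zexp s' t'.
Proof.
rewrite /zexp expRD; apply: complexP; rewrite ?ReM ?ImM /= ?cosD ?sinD; ring.
Qed.

Lemma zexp_local e : 0 < e -> exists2 d : R, 0 < d & forall x y, `|x| <= d -> `|y| <= d ->
  normc (zexp x y - 1 - (x +i* y)%C) <= e * (`|x| + `|y|).
Proof.
move=> e0; have e8 : 0 < e / 8 by rewrite divr_gt0.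
have [d1 d10 H1] := is_derive_dist (is_derive_expR 0) e8.
have [d2 d20 H2] := is_derive_dist (is_derive_cos 0) e8.
have [d3 d30 H3] := is_derive_dist (is_derive_sin 0) e8.
have [d4 d40 H4] := is_derive_dist (is_derive_expR 0) (@ltr01 R).
(* The bound 1/2 on |x| gives |E| <= 2, and e / 8 on |y| controls the mixed product (E - 1) y. *)
pose d := Num.min (Num.min d1 d2) (Num.min (Num.min d3 d4) (Num.min (2^-1) (e / 8))).
exists d => [|x y]; first by rewrite /d !lt_min d10 d20 d30 d40 e8 invr_gt0 ltr0n.
rewrite /d !le_min => /andP[/andP[x1 x2] /andP[/andP[x3 x4] /andP[x5 x6]]].
move=> /andP[/andP[y1 y2] /andP[/andP[y3 y4] /andP[y5 y6]]].
have := H1 x x1; have := H2 y y2; have := H3 y y3; have := H4 x x4.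
rewrite expR0 cos0 sin0 oppr0 mul0r !subr0 ?addr0 !mul1r.
set E := expR x; set c := cos y; set s := sin y => h4 h3 h2 h1.
have E2 : `|E| <= 2.
  have -> : E = (E - 1 - x) + 1 + x by ring.
  by rewrite (le_trans (ler_normD _ _))// (le_trans (lerD (ler_normD _ _) (lexx _)))// normr1; lra.
have E1 : `|E - 1| <= 2 * `|x|.
  have -> : E - 1 = (E - 1 - x) + x by ring.
  by apply: le_trans (ler_normD _ _) _; lra.
apply: le_trans (normc_le_add _) _.
rewrite !ReD !ImD !ReN !ImN /= -/E -/c -/s.
have A : `|E * c - 1 - x| <= e / 2 * (`|x| + `|y|).
  have -> : E * c - 1 - x = (E - 1 - x) + E * (c - 1) by ring.
  rewrite (le_trans (ler_normD _ _))// normrM.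
  have : `|E| * `|c - 1| <= 2 * (e / 8 * `|y|) by apply: ler_pM.
  have := normr_ge0 x; have := normr_ge0 y; nra.
have B : `|E * s - 0 - y| <= e / 2 * (`|x| + `|y|).
  have -> : E * s - 0 - y = E * (s - y) + (E - 1) * y by ring.
  rewrite (le_trans (ler_normD _ _))// !normrM.
  have : `|E| * `|s - y| <= 2 * (e / 8 * `|y|) by apply: ler_pM.
  have : `|E - 1| * `|y| <= (2 * `|x|) * (e / 8) by apply: ler_pM.
  have := normr_ge0 x; have := normr_ge0 y; nra.
lra.
Qed.

(** Chain rule for G composed with the exponential. Multiplicativity of [zexp] reduces the increment
    of the inner function to its behaviour at 0. *)
Lemma cdiff_polar G s t c : cdiff G (zexp s t) c -> forall e, 0 < e ->
  exists2 d : R, 0 < d & forall s' t', `|s' - s| <= d -> `|t' - t| <= d ->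
  normc (G (zexp s' t') - G (zexp s t) - c * zexp s t * ((s' - s) +i* (t' - t))%C)
    <= e * (`|s' - s| + `|t' - t|).
Proof.
set z := zexp s t => HG e e0.
have z0 : 0 < normc z by rewrite normc_zexp expR_gt0.
have e1 : 0 < e / (4 * normc z) by rewrite divr_gt0// mulr_gt0.
have e2 : 0 < e / (2 * (normc c + 1) * normc z).
  by rewrite divr_gt0// !mulr_gt0// ltr_wpDl// normc_ge0.
have [d1 d10 H1] := HG _ e1.
have [d2 d20 H2] := zexp_local e2; have [d3 d30 H3] := zexp_local (@ltr01 R).
exists (Num.min (Num.min d2 d3) (d1 / (4 * normc z))) => [|s' t'].
  by rewrite !lt_min d20 d30 divr_gt0// mulr_gt0.
rewrite !le_min => /andP[/andP[s2 s3] s1] /andP[/andP[t2 t3] t1].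
have := H2 _ _ s2 t2; have := H3 _ _ s3 t3.
set x := s' - s in s1 s2 s3 *; set y := t' - t in t1 t2 t3 *; set w := (x +i* y)%C.
set E := zexp x y => h3 h2.
have zE : zexp s' t' = z * E by rewrite -zexpD /x /y; congr zexp; ring.
have nw : normc w <= `|x| + `|y| by exact: (normc_le_add w).
have nE : normc (E - 1) <= 2 * (`|x| + `|y|).
  have -> : E - 1 = (E - 1 - w) + w by ring.
  by apply: le_trans (le_normcD _ _) _; lra.
set h := z * (E - 1).
have nh : normc h <= normc z * (2 * (`|x| + `|y|)) by rewrite Normc.normcM ler_wpM2l// ltW.
have hd : normc h <= d1.
  apply: le_trans nh _; move: s1 t1; rewrite !ler_pdivlMr ?mulr_gt0//; nra.
have -> : G (zexp s' t') - G z - c * z * w =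
    (G (z + h) - G z - c * h) + c * z * (E - 1 - w).
  by rewrite (_ : z + h = zexp s' t') ?zE; rewrite /h; ring.
apply: le_trans (le_normcD _ _) _; rewrite 2!Normc.normcM.
have A : normc (G (z + h) - G z - c * h) <= e / 2 * (`|x| + `|y|).
  apply: le_trans (H1 _ hd) _.
  apply: (@le_trans _ _ (e / (4 * normc z) * (normc z * (2 * (`|x| + `|y|))))).
    by rewrite ler_wpM2l ?(ltW e1).
  by rewrite le_eqVlt; apply/orP; left; apply/eqP; field; rewrite gt_eqF.
have c0 := normc_ge0 c.
have B : normc c * normc z * normc (E - 1 - w) <= e / 2 * (`|x| + `|y|).
  apply: (@le_trans _ _ ((normc c + 1) * normc z *
     (e / (2 * (normc c + 1) * normc z) * (`|x| + `|y|)))).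
    by apply: ler_pM => //; rewrite ?mulr_ge0 ?normc_ge0 ?(ltW z0)// ler_wpM2r ?(ltW z0)// lerDl.
  rewrite le_eqVlt; apply/orP; left; apply/eqP; field.
  by rewrite (gt_eqF z0)/= gt_eqF// ltr_wpDl.
lra.
Qed.

Definition cmean (h : R -> R[i]) : R[i] :=
  ((((pi *+ 2)^-1)%:C)%C * cint mu `[0, pi *+ 2] h).

Lemma pi2_gt0 : 0 < pi *+ 2 :> R.
Proof. by rewrite mulrn_wgt0// pi_gt0. Qed.

(** By the Cauchy-Riemann equations for G composed with the exponential, Green's formula applies to
    the pairs (Re, Im) and (Im, -Re). The edges t = 0 and t = 2 pi cancel by periodicity, which
    leaves the equality of the integrals over the two circles. *)
Lemma circle_mean_cst G a b : 0 < a -> a <= b ->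
  (forall u, a <= normc u <= b -> exists c, cdiff G u c) ->
  cmean (fun t => G (circ a t)) = cmean (fun t => G (circ b t)).
Proof.
move=> a0 ab HG; have b0 : 0 < b := lt_le_trans a0 ab.
have lab : ln a <= ln b by rewrite ler_ln// posrE.
pose Gr s t := cRe (G (zexp s t)); pose Gi s t := cIm (G (zexp s t)).
have key s t : ln a <= s <= ln b -> exists w : R[i],
    [/\ rdiff2 Gr s t (cRe w) (- cIm w), rdiff2 Gi s t (cIm w) (cRe w) &
        rdiff2 (fun s t => - Gr s t) s t (- cRe w) (cIm w)].
  move=> /andP[as_ sb]; have [|c Hc] := HG (zexp s t).
    by rewrite normc_zexp -{1}(lnK a0) -{1}(lnK b0) !ler_expR as_.
  exists (c * zexp s t).
  have := cdiff_polar Hc; set z := c * zexp s t => H.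
  have H' e : 0 < e -> exists2 d : R, 0 < d & forall s' t', `|s' - s| <= d -> `|t' - t| <= d ->
     `|Gr s' t' - Gr s t - cRe z * (s' - s) - (- cIm z) * (t' - t)| <= e * (`|s' - s| + `|t' - t|)
     /\ `|Gi s' t' - Gi s t - cIm z * (s' - s) - cRe z * (t' - t)| <= e * (`|s' - s| + `|t' - t|).
    move=> /H[d d0 {}H]; exists d => // s' t' sd td; have {}H := H _ _ sd td; split.
      apply: le_trans H; apply: le_trans (normc_re_le _).
      rewrite /Gr; case: (G (zexp s' t')) (G (zexp s t)) z => [? ?] [? ?] [? ?] /=.
      by rewrite le_eqVlt; apply/orP; left; apply/eqP; congr (`| _ |); ring.
    apply: le_trans H; apply: le_trans (normc_im_le _).
    rewrite /Gi; case: (G (zexp s' t')) (G (zexp s t)) z => [? ?] [? ?] [? ?] /=.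
    by rewrite le_eqVlt; apply/orP; left; apply/eqP; congr (`| _ |); ring.
  split=> e /H'[d d0 {}H]; exists d => // s' t' sd td; have [h1 h2] := H _ _ sd td => //.
  rewrite -normrN; apply: le_trans h1; rewrite le_eqVlt; apply/orP; left; apply/eqP.
  by congr (`| _ |); ring.
have z2 s : zexp s (pi *+ 2) = zexp s 0 by rewrite /zexp /circ cos2pi sin2pi cos0 sin0.
have flat (Q : R -> R -> R) (l m : R) : Q ^~ (pi *+ 2) = Q ^~ 0 ->
    rint l m (Q ^~ (pi *+ 2)) - rint l m (Q ^~ 0) = 0.
  by move=> ->; exact: subrr.
have hr : rint 0 (pi *+ 2) (Gr (ln b)) = rint 0 (pi *+ 2) (Gr (ln a)).
  apply: subr0_eq; apply: (etrans _ (flat Gi (ln a) (ln b) _)); last first.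
    by apply/funext => s; rewrite /Gi z2.
  apply: (@green_goursat R Gr Gi) => //; first exact: ltW pi2_gt0.
  move=> s t sab _; have [w [H1 H2 _]] := key s t sab.
  by exists (cRe w), (- cIm w), (cIm w); split; [exact: H1|exact: H2].
have hi : rint 0 (pi *+ 2) (Gi (ln b)) = rint 0 (pi *+ 2) (Gi (ln a)).
  apply: subr0_eq; apply: (etrans _ (flat (fun s t => - Gr s t) (ln a) (ln b) _)); last first.
    by apply/funext => s; rewrite /Gr z2.
  have := @green_goursat R Gi (fun s t => - Gr s t) _ _ _ _ lab (ltW pi2_gt0); apply.
  move=> s t sab _; have [w [_ H1 H2]] := key s t sab.
  by exists (cIm w), (cRe w), (- cRe w); split; [exact: H1|exact: H2].
rewrite /cmean /cint; congr (_ * (_ +i* _)%C).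
  by move: hr; rewrite /rint /Gr /zexp !lnK.
by move: hi; rewrite /rint /Gi /zexp !lnK.
Qed.

Lemma seq_cst (r : R) : (fun=> r) n @[n --> \oo] --> r.
Proof. exact: cvg_cst. Qed.
Arguments seq_cst : clear implicits.

Lemma sum_iota (V : nmodType) (f : nat -> V) K :
  \sum_(k <- iota 0 K) f k = \sum_(k < K) f k.
Proof. by rewrite -(big_mkord xpredT f) /index_iota subn0. Qed.

Lemma ccvg_shiftS (x : nat -> R[i]) l : ccvg x l -> ccvg (fun n => x n.+1) l.
Proof.
move=> [xr xi]; split.
  by rewrite (cvg_shiftS (fun n => cRe (x n))).
by rewrite (cvg_shiftS (fun n => cIm (x n))).
Qed.

Lemma scont_cmeas (D : set R) (h : R -> R[i]) : measurable D ->
  (forall (t : nat -> R) l, t n @[n --> \oo] --> l -> ccvg (fun n => h (t n)) (h l)) ->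
  cmeas D h.
Proof.
move=> mD H; split; apply: measurable_funTS; apply: continuous_measurable_fun => l.
  by apply/(@cvg_nbhsP _ R^o) => t /H[].
by apply/(@cvg_nbhsP _ R^o) => t /H[].
Qed.

Lemma ccvg_circ (r t : nat -> R) r0 t0 : r n @[n --> \oo] --> r0 ->
  t n @[n --> \oo] --> t0 -> ccvg (fun n => circ (r n) (t n)) (circ r0 t0).
Proof.
move=> rr tt; split; apply: cvgM => //.
  by apply: continuous_cvg => //; exact: continuous_cos.
by apply: continuous_cvg => //; exact: continuous_sin.
Qed.

Lemma integrable_circle_cst (M : R) : mu.-integrable `[0, pi *+ 2] (EFin \o (fun=> M)).
Proof. by apply: cont_on_integrable => x _; exact: cvg_cst. Qed.

Lemma bounded_circle (h : R -> R[i]) M : cmeas `[0, pi *+ 2] h ->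
  (forall t, normc (h t) <= M) -> cintegrable mu `[0, pi *+ 2] h.
Proof.
move=> mh hM; apply: (@le_cintegrable _ _ _ mu _ _ _ (fun=> M)) => //.
exact: integrable_circle_cst.
Qed.

Lemma normc_cmean (h : R -> R[i]) M : cmeas `[0, pi *+ 2] h ->
  (forall t, normc (h t) <= M) -> normc (cmean h) <= M.
Proof.
move=> mh hM; have ih := bounded_circle mh hM.
have p2 := ltW pi2_gt0; rewrite /cmean Normc.normcM normc_real ger0_norm ?invr_ge0//.
rewrite ler_pdivrMl ?pi2_gt0// mulrC.
have := normc_cint_le _ ih (integrable_circle_cst M) (fun t _ => hM t) => /(_ (measurable_itv _)).
by rewrite -/(rint 0 (pi *+ 2) (fun=> M)) rint_cst// subr0.
Qed.

Lemma cmeanZ c (h : R -> R[i]) : cintegrable mu `[0, pi *+ 2] h ->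
  cmean (fun t => c * h t) = c * cmean h.
Proof. by move=> ih; rewrite /cmean cintZ// mulrCA. Qed.

Lemma cmeanD (h k : R -> R[i]) : cintegrable mu `[0, pi *+ 2] h ->
  cintegrable mu `[0, pi *+ 2] k -> cmean (fun t => h t + k t) = cmean h + cmean k.
Proof. by move=> ih ik; rewrite /cmean cintD// mulrDr. Qed.

Lemma cmean_sum I (s : seq I) (F : I -> R -> R[i]) :
  (forall i, cintegrable mu `[0, pi *+ 2] (F i)) ->
  cmean (fun t => \sum_(i <- s) F i t) = \sum_(i <- s) cmean (F i).
Proof. by move=> iF; rewrite /cmean cint_sum// mulr_sumr. Qed.

Lemma cmean_cst c : cmean (fun=> c) = c.
Proof.
rewrite /cmean; have -> : cint mu `[0, pi *+ 2] (fun=> c) = ((pi *+ 2)%:C)%C * c.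
  rewrite realcM; have p2 := ltW pi2_gt0.
  by congr (_ +i* _)%C; rewrite -/(rint 0 (pi *+ 2) (fun=> _)) rint_cst// subr0 mulrC.
rewrite mulrA -rmorphM/= mulVf ?gt_eqF ?pi2_gt0// rmorph1 mul1r//.
Qed.

Lemma cmean_dominated (h_ : nat -> R -> R[i]) h M :
  (forall n, cmeas `[0, pi *+ 2] (h_ n)) -> (forall n t, normc (h_ n t) <= M) ->
  (forall t, ccvg (h_ ^~ t) (h t)) -> ccvg (fun n => cmean (h_ n)) (cmean h).
Proof.
move=> mh hM hh; apply: ccvgM; first exact: ccvg_cst.
by have [] := @cdominated _ _ _ mu `[0, pi *+ 2] (measurable_itv _) h_ h (fun=> M) mh
   (fun t _ => hh t) (integrable_circle_cst M) (fun n t _ => hM n t).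
Qed.

(** The mean does not depend on the radius, yet passing from radius 1 to radius 2 multiplies it by
    2^(-k), which differs from 1. Hence it is zero. *)
Lemma cmean_pow k : (0 < k)%N -> forall r, 0 < r -> cmean (fun t => circ r t ^- k) = 0.
Proof.
move=> k0 r r0; have cX a b : 0 < a -> a <= b ->
    cmean (fun t => circ a t ^- k) = cmean (fun t => circ b t ^- k).
  move=> a0 ab; apply: (@circle_mean_cst (fun u => u ^- k)) => // u /andP[au _].
  have u0 : u != 0 by rewrite -normc_gt0 (lt_le_trans a0).
  have [c] := cdiffX k (cdiff_inv u0).
  by exists c; rewrite (_ : (fun v => v ^- k) = (fun v => (v - 0)^-1 ^+ k))//; apply/funext => v;
    rewrite subr0 exprVn.
have mcis : cmeas `[0, pi *+ 2] (fun t => cis t ^- k).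
  apply: scont_cmeas => // t l tl.
  have E x : cis x ^- k = (cis x)^*%C ^+ k.
    rewrite -exprVn; congr (_ ^+ _).
    have n0 : cis x != 0 by rewrite -normc_gt0 normc_cis.
    by apply: (mulfI n0); rewrite mulfV// mulrC mulc_conj normc_cis expr1n.
  rewrite E; under eq_fun do rewrite E.
  apply/ccvgX/ccvgJ; have := ccvg_circ (seq_cst (1 : R)) tl.
  have c1 x : circ 1 x = cis x by rewrite /circ !mul1r.
  by rewrite c1; under eq_fun do rewrite c1.
have icis : cintegrable mu `[0, pi *+ 2] (fun t => cis t ^- k).
  apply: (@bounded_circle _ 1) => // t.
  by rewrite Normc.normcV normcX normc_cis expr1n invr1.
have S a : cmean (fun t => circ a t ^- k) = ((a%:C)%C ^- k) * cmean (fun t => cis t ^- k).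
  by rewrite -cmeanZ//; congr cmean; apply/funext => t; rewrite circE exprMn invfM.
have h12 : (1 : R) <= 2 by rewrite ler1n.
have := etrans (esym (S 1)) (etrans (cX 1 2 ltr01 h12) (S 2)).
rewrite (S r); set c := cmean (fun t => cis t ^- k); clearbody c; clear -k0 => E.
have : (1 - ((2 : R)%:C)%C ^- k) * c = 0.
  by rewrite mulrBl -E rmorph1 expr1n invr1 subrr.
move/eqP; rewrite mulf_eq0 subr_eq0 => /orP[/eqP H|/eqP ->]; last by rewrite mulr0.
have : normc (1 : R[i]) = normc (((2 : R)%:C)%C ^- k) by rewrite H.
rewrite Normc.normc1 Normc.normcV normcX normc_real ger0_norm// => /esym/eqP.
rewrite invr_eq1 => /eqP H2; have : 1 < (2 : R) ^+ k by rewrite exprn_egt1 ?ltr1n// -lt0n.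
by rewrite H2 ltxx.
Qed.

(** On a circle centred at 0, du / (2 pi i (u - z)) is u / (u - z) times the normalized dt. [ckern]
    is the truncated geometric expansion of this kernel. *)
Definition cker (u z : R[i]) : R[i] := u / (u - z).
Definition ckern K (u z : R[i]) : R[i] := \sum_(k < K) z ^+ k * u ^- k.

Lemma ckern_le K u z : normc z < normc u ->
  normc (ckern K u z) <= (1 - normc z / normc u)^-1.
Proof.
move=> zu; have u0 : 0 < normc u by apply: le_lt_trans zu; exact: normc_ge0.
apply: le_trans (normc_sum _ _ _) _.
have := @geo_sum_le R (normc z / normc u) K.
rewrite divr_ge0 ?normc_ge0//= ltr_pdivrMr// mul1r zu => /(_ isT); apply: le_trans.
rewrite sum_iota; apply: ler_sum => k _.
by rewrite Normc.normcM Normc.normcV !normcX expr_div_n.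
Qed.

Lemma ckern_cvg u z : normc z < normc u -> ccvg (fun K => ckern K u z) (cker u z).
Proof.
move=> zu; have u0 : 0 < normc u by apply: le_lt_trans zu; exact: normc_ge0.
have uN0 : u != 0 by rewrite -normc_gt0.
have uz : u - z != 0.
  by rewrite subr_eq0; apply: contraL zu => /eqP ->; rewrite ltxx.
have E K : ckern K u z - cker u z = - (cker u z * (z / u) ^+ K).
  have -> : ckern K u z = \sum_(k < K) (z / u) ^+ k.
    by apply: eq_bigr => k _; rewrite expr_div_n.
  have zu1 : z / u - 1 != 0.
    by rewrite subr_eq0; apply: contra uz => /eqP H; rewrite -[z](divfK uN0) H mul1r subrr.
  apply: (mulfI zu1); rewrite mulrBr -subrX1 /cker.
  by field; rewrite uN0 uz.
apply/ccvg_norm0.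
have -> : (fun K => normc (ckern K u z - cker u z)) =
   (fun K => normc (cker u z) * (normc z / normc u) ^+ K).
  by apply/funext => K; rewrite E normcN Normc.normcM normcX [normc (z / u)]Normc.normcM
    Normc.normcV.
rewrite -(mulr0 (normc (cker u z))); apply: cvgM; first exact: cvg_cst.
apply: cvg_expr; rewrite ger0_norm ?divr_ge0 ?normc_ge0// ltr_pdivrMr//.
by rewrite mul1r.
Qed.

Lemma circ_neq0 r t : 0 < r -> circ r t != 0.
Proof. by move=> r0; rewrite -normc_gt0 normc_circ gtr0_norm. Qed.

Lemma ccvgV (x : nat -> R[i]) l : l != 0 -> ccvg x l -> ccvg (fun n => (x n)^-1) l^-1.
Proof. by move=> l0 xl; have := cdiff_scont (cdiff_inv l0); rewrite /scont subr0 => /(_ x xl);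
  under eq_fun do rewrite subr0. Qed.

Lemma cker_meas r z : normc z < r -> cmeas `[0, pi *+ 2] (fun t => cker (circ r t) z).
Proof.
move=> zr; have r0 : 0 < r by apply: le_lt_trans zr; exact: normc_ge0.
apply: scont_cmeas => // t l tl; have cl := ccvg_circ (seq_cst r) tl.
apply: ccvgM => //; apply: ccvgV.
  by rewrite subr_eq0; apply: contraTneq zr => <-; rewrite normc_circ gtr0_norm// ltxx.
by apply: ccvgD => //; exact: ccvg_cst.
Qed.

Lemma circV_meas r k : 0 < r -> cmeas `[0, pi *+ 2] (fun t => circ r t ^- k).
Proof.
move=> r0; apply: scont_cmeas => // t l tl.
apply: ccvgV; first by rewrite expf_neq0 ?circ_neq0.
exact/ccvgX/(ccvg_circ (seq_cst r) tl).
Qed.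

Lemma cker_mean r z : normc z < r -> cmean (fun t => cker (circ r t) z) = 1.
Proof.
move=> zr; have r0 : 0 < r by apply: le_lt_trans zr; exact: normc_ge0.
have zc t : normc z < normc (circ r t) by rewrite normc_circ gtr0_norm.
have ci k : cintegrable mu `[0, pi *+ 2] (fun t => circ r t ^- k).
  apply: (@bounded_circle _ (r ^- k)); first exact: circV_meas.
  by move=> t; rewrite Normc.normcV normcX normc_circ gtr0_norm.
have mk K : cmeas `[0, pi *+ 2] (fun t => ckern K (circ r t) z).
  by apply: cmeas_sum => k; apply: cmeasM; [exact: cmeas_cst|exact: circV_meas].
have cv := @cmean_dominated (fun K t => ckern K (circ r t) z)
   (fun t => cker (circ r t) z) (1 - normc z / r)^-1 mk.
(* The index K.+1 excludes the empty sum, whose mean is 0. From then on the term k = 0 alone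
   survives. *)
apply: (@ccvg_unique _ (fun K => cmean (fun t => ckern K.+1 (circ r t) z))).
  apply: (@cmean_dominated (fun K t => ckern K.+1 (circ r t) z) _ (1 - normc z / r)^-1) => //.
  - by move=> K t; rewrite (le_trans (ckern_le _ (zc t)))// normc_circ gtr0_norm.
  - by move=> t; exact: (ccvg_shiftS (ckern_cvg (zc t))).
have -> : (fun K => cmean (fun t => ckern K.+1 (circ r t) z)) = (fun=> 1).
  apply/funext => K; rewrite /ckern cmean_sum; last by move=> k; exact: cintegrableZ.
  rewrite big_ord_recl big1 ?addr0.
    rewrite expr0; under [X in cmean X]eq_fun do rewrite expr0 invr1 mulr1.
    exact: cmean_cst.
  by move=> k _; rewrite cmeanZ// cmean_pow// mulr0.
exact: ccvg_cst.
Qed.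

Section CauchyFormula.
Variables (G : R[i] -> R[i]) (r M : R) (z : R[i]).
Hypothesis zr : normc z < r.
Hypothesis HG : forall u, normc u <= r -> exists c, cdiff G u c.
Hypothesis GM : forall u, normc u <= r -> normc (G u) <= M.

Let r0 : 0 < r. Proof. by apply: le_lt_trans zr; exact: normc_ge0. Qed.

Let G_meas a : 0 <= a <= r -> cmeas `[0, pi *+ 2] (fun t => G (circ a t)).
Proof.
move=> /andP[a0 ar]; apply: scont_cmeas => // t l tl.
have [|c Hc] := HG (u := circ a l); first by rewrite normc_circ ger0_norm.
exact: (cdiff_scont Hc) (ccvg_circ (seq_cst a) tl).
Qed.

(* The circle means of the holomorphic function u * q u, where q is the
   difference quotient at z, do not depend on the radius: they are constant on
   either side of the removable singularity and continuous across it. *)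
Lemma cauchy_formula : cmean (fun t => G (circ r t) * cker (circ r t) z) = G z.
Proof.
have [c Hc] := HG (ltW zr).
pose q u := if u == z then c else (G u - G z) / (u - z).
have qd u : u != z -> normc u <= r -> exists b, cdiff (fun u => u * q u) u b.
  move=> uz ur; have [b Hb] := HG ur.
  have H := cdiffM (cdiff_id u) (cdiffM (cdiffB Hb (cdiff_cst (G z) u)) (cdiff_inv uz)).
  eexists; apply: (cdiff_near (d := normc (u - z) / 2)) H.
    by rewrite divr_gt0 ?normc_gt0 ?subr_eq0.
  move=> h hu; rewrite /= /q ifF//; apply/negbTE; apply/eqP => uhz.
  have : normc (u - z) = normc h by rewrite -uhz opprD addrA subrr sub0r normcN.
  move=> E; have : 0 < normc (u - z) by rewrite normc_gt0 subr_eq0.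
  by rewrite E in hu *; lra.
have qz : scont q z.
  move=> v vz; apply/ccvg_norm0/cvgrPdist_le => e e0.
  have [d d0 H] := Hc _ e0; have /ccvg_norm0/cvgrPdist_le/(_ _ d0) := vz.
  apply: filterS => n; rewrite !sub0r !normrN !ger0_norm ?normc_ge0// => /H {}H.
  rewrite /q eqxx; case: eqP => [_|/eqP vnz]; first by rewrite subrr Normc.normc0 ltW.
  have w0 : v n - z != 0 by rewrite subr_eq0.
  move: H; rewrite [z + _]addrC subrK => H.
  have -> : (G (v n) - G z) / (v n - z) - c = (G (v n) - G z - c * (v n - z)) / (v n - z).
    by field.
  by rewrite Normc.normcM Normc.normcV ler_pdivrMr ?normc_gt0.
have qc u : normc u <= r -> scont (fun u => u * q u) u.
  move=> ur; have [->|uz] := eqVneq u z; last first.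
    by have [b Hb] := qd _ uz ur; exact: cdiff_scont Hb.
  by move=> v vz; apply: ccvgM => //; exact: qz.
have [K HK] : exists K, forall u, normc u <= r -> normc (u * q u) <= K.
  have [d d0 H] := Hc 1 ltr01.
  have M0 : 0 <= M by apply: le_trans (GM (ltW zr)); exact: normc_ge0.
  have c0 := normc_ge0 c.
  exists (r * (normc c + 1 + 2 * M / d)) => u ur; rewrite Normc.normcM.
  apply: ler_pM; rewrite ?normc_ge0// /q; case: eqP => [_|/eqP uz].
    by rewrite -addrA lerDl addr_ge0// divr_ge0 ?mulr_ge0// ltW.
  have w0 : u - z != 0 by rewrite subr_eq0.
  rewrite Normc.normcM Normc.normcV.
  have [ud|du] := leP (normc (u - z)) d.
    have := H _ ud; rewrite [z + _]addrC subrK mul1r => {}H.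
    apply: (@le_trans _ _ (normc c + 1)); last by rewrite lerDl divr_ge0 ?mulr_ge0// ltW.
    rewrite ler_pdivrMr ?normc_gt0// -[G u - G z](subrK (c * (u - z))).
    apply: le_trans (le_normcD _ _) _; rewrite Normc.normcM mulrDl mul1r addrC.
    by rewrite lerD2l.
  apply: (@le_trans _ _ (2 * M / d)); last by rewrite lerDr addr_ge0.
  apply: ler_pM; rewrite ?normc_ge0 ?invr_ge0 ?normc_ge0//.
    apply: le_trans (le_normcD _ _) _; rewrite normcN mulr2n mulrDl mul1r.
    by apply: lerD; apply: GM => //; exact: ltW.
  by rewrite lef_pV2 ?posrE// ?ltW// normc_gt0.
pose m a := cmean (fun t => circ a t * q (circ a t)).
have mq a : 0 <= a <= r -> cmeas `[0, pi *+ 2] (fun t => circ a t * q (circ a t)).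
  move=> /andP[a0 ar]; apply: scont_cmeas => // t l tl.
  apply: (qc (circ a l)); first by rewrite normc_circ ger0_norm.
  exact: (ccvg_circ (seq_cst a) tl).
have mc (a : nat -> R) l : (forall n, 0 <= a n <= r) -> 0 <= l <= r ->
    a n @[n --> \oo] --> l -> ccvg (fun n => m (a n)) (m l).
  move=> ar lr al; apply: (@cmean_dominated _ _ K).
  - by move=> n; exact: mq.
  - by move=> n t; apply: HK; rewrite normc_circ; have /andP[? ?] := ar n; rewrite ger0_norm.
  move=> t; apply: (qc (circ l t)); first by rewrite normc_circ; have /andP[? ?] := lr;
    rewrite ger0_norm.
  exact: (ccvg_circ al (seq_cst t)).
have cst a b : 0 < a -> a <= b -> b <= r -> (b < normc z) || (normc z < a) -> m a = m b.
  move=> a0 ab br H; apply: (@circle_mean_cst (fun u => u * q u)) => // u /andP[au ub].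
  apply: qd; last exact: le_trans ub br.
  case/orP: H => H; first by apply: contraTneq ub => ->; rewrite -ltNge.
  by apply: contraTneq au => ->; rewrite -ltNge.
(* A mean that is constant on ]l0, l1] keeps its value at l0 by continuity in the radius. It is used
   at l0 = |z|, to pass the singularity, and at l0 = 0, where the mean vanishes. *)
have lim0 l0 l1 : 0 <= l0 -> l0 < l1 -> l1 <= r ->
    (forall a, l0 < a -> a <= l1 -> m a = m l1) -> m l0 = m l1.
  move=> l00 l01 l1r H; pose a n := l0 + (l1 - l0) / n.+1%:R.
  have al : a n @[n --> \oo] --> l0.
    rewrite -[X in _ --> X]addr0; apply: cvgD; first exact: cvg_cst.
    rewrite -(mulr0 (l1 - l0)); apply: cvgM; first exact: cvg_cst.
    exact: cvg_harmonic.
  have aI n : l0 < a n <= l1.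
    rewrite /a ltrDl divr_gt0 ?subr_gt0//= -lerBrDl ler_pdivrMr// ler_pMr ?subr_gt0//.
    by rewrite ler1n.
  apply: (@ccvg_unique _ (fun n => m (a n))).
    apply: mc => // [n|]; last by rewrite l00 (le_trans (ltW l01)).
    by have /andP[? ?] := aI n; rewrite (le_trans l00 (ltW _))// (le_trans _ l1r).
  have -> : (fun n => m (a n)) = (fun=> m l1); last exact: ccvg_cst.
  by apply/funext => n; have /andP[? ?] := aI n; exact: H.
have m0 : m 0 = 0.
  rewrite /m -(cmean_cst 0); congr cmean; apply/funext => t.
  by rewrite circE rmorph0 mul0r mul0r.
have mr : m r = 0.
  rewrite -(lim0 (normc z) r (normc_ge0 _) zr (lexx _)); last first.
    by move=> a za ar; apply: cst; rewrite ?za ?orbT ?lexx// (le_lt_trans _ za)// normc_ge0.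
  have [z0|z0] := eqVneq (normc z) 0; first by rewrite z0.
  have nz0 : 0 < normc z by rewrite lt_def z0 normc_ge0.
  (* Radii increasing to |z|; n.+2 rather than n.+1 keeps the first one positive. *)
  pose a n := normc z - normc z / n.+2%:R.
  have al : a n @[n --> \oo] --> normc z.
    rewrite -[X in _ --> X]subr0; apply: cvgB; first exact: cvg_cst.
    rewrite -(mulr0 (normc z)); apply: cvgM; first exact: cvg_cst.
    by rewrite (cvg_shiftS (@harmonic R)); exact: cvg_harmonic.
  have aI n : 0 < a n < normc z.
    by rewrite /a subr_gt0 ltr_pdivrMr// ltr_pMr// ltr1n//= ltrBlDr ltrDl divr_gt0.
  apply: (@ccvg_unique _ (fun n => m (a n))).
    apply: mc => // [n|]; last by rewrite normc_ge0 ltW.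
    by have /andP[? ?] := aI n; rewrite ltW//= ltW// (lt_trans _ zr).
  have -> : (fun n => m (a n)) = (fun=> 0); last exact: ccvg_cst.
  apply/funext => n; have /andP[an0 anz] := aI n; rewrite -(lim0 0 (a n)) ?m0//.
    by rewrite ltW// (lt_trans anz).
  by move=> b b0 ba; apply: cst => //; rewrite ?anz// ltW// (lt_trans anz).
have ck := cker_meas zr.
have nk t : normc (cker (circ r t) z) <= r / (r - normc z).
  rewrite Normc.normcM Normc.normcV normc_circ gtr0_norm// ler_pM2l//.
  rewrite lef_pV2 ?posrE ?subr_gt0// ?normc_gt0; last first.
    by rewrite subr_eq0; apply: contraTneq zr => <-; rewrite normc_circ gtr0_norm// ltxx.
  rewrite lerBlDr -{1}(gtr0_norm r0) -(normc_circ r t) -{1}[circ r t](subrK z).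
  exact: le_normcD.
have ik : cintegrable mu `[0, pi *+ 2] (fun t => cker (circ r t) z).
  exact: bounded_circle nk.
have iGk : cintegrable mu `[0, pi *+ 2] (fun t => G (circ r t) * cker (circ r t) z).
  apply: (@bounded_circle _ (M * (r / (r - normc z)))).
    by apply: cmeasM => //; apply: G_meas; rewrite lexx ltW.
  move=> t; rewrite Normc.normcM ler_pM ?normc_ge0//.
  by apply: GM; rewrite normc_circ gtr0_norm.
(* On the circle u q(u) = (G u - G z) u / (u - z), and the kernel has mean 1, so the vanishing of
   this mean is the formula. *)
have : m r = cmean (fun t => G (circ r t) * cker (circ r t) z + (- G z) * cker (circ r t) z).
  congr cmean; apply/funext => t; rewrite /q ifF; last first.
    by apply: contraTF zr => /eqP <-; rewrite normc_circ gtr0_norm// ltxx.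
  by rewrite /cker mulNr -mulrBl mulrCA.
rewrite mr cmeanD//; last exact: cintegrableZ.
rewrite cmeanZ// cker_mean// mulr1 => /esym/eqP; rewrite subr_eq0 => /eqP //.
Qed.

End CauchyFormula.
End Circle.

(** * Expansion on polydiscs *)

Section PolydiscSeries.
Variable R : realType.
Local Notation mu := (@lebesgue_measure R).
Local Notation Ci := `[0, pi *+ 2]%classic.

Definition tuple_cons (T : Type) d (x : T) (s : d.-tuple T) : d.+1.-tuple T :=
  [tuple of x :: s].

Definition tupd (T : Type) d (s : d.-tuple T) (j : 'I_d) (u : T) : d.-tuple T :=
  [tuple if i == j then u else tnth s i | i < d].

Lemma tupd_head (T : Type) d (x u : T) (s : d.-tuple T) :
  tupd (tuple_cons x s) ord0 u = tuple_cons u s.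
Proof.
apply: eq_from_tnth => i; rewrite tnth_mktuple.
by case: (unliftP ord0 i) => [j|] ->; rewrite ?tnthS ?tnth0 ?eqxx.
Qed.

Lemma tupd_tail (T : Type) d (x u : T) (s : d.-tuple T) j :
  tupd (tuple_cons x s) (lift ord0 j) u = tuple_cons x (tupd s j u).
Proof.
apply: eq_from_tnth => i; rewrite tnth_mktuple.
case: (unliftP ord0 i) => [k|] ->; rewrite ?tnthS ?tnth0 ?tnth_mktuple//.
Qed.

Definition polydisc d (rho : d.-tuple R) (s : d.-tuple R[i]) :=
  forall j, normc (tnth s j) <= tnth rho j.

Definition tcvg d (v : nat -> d.-tuple R[i]) (s : d.-tuple R[i]) :=
  forall j, ccvg (fun n => tnth (v n) j) (tnth s j).

(** Joint sequential continuity on the closed polydisc; with the separate holomorphy [thol] it is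
    what an iterated one-variable Cauchy formula uses. *)
Definition tcont d (rho : d.-tuple R) (F : d.-tuple R[i] -> R[i]) :=
  forall v s, (forall n, polydisc rho (v n)) -> polydisc rho s -> tcvg v s ->
  ccvg (fun n => F (v n)) (F s).

Definition thol d (rho : d.-tuple R) (F : d.-tuple R[i] -> R[i]) :=
  forall s, polydisc rho s -> forall j, exists c, cdiff (fun u => F (tupd s j u)) (tnth s j) c.

Lemma polydisc_cons d r (rho : d.-tuple R) x s :
  polydisc (tuple_cons r rho) (tuple_cons x s) <-> normc x <= r /\ polydisc rho s.
Proof.
split=> [H|[xr H] j].
  split; first by have := H ord0; rewrite !tnth0.
  by move=> j; have := H (lift ord0 j); rewrite !tnthS.
by case: (unliftP ord0 j) => [k|] ->; rewrite ?tnthS ?tnth0.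
Qed.

Lemma tcvg_cons d (x : nat -> R[i]) (v : nat -> d.-tuple R[i]) y s :
  ccvg x y -> tcvg v s -> tcvg (fun n => tuple_cons (x n) (v n)) (tuple_cons y s).
Proof.
move=> xy vs j; case: (unliftP ord0 j) => [k|] ->.
  by rewrite tnthS; under eq_fun do rewrite tnthS.
by rewrite tnth0; under eq_fun do rewrite tnth0.
Qed.

Lemma tcont_cons d r (rho : d.-tuple R) F x : tcont (tuple_cons r rho) F ->
  normc x <= r -> tcont rho (fun s => F (tuple_cons x s)).
Proof.
move=> HF xr v s vr sr vs; apply: HF.
- by move=> n; apply/polydisc_cons.
- by apply/polydisc_cons.
- by apply: tcvg_cons => //; exact: ccvg_cst.
Qed.

Lemma thol_cons d r (rho : d.-tuple R) F x : thol (tuple_cons r rho) F ->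
  normc x <= r -> thol rho (fun s => F (tuple_cons x s)).
Proof.
move=> HF xr s sr j.
have [|c] := HF (tuple_cons x s) _ (lift ord0 j); first by apply/polydisc_cons.
rewrite tnthS => H; exists c; rewrite (_ : (fun u => _) =
  (fun u => F (tupd (tuple_cons x s) (lift ord0 j) u)))//.
by apply/funext => u; rewrite tupd_tail.
Qed.

(** The Cauchy integral for the Taylor coefficient of index al, over the torus of polyradius rho, as
    an iterated circle mean. Recursion on d replaces integration on a product. *)
Fixpoint coefT d : d.-tuple R -> d.-tuple nat -> (d.-tuple R[i] -> R[i]) -> R[i] :=
  match d with
  | 0 => fun _ _ F => F [tuple]
  | d'.+1 => fun rho al F =>
      cmean (fun t => coefT (behead_tuple rho) (behead_tuple al)
                        (fun s => F (tuple_cons (circ (thead rho) t) s)) *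
                      circ (thead rho) t ^- thead al)
  end.

Lemma behead_cons (T : Type) d (x : T) (s : d.-tuple T) :
  behead_tuple (tuple_cons x s) = s.
Proof. exact: val_inj. Qed.

Lemma coefT_cons d r (rho : d.-tuple R) k al F :
  coefT (tuple_cons r rho) (tuple_cons k al) F =
  cmean (fun t => coefT rho al (fun s => F (tuple_cons (circ r t) s)) * circ r t ^- k).
Proof. by rewrite /= !behead_cons !theadE. Qed.

Lemma mon_gt0 d (rho : d.-tuple R) al : (forall j, 0 < tnth rho j) -> 0 < mon al rho.
Proof. by move=> r0; apply: prodr_gt0 => j _; rewrite exprn_gt0. Qed.

Lemma tuple_cons_pos d r (rho : d.-tuple R) : (forall j, 0 < tnth (tuple_cons r rho) j) ->
  0 < r /\ forall j, 0 < tnth rho j.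
Proof.
by move=> H; split=> [|j]; [have := H ord0|have := H (lift ord0 j)]; rewrite ?tnth0 ?tnthS.
Qed.

(** The Cauchy estimate and the continuity under bounded convergence are proved together: the outer
    integrand is measurable because the inner coefficient depends continuously on the first
    variable, which is the second claim in dimension d. *)
Lemma coefT_spec d (rho : d.-tuple R) al M : (forall j, 0 < tnth rho j) ->
  (forall F, tcont rho F -> (forall s, polydisc rho s -> normc (F s) <= M) ->
     normc (coefT rho al F) <= M / mon al rho) /\
  (forall F_ F, (forall n, tcont rho (F_ n)) -> tcont rho F ->
     (forall n s, polydisc rho s -> normc (F_ n s) <= M) ->
     (forall s, polydisc rho s -> ccvg (F_ ^~ s) (F s)) ->
     ccvg (fun n => coefT rho al (F_ n)) (coefT rho al F)).
Proof.
elim: d rho al => [|d IH] rho al.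
  move=> _; split=> [F _ FM|F_ F _ _ _ FF] /=; last by apply: FF => -[].
  by rewrite /mon big_ord0 divr1; apply: FM => -[].
case/tupleP: rho => r rho; case/tupleP: al => k al.
rewrite -/(tuple_cons r rho) -/(tuple_cons k al) => /tuple_cons_pos[r0 rho0].
have [IH1 IH2] := IH rho al rho0.
have cr t : normc (circ r t) <= r by rewrite normc_circ gtr0_norm.
have meas F : tcont (tuple_cons r rho) F ->
    (forall s, polydisc (tuple_cons r rho) s -> normc (F s) <= M) ->
    cmeas Ci (fun t => coefT rho al (fun s => F (tuple_cons (circ r t) s)) * circ r t ^- k).
  move=> cF FM; apply: cmeasM; last exact: circV_meas.
  apply: scont_cmeas => // t l tl.
  apply: (IH2 (fun n s => F (tuple_cons (circ r (t n)) s))).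
  - by move=> n; exact: tcont_cons cF (cr _).
  - exact: tcont_cons cF (cr _).
  - by move=> n s sr; apply: FM; apply/polydisc_cons.
  - move=> s sr; apply: cF => [n||]; try by apply/polydisc_cons.
    apply: tcvg_cons; last by move=> j; exact: ccvg_cst.
    exact: (ccvg_circ (@seq_cst R r) tl).
have bnd F : tcont (tuple_cons r rho) F ->
    (forall s, polydisc (tuple_cons r rho) s -> normc (F s) <= M) -> forall t,
    normc (coefT rho al (fun s => F (tuple_cons (circ r t) s)) * circ r t ^- k)
      <= M / mon (tuple_cons k al) (tuple_cons r rho).
  move=> cF FM t; rewrite Normc.normcM Normc.normcV normcX normc_circ gtr0_norm//.
  rewrite mon_cons invfM [_^-1 / _]mulrC mulrA ler_pM2r ?invr_gt0 ?exprn_gt0//.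
  apply: IH1; first exact: tcont_cons cF (cr _).
  by move=> s sr; apply: FM; apply/polydisc_cons.
split=> [F cF FM|F_ F cF_ cF FM FF]; rewrite ?coefT_cons.
  by apply: normc_cmean; [exact: meas|exact: bnd].
under eq_fun do rewrite coefT_cons.
apply: (@cmean_dominated _ _ _ (M / mon (tuple_cons k al) (tuple_cons r rho))).
- by move=> n; apply: meas => // s sr; exact: FM.
- by move=> n; apply: bnd => // s sr; exact: FM.
move=> t; apply: ccvgM; last exact: ccvg_cst.
apply: (IH2 (fun n s => F_ n (tuple_cons (circ r t) s))).
- by move=> n; exact: tcont_cons (cF_ n) (cr _).
- exact: tcont_cons cF (cr _).
- by move=> n s sr; apply: FM; apply/polydisc_cons.
- by move=> s sr; apply: FF; apply/polydisc_cons.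
Qed.

Lemma box_sum_consC d K (f : d.+1.-tuple nat -> R[i]) :
  \sum_(al <- box d.+1 K) f al =
  \sum_(k <- iota 0 K) \sum_(al <- box d K) f (tuple_cons k al).
Proof. by rewrite /= big_allpairs_dep. Qed.

Definition boxsum d (c : d.-tuple nat -> R[i]) K (s : d.-tuple R[i]) : R[i] :=
  \sum_(al <- box d K) c al * mon al s.

(** Induction on d. The box sum in d + 1 variables is the circle mean of the truncated kernel times
    the box sum of the slice in the remaining variables. The uniform bound, carried along as the
    first conclusion, is the majorant that allows the limit under the mean; the limit is the Cauchy
    formula in the first variable. *)
Lemma polydisc_series d (rho : d.-tuple R) F M : (forall j, 0 < tnth rho j) ->
  tcont rho F -> thol rho F -> (forall s, polydisc rho s -> normc (F s) <= M) ->
  forall s, (forall j, normc (tnth s j) < tnth rho j) ->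
  (forall K, normc (boxsum (fun al => coefT rho al F) K s) <=
     M * \prod_j (1 - normc (tnth s j) / tnth rho j)^-1) /\
  ccvg (fun K => boxsum (fun al => coefT rho al F) K s) (F s).
Proof.
elim: d rho F => [|d IH] rho F.
  move=> _ cF hF FM s _; have E : (fun K => boxsum (fun al => coefT rho al F) K s) = (fun=> F s).
    apply/funext => K; rewrite /boxsum /= big_seq1 /mon big_ord0 mulr1; congr F.
    by apply: eq_from_tnth => -[].
  split=> [K|]; last by rewrite E; exact: ccvg_cst.
  by rewrite (congr1 (fun f => f K) E) big_ord0 mulr1; apply: FM => -[].
case/tupleP: rho => r rho; rewrite -/(tuple_cons r rho) => rp cF hF FM s.
have [r0 rho0] := tuple_cons_pos rp.
case/tupleP: s => x s; rewrite -/(tuple_cons x s) => xs.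
have xr : normc x < r by have := xs ord0; rewrite !tnth0.
have sr j : normc (tnth s j) < tnth rho j by have := xs (lift ord0 j); rewrite !tnthS.
have srp : polydisc rho s by move=> j; exact: ltW.
have cr t : normc (circ r t) <= r by rewrite normc_circ gtr0_norm.
pose Ft t := fun s => F (tuple_cons (circ r t) s).
have cFt t : tcont rho (Ft t) := tcont_cons cF (cr t).
have FtM t s' : polydisc rho s' -> normc (Ft t s') <= M.
  by move=> H; apply: FM; apply/polydisc_cons.
have IHt t := IH rho (Ft t) rho0 (cFt t) (thol_cons hF (cr t)) (FtM t) s sr.
pose P := M * \prod_j (1 - normc (tnth s j) / tnth rho j)^-1.
pose S K t := boxsum (fun al => coefT rho al (Ft t)) K s.
have mc al : cmeas Ci (fun t => coefT rho al (Ft t)).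
  apply: scont_cmeas => // t l tl.
  apply: ((coefT_spec al M rho0).2 (fun n s => Ft (t n) s)) => //.
  - by move=> n; exact: FtM.
  - move=> s' sr'; apply: cF => [n||]; try by apply/polydisc_cons.
    apply: tcvg_cons; last by move=> j; exact: ccvg_cst.
    exact: (ccvg_circ (@seq_cst R r) tl).
have mS K : cmeas Ci (S K).
  by apply: cmeas_sum => al; apply: cmeasM => //; exact: cmeas_cst.
have mk K : cmeas Ci (fun t => ckern K (circ r t) x).
  by apply: cmeas_sum => k; apply: cmeasM; [exact: cmeas_cst|exact: circV_meas].
have E K : boxsum (fun al => coefT (tuple_cons r rho) al F) K (tuple_cons x s) =
    cmean (fun t => ckern K (circ r t) x * S K t).
  rewrite /boxsum box_sum_consC.
  have iT k al : cintegrable mu Ci (fun t => coefT rho al (Ft t) * circ r t ^- k).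
    apply: (@bounded_circle _ _ (M / mon al rho * r ^- k)).
      by apply: cmeasM => //; exact: circV_meas.
    move=> t; rewrite Normc.normcM Normc.normcV normcX normc_circ gtr0_norm//.
    rewrite ler_pM2r ?invr_gt0 ?exprn_gt0//.
    by apply: (coefT_spec al M rho0).1; [exact: cFt|exact: FtM].
  rewrite [RHS](_ : _ = cmean (fun t => \sum_(k <- iota 0 K) \sum_(al <- box d K)
     (x ^+ k * mon al s) * (coefT rho al (Ft t) * circ r t ^- k))); last first.
    congr cmean; apply/funext => t; rewrite /ckern /S /boxsum sum_iota mulr_suml.
    apply: eq_bigr => k _; rewrite mulr_sumr; apply: eq_bigr => al _; ring.
  rewrite cmean_sum => [|k]; last by apply: cintegrable_sum => // al; exact: cintegrableZ.
  apply: eq_bigr => k _; rewrite cmean_sum => [|al]; last exact: cintegrableZ.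
  apply: eq_bigr => al _; rewrite cmeanZ// -/(tuple_cons k al) coefT_cons mon_cons.
  by rewrite mulrC.
have bS K t : normc (ckern K (circ r t) x * S K t) <= (1 - normc x / r)^-1 * P.
  rewrite Normc.normcM; apply: ler_pM; rewrite ?normc_ge0//; last exact: (IHt t).1.
  by have := @ckern_le R K (circ r t) x; rewrite normc_circ gtr0_norm//; apply.
have mkS K : cmeas Ci (fun t => ckern K (circ r t) x * S K t) by exact: cmeasM.
split=> [K|].
  rewrite E big_ord_recl !tnth0 mulrCA.
  under [X in _ <= _ * (M * X)]eq_bigr do rewrite !tnthS.
  exact: normc_cmean.
under eq_fun do rewrite E.
have <- : cmean (fun t => F (tuple_cons (circ r t) s) * cker (circ r t) x) =
    F (tuple_cons x s).
  apply: (@cauchy_formula _ (fun u => F (tuple_cons u s)) r M) => // u ur.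
    have [|c] := hF (tuple_cons u s) _ ord0; first by apply/polydisc_cons.
    rewrite tnth0 => H; exists c; rewrite (_ : (fun u => _) =
      (fun v => F (tupd (tuple_cons u s) ord0 v)))//.
    by apply/funext => v; rewrite tupd_head.
  by apply: FM; apply/polydisc_cons.
apply: (cmean_dominated mkS bS) => t; rewrite mulrC; apply: ccvgM.
  by apply: ckern_cvg; rewrite normc_circ gtr0_norm.
by have [] := IHt t.
Qed.

End PolydiscSeries.

(** * Rotation invariance *)

Section MeasurePreserving.
Context {R : realType}.

Definition image_measure d1 d2 (T1 : measurableType d1) (T2 : measurableType d2)
    (mu : {measure set T1 -> \bar R}) (f : T1 -> T2) (mf : measurable_fun setT f) :
    {measure set T2 -> \bar R} :=
  measure_function_pushforward__canonical__measure_function_Measure mu mf.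

Definition mpres disp (T : measurableType disp) (mu : {measure set T -> \bar R}) (f : T -> T) :=
  measurable_fun setT f /\ forall A, measurable A -> mu (f @^-1` A) = mu A.

Lemma mpres_comp disp (T : measurableType disp) (mu : {measure set T -> \bar R}) (f g : T -> T) :
  mpres mu f -> mpres mu g -> mpres mu (f \o g).
Proof.
move=> [mf Hf] [mg Hg]; split; first exact: measurableT_comp.
move=> A mA; rewrite comp_preimage Hg ?Hf//.
by rewrite -[X in measurable X]setTI; exact: mf.
Qed.

Lemma mpres_id disp (T : measurableType disp) (mu : {measure set T -> \bar R}) : mpres mu id.
Proof. by split. Qed.

Lemma mpres_cint disp (T : measurableType disp) (mu : {measure set T -> \bar R})
    (D : set T) (f : T -> T) (h : T -> R[i]) : measurable D -> mpres mu f -> f @^-1` D = D ->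
  cintegrable mu D h -> cintegrable mu D (h \o f) -> cint mu D (h \o f) = cint mu D h.
Proof.
move=> mD [mf Hf] fD [hr hi] [hfr hfi].
have key (p : T -> R) : mu.-integrable D (EFin \o p) ->
    mu.-integrable D (EFin \o p \o f) ->
    \int[mu]_(t in D) p (f t) = \int[mu]_(t in D) p t.
  move=> ip ipf; rewrite /Rintegral; congr fine.
  have mp := measurable_int mu ip.
  have Df t : t \in D -> f t \in D.
    by rewrite !inE => Dt; rewrite -[D _]/((f @^-1` D) t) fD.
  (* p is measurable on D only; its extension by zero is measurable on the whole space, as the
     pushforward formula requires. *)
  have mpD := (measurable_restrictT _ mD).1 mp.
  have E := @integral_pushforward _ _ _ _ R f mf mu D _ mpD.
  rewrite fD in E.
  transitivity (\int[mu]_(t in D) (((EFin \o p) \_ D) \o f) t)%E.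
    by apply: eq_integral => t Dt; rewrite /= patchE Df.
  rewrite -(E _ mD); last first.
    by apply: eq_integrable ipf => // t Dt; rewrite /= patchE Df.
  transitivity (\int[mu]_(t in D) ((EFin \o p) \_ D) t)%E.
    by apply: eq_measure_integral => A mA _; exact: Hf.
  by apply: eq_integral => t Dt; rewrite /= patchE Dt.
by rewrite /cint (key (fun t => cRe (h t))) ?(key (fun t => cIm (h t))).
Qed.

Lemma mpres_pair d1 d2 (T1 : measurableType d1) (T2 : measurableType d2)
    (m1 : {sigma_finite_measure set T1 -> \bar R})
    (m2 : {sigma_finite_measure set T2 -> \bar R}) f g :
  mpres m1 f -> mpres m2 g -> mpres (sfprod m1 m2) (fun x => (f x.1, g x.2)).
Proof.
move=> [mf Hf] [mg Hg].
have mfg : measurable_fun setT (fun x : T1 * T2 => (f x.1, g x.2)).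
  apply: measurable_fun_pair.
    exact: (measurableT_comp mf measurable_fst).
  exact: (measurableT_comp mg measurable_snd).
split=> // A mA; apply/esym.
apply: (@product_measure_unique _ _ _ _ R m1 m2 (image_measure (sfprod m1 m2) mfg)) => //.
move=> B C mB mC; rewrite /= /pushforward.
rewrite (_ : _ @^-1` _ = (f @^-1` B) `*` (g @^-1` C))//.
have pre d (T : measurableType d) (F : T -> T) (D : set T) : measurable_fun setT F ->
    measurable D -> measurable (F @^-1` D).
  by move=> mF mD; rewrite -[X in measurable X]setTI; exact: mF.
by rewrite /sfprod product_measure1E ?Hf ?Hg//; exact: pre.
Qed.

Lemma mpres_swap d1 (T1 : measurableType d1)
    (m1 : {sigma_finite_measure set T1 -> \bar R}) :
  mpres (sfprod m1 m1) (fun x => (x.2, x.1)).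
Proof.
have msw : measurable_fun setT (fun x : T1 * T1 => (x.2, x.1)).
  by apply: measurable_fun_pair; [exact: measurable_snd|exact: measurable_fst].
split=> // A mA; apply/esym.
apply: (@product_measure_unique _ _ _ _ R m1 m1 (image_measure (sfprod m1 m1) msw)) => //.
move=> B C mB mC; rewrite /= /pushforward.
rewrite (_ : _ @^-1` _ = C `*` B); last first.
  by apply/seteqP; split => -[x y] [].
by rewrite /sfprod product_measure1E// muleC.
Qed.

Lemma translation_invariant (c : R) :
  mpres (@lebesgue_measure R) (fun x : measurableTypeR R => x + c).
Proof.
have mc : measurable_fun setT ((fun x => x + c) : measurableTypeR R -> measurableTypeR R).
  exact: measurable_funD.
split=> // A mA; apply/esym.
have := @lebesgue_measure_unique R (@image_measure _ _ (measurableTypeR R) (measurableTypeR R)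
  (@lebesgue_measure R) _ mc) _ A mA.
apply; rewrite {A mA}.
move=> _ [[a b] _ <-]; rewrite /= /pushforward.
have -> : (fun x : R => x + c) @^-1` `]a, b] = `]a - c, b - c]%classic.
  by apply/seteqP; split => x /=; rewrite !in_itv/= ltrBlDr lerBrDr.
by rewrite !lebesgue_measure_itv/= !lte_fin ltrD2r; case: ifP => // _; rewrite -!EFinB;
  congr EFin; ring.
Qed.

Notation leb2 := (sfprod (@lebesgue_measure R) (@lebesgue_measure R)).

(** On each vertical section the shear is a translation. *)
Lemma shear_preserving (t : R) :
  mpres leb2 (fun x : measurableTypeR R * measurableTypeR R => (x.1, x.2 + t * x.1)).
Proof.
have ms : measurable_fun setT (fun x : measurableTypeR R * measurableTypeR R =>
  (x.1, x.2 + t * x.1)).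
  apply: measurable_fun_pair; first exact: measurable_fst.
  apply: measurable_funD; first exact: measurable_snd.
  by apply: measurable_funM => //; exact: measurable_fst.
split=> // A mA; rewrite /sfprod /product_measure1; apply: eq_integral => x _ /=.
rewrite -((translation_invariant (t * x)).2 (xsection A x)); last exact: measurable_xsection.
by congr (lebesgue_measure _); apply/seteqP; split => y; rewrite /= ?xsectionE.
Qed.

Definition plane_rot (th : R) (x : R * R) : R * R :=
  (cos th * x.1 - sin th * x.2, sin th * x.1 + cos th * x.2).

(** A rotation is a product of three shears, with parameters -tan (th / 2), sin th and -tan (th /
    2); the horizontal ones are vertical shears conjugated by the exchange of the coordinates. *)
Lemma rot_half (th : R) : cos (th / 2) != 0 -> mpres leb2 (plane_rot th).
Proof.
move=> c0; pose s := sin (th / 2) / cos (th / 2).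
have E : plane_rot th = (fun x => (x.2, x.1)) \o (fun x => (x.1, x.2 + (- s) * x.1)) \o
    (fun x => (x.2, x.1)) \o (fun x => (x.1, x.2 + sin th * x.1)) \o
    (fun x => (x.2, x.1)) \o (fun x => (x.1, x.2 + (- s) * x.1)) \o (fun x => (x.2, x.1)).
  have thE : th = th / 2 + th / 2 by field.
  have sE : sin th = 2 * (sin (th / 2) * cos (th / 2)) by rewrite {1}thE sinD; ring.
  have cE : cos th = cos (th / 2) ^+ 2 - sin (th / 2) ^+ 2 by rewrite {1}thE cosD.
  have one := cos2Dsin2 (th / 2).
  apply/funext => -[x y]; rewrite /plane_rot /= sE cE /s.
  have sq : sin (th / 2) ^+ 2 = 1 - cos (th / 2) ^+ 2 by lra.
  move: (sin (th / 2)) (cos (th / 2)) sq c0 => S C sq C0; congr pair.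
    by field: sq; rewrite C0.
  by field: sq; rewrite C0.
rewrite E; have sw := mpres_swap (@lebesgue_measure R).
do 6!(apply: mpres_comp; last by [exact: sw|exact: shear_preserving]); exact: sw.
Qed.

(** For m = 1 the half-angle of pi / m has cosine 0. Composing two rotations by half the angle keeps
    all cosines positive. *)
Lemma rotation_invariant (m : nat) : (0 < m)%N -> mpres leb2 (plane_rot (pi / m%:R)).
Proof.
move=> m0; have E : plane_rot (pi / m%:R) = plane_rot (pi / m%:R / 2) \o plane_rot (pi / m%:R / 2).
  have thE : pi / m%:R = pi / m%:R / 2 + pi / m%:R / 2 :> R by field; rewrite pnatr_eq0 -lt0n.
  apply/funext => -[x y]; rewrite /plane_rot {1 2 3 4}thE cosD sinD /=.
  by congr pair; ring.
have H : mpres leb2 (plane_rot (pi / m%:R / 2)).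
  apply: rot_half; rewrite gt_eqF// cos_gt0_pihalf//.
  have p0 := pi_gt0 R; have m1 : 1 <= m%:R :> R by rewrite ler1n.
  have : 0 < pi / m%:R :> R by rewrite divr_gt0// ltr0n.
  have : pi / m%:R <= pi :> R by rewrite ler_pdivrMr ?ltr0n// ler_peMr// ltW.
  by move: (pi / m%:R) => q; lra.
by rewrite E; exact: mpres_comp.
Qed.

Definition at_coord (T : Type) d (j : 'I_d) (f : T -> T) (u : d.-tuple T) : d.-tuple T :=
  tupd u j (f (tnth u j)).

Lemma mpres_mpow disp (T : measurableType disp) (mu : {sigma_finite_measure set T -> \bar R})
    d (j : 'I_d) (f : T -> T) : mpres mu f -> mpres (mpow mu d) (at_coord j f).
Proof.
move=> [mf Hf].
have mat_ d' (i : 'I_d') : measurable_fun setT (@at_coord T d' i f).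
  apply/measurable_fun_tnthP => k; rewrite /at_coord /tupd.
  set F := (X in measurable_fun _ X).
  have -> : F = (fun u => if k == i then f (tnth u i) else tnth u k).
    by apply/funext => u; rewrite /F /= tnth_mktuple.
  case: eqP => _; last exact: measurable_tnth.
  by apply: measurableT_comp => //; exact: measurable_tnth.
split; first exact: mat_.
elim: d j => [[]//|d IH] j A mA.
rewrite /= /mpow_step /pushforward -comp_preimage.
have mcA : measurable (@tcons _ T d @^-1` A).
  by rewrite -[X in measurable X]setTI; exact: measurable_tcons.
case: (unliftP ord0 j) => [i|] ->.
  have -> : at_coord (lift ord0 i) f \o @tcons _ T d =
      @tcons _ T d \o (fun x => (id x.1, at_coord i f x.2)).
    by apply/funext => -[x u]; rewrite /= /at_coord /tcons /= -/(tuple_cons x u) tnthS tupd_tail.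
  rewrite comp_preimage.
  have [|_ ->//] := @mpres_pair _ _ _ _ mu (mpow mu d) id (at_coord i f) (mpres_id mu).
  by split; [exact: mat_|exact: IH].
have -> : at_coord ord0 f \o @tcons _ T d = @tcons _ T d \o (fun x => (f x.1, id x.2)).
  by apply/funext => -[x u]; rewrite /= /at_coord /tcons /= -/(tuple_cons x u) tnth0 tupd_head.
rewrite comp_preimage.
by have [|_ ->//] := @mpres_pair _ _ _ _ mu (mpow mu d) f id _ (mpres_id _).
Qed.

Definition zvec d (u : coords R d) : d.-tuple R[i] :=
  [tuple ((tnth u j).1 +i* (tnth u j).2)%C | j < d].

Definition sqn d (u : coords R d) : R := sqnorm (cvec u).

Lemma rot_cis th x : ((plane_rot th x).1 +i* (plane_rot th x).2)%C = cis th * (x.1 +i* x.2)%C.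
Proof. by apply: complexP; rewrite ?ReM ?ImM /plane_rot //= addrC. Qed.

Lemma cis_pow th m : cis th ^+ m = cis (th *+ m) :> R[i].
Proof.
elim: m => [|m IH]; first by rewrite mulr0n /cis cos0 sin0.
rewrite exprS IH mulrS; apply: complexP; rewrite ?ReM ?ImM /= ?cosD ?sinD //.
by rewrite addrC.
Qed.

Lemma conjcM (x y : R[i]) : ((x * y)^*)%C = (x^*)%C * (y^*)%C.
Proof. exact: rmorphM. Qed.

Lemma conjcX (x : R[i]) n : ((x ^+ n)^*)%C = (x^*)%C ^+ n.
Proof. exact: rmorphXn. Qed.

Lemma conjcJ (x : R[i]) : (((x^*)%C)^*)%C = x.
Proof. by case: x => a b /=; rewrite opprK. Qed.

(** With m = |a - b| the product is exp (i pi (b - a) / m), that is exp (i pi) or exp (- i pi). *)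
Lemma cis_root (a b : nat) : a != b ->
  exists2 m, (0 < m)%N & (cis (pi / m%:R))^*%C ^+ a * cis (pi / m%:R) ^+ b = -1 :> R[i].
Proof.
have H k l : (k < l)%N ->
    (cis (pi / (l - k)%:R))^*%C ^+ k * cis (pi / (l - k)%:R) ^+ l = -1 :> R[i].
  move=> kl; have m0 : (0 < l - k)%N by rewrite subn_gt0.
  rewrite -[X in _ * _ ^+ X = _](subnKC (ltnW kl)) exprD mulrA -exprMn mulc_conj normc_cis.
  rewrite (expr1n _ 2) -[X in X ^+ k]/(1 : R[i]) expr1n mul1r cis_pow -[(pi / _) *+ _]mulr_natr
    divfK ?pnatr_eq0 -?lt0n//.
  by rewrite /cis cospi sinpi; apply: complexP; rewrite /= ?oppr0.
case: ltngtP => // ab _; first by exists (b - a)%N; [rewrite subn_gt0|exact: H].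
exists (a - b)%N; first by rewrite subn_gt0.
have := congr1 (@conjc R) (H b a ab); rewrite conjcM !conjcX conjcJ mulrC => ->.
by apply: complexP; rewrite /= ?oppr0.
Qed.

Lemma zvec_rot d (j : 'I_d) th u i :
  tnth (zvec (at_coord j (plane_rot th) u)) i = (if i == j then cis th else 1) * tnth (zvec u) i.
Proof.
rewrite !tnth_mktuple; case: eqP => [->|_]; first by rewrite rot_cis.
by rewrite mul1r.
Qed.

Lemma mon_rot d (j : 'I_d) th u (al : d.-tuple nat) :
  mon al (zvec (at_coord j (plane_rot th) u)) = cis th ^+ tnth al j * mon al (zvec u).
Proof.
rewrite /mon (bigD1 j)//= [in RHS](bigD1 j)//= mulrA zvec_rot eqxx exprMn.
congr (_ * _); apply: eq_bigr => i /negbTE ij.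
by rewrite zvec_rot ij mul1r.
Qed.

Lemma sqn_zvec d (u : coords R d) : sqn u = \sum_j normc (tnth (zvec u) j) ^+ 2.
Proof. by apply: eq_bigr => j _; rewrite mxE tnth_mktuple. Qed.

Lemma sqn_rot d (j : 'I_d) th (u : coords R d) : sqn (at_coord j (plane_rot th) u) = sqn u.
Proof.
rewrite !sqn_zvec; apply: eq_bigr => i _; rewrite zvec_rot Normc.normcM.
by case: eqP => _; rewrite ?normc_cis ?Normc.normc1 mul1r.
Qed.

Lemma rot_cball d (j : 'I_d) th : at_coord j (plane_rot th) @^-1` (@cball R d) = @cball R d.
Proof. by apply/seteqP; split=> u; rewrite /cball /unit_ball /= -![sqnorm _]/(sqn _) sqn_rot. Qed.

Lemma tau_rotation_invariant d (j : 'I_d) m : (0 < m)%N ->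
  mpres (@tau R d) (at_coord j (plane_rot (pi / m%:R))).
Proof.
move=> m0; have [mf Hf] := @mpres_mpow _ _ _ d j _ (rotation_invariant m0).
split=> // A mA; rewrite /tau.
have mAB : measurable (A `&` @cball R d) by apply: measurableI => //; exact: measurable_cball.
transitivity (\int[image_measure (leb2d R d) mf]_(u in A `&` @cball R d)
    ((1 - sqnorm (cvec u)) `^ (- d.+1%:R))%:E)%E; last first.
  by apply: eq_measure_integral => B mB _; exact: Hf.
have := @ge0_integral_pushforward _ _ _ _ R _ mf (leb2d R d) (A `&` @cball R d)
  (fun u => ((1 - sqnorm (cvec u)) `^ (- d.+1%:R))%:E) mAB.
rewrite preimage_setI rot_cball => ->.
- by apply: eq_integral => u _ /=; rewrite -![sqnorm _]/(sqn _) sqn_rot.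
- by apply/measurable_EFinP/measurable_funTS; exact: measurable_weight.
- by move=> u _; rewrite lee_fin powR_ge0.
Qed.

(* Rotating the j-th coordinate by an angle at which conj(z_j)^a * z_j^b takes the
   value -1 shows that the integral equals its opposite. *)
Lemma monomial_orthogonal d (al be : d.-tuple nat) (k : coords R d -> R) :
  (forall j th u, k (at_coord j (plane_rot th) u) = k u) -> al != be ->
  cintegrable (@tau R d) (@cball R d)
    (fun u => (mon al (zvec u))^*%C * mon be (zvec u) * ((k u)%:C)%C) ->
  cint (@tau R d) (@cball R d)
    (fun u => (mon al (zvec u))^*%C * mon be (zvec u) * ((k u)%:C)%C) = 0.
Proof.
move=> kr albe; set h := (fun u => _) => ih.
have [j ajb] : exists j, tnth al j != tnth be j.
  by apply/existsP; apply: contraNT albe => /existsPn H; apply/eqP/eq_from_tnth => j;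
    exact/eqP/negPn/H.
have [m m0 Hm] := cis_root ajb; set th : R := pi / m%:R in Hm.
have hrot : h \o at_coord j (plane_rot th) = (fun u => (-1) * h u).
  apply/funext => u; rewrite /h /= !mon_rot kr rmorphM rmorphXn /= -Hm; ring.
have mB := @measurable_cball R d.
have H := tau_rotation_invariant j m0.
have ihr : cintegrable (@tau R d) (@cball R d) (h \o at_coord j (plane_rot th)).
  by rewrite hrot; exact: cintegrableZ.
have := mpres_cint mB H (rot_cball j th) ih ihr; rewrite hrot cintZ// mulN1r => /eqP.
by rewrite eq_sym -addr_eq0 -mulr2n -mulr_natl mulf_eq0 pnatr_eq0/= => /eqP.
Qed.

End MeasurePreserving.

(** * Moments of the ball *)

Section RealIntegrals.
Variable R : realType.
Local Notation leb := (@lebesgue_measure R).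
Implicit Types (a b s t : R).

Lemma is_derive_derive1 (F : R -> R) (x c : R) : is_derive x (1 : R) F c ->
  derivable F x 1 /\ F^`()%classic x = c.
Proof. by move=> H; split=> //; rewrite derive1E; exact: derive_val. Qed.

Lemma integral_is_derive (F f : R -> R) a b : a <= b ->
  (forall x, a <= x <= b -> derivable F x 1 /\ F^`()%classic x = f x) ->
  (forall x, a <= x <= b -> {for x, continuous f}) ->
  (\int[leb]_(x in `[a, b]) (f x)%:E = (F b - F a)%:E)%E.
Proof.
rewrite le_eqVlt => /predU1P[<- _ _|ab dF cf].
  by rewrite set_itv1 integral_set1 subrr.
have cF x : a <= x <= b -> {for x, continuous F}.
  by move=> /dF[dFx _]; apply/differentiable_continuous/derivable1_diffP.
rewrite (@continuous_FTC2 _ f F)//.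
- apply/subspace_continuousP => x /=; rewrite in_itv/= => xab.
  by apply: cvg_within_filter; exact: cf.
- split.
  + by move=> x; rewrite in_itv/= => /andP[ax xb]; have [] := dF x _; rewrite ?ltW.
  + by apply: cvg_at_right_filter; apply: cF; rewrite lexx ltW.
  + by apply: cvg_at_left_filter; apply: cF; rewrite lexx ltW.
- move=> x; rewrite in_itv/= => /andP[ax xb]; by have [] := dF x _; rewrite ?ltW.
Qed.

Lemma powR_continuous b t : 0 < t -> {for t, continuous (fun x : R => x `^ b)}.
Proof.
move=> t0; have H := is_derive1_powR b t0.
by apply/differentiable_continuous/derivable1_diffP.
Qed.

Lemma itv_bigcup_co s : 0 < s -> \bigcup_n `[0, s - s / n.+1%:R]%classic = `[0, s[%classic.
Proof.
move=> s0; apply/seteqP; split=> t /=.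
  move=> [n _]; rewrite /= !in_itv/= => /andP[-> ts]; apply: le_lt_trans ts _.
  by rewrite ltrBlDr ltrDl divr_gt0// ltr0n.
rewrite in_itv/= => /andP[t0 ts].
have st : 0 < (s - t) / s by rewrite divr_gt0// subr_gt0.
exists (Num.truncn (((s - t) / s)^-1)) => //=; rewrite in_itv/= t0/=.
have H : ((s - t) / s)^-1 < (Num.truncn (((s - t) / s)^-1)).+1%:R by exact: truncnS_gt.
rewrite lerBrDr -lerBrDl ler_pdivrMr ?ltr0n//.
have : s = (s - t) * ((s - t) / s)^-1 by rewrite invf_div mulrC divfK// gt_eqF// subr_gt0.
by move=> {1}->; rewrite ler_wpM2l ?subr_ge0// ltW.
Qed.

(** For b < 0 the integrand blows up at s, so the antiderivative is used on [0, s - s / (n + 1)] and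
    the intervals are exhausted monotonically. *)
Lemma integral_powR_co s b : 0 < s -> -1 < b ->
  (\int[leb]_(t in `[0%R, s[) ((s - t) `^ b)%:E = (s `^ (b + 1) / (b + 1))%:E)%E.
Proof.
move=> s0 b1; have b10 : 0 < b + 1 by lra.
have mf D : measurable_fun D (fun t : R => ((s - t) `^ b)%:E).
  apply/measurable_EFinP/measurable_funTS; apply: (measurableT_comp (measurable_powR b)).
  exact: measurable_funB.
have cvg1 := @ge0_nondecreasing_set_cvg_integral _ (measurableTypeR R) R
  (fun n => `[0, s - s / n.+1%:R]%classic) (fun t => ((s - t) `^ b)%:E) leb.
have E n : (\int[leb]_(t in `[0%R, (s - s / n.+1%:R)%R]) ((s - t) `^ b)%:E =
   ((s `^ (b + 1) - (s / n.+1%:R) `^ (b + 1)) / (b + 1))%:E)%E.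
  have n0 : 0 < s / n.+1%:R by rewrite divr_gt0// ltr0n.
  pose F t := - (s - t) `^ (b + 1) / (b + 1).
  have -> : ((s `^ (b + 1) - (s / n.+1%:R) `^ (b + 1)) / (b + 1)) =
      F (s - s / n.+1%:R) - F 0.
    by rewrite /F subKr subr0; lra.
  apply: (integral_is_derive (F := F)).
  - by rewrite subr_ge0 ler_pdivrMr ?ltr0n// ler_peMr ?ler1n// ltW.
  - move=> x /andP[x0 xs].
    have sx : 0 < s - x by rewrite subr_gt0 (le_lt_trans xs)// ltrBlDr ltrDl.
    have H1 := is_derive1_powR (b + 1) sx.
    have H2 : is_derive x 1 (fun t : R => s - t) (-1).
      have := is_deriveB (is_derive_cst s x 1) (is_derive_id x 1).
      by rewrite sub0r.
    have H3 := @is_derive1_comp R _ (fun t => s - t) x _ _ H1 H2.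
    apply: is_derive_derive1.
    rewrite (_ : F = (- (b + 1)^-1) *: ((fun x => x `^ (b + 1)) \o (fun t => s - t))).
      have -> : (s - x) `^ b = - (b + 1)^-1 *: ((b + 1) * (s - x) `^ (b + 1 - 1) * -1).
        by rewrite addrK /GRing.scale /=; field; lra.
      exact: is_deriveZ.
    by apply/funext => t; rewrite /F !fctE /GRing.scale /=; lra.
  - move=> x /andP[x0 xs].
    have sx : 0 < s - x by rewrite subr_gt0 (le_lt_trans xs)// ltrBlDr ltrDl.
    apply: (@continuous_comp _ _ _ (fun t => s - t) (fun x => x `^ b)); last exact: powR_continuous.
    by apply: cvgB; [exact: cvg_cst|exact: cvg_id].
move: cvg1; rewrite itv_bigcup_co// => cvg1; symmetry; apply: cvg_unique (cvg1 _ _ _ _) => //.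
- rewrite /=; under eq_fun do rewrite E.
  apply: cvg_EFin; first by near=> n.
  have -> : fine \o (fun n : nat => ((s `^ (b + 1) - (s / n.+1%:R) `^ (b + 1)) / (b + 1))%:E) =
    (fun n => (s `^ (b + 1) - (s / n.+1%:R) `^ (b + 1)) / (b + 1)) by [].
  have -> : s `^ (b + 1) / (b + 1) = (s `^ (b + 1) - 0) / (b + 1) by rewrite subr0.
  apply: cvgM; last exact: cvg_cst.
  apply: cvgB; first exact: cvg_cst.
  move/cvg_at_rightP: (powR_cvg0 b10); apply; split; first by move=> n; rewrite divr_gt0// ltr0n.
  by rewrite -(mulr0 s); apply: cvgMr; exact: cvg_harmonic.
- move=> n m nm; apply/subsetPset => t /=; rewrite !in_itv/= => /andP[-> ts].
  apply: le_trans ts _; rewrite lerD2l lerN2 ler_wpM2l ?(ltW s0)// lef_pV2 ?posrE ?ltr0n//.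
  by rewrite ler_nat.
- by move=> n; exact: mf.
- by move=> n t _; rewrite lee_fin powR_ge0.
Unshelve. all: by end_near. Qed.

Lemma powR_succ (x b : R) : 0 < x -> x `^ (b + 1) = x `^ b * x.
Proof. by move=> x0; rewrite powRD ?(gt_eqF x0) ?implybT// powRr1// ltW. Qed.

(** The Beta integral, by induction on k for all b: from t + (s - t) = s, the integral for (k + 1,
    b) plus the one for (k, b + 1) is s times the one for (k, b). *)
Lemma integral_beta s b k : 0 < s -> -1 < b ->
  (\int[leb]_(t in `[0%R, s[) (t ^+ k * (s - t) `^ b)%:E =
   (s `^ (b + k.+1%:R) * k`!%:R / poch (b + 1) k.+1)%:E)%E.
Proof.
move=> s0; elim: k b => [|k IH] b b1.
  under eq_integral do rewrite expr0 mul1r.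
  by rewrite integral_powR_co// /poch big_ord1 addr0 fact0 mulr1.
have mf j c : measurable_fun `[0, s[%classic (fun t : measurableTypeR R =>
  (t ^+ j * (s - t) `^ c)%:E).
  apply/measurable_EFinP/measurable_funTS/measurable_funM; first exact: measurable_funX.
  apply: (measurableT_comp (measurable_powR c)); exact: measurable_funB.
have f0 j c (t : R) : `[0, s[%classic t -> (0 <= (t ^+ j * (s - t) `^ c)%:E)%E.
  by rewrite /= in_itv/= => /andP[t0 _]; rewrite lee_fin mulr_ge0 ?powR_ge0// exprn_ge0.
have E : (\int[leb]_(t in `[0%R, s[) (t ^+ k.+1 * (s - t) `^ b)%:E +
   \int[leb]_(t in `[0%R, s[) (t ^+ k * (s - t) `^ (b + 1))%:E =
   s%:E * \int[leb]_(t in `[0%R, s[) (t ^+ k * (s - t) `^ b)%:E)%E.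
  rewrite -ge0_integralD//; [|exact: f0|exact: mf|exact: f0|exact: mf].
  rewrite -ge0_integralZl; [|exact: measurable_itv|exact: mf|exact: f0|by rewrite lee_fin ltW].
  apply: eq_integral => t; rewrite inE/= in_itv/= => /andP[t0 ts].
  rewrite -EFinD -EFinM powR_succ ?subr_gt0//; congr EFin; rewrite exprS; ring.
rewrite (IH b)// (IH (b + 1)) in E; last by lra.
(* The sum in E is finite, which rules out an infinite value of the unknown integral. *)
case: (integral _ _ _) E => [r| |]//=.
rewrite -EFinD -EFinM => -[E]; congr EFin.
have b0 : 0 < b + 1 by lra.
have kp : 0 <= k%:R :> R by [].
have p1 : 0 < poch (b + 1 + 1) k by apply: poch_gt0; lra.
have P1 : poch (b + 1) k.+1 = (b + 1) * poch (b + 1 + 1) k by rewrite pochS.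
have P2 : poch (b + 1 + 1) k.+1 = poch (b + 1 + 1) k * (b + 1 + 1 + k%:R).
  by rewrite /poch big_ord_recr.
have P3 : poch (b + 1) k.+2 = (b + 1) * poch (b + 1 + 1) k.+1 by rewrite pochS.
have Q1 : s `^ (b + 1 + k.+1%:R) = s `^ (b + k.+1%:R) * s.
  by rewrite -powR_succ//; congr (_ `^ _); ring.
have Q2 : s `^ (b + k.+2%:R) = s `^ (b + k.+1%:R) * s.
  by rewrite -powR_succ//; congr (_ `^ _); rewrite -[in LHS]natr1; ring.
move: E; rewrite Q1 Q2 P3 P1 P2 factS natrM -[k.+1%:R]natr1.
move: (poch _ k) (s `^ _) (k`!%:R) p1 => P q f p1 E.
by apply: (@addIr _ (q * s * f / (P * (b + 1 + 1 + k%:R)))); rewrite E; field; lra.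
Qed.

Notation leb2 := (sfprod leb leb).

Lemma disc_section (c x : R) :
  leb [set y | x ^+ 2 + y ^+ 2 <= c] = (2 * Num.sqrt (c - x ^+ 2))%:E.
Proof.
have [cx|cx] := leP 0 (c - x ^+ 2); last first.
  rewrite (_ : [set y | _] = set0) ?measure0 ?(ltr0_sqrtr cx) ?mulr0//.
  apply/seteqP; split=> // y /= H; have := sqr_ge0 y; lra.
rewrite (_ : [set y | _] = `[- Num.sqrt (c - x ^+ 2), Num.sqrt (c - x ^+ 2)]%classic).
  rewrite lebesgue_measure_itv/= lte_fin; have := sqrtr_ge0 (c - x ^+ 2).
  set r := Num.sqrt _; rewrite le_eqVlt => /predU1P[<-|r0]; first by rewrite oppr0 ltxx mulr0.
  by rewrite ifT -?EFinB; [congr EFin; lra|lra].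
apply/seteqP; split=> y /=; rewrite in_itv/= -ler_norml -sqrtr_sqr.
  by move=> H; rewrite ler_wsqrtr//; lra.
by rewrite ler_sqrt//; lra.
Qed.

Lemma measurable_disc (c : R) :
  measurable [set x : measurableTypeR R * measurableTypeR R | x.1 ^+ 2 + x.2 ^+ 2 <= c].
Proof.
rewrite (_ : [set x | _] = setT `&` (fun x : measurableTypeR R * measurableTypeR R => x.1 ^+ 2 +
  x.2 ^+ 2) @^-1` `]-oo, c]%classic).
  have mf : measurable_fun setT (fun x : measurableTypeR R * measurableTypeR R => x.1 ^+ 2 +
    x.2 ^+ 2).
    by apply: measurable_funD; apply: measurable_funX.
  by apply: mf => //; exact: measurable_itv.
by rewrite setTI; apply/seteqP; split=> x /=; rewrite in_itv.
Qed.

(** The lengths of the vertical sections are integrated by the substitution x = r sin t, after which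
    c (t + sin t cos t) is an antiderivative. *)
Lemma disc_area (c : R) : 0 <= c ->
  leb2 [set x | x.1 ^+ 2 + x.2 ^+ 2 <= c] = (pi * c)%:E.
Proof.
move=> c0; rewrite /sfprod /product_measure1.
pose r := Num.sqrt c; have r0 : 0 <= r by exact: sqrtr_ge0.
have rr : r ^+ 2 = c by rewrite sqr_sqrtr.
transitivity (\int[leb]_(x in `[(- r)%R, r]) (2 * Num.sqrt (c - x ^+ 2))%:E)%E.
  rewrite [RHS]integral_mkcond; apply: eq_integral => x _ /=.
  rewrite (_ : xsection _ x = [set y | x ^+ 2 + y ^+ 2 <= c]); last first.
    by apply/seteqP; split => y; rewrite xsectionE/=.
  rewrite disc_section patchE; case: ifPn => // /negP xr; congr EFin.
  rewrite ler0_sqrtr ?mulr0// leNgt; apply/negP => cx; apply: xr.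
  by rewrite inE/= in_itv/= -ler_norml -(@ler_sqr R) ?nnegrE// real_normK ?num_real// rr; lra.
have p0 := pi_gt0 R.
have cosd t : is_derive t (1 : R) (fun t : R => r * sin t) (r * cos t).
  have := is_deriveZ r (is_derive_sin t); exact.
have [r1|r1] := eqVneq r 0.
  by rewrite r1 oppr0 set_itv1 integral_set1 -rr r1 expr0n/= mulr0.
have {}r1 : 0 < r by rewrite lt_neqAle eq_sym r1.
have F' : (fun t : R => r * sin t)^`()%classic = (fun t => r * cos t).
  by apply/funext => t; have [] := is_derive_derive1 (cosd t).
have -> : `[(- r), r]%classic = `[(fun t : R => r * sin t) (- (pi / 2)),
  (fun t : R => r * sin t) (pi / 2)]%classic.
  by rewrite /= sinN sin_pihalf mulrN mulr1.
have cF : continuous (fun t : R => r * cos t).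
  by move=> t; apply: cvgM; [exact: cvg_cst|exact: continuous_cos].
have cG : continuous (fun t : R => r * sin t).
  by move=> t; apply: cvgM; [exact: cvg_cst|exact: continuous_sin].
rewrite (@integration_by_substitution_increasing _ (fun t => r * sin t)
  (fun x => 2 * Num.sqrt (c - x ^+ 2))); first last.
- apply: continuous_subspaceT => x; apply: cvgM; first exact: cvg_cst.
  apply: continuous_cvg; first exact: sqrt_continuous.
  by apply: cvgB; [exact: cvg_cst|exact: exprn_continuous].
- split.
  + by move=> t _; exact: ex_derive.
  + by apply: cvg_at_right_filter; exact: cG.
  + by apply: cvg_at_left_filter; exact: cG.
- by rewrite F'; apply: cvgP; apply: cvg_at_left_filter; exact: cF.
- by rewrite F'; apply: cvgP; apply: cvg_at_right_filter; exact: cF.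
- by rewrite F' => t _; exact: cF.
- move=> x y xI yI xy /=; by rewrite ltr_pM2l// ltr_sin.
- lra.
pose G (t : R) := c * (t + sin t * cos t).
transitivity (\int[leb]_(t in `[(- (pi / 2))%R, (pi / 2)%R]) (2 * c * cos t ^+ 2)%:E)%E.
  apply: eq_integral => t; rewrite inE/= in_itv/= => tI.
  rewrite F' !fctE; congr EFin => /=.
  have -> : c - (r * sin t) ^+ 2 = (r * cos t) ^+ 2 by rewrite !exprMn rr sin2cos2; ring.
  rewrite sqrtr_sqr ger0_norm ?mulr_ge0 ?cos_ge0_pihalf//.
  by transitivity (2 * (r ^+ 2 * cos t ^+ 2)); [ring|rewrite rr; ring].
have pp : - (pi / 2) <= pi / 2 :> R by lra.
rewrite (@integral_is_derive G (fun t => 2 * c * cos t ^+ 2) _ _ pp).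
- rewrite /G; congr EFin; rewrite cosN cos_pihalf; lra.
- move=> t _; apply: is_derive_derive1.
  have H := is_deriveZ c (is_deriveD (is_derive_id t 1)
    (is_deriveM (is_derive_sin t) (is_derive_cos t))).
  apply: (is_derive_eq H).
  rewrite /GRing.scale /=; have := sin2cos2 t; rewrite !expr2; nra.
- move=> t _; apply: cvgM; first exact: cvg_cst.
  by apply: cvgM; exact: continuous_cos.
Qed.

Definition radius2 (x : measurableTypeR R * measurableTypeR R) : measurableTypeR R :=
  x.1 ^+ 2 + x.2 ^+ 2.

Lemma measurable_radius2 : measurable_fun setT radius2.
Proof. by apply: measurable_funD; apply: measurable_funX. Qed.

(** Takes the place of polar coordinates. The image of planar measure divided by pi, plus the
    restriction of Lebesgue measure to the negative axis, agrees with Lebesgue measure on half-open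
    intervals by the area of discs, hence everywhere. *)
Lemma radius2_law (A : set (measurableTypeR R)) : measurable A ->
  A `<=` [set t | 0 <= t] -> leb2 (radius2 @^-1` A) = (pi%:E * leb A)%E.
Proof.
have p0 : 0 < pi :> R := pi_gt0 R.
have ip0 : 0 <= pi^-1 :> R by rewrite invr_ge0 ltW.
have mn := measurable_itv (`]-oo, (0 : R)[ : interval R).
pose m1 := mscale (NngNum ip0) (image_measure leb2 measurable_radius2).
pose m2 := mrestr leb mn.
have E (B : set (measurableTypeR R)) : measurable B -> leb B = measure_add m1 m2 B.
  apply: lebesgue_measure_unique => _ [[a b] _ <-].
  transitivity (m1 `]a, b]%classic + m2 `]a, b]%classic)%E; last exact/esym/measure_addE.
  rewrite /m1 /m2 /mscale /mrestr /= /pushforward.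
  have [ba|ab] := leP b a.
    rewrite (_ : `]a, b]%classic = set0); last first.
      by apply/seteqP; split=> // x /=; rewrite in_itv/=; lra.
    by rewrite preimage_set0 set0I !measure0 mule0 adde0.
  have r0 x : 0 <= radius2 x by rewrite addr_ge0 ?sqr_ge0.
  rewrite lebesgue_measure_itv /= lte_fin ab -EFinB.
  have [b0|b0] := ltP b 0.
    rewrite (_ : radius2 @^-1` _ = set0); last first.
      by apply/seteqP; split=> // x /=; rewrite in_itv/=; have := r0 x; lra.
    rewrite measure0 mule0 add0e (_ : _ `&` _ = `]a, b]%classic).
      by rewrite lebesgue_measure_itv /= lte_fin ab -EFinB.
    by apply/seteqP; split=> x /=; rewrite !in_itv/=; [case|move=> xab; split=> //; lra].
  have [a0|a0] := ltP a 0.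
    rewrite (_ : radius2 @^-1` _ = [set x | x.1 ^+ 2 + x.2 ^+ 2 <= b]); last first.
      apply/seteqP; split=> x /=; rewrite in_itv/=; first by case/andP.
      by move=> ->; have := r0 x; rewrite /radius2; lra.
    rewrite disc_area// -EFinM mulKf ?gt_eqF// (_ : _ `&` _ = `]a, 0[%classic).
      by rewrite lebesgue_measure_itv /= lte_fin a0 -EFinB -EFinD; congr EFin; ring.
    by apply/seteqP; split=> x /=; rewrite !in_itv/=; [move=> [] H1 H2; lra|move=> xab; split; lra].
  rewrite (_ : radius2 @^-1` _ = [set x | x.1 ^+ 2 + x.2 ^+ 2 <= b] `\`
    [set x | x.1 ^+ 2 + x.2 ^+ 2 <= a]); last first.
    apply/seteqP; split=> x /=; rewrite in_itv/= /radius2.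
      by move=> /andP[H1 H2]; split => //; apply/negP; rewrite -ltNge.
    by move=> [-> /negP]; rewrite -ltNge andbT.
  rewrite measureD; [|exact: measurable_disc|exact: measurable_disc|]; last first.
    suff : (leb2 [set x | (x.1 ^+ 2 + x.2 ^+ 2 <= b)%R] < +oo)%E by [].
    by rewrite disc_area// ltry.
  rewrite (_ : _ `&` _ = [set x | x.1 ^+ 2 + x.2 ^+ 2 <= a]); last first.
    by apply/seteqP; split=> x /=; [case|move=> H; split=> //; lra].
  transitivity ((pi^-1)%:E * ((pi * b)%:E - (pi * a)%:E) + leb (`]a, b] `&` `]-oo, 0%R[))%E;
    last first.
    by congr (_ * (_ - _) + _)%E; apply/esym; exact: disc_area.
  rewrite -EFinB -EFinM -mulrBr mulKf ?gt_eqF//.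
  rewrite (_ : _ `&` _ = set0) ?measure0 ?adde0//.
  by apply/seteqP; split=> // x /=; rewrite !in_itv/=; lra.
move=> mA A0; rewrite (E _ mA) measure_addE /m1 /m2 /= /mscale /mrestr /= /pushforward.
rewrite (_ : A `&` _ = set0) ?measure0 ?adde0; last first.
  by apply/seteqP; split => // x /= []; rewrite in_itv/= => /A0/=; lra.
by rewrite muleA -EFinM divff ?gt_eqF// mul1e.
Qed.

Lemma integral_radius2 (g : measurableTypeR R -> \bar R) : measurable_fun setT g ->
  (forall t, 0 <= g t)%E ->
  (\int[leb2]_x g (radius2 x) = pi%:E * \int[leb]_(t in [set t | (0 <= t)%R]) g t)%E.
Proof.
move=> mg g0; have p0 : 0 <= pi :> R := pi_ge0 R.
have mi : measurable ([set t | 0 <= t] : set (measurableTypeR R)).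
  by rewrite -set_itvcy; exact: measurable_itv.
have := @ge0_integral_pushforward _ _ _ _ R _ measurable_radius2 leb2 _ g mi.
rewrite (_ : radius2 @^-1` _ = setT); last first.
  by apply/seteqP; split=> x //= _; rewrite addr_ge0 ?sqr_ge0.
move=> <- //; last exact: measurable_funTS.
transitivity (\int[mscale (NngNum p0) leb]_(t in [set t | (0 <= t)%R]) g t)%E.
  by apply: (@eq_measure_integral _ _ _ _ _ (image_measure leb2 measurable_radius2)) => A mA A0;
    exact: radius2_law.
by rewrite ge0_integral_mscale//; exact: measurable_funTS.
Qed.

Lemma sqn_tcons d (x : measurableTypeR R * measurableTypeR R) (u : coords R d) :
  sqn (tcons (x, u)) = radius2 x + sqn u.
Proof.
by rewrite /sqn !sqnorm_cvec big_ord_recl tnth0; congr (_ + _); apply: eq_bigr => j _;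
  rewrite tnthS.
Qed.

Lemma mon_tcons d k (al : d.-tuple nat) (x : measurableTypeR R * measurableTypeR R)
  (u : coords R d) :
  mon [tuple of k :: al] (zvec (tcons (x, u))) = (x.1 +i* x.2)%C ^+ k * mon al (zvec u).
Proof.
rewrite -mon_cons; congr mon; apply: eq_from_tnth => j; rewrite tnth_mktuple.
by case: (unliftP ord0 j) => [i|] ->; rewrite ?tnthS ?tnth0 ?tnth_mktuple.
Qed.

(** The squared radius s is a parameter because fixing one coordinate z_0 of the ball leaves a ball
    of squared radius s - |z_0|^2. *)
Definition moment_density d (al : d.-tuple nat) s b (u : coords R d) : R :=
  if sqn u < s then normc (mon al (zvec u)) ^+ 2 * (s - sqn u) `^ b else 0.

Lemma measurable_sqn d : measurable_fun setT (@sqn R d).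
Proof. exact: measurable_sqnorm_cvec. Qed.

Lemma cmeas_zvec d (j : 'I_d) : cmeas setT (fun u : coords R d => tnth (zvec u) j).
Proof.
split; (under eq_fun do rewrite tnth_mktuple/=).
  by apply: (measurableT_comp measurable_fst); exact: measurable_tnth.
by apply: (measurableT_comp measurable_snd); exact: measurable_tnth.
Qed.

Lemma cmeas_mon d (al : d.-tuple nat) : cmeas setT (fun u : coords R d => mon al (zvec u)).
Proof. by apply: cmeas_prod => // j; apply: cmeasX; exact: cmeas_zvec. Qed.

Lemma measurable_moment_density d (al : d.-tuple nat) s b :
  measurable_fun setT (moment_density al s b).
Proof.
apply: measurable_fun_if => //.
- by apply: measurable_fun_ltr => //; exact: measurable_sqn.
- apply: measurable_funTS; apply: measurable_funM.
    by apply: measurable_funX; apply: measurable_normc => //; exact: cmeas_mon.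
  apply: (measurableT_comp (measurable_powR b)); apply: measurable_funB => //;
    exact: measurable_sqn.
Qed.

Lemma moment_density_ge0 d (al : d.-tuple nat) s b u : 0 <= moment_density al s b u.
Proof. by rewrite /moment_density; case: ifP => // _; rewrite mulr_ge0 ?powR_ge0 ?sqr_ge0. Qed.

Lemma sqn_ge0 d (u : coords R d) : 0 <= sqn u.
Proof. by apply: sumr_ge0 => j _; rewrite sqr_ge0. Qed.

(** Induction on d. After Tonelli the inner integral is the case d with s - |z_0|^2 in place of s, a
    power of s - |z_0|^2. The outer one depends on |z_0|^2 only and becomes pi times a Beta
    integral. *)
Lemma integral_moment d (al : d.-tuple nat) s b : 0 < s -> -1 < b ->
  (\int[leb2d R d]_u (moment_density al s b u)%:E =
   (pi ^+ d * (mfact al)%:R / poch (b + 1) (d + msize al) * s `^ (b + (d + msize al)%:R))%:E)%E.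
Proof.
elim: d al s b => [|d IH] al s b s0 b1.
  rewrite /leb2d /= integral_dirac// ?diracT ?mul1e//; last first.
    by apply/measurable_EFinP; exact: measurable_moment_density.
  have q0 : sqn ([tuple] : coords R 0) = 0 by rewrite /sqn /sqnorm big_ord0.
  rewrite /moment_density q0 s0 subr0 /mon big_ord0 normc_real normr1 expr1n.
  by rewrite /mfact /msize /poch !big_ord0 addr0 divr1 !mul1r.
case/tupleP: al => k al.
have mf := @measurable_moment_density d.+1 [tuple of k :: al] s b.
have mc := @measurable_tcons _ (measurableTypeR R * measurableTypeR R)%type d.
have f0 (x : _ * coords R d) : (0 <= (moment_density [tuple of k :: al] s b (tcons x))%:E)%E.
  by rewrite lee_fin moment_density_ge0.
have := @ge0_integral_pushforward _ _ _ _ R _ mc (sfprod leb2 (leb2d R d)) setT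
  (fun u => (moment_density [tuple of k :: al] s b u)%:E) measurableT.
rewrite preimage_setT => ->; last first.
- by move=> y _; rewrite lee_fin moment_density_ge0.
- exact/measurable_EFinP.
rewrite fubini_tonelli1//; last first.
  by apply/measurable_EFinP; apply: measurableT_comp.
pose m := (d + msize al)%N; pose C : R := pi ^+ d * (mfact al)%:R / poch (b + 1) m.
have b10 : 0 < b + 1 by lra.
have C0 : 0 <= C by rewrite divr_ge0 ?(ltW (poch_gt0 _ _))// mulr_ge0 ?exprn_ge0 ?pi_ge0.
(* The absolute value makes g nonnegative on the whole line, as [integral_radius2] asks; it
   disappears on t >= 0. *)
pose g (t : R) := if t < s then C * (`|t| ^+ k * (s - t) `^ (b + m%:R)) else 0.
have g0 t : 0 <= g t by rewrite /g; case: ifP => // _; apply: mulr_ge0 => //;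
  rewrite mulr_ge0 ?powR_ge0 ?exprn_ge0.
transitivity (\int[leb2]_x (g (radius2 x))%:E)%E.
  apply: eq_integral => x _; rewrite /fubini_F /=.
  have r0 : 0 <= radius2 x by rewrite addr_ge0 ?sqr_ge0.
  have nE u : normc (mon [tuple of k :: al] (zvec (tcons (x, u)))) ^+ 2 =
      `|radius2 x| ^+ k * normc (mon al (zvec u)) ^+ 2.
    rewrite mon_tcons Normc.normcM exprMn normcX -!exprM mulnC exprM; congr (_ ^+ _ * _).
    by rewrite /= sqr_sqrtr ?ger0_norm// addr_ge0 ?sqr_ge0.
  rewrite /g; case: ifPn => [xs|]; last first.
    rewrite -leNgt => xs; apply: integral0_eq => u _; congr EFin.
    rewrite /moment_density sqn_tcons ifN// -leNgt (le_trans xs)// lerDl; exact: sqn_ge0.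
  have sx : 0 < s - radius2 x by rewrite subr_gt0.
  transitivity (\int[leb2d R d]_u ((`|radius2 x| ^+ k)%:E *
    (moment_density al (s - radius2 x) b u)%:E))%E.
    apply: eq_integral => u _; rewrite -EFinM; congr EFin.
    rewrite /moment_density sqn_tcons ltrBrDl; case: ifP => _; last by rewrite mulr0.
    have -> : s - (radius2 x + sqn u) = s - radius2 x - sqn u by ring.
    by rewrite nE [in RHS]mulrA.
  rewrite ge0_integralZl//; last 2 first.
  - by apply/measurable_EFinP; exact: measurable_moment_density.
  - by move=> u _; rewrite lee_fin moment_density_ge0.
  by rewrite IH// -EFinM; congr EFin; rewrite mulrCA mulrA.
have mg : measurable_fun setT (g : measurableTypeR R -> R).
  apply: measurable_fun_if => //; first exact: measurable_fun_ltr.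
  apply: measurable_funTS; apply: measurable_funM => //; apply: measurable_funM.
    by apply: (measurableT_comp (@measurable_funX _ _ _ _ _ k (@normr_measurable R setT))).
  by apply: (measurableT_comp (measurable_powR _)); exact: measurable_funB.
rewrite (integral_radius2 (g := fun t => (g t)%:E)); last 2 first.
- exact/measurable_EFinP.
- by move=> t; rewrite lee_fin.
transitivity (pi%:E * (C%:E * \int[leb]_(t in `[0%R, s[) (t ^+ k * (s - t) `^ (b + m%:R))%:E))%E.
  congr (_ * _)%E; rewrite -ge0_integralZl//; last 2 first.
  - apply/measurable_EFinP/measurable_funTS; apply: measurable_funM; first exact: measurable_funX.
    by apply: (measurableT_comp (measurable_powR _)); exact: measurable_funB.
  - by move=> t /=; rewrite in_itv/= => /andP[t0 _]; rewrite lee_fin mulr_ge0 ?powR_ge0 ?exprn_ge0.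
  rewrite [LHS]integral_mkcond [RHS]integral_mkcond; apply: eq_integral => t _.
  rewrite !patchE /g.
  have -> : (t \in `[0%R, s[%classic) = (t \in [set t : R | 0 <= t]) && (t < s).
    by rewrite !mem_setE/= in_itv.
  case: ifPn => [t0|]; last by [].
  rewrite mem_setE/= in t0; case: ifP => //= _.
  by rewrite -EFinM ger0_norm.
rewrite integral_beta//; last by have : 0 <= m%:R :> R by []; lra.
rewrite -!EFinM; congr EFin.
rewrite msize_cons mfact_cons natrM exprS.
rewrite (_ : (d.+1 + (k + msize al) = m + k.+1)%N); last by rewrite /m; lia.
rewrite (_ : b + (m + k.+1)%:R = b + m%:R + k.+1%:R); last by rewrite natrD addrA.
rewrite pochD (_ : b + 1 + m%:R = b + m%:R + 1); last by ring.
rewrite /C invfM.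
move: (_ `^ _) (poch _ m)^-1 (poch _ k.+1)^-1 (pi ^+ d) => w x y z; ring.
Qed.

End RealIntegrals.

(** * The Gamma function and the constant c_lambda *)

Section GammaFunction.
Variable R : realType.
Local Notation leb := (@lebesgue_measure R).
Implicit Types (s t b x : R).

Lemma reflection_invariant s :
  mpres leb (fun t : measurableTypeR R => s - t).
Proof.
have mc : measurable_fun setT ((fun t => s - t) : measurableTypeR R -> measurableTypeR R).
  exact: measurable_funB.
split=> // A mA; apply/esym.
have := @lebesgue_measure_unique R (@image_measure R _ _ (measurableTypeR R) (measurableTypeR R)
  leb _ mc) _ A mA.
apply; rewrite {A mA}.
move=> _ [[a b] _ <-]; rewrite /= /pushforward.
have -> : (fun x : R => s - x) @^-1` `]a, b] = `[s - b, s - a[%classic.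
  by apply/seteqP; split => x /=; rewrite !in_itv/= => /andP[? ?]; apply/andP; split; lra.
rewrite !lebesgue_measure_itv/= !lte_fin ltrD2l ltrN2; case: ifP => // _.
by rewrite -!EFinB; congr EFin; ring.
Qed.

Lemma integral_powR s b : 0 < s -> -1 < b ->
  (\int[leb]_(t in `]0%R, s]) (t `^ b)%:E = (s `^ (b + 1) / (b + 1))%:E)%E.
Proof.
move=> s0 b1; have [mr Hr] := reflection_invariant s.
rewrite -(integral_powR_co s0 b1).
transitivity (\int[image_measure leb mr]_(t in `]0%R, s]) (t `^ b)%:E)%E.
  by apply: eq_measure_integral => A mA _; exact/esym/Hr.
have := @ge0_integral_pushforward _ _ _ _ R _ mr leb `]0, s]%classic (fun t => (t `^ b)%:E).
move=> -> //.
- congr (integral _ _ _); apply/seteqP; split=> x /=; rewrite !in_itv/= => /andP[? ?];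
    by apply/andP; split; lra.
- by apply/measurable_EFinP/measurable_funTS; exact: measurable_powR.
- by move=> t _; rewrite lee_fin powR_ge0.
Qed.

(** Euler's integral with values in the extended reals, so that the functional equation can be
    proved by Tonelli before finiteness is known, and then used to prove finiteness. *)
Definition gam x : \bar R := (\int[leb]_(t in `]0%R, +oo[) (t `^ (x - 1) * expR (- t))%:E)%E.

Lemma expRN_is_derive t : is_derive t (1 : R) (fun u : R => - expR (- u)) (expR (- t)).
Proof.
have H := @is_derive1_comp R expR (fun u => - u) t _ _ (is_derive_expR (- t))
  (is_deriveN (is_derive_id t 1)).
have := is_deriveN H; rewrite mulrN1 opprK; exact.
Qed.

Lemma expRN_continuous : continuous (fun u : R => expR (- u)).
Proof.
move=> x; apply: continuous_cvg; first exact: continuous_expR.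
by apply: cvgN; exact: cvg_id.
Qed.

Lemma integral_expRN t : (\int[leb]_(u in `[t, +oo[) (expR (- u))%:E = (expR (- t))%:E)%E.
Proof.
rewrite (@ge0_continuous_FTC2y _ (fun u => expR (- u)) (fun u => - expR (- u)) _ 0).
- by rewrite sub0e /= opprK.
- by move=> x _; exact: expR_ge0.
- by apply: continuous_subspaceT => x; exact: expRN_continuous.
- by rewrite -oppr0; apply: cvgN; exact: cvgr_expR.
- by move=> x _; have [] := is_derive_derive1 (expRN_is_derive x).
- by apply: cvg_at_right_filter; apply: cvgN; exact: expRN_continuous.
- by move=> x _; have [] := is_derive_derive1 (expRN_is_derive x).
Qed.

Lemma gam_measurable x (D : set (measurableTypeR R)) :
  measurable_fun D (fun t : measurableTypeR R => (t `^ x * expR (- t))%:E).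
Proof.
apply/measurable_EFinP/measurable_funTS/measurable_funM; first exact: measurable_powR.
exact: measurableT_comp.
Qed.

(** Integrate t^(x-1) exp(-u) over the region 0 < t <= u in both orders: first in t it gives u^x
    exp(-u) / x, first in u it gives t^(x-1) exp(-t). *)
Lemma gamS x : 0 < x -> gam (x + 1) = (x%:E * gam x)%E.
Proof.
move=> x0.
pose T := measurableTypeR R.
pose F (p : T * T) := (if (0 < p.2) && (p.2 <= p.1) then p.2 `^ (x - 1) * expR (- p.1) else 0)%:E.
have F0 p : (0 <= F p)%E.
  by rewrite /F; case: ifP => // _; rewrite lee_fin mulr_ge0 ?powR_ge0 ?expR_ge0.
have mF : measurable_fun setT F.
  apply/measurable_EFinP; apply: measurable_fun_if => //.
    by apply: measurable_and; [apply: measurable_fun_ltr|apply: measurable_fun_ler].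
  apply: measurable_funTS; apply: measurable_funM.
    by apply: (measurableT_comp (measurable_powR _)).
  by apply: measurableT_comp => //; apply: measurableT_comp.
have := @fubini_tonelli _ _ T T R leb leb F mF F0.
have -> : (\int[leb]_u \int[leb]_t F (u, t) = (x^-1)%:E * gam (x + 1))%E.
  rewrite -ge0_integralZl//; last 3 first.
  - exact: gam_measurable.
  - by move=> t _; rewrite lee_fin mulr_ge0 ?powR_ge0 ?expR_ge0.
  - by rewrite lee_fin invr_ge0 ltW.
  rewrite [RHS]integral_mkcond; apply: eq_integral => u _.
  rewrite patchE; case: ifPn => [|/negP]; rewrite inE/= in_itv/= andbT => u0; last first.
    apply: integral0_eq => t _; rewrite /F /=; case: ifP => // /andP[t0 tu].
    by exfalso; apply: u0; exact: lt_le_trans tu.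
  transitivity (\int[leb]_(t in `]0%R, u]) ((expR (- u))%:E * (t `^ (x - 1))%:E))%E.
    rewrite [RHS]integral_mkcond; apply: eq_integral => t _.
    rewrite patchE mem_setE/= in_itv/= /F/=; case: ifP => // _.
    by rewrite -EFinM mulrC.
  rewrite ge0_integralZl//; last 2 first.
  - by apply/measurable_EFinP/measurable_funTS; exact: measurable_powR.
  - by move=> t _; rewrite lee_fin powR_ge0.
  rewrite integral_powR//; last by lra.
  rewrite -!EFinM subrK addrK; congr EFin; ring.
have -> : (\int[leb]_t \int[leb]_u F (u, t) = gam x)%E.
  rewrite /gam [RHS]integral_mkcond; apply: eq_integral => t _.
  rewrite patchE; case: ifPn => [|/negP]; rewrite inE/= in_itv/= andbT => t0; last first.
    by apply: integral0_eq => u _; rewrite /F /=; case: ifP => // /andP[].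
  transitivity (\int[leb]_(u in `[t, +oo[) ((t `^ (x - 1))%:E * (expR (- u))%:E))%E.
    rewrite [RHS]integral_mkcond; apply: eq_integral => u _.
    rewrite patchE mem_setE/= in_itv/= andbT /F/= t0/=.
    by case: (t <= u).
  rewrite ge0_integralZl//; last 2 first.
  - by apply/measurable_EFinP/measurable_funTS; exact: measurableT_comp.
  - by rewrite lee_fin powR_ge0.
  by rewrite integral_expRN -EFinM.
by move=> <-; rewrite muleA -EFinM divff ?gt_eqF// mul1e.
Qed.

Lemma gam_gt0 x : 0 < x -> (0 < gam x)%E.
Proof.
move=> x0; apply: (@lt_le_trans _ _ (\int[leb]_(t in `]0%R, 1%R])
  ((expR (-1))%:E * (t `^ (x - 1))%:E))%E).
  rewrite ge0_integralZl//; last 2 first.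
  - by apply/measurable_EFinP/measurable_funTS; exact: measurable_powR.
  - by move=> t _; rewrite lee_fin powR_ge0.
  rewrite integral_powR//; last by lra.
  by rewrite -EFinM lte_fin mulr_gt0 ?expR_gt0// divr_gt0// ?powR_gt0// subrK.
rewrite /gam.
apply: le_trans (_ : _ <= \int[leb]_(t in `]0%R, 1%R]) (t `^ (x - 1) * expR (- t))%:E)%E _.
  apply: ge0_le_integral => //.
  - by move=> t _; rewrite lee_fin mulr_ge0 ?powR_ge0 ?expR_ge0.
  - by apply/measurable_EFinP/measurable_funTS/measurable_funM => //; exact: measurable_powR.
  - exact: gam_measurable.
  - move=> t; rewrite /= in_itv/= => /andP[t0 t1]; rewrite lee_fin mulrC ler_wpM2l ?powR_ge0//.
    by rewrite ler_expR lerN2.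
apply: ge0_subset_integral => //.
- exact: gam_measurable.
- by move=> t _; rewrite lee_fin mulr_ge0 ?powR_ge0 ?expR_ge0.
- by move=> t /=; rewrite !in_itv/= => /andP[->].
Qed.

(** The functional equation reduces to x <= 1, where the integrand is at most t^(x-1) on ]0, 1] and
    at most exp(-t) beyond 1. *)
Lemma gam_fin x : 0 < x -> (gam x < +oo)%E.
Proof.
have [n] : exists n, x <= n%:R by exists (Num.truncn x).+1; rewrite ltW// truncnS_gt.
elim: n x => [x x1 x0|n IH x xn x0]; first by rewrite ltNge x1 in x0.
have [x1|x1] := leP x 1; last first.
  rewrite -[x](subrK 1) gamS ?subr_gt0// lte_mul_pinfty ?lee_fin ?IH ?subr_gt0// ?subr_ge0
    ?(ltW x1)//.
  by rewrite -natr1 in xn; lra.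
apply: (@le_lt_trans _ _ (\int[leb]_(t in `]0%R, 1%R]) (t `^ (x - 1))%:E +
   \int[leb]_(t in `[1%R, +oo[) (expR (- t))%:E)%E); last first.
  rewrite integral_powR//; last by lra.
  by rewrite integral_expRN -EFinD ltry.
have f0 (D : set (measurableTypeR R)) t : D t -> (0 <= (t `^ (x - 1) * expR (- t))%:E)%E.
  by move=> _; rewrite lee_fin mulr_ge0 ?powR_ge0 ?expR_ge0.
rewrite /gam (_ : `]0, +oo[%classic = `]0, 1]%classic `|` `]1, +oo[%classic); last first.
  apply/seteqP; split=> t /=; rewrite !in_itv/= ?andbT; last by case; lra.
  by move=> ->; case: (leP t 1); [left|right].
rewrite ge0_integral_setU//; first last.
- by apply/disj_setPS => t /=; rewrite !in_itv/=; lra.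
- exact: f0.
- exact: gam_measurable.
apply: leeD.
  apply: ge0_le_integral => //.
  - exact: f0.
  - exact: gam_measurable.
  - by apply/measurable_EFinP/measurable_funTS; exact: measurable_powR.
  - move=> t /=; rewrite in_itv/= => /andP[t0 t1]; rewrite lee_fin ler_piMr ?powR_ge0//.
    by rewrite -expR0 ler_expR; lra.
apply: (@le_trans _ _ (\int[leb]_(t in `]1%R, +oo[) (expR (- t))%:E)%E).
  apply: ge0_le_integral => //.
  - exact: f0.
  - exact: gam_measurable.
  - by apply/measurable_EFinP/measurable_funTS; exact: measurableT_comp.
  - move=> t /=; rewrite in_itv/= andbT => t1; rewrite lee_fin ler_piMl ?expR_ge0//.
    have t0 : 0 < t by lra.
    by rewrite -[leRHS](powRr0 t) ler_powR ?(ltW t1)//; lra.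
apply: ge0_subset_integral => //.
- by apply/measurable_EFinP/measurable_funTS; exact: measurableT_comp.
- by move=> t /=; rewrite !in_itv/= !andbT; exact: ltW.
Qed.

Lemma Gamma_ratio x d : 0 < x -> Gamma x != 0 /\ Gamma (x + d%:R) = poch x d * Gamma x.
Proof.
move=> x0.
have gam_finE y : 0 < y -> gam y \is a fin_num.
  by move=> y0; rewrite ge0_fin_numE ?gam_fin// ltW// gam_gt0.
have E y : 0 < y -> (Gamma y)%:E = gam y.
  move=> y0; rewrite /Gamma y0 addr0 big_ord0 divr1 /Gamma_int /Rintegral.
  by rewrite fineK//; exact: gam_finE.
split; first by rewrite gt_eqF// -lte_fin E// gam_gt0.
elim: d => [|d IH]; first by rewrite addr0 /poch big_ord0 mul1r.
have xd : 0 < x + d%:R by rewrite ltr_wpDr.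
apply: EFin_inj; rewrite E -natr1 addrA; last by lra.
by rewrite gamS// -E// IH -EFinM /poch big_ord_recr/=; congr EFin; ring.
Qed.

(** Gamma (sg) / Gamma (sg - d) is the rising factorial (sg - d)_d, the form in which it cancels
    against the moments. *)
Lemma clam_gtd d (sg : R) : d%:R < sg -> clam d sg = poch (sg - d%:R) d / pi ^+ d.
Proof.
move=> ds; rewrite /clam leNgt ds andbF.
have [|G0 G1] := @Gamma_ratio (sg - d%:R) d; first by rewrite subr_gt0.
rewrite subrK in G1; rewrite G1 invfM; field.
by rewrite G0 andbT expf_neq0// gt_eqF// pi_gt0.
Qed.

End GammaFunction.

(** * Integration against a measure given by a density *)

Section Density.
Import HBNNSimple.
Context {disp : measure_display} {T : measurableType disp} {R : realType}.
Variables (mu nu : {measure set T -> \bar R}) (D : set T) (w : T -> R).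
Hypotheses (mD : measurable D) (mw : measurable_fun setT w) (w0 : forall t, 0 <= w t).
Hypothesis nuE : forall A, measurable A -> nu A = (\int[mu]_(t in A `&` D) (w t)%:E)%E.
Local Open Scope ereal_scope.

(** Indicators, simple functions, monotone limits. The hypothesis [nuE] has the shape of the
    definition of [tau], so that integrals against [tau] become Lebesgue integrals. *)
Lemma integral_density (f : T -> R) : measurable_fun D f -> (forall t, 0 <= f t)%R ->
  \int[nu]_(t in D) (f t)%:E = \int[mu]_(t in D) (f t * w t)%:E.
Proof.
move=> mf f0.
have mf' : measurable_fun D (EFin \o f) by exact/measurable_EFinP.
pose h := nnsfun_approx mD mf'.
have hf t : D t -> EFin (h n t) @[n --> \oo] --> (f t)%:E.
  by move=> Dt; apply: (@cvg_nnsfun_approx _ _ _ _ mD _ mf') => // x _; rewrite lee_fin.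
have mh n : measurable_fun D (h n) by exact: measurable_funTS.
have ndh t a b : (a <= b)%N -> (h a t <= h b t)%R by move=> ab; exact/lefP/nd_nnsfun_approx.
have -> : \int[nu]_(t in D) (f t)%:E = lim (\int[nu]_(t in D) (EFin \o h n) t @[n --> \oo]).
  rewrite -monotone_convergence//.
  - by apply: eq_integral => t /[!inE] Dt; apply/esym/cvg_lim => //; exact: hf.
  - by move=> n; exact/measurable_EFinP.
  - by move=> n t Dt /=; rewrite lee_fin.
  - by move=> t Dt a b ab; rewrite lee_fin; exact: ndh.
have -> : \int[mu]_(t in D) (f t * w t)%:E =
    lim (\int[mu]_(t in D) (h n t * w t)%:E @[n --> \oo]).
  rewrite -monotone_convergence//.
  - apply: eq_integral => t /[!inE] Dt; apply/esym/cvg_lim => //.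
    rewrite EFinM; under eq_fun do rewrite EFinM.
    by apply: cvgeZr => //; exact: hf.
  - move=> n; apply/measurable_EFinP/measurable_funM => //; exact: measurable_funTS.
  - by move=> n t Dt /=; rewrite lee_fin mulr_ge0.
  - by move=> t Dt a b ab; rewrite lee_fin ler_wpM2r//; exact: ndh.
suff suf n : \int[mu]_(t in D) (h n t * w t)%:E = \int[nu]_(t in D) (EFin \o h n) t.
  by under [in RHS]eq_fun do rewrite suf.
have indich r : measurable_fun D (fun t => (r * \1_(h n @^-1` [set r]) t)%:E).
  by apply/measurable_EFinP/measurable_funM => //; exact: measurable_funTS.
transitivity (\int[nu]_(t in D)
   (\sum_(y \in range (h n)) (y * \1_(h n @^-1` [set y]) t)%:E)); last first.
  by apply: eq_integral => t tD; rewrite /= fimfunE -fsumEFin.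
rewrite ge0_integral_fsum//; last by move=> y t Dt; exact: nnfun_muleindic_ge0.
transitivity (\int[mu]_(t in D) (\sum_(y \in range (h n))
    (y * \1_(h n @^-1` [set y]) t)%:E * (w t)%:E)).
  apply: eq_integral => t tD.
  rewrite -ge0_mule_fsuml => [|y]; last exact: nnfun_muleindic_ge0.
  by rewrite fsumEFin // -(fimfunE _ t) EFinM.
rewrite ge0_integral_fsum//; last 2 first.
  - move=> y; apply: emeasurable_funM => //; apply/measurable_EFinP; exact: measurable_funTS.
  - by move=> y t Dt; apply: mule_ge0; [rewrite EFinM; exact: nnfun_muleindic_ge0|rewrite lee_fin].
apply: eq_fsbigr => r rhn.
under [RHS]eq_integral do rewrite EFinM.
rewrite integralZl_indic_nnsfun => //.
under eq_integral do rewrite EFinM -muleA.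
rewrite ge0_integralZl//.
- under eq_integral do rewrite muleC.
  rewrite (eq_integral ((EFin \o w) \_ (h n @^-1` [set r]))); last first.
    by move=> x xE; rewrite epatch_indic.
  rewrite -integral_mkcondr integral_indic// nuE//.
    by congr (_ * integral _ _ _); rewrite setIC -setIA setIid.
  exact: measurableI.
- apply: emeasurable_funM; first exact/measurable_EFinP/measurable_funTS.
  exact/measurable_EFinP/measurable_funTS.
- by move=> t Et; rewrite mule_ge0 ?lee_fin.
- by move: rhn; rewrite inE => -[t _ <-]; rewrite lee_fin.
Qed.
End Density.

(** * Norms and orthogonality of the monomials for mu_sg *)

Section WeightedMonomials.
Variables (R : realType) (d : nat).
Local Notation ta := (@tau R d).
Local Notation B := (@cball R d).
Implicit Types (al be : d.-tuple nat) (sg : R).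

Lemma integral_tau (f : coords R d -> R) : measurable_fun B f -> (forall u, 0 <= f u) ->
  (\int[ta]_(u in B) (f u)%:E =
   \int[leb2d R d]_(u in B) (f u * (1 - sqn u) `^ (- d.+1%:R))%:E)%E.
Proof.
move=> mf f0; apply: (@integral_density _ _ _ (leb2d R d) ta B) => //.
- exact: measurable_cball.
- exact: measurable_weight.
- by move=> u; exact: powR_ge0.
Qed.

Lemma mu_density_ge0 sg (u : coords R d) : d%:R < sg -> 0 <= mu_density sg u.
Proof.
move=> ds; rewrite /mu_density clam_gtd// mulr_ge0 ?powR_ge0// divr_ge0 ?exprn_ge0 ?pi_ge0//.
by rewrite ltW// poch_gt0// subr_gt0.
Qed.

Lemma measurable_mu_density sg (D : set (coords R d)) : measurable_fun D (mu_density sg).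
Proof. by apply: measurable_funTS; apply: measurable_funM => //; exact: measurable_weight. Qed.

Lemma cmeas_monS (D : set (coords R d)) al : cmeas D (fun u : coords R d => mon al (zvec u)).
Proof. by have [? ?] := @cmeas_mon R d al; split; exact: measurable_funTS. Qed.

(** With exponent b = sg - d - 1 the moment is pi^d al! / (sg - d)_(d + |al|). The factor (sg - d)_d
    / pi^d of [clam] cancels its first part and leaves al! / (sg)_|al|. *)
Lemma monomial_norm sg al : d%:R < sg ->
  (\int[ta]_(u in B) (mu_density sg u * normc (mon al (zvec u)) ^+ 2)%:E = ((kappa sg al)^-1)%:E)%E.
Proof.
move=> ds; have sd : 0 < sg - d%:R by lra.
rewrite integral_tau; last 2 first.
- apply: measurable_funM; first exact: measurable_mu_density.
  by apply: measurable_funTS; apply: measurable_funX; apply: measurable_normc => //;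
    exact: cmeas_mon.
- by move=> u; rewrite mulr_ge0 ?mu_density_ge0// sqr_ge0.
transitivity (\int[leb2d R d]_u ((clam d sg)%:E * (moment_density al 1 (sg - d.+1%:R) u)%:E))%E.
  rewrite integral_mkcond; apply: eq_integral => u _.
  rewrite patchE (_ : (u \in B) = (sqn u < 1)); last by apply/idP/idP; rewrite inE.
  rewrite /moment_density; case: ifP => u1; last by rewrite mule0.
    rewrite -EFinM; congr EFin; rewrite /mu_density -[sqnorm _]/(sqn u).
    rewrite powRD; last by apply/implyP => _; rewrite gt_eqF// subr_gt0.
    by ring.
have b1 : -1 < sg - d.+1%:R by rewrite -natr1; lra.
rewrite ge0_integralZl//; last 3 first.
- by apply/measurable_EFinP; exact: measurable_moment_density.
- by move=> u _; rewrite lee_fin moment_density_ge0.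
- by rewrite lee_fin clam_gtd// divr_ge0 ?exprn_ge0 ?pi_ge0// ltW// poch_gt0.
rewrite integral_moment// powR1 mulr1 -EFinM clam_gtd//; congr EFin.
rewrite (_ : sg - d.+1%:R + 1 = sg - d%:R); last by rewrite -natr1; ring.
rewrite pochD subrK /kappa invf_div.
have p0 : pi ^+ d != 0 :> R by rewrite expf_neq0// gt_eqF// pi_gt0.
have q0 : 0 < poch (sg - d%:R) d by exact: poch_gt0.
have sg0 : 0 < sg by apply: le_lt_trans ds.
have r0 : 0 < poch sg (msize al) by exact: poch_gt0.
by field; rewrite p0 (gt_eqF q0) (gt_eqF r0).
Qed.

Lemma monomial_pairing sg al be : d%:R < sg ->
  cintegrable ta B (fun u => (mu_density sg u)%:C%C * ((mon al (zvec u))^*%C * mon be (zvec u))) /\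
  cint ta B (fun u => (mu_density sg u)%:C%C * ((mon al (zvec u))^*%C * mon be (zvec u))) =
    if al == be then (((kappa sg al)^-1)%:C)%C else 0.
Proof.
move=> ds; have mB := @measurable_cball R d.
have mm al' : measurable_fun B (fun u : coords R d => mu_density sg u *
  normc (mon al' (zvec u)) ^+ 2).
  apply: measurable_funM; first exact: measurable_mu_density.
  by apply: measurable_funTS; apply: measurable_funX; apply: measurable_normc => //;
    exact: cmeas_mon.
have sg0 : 0 < sg by apply: le_lt_trans ds.
have p0 al' u : 0 <= mu_density sg u * normc (mon al' (zvec u)) ^+ 2 by rewrite mulr_ge0
  ?mu_density_ge0// sqr_ge0.
have im al' : ta.-integrable B (fun u => (mu_density sg u * normc (mon al' (zvec u)) ^+ 2)%:E).
  apply/integrableP; split; first exact/measurable_EFinP.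
  under eq_integral do rewrite /= ger0_norm//.
  by rewrite monomial_norm// ltry.
have ih : cintegrable ta B (fun u => (mu_density sg u)%:C%C *
  ((mon al (zvec u))^*%C * mon be (zvec u))).
  apply: (le_cintegrable _ _ (integrableD mB (im al) (im be))) => //.
    apply: cmeasM; first by apply: cmeas_real; exact: measurable_mu_density.
    by apply: cmeasM; [apply: cmeasJ|]; exact: cmeas_monS.
  move=> u _; rewrite !Normc.normcM normc_conj normc_real ger0_norm ?mu_density_ge0//.
  rewrite -mulrDr ler_wpM2l ?mu_density_ge0//.
  have := normc_ge0 (mon al (zvec u)); have := normc_ge0 (mon be (zvec u)).
  move: (normc _) (normc _) => x y; nra.
split=> //.
case: eqP => [<-|/eqP albe].
  transitivity (cint ta B (fun u => ((mu_density sg u * normc (mon al (zvec u)) ^+ 2)%:C)%C)).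
    by apply: eq_cint => u _; rewrite mulc_conj -rmorphM.
  apply: complexP => /=; last by rewrite /Rintegral integral0_eq.
  by rewrite /Rintegral monomial_norm.
have E : (fun u : coords R d => (mu_density sg u)%:C%C *
  ((mon al (zvec u))^*%C * mon be (zvec u))) =
    (fun u => (mon al (zvec u))^*%C * mon be (zvec u) * ((mu_density sg u)%:C)%C).
  by apply/funext => u; rewrite mulrC.
rewrite E; apply: monomial_orthogonal => [j th u|//|]; last by rewrite -E.
by rewrite /mu_density -![sqnorm _]/(sqn _) sqn_rot.
Qed.
End WeightedMonomials.

(** * Power series on the ball *)

Section CoefficientUniqueness.
Variable R : realType.
Local Notation mu := (@lebesgue_measure R).
Implicit Types (r : R).

Lemma cmeanJ (h : R -> R[i]) : cintegrable mu `[0, pi *+ 2] h ->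
  cmean (fun t => (h t)^*%C) = (cmean h)^*%C.
Proof.
move=> ih; rewrite /cmean cintJ//; apply: complexP; rewrite !realcM /=; first by [].
by rewrite mulrN.
Qed.

Lemma circle_pairing r (k l : nat) : 0 < r ->
  cmean (fun t => circ r t ^+ l * circ r t ^- k) = (l == k)%:R.
Proof.
move=> r0; have c0 t : circ r t ^+ l != 0 by rewrite expf_neq0// circ_neq0.
have ck t : circ r t ^+ k != 0 by rewrite expf_neq0// circ_neq0.
case: ltngtP => [lk|kl|->].
- rewrite -[RHS](@cmean_pow R (k - l) _ r r0) ?subn_gt0//; congr cmean; apply/funext => t.
  by rewrite -[in LHS](subnKC (ltnW lk)) exprD invfM mulrA divff// mul1r.
- have m0 : (0 < l - k)%N by rewrite subn_gt0.
  (* On the circle u^m = r^(2m) conj(u^(-m)), which reduces positive powers to the negative ones of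
     [cmean_pow]. *)
  transitivity (cmean (fun t => ((r ^+ 2) ^+ (l - k))%:C%C * (circ r t ^- (l - k))^*%C)).
    congr cmean; apply/funext => t.
    rewrite -[in LHS](subnKC (ltnW kl)) exprD mulrAC divff// mul1r.
    have -> : (((r ^+ 2) ^+ (l - k))%:C)%C = (circ r t ^+ (l - k))^*%C * circ r t ^+ (l - k).
      by rewrite mulc_conj normcX normc_circ gtr0_norm// -!exprM mulnC.
    have cm : circ r t ^+ (l - k) != 0 by rewrite expf_neq0// circ_neq0.
    by rewrite mulrAC -rmorphM/= divff// rmorph1 mul1r.
  have ic : cintegrable mu `[0, pi *+ 2] (fun t => circ r t ^- (l - k)).
    apply: (@bounded_circle _ _ (r ^- (l - k))); first exact: circV_meas.
    by move=> t; rewrite Normc.normcV normcX normc_circ gtr0_norm.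
  rewrite cmeanZ; last first.
    apply: (@bounded_circle _ _ (r ^- (l - k))); first by apply: cmeasJ => //; exact: circV_meas.
    by move=> t; rewrite normc_conj Normc.normcV normcX normc_circ gtr0_norm.
  by rewrite cmeanJ// cmean_pow// conjc0 mulr0.
- rewrite -[RHS](@cmean_cst R); congr cmean; apply/funext => t.
  by rewrite divff.
Qed.

Lemma coefT_poly d (rho : d.-tuple R) al I (L : seq I) (c : I -> R[i]) (b : I -> d.-tuple nat) :
  (forall j, 0 < tnth rho j) ->
  coefT rho al (fun s => \sum_(i <- L) c i * mon (b i) s) = \sum_(i <- L) c i * (b i == al)%:R.
Proof.
elim: d rho al b c => [|d IH] rho al b c.
  move=> _ /=; apply: eq_bigr => i _; rewrite /mon big_ord0 (_ : (_ == _) = true)//.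
  by apply/eqP/eq_from_tnth => -[].
case/tupleP: rho => r rho; case/tupleP: al => k al.
rewrite -/(tuple_cons r rho) -/(tuple_cons k al) => /tuple_cons_pos[r0 rho0].
rewrite coefT_cons.
have bE i : b i = tuple_cons (thead (b i)) (behead_tuple (b i)) by exact: tuple_eta.
transitivity (cmean (fun t => \sum_(i <- L) (c i * (behead_tuple (b i) == al)%:R) *
    (circ r t ^+ thead (b i) * circ r t ^- k))).
  congr cmean; apply/funext => t.
  have -> : (fun s => \sum_(i <- L) c i * mon (b i) (tuple_cons (circ r t) s)) =
     (fun s => \sum_(i <- L) (c i * circ r t ^+ thead (b i)) * mon (behead_tuple (b i)) s).
    by apply/funext => s; apply: eq_bigr => i _; rewrite {1}bE mon_cons mulrA.
  rewrite IH// mulr_suml; apply: eq_bigr => i _; ring.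
have ic i : cintegrable mu `[0, pi *+ 2] (fun t => circ r t ^+ thead (b i) * circ r t ^- k).
  apply: (@bounded_circle _ _ (r ^+ thead (b i) * r ^- k)).
    apply: cmeasM; last exact: circV_meas.
    apply: cmeasX; apply: scont_cmeas => // t l tl.
    exact: (ccvg_circ (@seq_cst R r) tl).
  by move=> t; rewrite Normc.normcM Normc.normcV !normcX normc_circ gtr0_norm.
rewrite cmean_sum; last by move=> i; exact: cintegrableZ.
apply: eq_bigr => i _; rewrite cmeanZ// circle_pairing// -mulrA; congr (_ * _).
rewrite -natrM mulnb; congr (_%:R); rewrite [in RHS]bE; congr nat_of_bool.
apply/andP/eqP => [[/eqP -> /eqP ->]//|H].
have := congr1 (@thead _ _) H; have := congr1 (fun t => behead_tuple t) H.
by rewrite !behead_cons !theadE => -> ->.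
Qed.

Lemma ccvg_near (x : nat -> R[i]) l : (\forall n \near \oo, x n = l) -> ccvg x l.
Proof. by move=> H; split; apply: cvg_near_cst; apply: filterS H => n ->. Qed.

Lemma ccvg_prod I (s : seq I) (F : I -> nat -> R[i]) (l : I -> R[i]) :
  (forall i, ccvg (F i) (l i)) ->
  ccvg (fun n => \prod_(i <- s) F i n) (\prod_(i <- s) l i).
Proof.
move=> Fl; elim: s => [|i s IH].
  by rewrite big_nil; under eq_fun do rewrite big_nil; exact: ccvg_cst.
by rewrite big_cons; under eq_fun do rewrite big_cons; exact: ccvgM.
Qed.

(** On the smaller torus the box sums of the expansion for rho' converge boundedly to F, so their
    coefficients over rho converge to that of F. By orthogonality the coefficient of a box sum is
    the one for rho' as soon as the box contains al. *)
Lemma coefT_shrink d (rho rho' : d.-tuple R) al F M :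
  (forall j, 0 < tnth rho j) -> (forall j, tnth rho j < tnth rho' j) ->
  tcont rho' F -> thol rho' F -> (forall s, polydisc rho' s -> normc (F s) <= M) ->
  coefT rho al F = coefT rho' al F.
Proof.
move=> r0 rr cF hF FM; have r'0 j : 0 < tnth rho' j by exact: lt_trans (rr j).
have PS := polydisc_series r'0 cF hF FM.
pose c := fun be => coefT rho' be F.
have M0 : 0 <= M.
  apply: le_trans (FM [tuple 0 | _ < d] _); first exact: normc_ge0.
  by move=> j; rewrite tnth_mktuple normc_real normr0 ltW.
have sr s : polydisc rho s -> forall j, normc (tnth s j) < tnth rho' j.
  by move=> H j; apply: le_lt_trans (rr j).
pose M' := M * \prod_j (1 - tnth rho j / tnth rho' j)^-1.
have q1 j : tnth rho j / tnth rho' j < 1 by rewrite ltr_pdivrMr// mul1r.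
have bS K s : polydisc rho s -> normc (boxsum c K s) <= M'.
  move=> Hs; apply: le_trans ((PS s (sr s Hs)).1 K) _; rewrite ler_wpM2l//.
  apply: ler_prod => j _; rewrite invr_ge0 subr_ge0.
  have H : normc (tnth s j) / tnth rho' j <= tnth rho j / tnth rho' j.
    by rewrite ler_pM2r ?invr_gt0.
  have q := q1 j; have H1 := le_lt_trans H q.
  rewrite (ltW H1) lef_pV2 ?posrE ?subr_gt0//=; lra.
have mono s : polydisc rho s -> polydisc rho' s by move=> H j; apply: le_trans (H j) (ltW (rr j)).
have cS K : tcont rho (boxsum c K).
  move=> v s _ _ vs; apply: ccvg_sum => al'; apply: ccvgM; first exact: ccvg_cst.
  by apply: ccvg_prod => j; apply: ccvgX; exact: vs.
have cF' : tcont rho F by move=> v s Hv Hs; apply: cF => [n|]; exact: mono.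
have := (coefT_spec al M' r0).2 (boxsum c) F cS cF' bS (fun s Hs => (PS s (sr s Hs)).2).
move=> /ccvg_unique; apply; apply: ccvg_near.
apply: filterS (box_big al) => K alK.
rewrite coefT_poly// (bigD1_seq al) ?box_uniq//= eqxx mulr1 big1 ?addr0// => be /negbTE ->.
by rewrite mulr0.
Qed.
End CoefficientUniqueness.

(** * From differentiable functions of row vectors to functions of tuples *)

Section RowVectors.
Variables (R : realType) (d : nat).
Local Notation Cd := 'rV[Cplx R]_d.

Definition rtup (z : Cd) : d.-tuple R[i] := [tuple z 0 j | j < d].
Definition trow (s : d.-tuple R[i]) : Cd := \row_j tnth s j.

Lemma tnth_rtup z j : tnth (rtup z) j = z 0 j.
Proof. by rewrite tnth_mktuple. Qed.

Lemma trowK s : rtup (trow s) = s.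
Proof. by apply: eq_from_tnth => j; rewrite tnth_rtup mxE. Qed.

Lemma rtupK z : trow (rtup z) = z.
Proof. by apply/rowP => j; rewrite mxE tnth_rtup. Qed.

Lemma cvec_zvec (u : coords R d) : cvec u = trow (zvec u).
Proof. by apply/rowP => j; rewrite !mxE tnth_mktuple. Qed.

Lemma sqnorm_rtup z : sqnorm z = \sum_j normc (tnth (rtup z) j) ^+ 2.
Proof. by apply: eq_bigr => j _; rewrite tnth_rtup. Qed.

Lemma sqnorm_trow s : sqnorm (trow s) = \sum_j normc (tnth s j) ^+ 2.
Proof. by rewrite sqnorm_rtup trowK. Qed.

Lemma normE (x : Cplx R) : `|x| = ((normc x)%:C)%C.
Proof. by case: x. Qed.

Lemma gt0_real (e : Cplx R) : 0 < e -> 0 < cRe e /\ e = ((cRe e)%:C)%C.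
Proof. by case: e => a b; rewrite ltcE /= => /andP[/eqP -> ->]. Qed.

Lemma near_row (z : Cd) (P : set Cd) : (\forall w \near z, P w) <->
  exists2 e : R, 0 < e & forall w : Cd, (forall j, normc (w 0 j - z 0 j) < e) -> P w.
Proof.
split.
  move=> /nbhs_ballP[e /= /gt0_real[e0 eE] H]; exists (cRe e) => // w Hw.
  apply: H; split; first by rewrite eE ltcR.
  move=> i j; rewrite ord1 -ball_normE /ball_/= eE normE ltcR -normcN opprB; exact: Hw.
move=> [e e0 H]; apply/nbhs_ballP; exists ((e%:C)%C); first by rewrite /= ltcR.
move=> w [_ zw]; apply: H => j; move: (zw 0 j); rewrite -ball_normE /ball_/= normE ltcR.
by rewrite -normcN opprB.
Qed.

Lemma near_cplx (z : Cplx R) (P : set (Cplx R)) : (\forall w \near z, P w) <->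
  exists2 e : R, 0 < e & forall w, normc (w - z) < e -> P w.
Proof.
split.
  move=> /nbhs_ballP[e /= /gt0_real[e0 eE] H]; exists (cRe e) => // w Hw.
  by apply: H; rewrite -ball_normE /ball_/= eE normE ltcR -normcN opprB.
move=> [e e0 H]; apply/nbhs_ballP; exists ((e%:C)%C); first by rewrite /= ltcR.
by move=> w zw; apply: H; move: zw; rewrite -ball_normE /ball_/= normE ltcR -normcN opprB.
Qed.

Definition ccont (f : Cd -> Cplx R) (z : Cd) := forall e : R, 0 < e -> exists2 dl : R, 0 < dl &
  forall w : Cd, (forall j, normc (w 0 j - z 0 j) < dl) -> normc (f w - f z) < e.

Lemma differentiable_ccont (f : Cd -> Cplx R) z : differentiable f z -> ccont f z.
Proof.
move=> /differentiable_continuous /cvgrPdist_lt cf e e0.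
have /near_row[dl dl0 H] : \forall w \near z, normc (f w - f z) < e.
  have := cf ((e%:C)%C); rewrite ltcR => /(_ e0); apply: filterS => w.
  by rewrite normE ltcR -normcN opprB.
by exists dl.
Qed.

Lemma ccont_tcvg f (v : nat -> d.-tuple R[i]) s : ccont f (trow s) -> tcvg v s ->
  ccvg (fun n => f (trow (v n))) (f (trow s)).
Proof.
move=> cf vs; apply/ccvg_norm0; apply/cvgrPdist_lt => e e0.
have [dl dl0 H] := cf e e0.
have : \forall n \near \oo, forall j, normc (tnth (v n) j - tnth s j) < dl.
  apply: filter_forall => j; have /ccvg_norm0/cvgrPdist_lt/(_ dl dl0) := vs j.
  by apply: filterS => n; rewrite sub0r normrN ger0_norm ?normc_ge0.
apply: filterS => n Hn; rewrite sub0r normrN ger0_norm ?normc_ge0//; apply: H => j.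
by rewrite !mxE.
Qed.

(** The closed disc is the continuous image of a closed part of the compact square [-b, b] x
    [-b, b]. *)
Lemma square_compact (b : R) : compact [set x : Cplx R | normc x <= b].
Proof.
pose g (p : R * R) : Cplx R := (p.1 +i* p.2)%C.
have gc : continuous g.
  move=> p; apply/cvgrPdist_lt => e /gt0_real[e0 eE].
  have h0 : 0 < cRe e / 2 by rewrite divr_gt0.
  near=> q; rewrite normE eE ltcR.
  apply: le_lt_trans (normc_le_add _) _.
  rewrite [cRe e]splitr; apply: ltrD.
    near: q.
    have : (fst : R * R -> R) q @[q --> p] --> p.1 by exact: cvg_fst.
    by move=> /cvgrPdist_lt/(_ _ h0).
  near: q.
  have : (snd : R * R -> R) q @[q --> p] --> p.2 by exact: cvg_snd.
  by move=> /cvgrPdist_lt/(_ _ h0).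
have cn : continuous (fun p : R * R => p.1 ^+ 2 + p.2 ^+ 2).
  move=> p; apply: cvgD; apply: (@cvg_comp _ _ _ _ (fun x : R => x ^+ 2)).
  - exact: cvg_fst.
  - exact: exprn_continuous.
  - exact: cvg_snd.
  - exact: exprn_continuous.
have [b0|b0] := leP 0 b; last first.
  rewrite (_ : [set x | _] = set0); first exact: compact0.
  by apply/seteqP; split=> // x /= H; have := normc_ge0 x; lra.
have -> : [set x : Cplx R | normc x <= b] =
    g @` ((`[- b, b] `*` `[- b, b]) `&` (fun p : R * R => p.1 ^+ 2 + p.2 ^+ 2) @^-1`
      [set x | x <= b ^+ 2]).
  apply/seteqP; split=> [x xb|x /= [[p q] [_ /= pq] <-]]; last first.
    by rewrite /g /= -(ler_pXn2r (n := 2)) ?nnegrE ?sqrtr_ge0// sqr_sqrtr// addr_ge0 ?sqr_ge0.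
  exists (cRe x, cIm x); last by case: (x).
  rewrite /= in xb; split.
    by split; rewrite /= in_itv/= -ler_norml;
      [apply: le_trans (normc_re_le x) xb|apply: le_trans (normc_im_le x) xb].
  by rewrite /= -normc_sq ler_pXn2r ?nnegrE ?normc_ge0.
apply: continuous_compact; first exact: continuous_subspaceT.
apply: compact_closedI; first by apply: compact_setX; exact: segment_compact.
by apply: closed_comp; [move=> p _; exact: cn|exact: closed_le].
Unshelve. all: by end_near. Qed.

Lemma normc_dist (x y : R[i]) : `|normc x - normc y| <= normc (x - y).
Proof.
have H (a b : R[i]) : normc a - normc b <= normc (a - b).
  by rewrite lerBlDr -{1}(subrK b a); exact: le_normcD.
have H1 := H x y; have := H y x; rewrite -[normc (y - x)]normcN opprB => H2.
by rewrite ler_norml; apply/andP; split; lra.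
Qed.

(** Provides the constant M of the Cauchy estimates: a closed polydisc is a product of compact
    discs. *)
Lemma polydisc_bounded (f : Cd -> Cplx R) (rho : d.-tuple R) :
  (forall s, polydisc rho s -> ccont f (trow s)) ->
  exists M, forall s, polydisc rho s -> normc (f (trow s)) <= M.
Proof.
move=> cf.
have K : compact [set z : Cd | forall j, [set x : Cplx R | normc x <= tnth rho j] (z ord0 j)].
  by apply: (@rV_compact (Cplx R) d (fun j => [set x : Cplx R | normc x <= tnth rho j])) => j;
    exact: square_compact.
set A := [set z | _] in K.
have cnf : {within A, continuous (fun z => normc (f z))}.
  apply: continuous_in_subspaceT => z /set_mem.
  suff : forall z : Cd, A z -> {for z, continuous (fun z => normc (f z))} by apply.
  move=> {}z zA; apply/(@cvgrPdist_lt _ _ _ _ (nbhs_filter z)) => e e0.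
  have [|dl dl0 H] := cf (rtup z) _ e e0; first by move=> j; rewrite tnth_rtup; exact: zA.
  rewrite rtupK in H; apply/near_row; exists dl => // w Hw.
  by apply: le_lt_trans (normc_dist _ _) _; rewrite -normcN opprB; exact: H.
have /compact_bounded[M [Mr HM]] := continuous_compact cnf K.
exists (M + 1) => s Hs; apply: le_trans (ler_norm _) _.
apply: (HM (M + 1)); first by rewrite ltrDl.
by exists (trow s) => // j /=; rewrite mxE.
Qed.

(** The coordinate derivative of a differentiable function is a complex derivative of the slice,
    since scalars are complex. *)
Lemma holomorphic_slice (f : Cd -> Cplx R) s j : differentiable f (trow s) ->
  exists c, cdiff (fun u => f (trow (tupd s j u))) (tnth s j) c.
Proof.
move=> df; have : derivable f (trow s) 'e_j by exact: diff_derivable.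
move=> /cvg_ex[/= c cvgc]; exists c => e e0.
have Hc := (@cvgrPdist_lt (Cplx R) (Cplx R) (Cplx R) (0^') _
  (fun h => h^-1 *: (f (h *: 'e_j + trow s) - f (trow s))) c).1 cvgc.
have := Hc (dnbhs_filter _) ((e%:C)%C); rewrite ltcR => /(_ e0).
rewrite near_withinE => /near_cplx[dl dl0 H].
exists (dl / 2); first by rewrite divr_gt0.
move=> h hd.
have tE : trow (tupd s j (tnth s j + h)) = (h : Cplx R) *: 'e_j + trow s.
  apply/rowP => i; rewrite !mxE tnth_mktuple eqxx/=; case: eqP => [->|_].
    by rewrite mulr1 addrC.
  by rewrite mulr0 add0r.
have sE : tupd s j (tnth s j) = s.
  by apply: eq_from_tnth => i; rewrite tnth_mktuple; case: eqP => [->|].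
have [->|h0] := eqVneq h 0.
  by rewrite addr0 mulr0 subrr subr0 normc_real normr0 mulr0.
have := H h; rewrite subr0 => /(_ _ h0).
have hdl : normc h < dl by lra.
move=> /(_ hdl); rewrite normE ltcR tE sE => /ltW Hh.
rewrite -[X in normc (X - _)](mulVKf h0) [c * h]mulrC -mulrBr Normc.normcM mulrC.
by rewrite ler_wpM2r ?normc_ge0// -normcN opprB.
Qed.
End RowVectors.

(** * Power series expansion on the ball *)

Section BallExpansion.
Variables (R : realType) (d : nat) (nu : nat -> d.-tuple nat).
Hypothesis nu_bij : bijective nu.
Local Notation Cd := 'rV[Cplx R]_d.
Implicit Types (a : nat -> R[i]) (s : d.-tuple R[i]) (rho : d.-tuple R).

Definition in_ball rho := (forall j, 0 < tnth rho j) /\ \sum_j tnth rho j ^+ 2 < 1.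

(** Absolute convergence on every closed polydisc inside the ball, recorded through bounded partial
    sums. Such polydiscs cover the ball. *)
Definition psummable a := forall rho, in_ball rho ->
  exists B, forall n, \sum_(i < n) normc (a i) * mon (nu i) rho <= B.

Definition nmod s : d.-tuple R := [tuple normc (tnth s j) | j < d].

Lemma normc_mon al s : normc (mon al s) = mon al (nmod s).
Proof. by rewrite normc_prod; apply: eq_bigr => j _; rewrite normcX tnth_mktuple. Qed.

Lemma mon_le al rho rho' : (forall j, 0 <= tnth rho j <= tnth rho' j) -> mon al rho <= mon al rho'.
Proof.
move=> H; apply: ler_prod => j _; have /andP[H0 H1] := H j.
by rewrite exprn_ge0//= lerXn2r ?nnegrE// (le_trans H0).
Qed.

Lemma polydisc_between s : \sum_j normc (tnth s j) ^+ 2 < 1 ->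
  exists2 rho, in_ball rho & forall j, normc (tnth s j) < tnth rho j.
Proof.
move=> s1; pose S := \sum_j normc (tnth s j) ^+ 2.
(* Adding e to each of the d squared moduli gives S + d e, still below 1 because of the denominator
   d + 1. *)
pose e := (1 - S) / d.+1%:R; have d0 : 0 < d.+1%:R :> R by rewrite ltr0n.
have e0 : 0 < e by rewrite divr_gt0// subr_gt0.
have p0 j : 0 < normc (tnth s j) ^+ 2 + e by rewrite ltr_wpDl// sqr_ge0.
exists [tuple Num.sqrt (normc (tnth s j) ^+ 2 + e) | j < d]; last first.
  move=> j; rewrite tnth_mktuple -(ltr_pXn2r (n := 2)) ?nnegrE ?normc_ge0 ?sqrtr_ge0//.
  by rewrite sqr_sqrtr ?(ltW (p0 j))// ltrDl.
split=> [j|]; first by rewrite tnth_mktuple sqrtr_gt0.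
under eq_bigr do rewrite tnth_mktuple sqr_sqrtr ?(ltW (p0 _))//.
rewrite big_split/= -/S sumr_const card_ord -mulr_natl.
have : e * d.+1%:R = 1 - S by rewrite divfK// gt_eqF.
rewrite -natr1; nra.
Qed.

Lemma psummable_csummable a s : psummable a -> \sum_j normc (tnth s j) ^+ 2 < 1 ->
  csummable (fun i => a i * mon (nu i) s).
Proof.
move=> pa /polydisc_between[rho rb sr]; have [B HB] := pa _ rb.
apply: (@csummable_le _ _ (fun i => normc (a i) * mon (nu i) rho) B _ HB) => i;
  rewrite Normc.normcM ler_wpM2l ?normc_ge0// normc_mon.
by apply: mon_le => j; rewrite tnth_mktuple normc_ge0 ltW.
Qed.

(** No single polydisc covers the ball, so the coefficients must be shown independent of the
    polydisc; each point is then treated in a polydisc around it. *)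
Lemma tuple_expansion (F : d.-tuple R[i] -> R[i]) :
  (forall rho, in_ball rho -> [/\ tcont rho F, thol rho F &
     exists M, forall s, polydisc rho s -> normc (F s) <= M]) ->
  exists2 a, psummable a & forall s, \sum_j normc (tnth s j) ^+ 2 < 1 ->
    F s = csum (fun i => a i * mon (nu i) s).
Proof.
move=> HF; have nui := bij_inj nu_bij.
have [|rho0 rb0 _] := polydisc_between (s := [tuple 0 | _ < d]).
  by rewrite big1// => j _; rewrite tnth_mktuple normc_real normr0 expr0n.
pose c al := coefT rho0 al F.
have cE rho al : in_ball rho -> coefT rho al F = c al.
  (* A common polyradius strictly below both, from which [coefT_shrink] leads to either one. *)
  move=> rb; pose rm : d.-tuple R := [tuple Num.min (tnth rho j) (tnth rho0 j) / 2 | j < d].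
  have m0 j : 0 < Num.min (tnth rho j) (tnth rho0 j) by rewrite lt_min rb.1 rb0.1.
  have rm0 j : 0 < tnth rm j by rewrite tnth_mktuple divr_gt0.
  have rmr j : tnth rm j < tnth rho j /\ tnth rm j < tnth rho0 j.
    rewrite tnth_mktuple; have := m0 j; set m := Num.min _ _ => m0j.
    have [H1 H2] : m <= tnth rho j /\ m <= tnth rho0 j by rewrite !ge_min !lexx orbT.
    by split; lra.
  have [c1 h1 [M1 b1]] := HF _ rb; have [c2 h2 [M2 b2]] := HF _ rb0.
  rewrite /c -(coefT_shrink al rm0 (fun j => (rmr j).1) c1 h1 b1).
  by rewrite -(coefT_shrink al rm0 (fun j => (rmr j).2) c2 h2 b2).
have cb rho al M : in_ball rho -> (forall s, polydisc rho s -> normc (F s) <= M) ->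
    normc (c al) * mon al rho <= M.
  move=> rb HM; have [c1 _ _] := HF _ rb.
  rewrite -ler_pdivlMr; last exact: mon_gt0 rb.1.
  by rewrite -(cE rho al rb); exact: (coefT_spec al M rb.1).1.
have ps : psummable (fun i => c (nu i)).
  move=> s sb.
  (* Cauchy estimates on a strictly larger polydisc leave a geometric majorant in the quotients
     q. *)
  have [|rho rb sr] := polydisc_between (s := [tuple ((tnth s j)%:C)%C | j < d]).
    under eq_bigr do rewrite tnth_mktuple normc_real ger0_norm ?(ltW (sb.1 _))//.
    exact: sb.2.
  have {}sr j : tnth s j < tnth rho j.
    by have := sr j; rewrite tnth_mktuple normc_real ger0_norm// ltW// sb.1.
  have [_ _ [M HM]] := HF _ rb.
  pose q : d.-tuple R := [tuple tnth s j / tnth rho j | j < d].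
  have q1 j : 0 <= tnth q j < 1.
    by rewrite tnth_mktuple divr_ge0 ?(ltW (sb.1 _)) ?(ltW (rb.1 _))//= ltr_pdivrMr ?rb.1// mul1r.
  have M0 : 0 <= M.
    apply: le_trans (cb rho (nu 0%N) M rb HM); apply: mulr_ge0; first exact: normc_ge0.
    by apply/ltW/mon_gt0; exact: rb.1.
  exists (M * \prod_j (1 - tnth q j)^-1) => n.
  have mq al : 0 <= mon al q by apply: prodr_ge0 => j _; rewrite exprn_ge0//; have /andP[] := q1 j.
  have [K HK] := @sum_le_box R d nu (fun al => mon al q) n nui mq.
  apply: (@le_trans _ _ (M * \sum_(i < n) mon (nu i) q)); last first.
    by rewrite ler_wpM2l// (le_trans HK)// box_mon_le.
  rewrite mulr_sumr; apply: ler_sum => i _.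
  have -> : mon (nu i) s = mon (nu i) rho * mon (nu i) q.
    rewrite -big_split/=; apply: eq_bigr => j _.
    by rewrite tnth_mktuple -exprMn mulrC divfK// gt_eqF// rb.1.
  by rewrite mulrA ler_wpM2r// cb.
exists (fun i => c (nu i)) => // s s1.
have [g gK Kg] := nu_bij.
have cs := psummable_csummable ps s1.
have [rho rb sr] := polydisc_between s1.
have [c1 h1 [M1 b1]] := HF _ rb.
have [_ H] := polydisc_series rb.1 c1 h1 b1 sr.
apply: ccvg_unique H _.
(* [polydisc_series] sums over boxes, [csum] along [nu]; the preimages of the boxes under [nu]
   exhaust the indices. *)
have := @csum_cvg R (fun K => [seq g al | al <- box d K]) _ cs.
rewrite (_ : (fun K => boxsum _ K s) = (fun K => \sum_(i <- [seq g al | al <- box d K]) c (nu i) *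
  mon (nu i) s)).
  apply.
  - by move=> K; rewrite map_inj_uniq ?box_uniq//; exact: can_inj Kg.
  - by move=> i; apply: filterS (box_big (nu i)) => K iK; apply/seq.mapP; exists (nu i).
apply/funext => K; rewrite big_map; apply: eq_bigr => al _.
by rewrite Kg cE.
Qed.

Lemma holomorphic_expansion (f : Cd -> Cplx R) : holomorphic f ->
  exists2 a, psummable a & forall z, unit_ball z ->
    f z = csum (fun i => a i * mon (nu i) (rtup z)).
Proof.
move=> hf.
have [rho rb|a pa fa] := @tuple_expansion (fun s => f (trow s)).
  have df s : polydisc rho s -> differentiable f (trow s).
    move=> Hs; apply: hf; rewrite /unit_ball /= sqnorm_trow; apply: le_lt_trans rb.2.
    by apply: ler_sum => j _; rewrite ler_pXn2r ?nnegrE ?normc_ge0// ltW// rb.1.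
  split.
  - by move=> v s Hv Hs vs; apply: ccont_tcvg => //; apply: differentiable_ccont; exact: df.
  - by move=> s Hs j; apply: holomorphic_slice; exact: df.
  - by apply: polydisc_bounded => s Hs; apply: differentiable_ccont; exact: df.
by exists a => // z zB; rewrite -fa ?rtupK// -sqnorm_rtup.
Qed.
End BallExpansion.

(** * Termwise differentiation of series *)

Lemma differentialP {K : numFieldType} {V W : normedModType K} (f : V -> W) (z : V)
    (T : {linear V -> W}) : continuous T ->
  (forall eps : K, 0 < eps -> \forall h \near (0 : V), `|f (h + z) - f z - T h| <= eps * `|h|) ->
  differentiable f z /\ forall v, 'd f z v = T v.
Proof.
move=> Tc H.
have fo : f \o shift z = cst (f z) + (T : V -> W) +o_0 id.
  apply/eqaddoP => eps e0; have := H eps e0; apply: filterS => h.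
  by rewrite !fctE /= opprD addrA.
have dfT : 'd f z = T :> (V -> W) by exact: diff_unique.
by split; [apply/diff_locallyP; rewrite dfT|move=> v; rewrite dfT].
Qed.

Section SeriesDifferentiable.
Variables (R : realType) (d : nat).
Local Notation Cd := 'rV[Cplx R]_d.

Definition rnorm (h : Cd) : R := cRe `|h|.

Lemma rnormE (h : Cd) : `|h| = ((rnorm h)%:C)%C.
Proof.
rewrite /rnorm; have := normr_ge0 h; case: (`|h|) => a b.
by rewrite lecE /= => /andP[/eqP -> _].
Qed.

Lemma rnorm_ge0 (h : Cd) : 0 <= rnorm h.
Proof. by have := normr_ge0 h; rewrite rnormE lecR. Qed.

Lemma rnormZ (c : Cplx R) (h : Cd) : rnorm (c *: h) = normc c * rnorm h.
Proof. by rewrite {1}/rnorm normrZ normE rnormE -rmorphM. Qed.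

Lemma normc_le_rnorm (h : Cd) j : normc (h 0 j) <= rnorm h.
Proof.
rewrite -lecR -rnormE -normE.
have : (`|h 0 j|%:nng)%:num <= mx_norm h.
  by rewrite mx_normE num_le; exact: (le_bigmax _ _ (ord0, j)).
by [].
Qed.

Lemma csumD (x y : nat -> R[i]) : csummable x -> csummable y ->
  csummable (fun i => x i + y i) /\ csum (fun i => x i + y i) = csum x + csum y.
Proof. by move=> sx sy; split; [exact: cintegrableD|rewrite /csum cintD]. Qed.

Lemma csumZ c (x : nat -> R[i]) : csummable x ->
  csummable (fun i => c * x i) /\ csum (fun i => c * x i) = c * csum x.
Proof. by move=> sx; split; [exact: cintegrableZ|rewrite /csum cintZ]. Qed.

Lemma small_tail (L : nat -> R) B (e : R) : 0 < e -> (forall i, 0 <= L i) ->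
  (forall n, \sum_(i < n) L i <= B) ->
  exists N, forall n, \sum_(i < n) (if (i < N)%N then 0 else L i) <= e.
Proof.
move=> e0 L0 LB; pose S := range (fun n => \sum_(i < n) L i).
have hS : has_sup S.
  by split; [exists 0, 0%N => //; rewrite big_ord0|exists B => _ [n _ <-]].
have [_ [N _ <-] HN] := sup_adherent e0 hS; exists N => n.
have [nN|Nn] := leqP n N.
  by rewrite big1 ?ltW// => i _; rewrite (leq_trans (ltn_ord i)).
have H : \sum_(i < n) L i <= sup S by apply: ub_le_sup; [exact: hS.2|exists n].
have E : \sum_(i < n) (if (i < N)%N then 0 else L i) + \sum_(i < N) L i = \sum_(i < n) L i.
  rewrite (big_ord_widen n L (ltnW Nn)) [X in _ + X]big_mkcond -big_split/=.
  by apply: eq_bigr => i _; case: ifP => _; rewrite ?add0r ?addr0.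
lra.
Qed.

Lemma derivative_bound (g : Cd -> Cplx R) z (dl L : R) : 0 < dl -> differentiable g z ->
  (forall w : Cd, (forall j, normc (w 0 j - z 0 j) < dl) -> normc (g w - g z) <= L *
    rnorm (w - z)) ->
  forall v, normc ('d g z v) <= L * rnorm v.
Proof.
move=> dl0 dg gL v; rewrite -deriveE//; apply/ler_addgt0Pr => e e0.
have cvgc : h^-1 *: (g (h *: v + z) - g z) @[h --> 0^'] --> 'D_v g z.
  exact: (@diff_derivable _ _ _ g z v dg).
have Hc := (@cvgrPdist_lt (Cplx R) (Cplx R) (Cplx R) (0^') _
  (fun h => h^-1 *: (g (h *: v + z) - g z)) _).1 cvgc.
have := Hc (dnbhs_filter _) ((e%:C)%C); rewrite ltcR => /(_ e0).
rewrite near_withinE => /near_cplx[dl' dl'0 H].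
(* A real step small enough both for the difference quotient and, once v is scaled by it, for the
   Lipschitz estimate. *)
pose t := Num.min (dl' / 2) (dl / (2 * (rnorm v + 1))).
have v0 : 0 < 2 * (rnorm v + 1) by have := rnorm_ge0 v; lra.
have t0 : 0 < t by rewrite lt_min !divr_gt0.
have t1 : t <= dl' / 2 by rewrite ge_min lexx.
have t2 : t * (2 * (rnorm v + 1)) <= dl.
  by rewrite -ler_pdivlMr// ge_min lexx orbT.
have tn : normc ((t%:C)%C) = t by rewrite normc_real gtr0_norm.
have tc0 : (t%:C)%C != 0 :> Cplx R by rewrite -normc_gt0 tn.
have := H ((t%:C)%C); rewrite subr0 tn => /(_ _ tc0).
have tdl : t < dl' by lra.
move=> /(_ tdl); rewrite normE ltcR => Ht.
have Hg := gL ((t%:C)%C *: v + z).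
rewrite addrK rnormZ tn in Hg.
have {}Hg : normc ((t%:C)%C^-1 *: (g ((t%:C)%C *: v + z) - g z)) <= L * rnorm v.
  rewrite Normc.normcM Normc.normcV tn ler_pdivrMl// mulrCA; apply: Hg => j.
  rewrite !mxE addrK Normc.normcM tn.
  have := normc_le_rnorm v j; have := rnorm_ge0 v; nra.
set q := _ *: _ in Hg Ht.
have := le_normcD ('D_v g z - q) q; rewrite subrK; lra.
Qed.

(** A summable family of Lipschitz constants at z bounds the increments and, by [derivative_bound],
    also the differentials. Finitely many terms are handled by their own differentiability, the tail
    by 2 L_i |h|. *)
Lemma series_differentiable (g : nat -> Cd -> Cplx R) (z : Cd) (L : nat -> R) (B dl : R)
    (f : Cd -> Cplx R) :
  0 < dl -> (forall i, differentiable (g i) z) ->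
  (forall i (w : Cd), (forall j, normc (w 0 j - z 0 j) < dl) ->
     normc (g i w - g i z) <= L i * rnorm (w - z)) ->
  (forall i, 0 <= L i) -> (forall n, \sum_(i < n) L i <= B) ->
  (forall w : Cd, (forall j, normc (w 0 j - z 0 j) < dl) ->
     csummable (g ^~ w) /\ f w = csum (g ^~ w)) ->
  differentiable f z /\ forall v, 'd f z v = csum (fun i => 'd (g i) z v).
Proof.
move=> dl0 dg gL L0 LB fE.
have Db i := derivative_bound dl0 (dg i) (gL i).
have Ds v : csummable (fun i => 'd (g i) z v).
  apply: (@csummable_le _ _ (fun i => L i * rnorm v) (B * rnorm v)) => // n.
  by rewrite -mulr_suml ler_wpM2r ?rnorm_ge0.
pose T (v : Cd) : Cplx R := csum (fun i => 'd (g i) z v).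
have Tb v : normc (T v) <= B * rnorm v.
  apply: csum_norm_le => // n; apply: le_trans (normc_sum _ _ _) _.
  apply: (@le_trans _ _ (\sum_(i < n) L i * rnorm v)); first exact: ler_sum.
  by rewrite -mulr_suml ler_wpM2r ?rnorm_ge0.
have Tlin : linear T.
  move=> c u v; rewrite -[c *: T u]/(c * T u) /T -(csumZ c (Ds u)).2
    -(csumD (csumZ c (Ds u)).1 (Ds v)).2.
  by apply: eq_csum => i; exact: linearP.
pose TL : {linear Cd -> Cplx R} := HB.pack T (GRing.isLinear.Build _ _ _ _ T Tlin).
have TE v : TL v = T v by [].
have Tc : continuous TL.
  move=> v; apply/(@cvgrPdist_lt _ _ _ _ (nbhs_filter v)) => e /gt0_real[e0 eE].
  have B1 : 0 < B + 1 by have := LB 0%N; rewrite big_ord0; lra.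
  have := (@cvgrPdist_lt _ _ _ _ (nbhs_filter v) id v).1 cvg_id (((cRe e / (B + 1))%:C)%C).
  rewrite ltcR divr_gt0// => /(_ isT); apply: filterS => w.
  rewrite rnormE ltcR ltr_pdivlMr// -linearB normE eE ltcR => H.
  apply: le_lt_trans (Tb _) (le_lt_trans _ H).
  by rewrite mulrC ler_wpM2l ?rnorm_ge0//; lra.
apply: (differentialP Tc) => eps.
  move=> /gt0_real[]; set e := cRe eps => e0 eE.
  (* The tail counts twice, so it contributes e / 2; the geometric weights [c] below share the other
     e / 2 with a total independent of N. *)
  have e4 : 0 < e / 4 by rewrite divr_gt0.
  have [N HN] := small_tail e4 L0 LB.
  pose c (i : nat) := e / 2 * 2^-1 ^+ i.+1.
  have c0 i : 0 < c i by rewrite mulr_gt0 ?divr_gt0// exprn_gt0// invr_gt0.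
  have sc n : \sum_(i < n) c i <= e / 2.
    have -> : \sum_(i < n) c i = e / 2 * (1 - 2^-1 ^+ n).
      elim: n => [|n IHn]; first by rewrite big_ord0 expr0 subrr mulr0.
      by rewrite big_ord_recr/= IHn /c [in RHS]exprS exprS; field.
    have : 0 <= (2^-1 : R) ^+ n by rewrite exprn_ge0// invr_ge0.
    by nra.
  have nearN : \forall h \near (0 : Cd), forall i : 'I_N,
      normc (g i (h + z) - g i z - 'd (g i) z h) <= c i * rnorm h.
    apply: (@filter_forall Cd 'I_N (fun i h => normc (g i (h + z) - g i z - 'd (g i) z h) <= c i *
      rnorm h)
      (nbhs (0 : Cd)) _) => i.
    have [_ /eqaddoP/(_ ((c i)%:C)%C)] := (diff_locallyP z (g i)).1 (dg i).
    rewrite ltcR => /(_ (c0 i)); apply: filterS => h.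
    by rewrite !fctE /= normE rnormE -rmorphM lecR opprD addrA.
  have near_dl : nbhs (0 : Cd) (fun h : Cd => forall j, normc (h 0 j) < dl).
    by apply/near_row; exists dl => // w Hw j; have := Hw j; rewrite mxE subr0.
  apply: filterS2 near_dl nearN => h hdl0 hN.
  have hdl : forall j, normc ((h + z) 0 j - z 0 j) < dl by move=> j; rewrite mxE addrK.
  have [s1 f1] := fE _ hdl.
  have [|s0 f0] := fE z; first by move=> j; rewrite subrr normc_real normr0.
  rewrite normE rnormE eE -rmorphM lecR.
  pose x i := g i (h + z) - g i z - 'd (g i) z h.
  have E : csummable x /\ csum x = f (h + z) - f z - T h.
    have [sn1 En1] := csumZ (-1) s0; have [sn2 En2] := csumZ (-1) (Ds h).
    have [sD1 ED1] := csumD s1 sn1; have [sD2 ED2] := csumD sD1 sn2.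
    have xE : x = (fun i => g i (h + z) + -1 * g i z + -1 * 'd (g i) z h).
      by apply/funext => i; rewrite /x !mulN1r.
    by rewrite xE; split=> //; rewrite ED2 ED1 En1 En2 f1 f0 !mulN1r.
  rewrite TE -E.2; apply: csum_norm_le; first exact: E.1.
  move=> n; apply: le_trans (normc_sum _ _ _) _.
  apply: (@le_trans _ _ (\sum_(i < n) (c i + 2 * (if (i < N)%N then 0 else L i)) * rnorm h)).
    apply: ler_sum => i _; rewrite /x.
    have [iN|Ni] := ltnP i N.
      by rewrite mulr0 addr0; exact: (hN (Ordinal iN)).
    have := le_normcD (g i (h + z) - g i z) (- 'd (g i) z h).
    rewrite normcN; have := Db i h; have := gL i _ hdl; rewrite addrK.
    have := rnorm_ge0 h; have := c0 i; nra.
  rewrite -mulr_suml ler_wpM2r ?rnorm_ge0// big_split/= -[X in _ + X]mulr_sumr.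
  by have := sc n; have := HN n; lra.
Qed.
End SeriesDifferentiable.

(** * Differentiation of power series and the Euler operator *)

Lemma derive_pow_shift (K : numFieldType) (c : K) n :
  'D_1 (fun h : K => (h + 1) ^+ n * c) (0 : K) = n%:R * c.
Proof.
have H1 := is_deriveX n (is_deriveD (is_derive_id (0 : K) (1 : K))
  (is_derive_cst (1 : K) (0 : K) (1 : K))).
have H2 := is_deriveZ c H1.
have EG : (fun h : K => (h + 1) ^+ n * c) = c *: ((id + cst 1) ^+ n : K -> K).
  by apply/funext => h; rewrite !fctE /= mulrC.
rewrite EG; have -> := @derive_val _ _ _ _ _ _ _ H2.
rewrite /GRing.scale /= !fctE /= add0r expr1n; ring.
Qed.

Section PowerSeriesDerivative.
Variables (R : realType).
Implicit Types (m M r : R).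

(** The factor r^k / m stands for the usual r^(k-1). With one m below all radii, the estimates of
    the coordinates combine into a multiple of [mon al rho] in [mon_lipschitz]. *)
Lemma pow_lipschitz (x y : R[i]) r m M k : 0 < m -> m <= r -> normc x <= r -> normc y <= r ->
  normc (x - y) <= M -> normc (x ^+ k - y ^+ k) <= k%:R / m * r ^+ k * M.
Proof.
move=> m0 mr xr yr xyM; have M0 : 0 <= M by apply: le_trans xyM; exact: normc_ge0.
have r0 : 0 <= r by lra.
elim: k => [|k IH]; first by rewrite !expr0 subrr normc_real normr0 !mul0r.
have -> : x ^+ k.+1 - y ^+ k.+1 = x * (x ^+ k - y ^+ k) + (x - y) * y ^+ k.
  by rewrite !exprS; ring.
apply: le_trans (le_normcD _ _) _; rewrite !Normc.normcM normcX.
apply: (@le_trans _ _ (r * (k%:R / m * r ^+ k * M) + M * r ^+ k)).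
  apply: lerD; apply: ler_pM; rewrite ?normc_ge0 ?exprn_ge0 ?normc_ge0//.
  by rewrite lerXn2r ?nnegrE ?normc_ge0.
have rk : 0 <= r ^+ k by rewrite exprn_ge0.
have H : 1 <= r / m by rewrite ler_pdivlMr// mul1r.
rewrite -natr1 exprS; have := mulr_ge0 rk M0; set w := r ^+ k * M => w0.
have -> : r * (k%:R / m * r ^+ k * M) + M * r ^+ k = k%:R / m * r * w + w by rewrite /w; ring.
have -> : (k%:R + 1) / m * (r * r ^+ k) * M = k%:R / m * r * w + r / m * w by rewrite /w; ring.
by rewrite lerD2l ler_peMl.
Qed.

Lemma mon_lipschitz d (al : d.-tuple nat) (s t : d.-tuple R[i]) (rho : d.-tuple R) m M :
  0 < m -> 0 <= M -> (forall j, m <= tnth rho j) -> polydisc rho s -> polydisc rho t ->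
  (forall j, normc (tnth s j - tnth t j) <= M) ->
  normc (mon al s - mon al t) <= (msize al)%:R / m * mon al rho * M.
Proof.
move=> m0 M0; elim: d al s t rho => [|d IH] al s t rho.
  move=> _ _ _ _; rewrite /mon !big_ord0 subrr normc_real normr0.
  by rewrite !mulr_ge0// ?invr_ge0 ltW.
case/tupleP: al => k al; case/tupleP: s => x s; case/tupleP: t => y t; case/tupleP: rho => r rho.
rewrite -!/(tuple_cons _ _) => mr /polydisc_cons[xr sr] /polydisc_cons[yr tr] st.
have mr0 : m <= r by have := mr ord0; rewrite tnth0.
have mrho j : m <= tnth rho j by have := mr (lift ord0 j); rewrite tnthS.
have xy : normc (x - y) <= M by have := st ord0; rewrite !tnth0.
have {}st j : normc (tnth s j - tnth t j) <= M by have := st (lift ord0 j); rewrite !tnthS.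
rewrite !mon_cons msize_cons.
have -> : x ^+ k * mon al s - y ^+ k * mon al t =
    x ^+ k * (mon al s - mon al t) + (x ^+ k - y ^+ k) * mon al t by ring.
apply: le_trans (le_normcD _ _) _; rewrite !Normc.normcM normcX.
have rho0 : 0 <= mon al rho.
  by apply: prodr_ge0 => j _; rewrite exprn_ge0// (le_trans (ltW m0)).
have r0 : 0 <= r by lra.
apply: (@le_trans _ _ (r ^+ k * ((msize al)%:R / m * mon al rho * M) + (k%:R / m * r ^+ k * M) *
  mon al rho)).
  apply: lerD; apply: ler_pM; rewrite ?normc_ge0 ?exprn_ge0 ?normc_ge0//.
  - by rewrite lerXn2r ?nnegrE ?normc_ge0.
  - exact: IH.
  - exact: pow_lipschitz.
  - rewrite normc_mon; apply: mon_le => j; rewrite tnth_mktuple normc_ge0; exact: tr.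
by rewrite natrD le_eqVlt; apply/orP; left; apply/eqP; ring.
Qed.

Variables (d : nat) (nu : nat -> d.-tuple nat).
Local Notation Cd := 'rV[Cplx R]_d.
Local Notation psum := (psummable nu).
Implicit Types (a : nat -> R[i]) (rho : d.-tuple R).

Lemma differentiable_mon (al : d.-tuple nat) (z : Cd) :
  differentiable (fun w : Cd => mon al (rtup w) : Cplx R) z.
Proof.
pose F (j : 'I_d) : Cd -> Cplx R := fun w => w 0 j ^+ tnth al j.
have dF j : differentiable (F j) z.
  have dc := @differentiable_coord (Cplx R) 1 d z 0 j.
  rewrite /F; elim: (tnth al j) => [|k IH].
    rewrite (_ : (fun w : Cd => _) = cst 1); first exact: differentiable_cst.
    by apply/funext => w; rewrite expr0.
  rewrite (_ : (fun w : Cd => w 0 j ^+ k.+1) = (fun w : Cd => w 0 j) * (fun w : Cd => w 0 j ^+ k)).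
    exact: differentiableM.
  by apply/funext => w; rewrite exprS.
have -> : (fun w : Cd => mon al (rtup w) : Cplx R) = (fun w => \prod_(j <- index_enum 'I_d) F j w).
  by apply/funext => w; apply: eq_bigr => j _; rewrite /F tnth_rtup.
elim: (index_enum 'I_d) => [|j s IH].
  rewrite (_ : (fun w : Cd => _) = cst 1); first exact: differentiable_cst.
  by apply/funext => w; rewrite big_nil.
rewrite (_ : (fun w : Cd => _) = F j * (fun w => \prod_(j <- s) F j w));
  first exact: differentiableM.
by apply/funext => w; rewrite big_cons.
Qed.

Lemma mon_scale (al : d.-tuple nat) (c : Cplx R) (z : Cd) :
  mon al (rtup (c *: z)) = c ^+ msize al * mon al (rtup z).
Proof.
rewrite /mon /msize -prodrXr -big_split/=; apply: eq_bigr => j _.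
by rewrite !tnth_rtup mxE exprMn.
Qed.

(** Euler's identity: by homogeneity the monomial at (1 + h) z is (1 + h)^|al| times its value at z,
    and the derivative at h = 0 is taken. *)
Lemma euler_mon (al : d.-tuple nat) (z : Cd) :
  'd (fun w : Cd => mon al (rtup w) : Cplx R) z z = (msize al)%:R * mon al (rtup z).
Proof.
rewrite -deriveE; last exact: differentiable_mon.
pose G (h : Cplx R) : Cplx R := (h + 1) ^+ msize al * mon al (rtup z).
have E : 'D_z (fun w : Cd => mon al (rtup w) : Cplx R) z = 'D_1 G (0 : Cplx R).
  have Eq : (fun h : Cplx R => h^-1 *: (((fun w : Cd => mon al (rtup w) : Cplx R) \o shift z)
    (h *: z) -
      (mon al (rtup z) : Cplx R))) = (fun h => h^-1 *: ((G \o shift 0) (h *: 1) - G 0)).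
    apply/funext => h /=; rewrite /G addr0 add0r expr1n mul1r -[h *: 1]/(h * 1) mulr1.
    by rewrite -mon_scale scalerDl scale1r.
  by rewrite /derive Eq.
rewrite E.
exact: derive_pow_shift.
Qed.

Definition euler_coef a i : R[i] := (msize (nu i))%:R * a i.

Lemma normc_nat n : normc (n%:R : R[i]) = n%:R.
Proof.
have -> : (n%:R : R[i]) = ((n%:R : R)%:C)%C by rewrite rmorph_nat.
by rewrite normc_real normr_nat.
Qed.

Lemma geo_mul_le (q : R) n : 0 <= q < 1 -> n%:R * q ^+ n <= (1 - q)^-1.
Proof.
move=> /andP[q0 q1]; have q10 : 0 < 1 - q by lra.
rewrite -[leRHS]mul1r ler_pdivlMr//.
(* The stronger bound 1 - q^n is what the induction on n preserves. *)
suff : n%:R * q ^+ n * (1 - q) <= 1 - q ^+ n by have := exprn_ge0 n q0; lra.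
elim: n => [|n IH]; first by rewrite !mul0r expr0 subrr.
have qn : 0 <= q ^+ n by exact: exprn_ge0.
have qn1 : q ^+ n <= 1 by rewrite exprn_ile1// ltW.
rewrite exprS -natr1; set w := q ^+ n in IH qn qn1 *.
have -> : (n%:R + 1) * (q * w) * (1 - q) = q * (n%:R * w * (1 - q)) + q * w * (1 - q) by ring.
have qw : q * w <= 1 by nra.
have : 0 <= (1 - q) * (1 - q * w) by rewrite mulr_ge0//; lra.
have := ler_wpM2l q0 IH; nra.
Qed.

Lemma psummable_euler_bound a rho : psum a -> in_ball rho ->
  exists B, forall n, \sum_(i < n) normc (a i) * ((msize (nu i))%:R * mon (nu i) rho) <= B.
Proof.
move=> pa [r0 r1]; pose T := \sum_j tnth rho j ^+ 2.
have T0 : 0 <= T by apply: sumr_ge0 => j _; exact: sqr_ge0.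
(* Since (1 + T)^2 > 4 T, the enlarged polyradius rho / q is still in the ball, and the gained
   factor q^|al| absorbs the degree |al|. *)
pose q := (1 + T) / 2; have q01 : 0 <= q < 1 by rewrite /q /T in r1 T0 *; lra.
have q0 : 0 < q by rewrite /q; lra.
have q10 : 0 < 1 - q by lra.
pose rho2 : d.-tuple R := [tuple tnth rho j / q | j < d].
have [|B HB] := pa rho2.
  split=> [j|]; first by rewrite tnth_mktuple divr_gt0.
  under eq_bigr do rewrite tnth_mktuple exprMn.
  rewrite -mulr_suml -/T exprVn ltr_pdivrMr ?exprn_gt0// mul1r /q.
  have : T < 1 by []. nra.
exists ((1 - q)^-1 * B) => n.
apply: (@le_trans _ _ ((1 - q)^-1 * \sum_(i < n) normc (a i) * mon (nu i) rho2)); last first.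
  by rewrite ler_wpM2l// invr_ge0 ltW.
rewrite mulr_sumr; apply: ler_sum => i _; rewrite [leRHS]mulrCA ler_wpM2l ?normc_ge0//.
have -> : mon (nu i) rho = q ^+ msize (nu i) * mon (nu i) rho2.
  rewrite /msize -prodrXr -big_split/=; apply: eq_bigr => j _.
  by rewrite tnth_mktuple -exprMn mulrC divfK// gt_eqF.
rewrite mulrA ler_wpM2r//; last exact: geo_mul_le.
by apply: prodr_ge0 => j _; rewrite exprn_ge0// tnth_mktuple divr_ge0// ltW.
Qed.

Lemma uniform_lower (F : 'I_d -> R) : (forall j, 0 < F j) -> exists2 m, 0 < m & forall j, m <= F j.
Proof.
move=> F0; have S0 : 0 <= \sum_j (F j)^-1 by apply: sumr_ge0 => j _; rewrite invr_ge0 ltW.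
(* A lower bound in closed form, which also makes sense for the empty family. *)
exists (1 + \sum_j (F j)^-1)^-1; first by rewrite invr_gt0; lra.
move=> j; rewrite -[F j]invrK lef_pV2 ?posrE ?invr_gt0//; last by lra.
rewrite (bigD1 j)//=; have : 0 <= \sum_(i < d | i != j) (F i)^-1.
  by apply: sumr_ge0 => i _; rewrite invr_ge0 ltW.
lra.
Qed.

Lemma linear_row (K : numFieldType) n (T : {linear 'rV[K]_n -> K}) (z : 'rV[K]_n) :
  T z = \sum_j z 0 j * T 'e_j.
Proof.
rewrite [in LHS](row_sum_delta z) linear_sum; apply: eq_bigr => j _.
exact: linearZ.
Qed.

Lemma psummable_derivative a (f : Cd -> Cplx R) : psum a ->
  (forall z, unit_ball z -> f z = csum (fun i => a i * mon (nu i) (rtup z))) ->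
  psum (euler_coef a) /\ forall z, unit_ball z -> differentiable f z /\
    eulerN f z = csum (fun i => euler_coef a i * mon (nu i) (rtup z)).
Proof.
move=> pa fE; split.
  move=> rho rb; have [B HB] := psummable_euler_bound pa rb; exists B => n.
  apply: le_trans (HB n); apply: ler_sum => i _.
  by rewrite /euler_coef Normc.normcM normc_nat [_%:R * normc _]mulrC -mulrA.
move=> z zB; have [|rho rb zr] := polydisc_between (s := rtup z); first by rewrite -sqnorm_rtup.
have [m m0 Hm] := uniform_lower rb.1.
have [dl dl0 Hdl] : exists2 dl, 0 < dl & forall j, dl <= tnth rho j - normc (z 0 j).
  by apply: uniform_lower => j; have := zr j; rewrite tnth_rtup subr_gt0.
pose g i (w : Cd) : Cplx R := a i * mon (nu i) (rtup w).
have [B HB] := psummable_euler_bound pa rb.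
pose L i := normc (a i) * ((msize (nu i))%:R / m * mon (nu i) rho).
have wr (w : Cd) : (forall j, normc (w 0 j - z 0 j) < dl) -> polydisc rho (rtup w).
  move=> H j; rewrite tnth_rtup -[w 0 j](subrK (z 0 j)).
  apply: le_trans (le_normcD _ _) _; have := H j; have := Hdl j; lra.
have zz : polydisc rho (rtup z) by move=> j; exact: ltW.
have mr0 al : 0 <= mon al rho by apply: ltW; apply: mon_gt0; exact: rb.1.
have dm i := differentiable_mon (nu i) z.
have gE i : g i = (a i : Cplx R) *: (fun w : Cd => mon (nu i) (rtup w) : Cplx R) by [].
have [|||||df dE] := @series_differentiable R d g z L (m^-1 * B) dl f dl0.
- by move=> i; rewrite gE; apply: differentiableZ; exact: dm.
- move=> i w Hw; rewrite /g -mulrBr Normc.normcM /L -[leRHS]mulrA; apply: ler_wpM2l;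
  first exact: normc_ge0.
  apply: mon_lipschitz => //; [exact: rnorm_ge0|exact: wr|].
  by move=> j; rewrite !tnth_rtup; have := normc_le_rnorm (w - z) j; rewrite !mxE.
- by move=> i; apply: mulr_ge0; [exact: normc_ge0|rewrite mulr_ge0// divr_ge0// ltW].
- move=> n; apply: (@le_trans _ _ (m^-1 * \sum_(i < n) normc (a i) *
  ((msize (nu i))%:R * mon (nu i) rho))).
    rewrite mulr_sumr; apply: ler_sum => i _; rewrite /L le_eqVlt; apply/orP; left; apply/eqP; ring.
  by rewrite ler_wpM2l// invr_ge0 ltW.
- move=> w Hw; have wB : \sum_j normc (tnth (rtup w) j) ^+ 2 < 1.
    apply: le_lt_trans rb.2; apply: ler_sum => j _.
    by rewrite lerXn2r ?nnegrE ?normc_ge0 ?(ltW (rb.1 j))//; exact: wr.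
  by split; [exact: psummable_csummable|rewrite fE// /unit_ball /= sqnorm_rtup].
split=> //.
(* N is differentiation in the direction z, so Euler's identity applies to each term. *)
have -> : eulerN f z = 'd f z z.
  have -> := linear_row ('d f z) z.
  by apply: eq_bigr => j _; rewrite deriveE.
rewrite dE; apply: eq_csum => i; rewrite gE diffZ//.
rewrite -[LHS]/(a i * ('d (fun w : Cd => mon (nu i) (rtup w) : Cplx R) z z)) euler_mon /euler_coef.
by rewrite mulrA [a i * _]mulrC.
Qed.
End PowerSeriesDerivative.

(** * Parseval formula *)

Section Parseval.
Variables (R : realType) (d : nat) (nu : nat -> d.-tuple nat) (sg : R).
Hypothesis nu_bij : bijective nu.
Hypothesis dsg : d%:R < sg.
Local Notation Cd := 'rV[Cplx R]_d.
Local Notation ta := (@tau R d).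
Local Notation B := (@cball R d).
Local Notation psum := (psummable nu).
Local Notation dens := (@mu_density R d sg).
Implicit Types (a b : nat -> R[i]) (M N : nat) (u : coords R d).

Let mB : measurable B := @measurable_cball R d.

Definition nmon i u : R[i] := mon (nu i) (zvec u).
Definition wt i : R := (kappa sg (nu i))^-1.
Definition monseries a u : R[i] := csum (fun i => a i * nmon i u).
(** The cut-off of the Parseval proof. Where it holds, all partial sums of both series are at most
    M, so M^2 times the density is an integrable majorant. It depends only on the |z_j|, hence is
    invariant under coordinate rotations and preserves orthogonality of monomials. *)
Definition abs_bound a b M u := forall n, \sum_(i < n) (normc (a i) + normc (b i)) *
  normc (nmon i u) <= M%:R.
Definition trunc_set a b M : set (coords R d) := [set u | abs_bound a b M u].
Definition trunc_dens a b M u : R := dens u * \1_(trunc_set a b M) u.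

Lemma cmeas_nmon (D : set (coords R d)) i : cmeas D (nmon i).
Proof. exact: cmeas_monS. Qed.

Lemma measurable_trunc_set a b M : measurable (trunc_set a b M).
Proof.
rewrite (_ : trunc_set a b M = \bigcap_n [set u | \sum_(i < n) (normc (a i) + normc (b i)) *
  normc (nmon i u) <= M%:R]).
  apply: bigcapT_measurable => n; rewrite -[X in measurable X]setTI.
  have mf : measurable_fun setT (fun u => \sum_(i < n) (normc (a i) + normc (b i)) *
    normc (nmon i u)).
    apply: measurable_sum => i; apply: measurable_funM => //.
    by apply: measurable_normc => //; exact: cmeas_nmon.
  rewrite (_ : [set u | _] = (fun u => \sum_(i < n) (normc (a i) + normc (b i)) *
    normc (nmon i u)) @^-1` `]-oo, M%:R]%classic).
    by apply: mf => //; exact: measurable_itv.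
  by apply/seteqP; split=> u /=; rewrite in_itv.
by apply/seteqP; split=> u /= H; [move=> n _; exact: H|move=> n; exact: H].
Qed.

Lemma measurable_trunc_dens (D : set (coords R d)) a b M : measurable_fun D (trunc_dens a b M).
Proof.
apply: measurable_funM; first exact: measurable_mu_density.
by apply: measurable_indic; exact: measurable_trunc_set.
Qed.

Lemma trunc_dens_ge0 a b M u : 0 <= trunc_dens a b M u.
Proof. by rewrite mulr_ge0 ?mu_density_ge0. Qed.

Lemma trunc_dens_le a b M u : trunc_dens a b M u <= dens u.
Proof. by rewrite ler_piMr ?mu_density_ge0// indicE; case: (_ \in _). Qed.

Lemma nmon_rot i j th u : normc (nmon i (at_coord j (plane_rot th) u)) = normc (nmon i u).
Proof. by rewrite /nmon mon_rot Normc.normcM normcX normc_cis expr1n mul1r. Qed.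

Lemma trunc_dens_rot a b M j th u :
  trunc_dens a b M (at_coord j (plane_rot th) u) = trunc_dens a b M u.
Proof.
have E1 : dens (at_coord j (plane_rot th) u) = dens u.
  by rewrite /mu_density -![sqnorm _]/(sqn _) sqn_rot.
have E2 : (at_coord j (plane_rot th) u \in trunc_set a b M) = (u \in trunc_set a b M).
  have S n : \sum_(i < n)
      (normc (a i) + normc (b i)) * normc (nmon i (at_coord j (plane_rot th) u)) =
      \sum_(i < n) (normc (a i) + normc (b i)) * normc (nmon i u).
    by apply: eq_bigr => i _; rewrite nmon_rot.
  by apply/idP/idP; rewrite !inE => H n; have := H n; rewrite S.
by rewrite /trunc_dens E1 !indicE E2.
Qed.

Lemma integrable_nmon i : ta.-integrable B (fun u => (dens u * normc (nmon i u) ^+ 2)%:E).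
Proof.
apply/integrableP; split.
  apply/measurable_EFinP/measurable_funM; first exact: measurable_mu_density.
  by apply: measurable_funX; apply: measurable_normc => //; exact: cmeas_nmon.
have p0 u : 0 <= dens u * normc (nmon i u) ^+ 2 by rewrite mulr_ge0 ?sqr_ge0// mu_density_ge0.
under eq_integral do rewrite /= (ger0_norm (p0 _)).
by rewrite monomial_norm// ltry.
Qed.

Lemma integrable_dens : ta.-integrable B (fun u => (dens u)%:E).
Proof.
apply/integrableP; split; first by apply/measurable_EFinP; exact: measurable_mu_density.
have := @monomial_norm R d sg [tuple 0%N | _ < d] dsg.
have E (u : coords R d) : dens u * normc (mon [tuple 0%N | _ < d] (zvec u)) ^+ 2 = dens u.
  rewrite /mon big1 ?normc_real ?normr1 ?expr1n ?mulr1// => j _.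
  by rewrite tnth_mktuple expr0.
under eq_integral do rewrite E.
under eq_integral do rewrite -[dens _]ger0_norm ?mu_density_ge0//.
by move=> ->; rewrite ltry.
Qed.

Definition tw a b M i : R[i] :=
  cint ta B (fun u => ((trunc_dens a b M u)%:C)%C * ((nmon i u)^*%C * nmon i u)).

Lemma trunc_pairing a b M i j :
  cintegrable ta B (fun u => ((trunc_dens a b M u)%:C)%C * ((nmon i u)^*%C * nmon j u)) /\
  cint ta B (fun u => ((trunc_dens a b M u)%:C)%C * ((nmon i u)^*%C * nmon j u)) =
    if i == j then tw a b M i else 0.
Proof.
have ih : cintegrable ta B (fun u => ((trunc_dens a b M u)%:C)%C * ((nmon i u)^*%C * nmon j u)).
  apply: (le_cintegrable mB _ (integrableD mB (integrable_nmon i) (integrable_nmon j))).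
    apply: cmeasM => //; first by apply: cmeas_real; exact: measurable_trunc_dens.
    by apply: cmeasM => //; [apply: cmeasJ => //|]; exact: cmeas_nmon.
  move=> u _; rewrite !Normc.normcM normc_conj normc_real ger0_norm ?trunc_dens_ge0//.
  rewrite -mulrDr; apply: ler_pM; rewrite ?trunc_dens_ge0 ?trunc_dens_le//.
    by rewrite mulr_ge0 ?normc_ge0.
  have := normc_ge0 (nmon i u); have := normc_ge0 (nmon j u).
  move: (normc _) (normc _) => x y; nra.
split=> //; case: eqP => [->//|/eqP ij].
have E : (fun u => ((trunc_dens a b M u)%:C)%C * ((nmon i u)^*%C * nmon j u)) =
    (fun u => (mon (nu i) (zvec u))^*%C * mon (nu j) (zvec u) * ((trunc_dens a b M u)%:C)%C).
  by apply/funext => u; rewrite mulrC.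
rewrite E; apply: monomial_orthogonal.
- by move=> l th u; exact: trunc_dens_rot.
- by rewrite (inj_eq (bij_inj nu_bij)).
- by rewrite -E.
Qed.

Lemma abs_bound_csummable a b M u : abs_bound a b M u ->
  [/\ csummable (fun i => a i * nmon i u), csummable (fun i => b i * nmon i u),
      (forall n, normc (\sum_(i < n) a i * nmon i u) <= M%:R) &
      (forall n, normc (\sum_(i < n) b i * nmon i u) <= M%:R)].
Proof.
move=> H.
have Ha i : normc (a i * nmon i u) <= (normc (a i) + normc (b i)) * normc (nmon i u).
  by rewrite Normc.normcM ler_wpM2r ?normc_ge0// lerDl normc_ge0.
have Hb i : normc (b i * nmon i u) <= (normc (a i) + normc (b i)) * normc (nmon i u).
  by rewrite Normc.normcM ler_wpM2r ?normc_ge0// lerDr normc_ge0.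
split.
- exact: (@csummable_le _ _ _ _ Ha H).
- exact: (@csummable_le _ _ _ _ Hb H).
- by move=> n; apply: le_trans (H n); apply: le_trans (normc_sum _ _ _) _; exact: ler_sum.
- by move=> n; apply: le_trans (H n); apply: le_trans (normc_sum _ _ _) _; exact: ler_sum.
Qed.

Lemma psum_abs_bound a b u : psum a -> psum b -> B u -> \forall M \near \oo, abs_bound a b M u.
Proof.
move=> pa pb uB; have [|rho rb zr] := polydisc_between (s := zvec u); first by rewrite -sqn_zvec.
have [B1 HB1] := pa _ rb; have [B2 HB2] := pb _ rb.
near=> M => n.
have mle i : normc (nmon i u) <= mon (nu i) rho.
  by rewrite normc_mon; apply: mon_le => j; rewrite tnth_mktuple normc_ge0 ltW.
apply: (@le_trans _ _ (B1 + B2)); last by near: M; exact: nbhs_infty_ger.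
apply: le_trans (lerD (HB1 n) (HB2 n)); rewrite -big_split/=; apply: ler_sum => i _.
by rewrite -mulrDl ler_wpM2l// addr_ge0 ?normc_ge0.
Unshelve. all: by end_near. Qed.

Lemma cmeas_pseries a : psum a -> cmeas B (monseries a).
Proof.
move=> pa; apply: (@cmeas_cvg _ _ _ B (fun n u => \sum_(i < n) a i * nmon i u)).
  by move=> n; apply: cmeas_sum => // i; apply: cmeasM => //; exact: cmeas_nmon.
move=> u uB; apply: csum_partial; apply: psummable_csummable => //.
by rewrite -sqn_zvec.
Qed.

(** For fixed M the orthogonality of the monomials under the cut-off density evaluates the finite
    sums, and the cut-off makes the limit in n dominated. [tw] is the squared norm of a monomial
    under that density. *)
Lemma trunc_parseval a b M : psum a -> psum b ->
  ccvg (fun n => \sum_(i < n) (a i)^*%C * b i * tw a b M i)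
    (cint ta B (fun u => ((trunc_dens a b M u)%:C)%C * ((monseries a u)^*%C * monseries b u))).
Proof.
move=> pa pb.
pose h n u := ((trunc_dens a b M u)%:C)%C *
  ((\sum_(i < n) a i * nmon i u)^*%C * (\sum_(i < n) b i * nmon i u)).
have mh n : cmeas B (h n).
  apply: cmeasM => //; first by apply: cmeas_real; exact: measurable_trunc_dens.
  apply: cmeasM => //; [apply: cmeasJ => //|]; apply: cmeas_sum => // i; apply: cmeasM => //;
    by [exact: cmeas_cst|exact: cmeas_nmon].
have hE n : cint ta B (h n) = \sum_(i < n) (a i)^*%C * b i * tw a b M i.
  have -> : h n = (fun u => \sum_(i < n) \sum_(j < n) ((a i)^*%C * b j) *
      (((trunc_dens a b M u)%:C)%C * ((nmon i u)^*%C * nmon j u))).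
    apply/funext => u; rewrite /h rmorph_sum/= mulr_suml mulr_sumr; apply: eq_bigr => i _.
    rewrite mulr_sumr mulr_sumr; apply: eq_bigr => j _; rewrite rmorphM /=; ring.
  have ij i j := (trunc_pairing a b M i j).
  rewrite cint_sum//; last first.
    move=> i; apply: cintegrable_sum => // j; apply: cintegrableZ => //; exact: (ij _ _).1.
  apply: eq_bigr => i _; rewrite cint_sum//; last first.
    by move=> j; apply: cintegrableZ => //; exact: (ij _ _).1.
  rewrite (bigD1 i)//= cintZ//; last exact: (ij _ _).1.
  rewrite (ij _ _).2 eqxx big1 ?addr0// => j ji.
  rewrite cintZ//; last exact: (ij _ _).1.
  by rewrite (ij _ _).2 ifN ?mulr0// eq_sym.
have [] := @cdominated _ _ _ ta B mB h
  (fun u => ((trunc_dens a b M u)%:C)%C * ((monseries a u)^*%C * monseries b u))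
  (fun u => M%:R ^+ 2 * dens u) mh.
- move=> u uB; apply: ccvgM; first exact: ccvg_cst.
  have us : \sum_j normc (tnth (zvec u) j) ^+ 2 < 1 by rewrite -sqn_zvec.
  apply: ccvgM; [apply: ccvgJ|]; apply: csum_partial; exact: psummable_csummable.
- have := integrableZl mB (M%:R ^+ 2) integrable_dens.
  by apply: eq_integrable => // u _; rewrite -EFinM.
- move=> n u uB; rewrite /h !Normc.normcM normc_conj normc_real ger0_norm ?trunc_dens_ge0//.
  have [uA|uA] := boolP (u \in trunc_set a b M); last first.
    rewrite /trunc_dens indicE (negbTE uA) mulr0 mul0r mulr_ge0 ?sqr_ge0//.
    exact: mu_density_ge0.
  have [_ _ Ha Hb] := abs_bound_csummable (set_mem uA).
  rewrite mulrC; apply: ler_pM; rewrite ?trunc_dens_ge0 ?trunc_dens_le ?mulr_ge0 ?normc_ge0//.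
  by rewrite expr2; apply: ler_pM; rewrite ?normc_ge0.
by move=> _; under eq_fun do rewrite hE.
Qed.

Lemma cintegrable_trunc a b M : psum a -> psum b ->
  cintegrable ta B (fun u => ((trunc_dens a b M u)%:C)%C * ((monseries a u)^*%C * monseries b u)).
Proof.
move=> pa pb.
apply: (@le_cintegrable _ _ _ ta B mB _ (fun u => M%:R ^+ 2 * dens u)).
- apply: cmeasM => //; first by apply: cmeas_real; exact: measurable_trunc_dens.
  by apply: cmeasM => //; [apply: cmeasJ => //|]; exact: cmeas_pseries.
- have := integrableZl mB (M%:R ^+ 2) integrable_dens.
  by apply: eq_integrable => // u _; rewrite -EFinM.
- move=> u uB; rewrite !Normc.normcM normc_conj normc_real ger0_norm ?trunc_dens_ge0//.
  have [uA|uA] := boolP (u \in trunc_set a b M); last first.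
    rewrite /trunc_dens indicE (negbTE uA) mulr0 mul0r mulr_ge0 ?sqr_ge0//.
    exact: mu_density_ge0.
  have [sa sb Ha Hb] := abs_bound_csummable (set_mem uA).
  rewrite mulrC; apply: ler_pM; rewrite ?trunc_dens_ge0 ?trunc_dens_le ?mulr_ge0 ?normc_ge0//.
  by rewrite expr2; apply: ler_pM; rewrite ?normc_ge0//; exact: csum_norm_le.
Qed.

Lemma Rintegral_nmon i : \int[ta]_(u in B) (dens u * normc (nmon i u) ^+ 2) = wt i.
Proof. by rewrite /Rintegral monomial_norm. Qed.

Lemma tw_real a b M i : tw a b M i = ((cRe (tw a b M i))%:C)%C /\ 0 <= cRe (tw a b M i) <= wt i.
Proof.
have ->: tw a b M i = cint ta B (fun u => ((trunc_dens a b M u * normc (nmon i u) ^+ 2)%:C)%C).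
  by apply: eq_cint => u _; rewrite mulc_conj -rmorphM.
split.
  by apply: complexP => //=; rewrite /Rintegral integral0_eq.
rewrite /=; have p0 u : 0 <= trunc_dens a b M u * normc (nmon i u) ^+ 2.
  by rewrite mulr_ge0 ?sqr_ge0// trunc_dens_ge0.
have ple u : trunc_dens a b M u * normc (nmon i u) ^+ 2 <= dens u * normc (nmon i u) ^+ 2.
  by rewrite ler_wpM2r ?sqr_ge0// trunc_dens_le.
rewrite Rintegral_ge0//= -Rintegral_nmon; apply: le_Rintegral => //; last exact: integrable_nmon.
apply: le_integrable (integrable_nmon i) => //.
  apply/measurable_EFinP; apply: measurable_funM; first exact: measurable_trunc_dens.
  by apply: measurable_funX; apply: measurable_normc => //; exact: cmeas_nmon.
by move=> u _; rewrite /= lee_fin !ger0_norm// (le_trans (p0 u)).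
Qed.

Lemma normc_tw a b M i : normc (tw a b M i) <= wt i.
Proof. by have [-> /andP[H0 H1]] := tw_real a b M i; rewrite normc_real ger0_norm. Qed.

Lemma wt_ge0 i : 0 <= wt i.
Proof. by have [_ /andP[H0 H1]] := tw_real 0 0 0%N i; exact: le_trans H1. Qed.

Lemma trunc_dens_cvg a b u : psum a -> psum b -> B u ->
  \forall M \near \oo, trunc_dens a b M u = dens u.
Proof.
move=> pa pb uB; apply: filterS (psum_abs_bound pa pb uB) => M H.
by rewrite /trunc_dens indicE mem_set// mulr1.
Qed.

Lemma tw_cvg a b i : psum a -> psum b -> ccvg (fun M => tw a b M i) (((wt i)%:C)%C).
Proof.
move=> pa pb.
have [] := @cdominated _ _ _ ta B mB
  (fun M u => ((trunc_dens a b M u)%:C)%C * ((nmon i u)^*%C * nmon i u))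
  (fun u => ((dens u)%:C)%C * ((nmon i u)^*%C * nmon i u))
  (fun u => dens u * normc (nmon i u) ^+ 2).
- move=> M; apply: cmeasM => //; first by apply: cmeas_real; exact: measurable_trunc_dens.
  by apply: cmeasM => //; [apply: cmeasJ => //|]; exact: cmeas_nmon.
- move=> u uB; apply: ccvg_near; apply: filterS (trunc_dens_cvg pa pb uB) => M ->//.
- exact: integrable_nmon.
- move=> M u _; rewrite mulc_conj -rmorphM normc_real ger0_norm.
    by rewrite ler_wpM2r ?sqr_ge0// trunc_dens_le.
  by rewrite mulr_ge0 ?sqr_ge0// trunc_dens_ge0.
move=> _; congr ccvg.
rewrite -[LHS]/(cint ta B (fun u => ((mu_density sg u)%:C)%C *
  ((mon (nu i) (zvec u))^*%C * mon (nu i) (zvec u)))).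
by rewrite (monomial_pairing _ _ dsg).2 eqxx.
Qed.

Lemma cnormsq (x : R[i]) : x^*%C * x = ((normc x ^+ 2)%:C)%C.
Proof. exact: mulc_conj. Qed.

(** For fixed M the sums increase with n to the truncated integral, hence stay below the full one;
    only then does M tend to infinity, in finitely many terms. Taking the two limits in this order
    needs no exchange. *)
Lemma coef_bound a : psum a ->
  ta.-integrable B (fun u => (dens u * normc (monseries a u) ^+ 2)%:E) ->
  forall n, \sum_(i < n) normc (a i) ^+ 2 * wt i <=
    \int[ta]_(u in B) (dens u * normc (monseries a u) ^+ 2).
Proof.
move=> pa iF n; set C0 := \int[ta]_(u in B) _.
pose S M n := \sum_(i < n) normc (a i) ^+ 2 * cRe (tw a a M i).
have SE M k : \sum_(i < k) (a i)^*%C * a i * tw a a M i = ((S M k)%:C)%C.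
  rewrite /S rmorph_sum/=; apply: eq_bigr => i _.
  by rewrite cnormsq (tw_real a a M i).1 -rmorphM.
have SM M k : S M k <= C0.
  have := trunc_parseval M pa pa; under eq_fun do rewrite SE.
  move=> [+ _] /=; set I := cint _ _ _ => cv.
  have nd : nondecreasing_seq (S M).
    apply/nondecreasing_seqP => m; rewrite /S big_ord_recr/= lerDl mulr_ge0 ?sqr_ge0//.
    by have [_ /andP[]] := tw_real a a M m.
  have := nondecreasing_cvgn_le nd (cvgP _ cv) k; rewrite (cvg_lim _ cv)// => /le_trans; apply.
  apply: le_trans (ler_norm _) _; apply: le_trans (normc_re_le _) _.
  apply: (normc_cint_le mB (cintegrable_trunc M pa pa) iF) => u _.
  rewrite cnormsq -rmorphM normc_real ger0_norm.
    by rewrite ler_wpM2r ?sqr_ge0// trunc_dens_le.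
  by apply: mulr_ge0; [exact: trunc_dens_ge0|exact: sqr_ge0].
have cS : ccvg (fun M => ((S M n)%:C)%C) (((\sum_(i < n) normc (a i) ^+ 2 * wt i)%:C)%C).
  under eq_fun do rewrite -SE.
  have -> : ((\sum_(i < n) normc (a i) ^+ 2 * wt i)%:C)%C = \sum_(i < n) (a i)^*%C * a i *
    ((wt i)%:C)%C.
    by rewrite rmorph_sum/=; apply: eq_bigr => i _; rewrite cnormsq -rmorphM.
  apply: ccvg_sum => i; apply: ccvgM; [exact: ccvg_cst|exact: tw_cvg].
have := normc_lim_le cS; rewrite normc_real => /(_ C0) H.
apply: le_trans (ler_norm _) (H _) => M; rewrite normc_real ger0_norm ?SM//.
apply: sumr_ge0 => i _; rewrite mulr_ge0 ?sqr_ge0//.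
by have [_ /andP[]] := tw_real a a M i.
Qed.

(** Converse of [coef_bound]: the truncated integrals are at most C, and the cut-off densities
    increase to the full one, so monotone convergence applies. *)
Lemma series_square_integrable a (C : R) : psum a ->
  (forall n, \sum_(i < n) normc (a i) ^+ 2 * wt i <= C) ->
  ta.-integrable B (fun u => (dens u * normc (monseries a u) ^+ 2)%:E).
Proof.
move=> pa aC.
pose psi M u := trunc_dens a a M u * normc (monseries a u) ^+ 2.
have mF : measurable_fun B (fun u => normc (monseries a u) ^+ 2).
  by apply: measurable_funX; apply: measurable_normc => //; exact: cmeas_pseries.
have psi0 M u : 0 <= psi M u by rewrite mulr_ge0 ?sqr_ge0// trunc_dens_ge0.
have d0 u : 0 <= dens u * normc (monseries a u) ^+ 2 by rewrite mulr_ge0 ?sqr_ge0// mu_density_ge0.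
have mpsi M : measurable_fun B (psi M) by apply: measurable_funM => //;
  exact: measurable_trunc_dens.
have psiC M : (\int[ta]_(u in B) (psi M u)%:E <= C%:E)%E.
  have E : cint ta B (fun u => ((trunc_dens a a M u)%:C)%C *
    ((monseries a u)^*%C * monseries a u)) =
      cint ta B (fun u => ((psi M u)%:C)%C).
    by apply: eq_cint => u _; rewrite cnormsq -rmorphM.
  have iI : cintegrable ta B (fun u => ((psi M u)%:C)%C).
    by apply: (eq_cintegrable mB _ (cintegrable_trunc M pa pa)) => u _; rewrite cnormsq -rmorphM.
  have ip : ta.-integrable B (EFin \o psi M) := iI.1.
  rewrite -[X in (X <= _)%E]fineK; last exact: integrable_fin_num ip.
  rewrite lee_fin -[fine _]/(cRe (cint ta B (fun u => ((psi M u)%:C)%C))) -E.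
  apply: le_trans (ler_norm _) _; apply: le_trans (normc_re_le _) _.
  apply: normc_lim_le (trunc_parseval M pa pa) _ => n.
  apply: le_trans (normc_sum _ _ _) (le_trans _ (aC n)); apply: ler_sum => i _.
  rewrite cnormsq Normc.normcM normc_real ger0_norm ?sqr_ge0// ler_wpM2l ?sqr_ge0//.
  exact: normc_tw.
apply/integrableP; split.
  by apply/measurable_EFinP; apply: measurable_funM => //; exact: measurable_mu_density.
rewrite (eq_integral (fun u => (dens u * normc (monseries a u) ^+ 2)%:E)); last first.
  by move=> u _; rewrite gee0_abs// lee_fin.
apply: (@le_lt_trans _ _ C%:E); last exact: ltry.
have ndA M N : (M <= N)%N -> trunc_set a a M `<=` trunc_set a a N.
  by move=> MN u Hu n; apply: le_trans (Hu n) _; rewrite ler_nat.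
have mpsi' M : measurable_fun B (fun u => (psi M u)%:E) by apply/measurable_EFinP; exact: mpsi.
have := @cvg_monotone_convergence _ _ _ ta B mB (fun M u => (psi M u)%:E).
move=> /(_ mpsi') cm.
have {}cm := cm (fun M u _ => psi0 M u).
rewrite (eq_integral (fun u => limn (fun M => (psi M u)%:E))); last first.
  move=> u /set_mem uB; apply/esym/cvg_lim => //; apply: cvg_near_cst.
  by apply: filterS (trunc_dens_cvg pa pa uB) => M E; rewrite /psi E.
have nd : forall u, B u -> {homo (fun M => (psi M u)%:E) : M N / (M <= N)%N >-> (M <= N)%E}.
  move=> u _ M N MN; rewrite lee_fin ler_wpM2r ?sqr_ge0//.
  rewrite /trunc_dens ler_wpM2l ?mu_density_ge0// !indicE ler_nat.
  by case: (boolP (u \in trunc_set a a M)) => // /set_mem /(ndA _ _ MN) uN; rewrite mem_set.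
have {}cm := cm nd; rewrite -(cvg_lim _ cm)//.
apply: lime_le; last by apply: nearW => M; exact: psiC.
exact: cvgP cm.
Qed.

(** M tends to infinity on both sides of the truncated identity: in the series [tw] is dominated by
    [wt], in the integral the cut-off density is dominated by the full one. *)
Lemma parseval a b (C1 C2 : R) : psum a -> psum b ->
  (forall n, \sum_(i < n) normc (a i) ^+ 2 * wt i <= C1) ->
  (forall n, \sum_(i < n) normc (b i) ^+ 2 * wt i <= C2) ->
  csummable (fun i => (a i)^*%C * b i * ((wt i)%:C)%C) /\
  cint ta B (fun u => ((dens u)%:C)%C * ((monseries a u)^*%C * monseries b u)) =
    csum (fun i => (a i)^*%C * b i * ((wt i)%:C)%C).
Proof.
move=> pa pb aC bC.
pose g i := normc (a i) ^+ 2 * wt i + normc (b i) ^+ 2 * wt i.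
have gC n : \sum_(i < n) g i <= C1 + C2 by rewrite /g big_split/=; apply: lerD;
  [exact: aC|exact: bC].
have xg (w : nat -> R[i]) : (forall i, normc (w i) <= wt i) -> forall i,
  normc ((a i)^*%C * b i * w i) <= g i.
  move=> ww i; rewrite !Normc.normcM normc_conj /g -mulrDl; apply: ler_pM;
    rewrite ?mulr_ge0 ?normc_ge0//.
  have := normc_ge0 (a i); have := normc_ge0 (b i); move: (normc _) (normc _) => x y; nra.
have sM M : csummable (fun i => (a i)^*%C * b i * tw a b M i).
  by apply: csummable_le gC; apply: xg => i; exact: normc_tw.
pose I M := cint ta B (fun u => ((trunc_dens a b M u)%:C)%C *
  ((monseries a u)^*%C * monseries b u)).
have IE M : I M = csum (fun i => (a i)^*%C * b i * tw a b M i).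
  exact: ccvg_unique (trunc_parseval M pa pb) (csum_partial (sM M)).
have [sx cx] := @csum_dominated R (fun M i => (a i)^*%C * b i * tw a b M i)
  (fun i => (a i)^*%C * b i * ((wt i)%:C)%C) g (C1 + C2)
  (fun i => ccvgM (@ccvg_cst _ ((a i)^*%C * b i)) (tw_cvg i pa pb))
  (fun M => xg _ (normc_tw a b M)) gC.
split=> //.
have := series_square_integrable pa aC; have := series_square_integrable pb bC.
move=> ib ia.
have [] := @cdominated _ _ _ ta B mB
  (fun M u => ((trunc_dens a b M u)%:C)%C * ((monseries a u)^*%C * monseries b u))
  (fun u => ((dens u)%:C)%C * ((monseries a u)^*%C * monseries b u))
  (fun u => dens u * normc (monseries a u) ^+ 2 + dens u * normc (monseries b u) ^+ 2).
- by move=> M; apply: cintegrable_meas; exact: cintegrable_trunc.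
- by move=> u uB; apply: ccvg_near; apply: filterS (trunc_dens_cvg pa pb uB) => M ->.
- by have := integrableD mB ia ib.
- move=> M u _; rewrite !Normc.normcM normc_conj normc_real ger0_norm ?trunc_dens_ge0//.
  rewrite -mulrDr; apply: ler_pM; rewrite ?trunc_dens_ge0 ?trunc_dens_le ?mulr_ge0 ?normc_ge0//.
  have := normc_ge0 (monseries a u); have := normc_ge0 (monseries b u).
  move: (normc _) (normc _) => x y; nra.
move=> _ cI; apply: ccvg_unique cI _; rewrite -/I.
by rewrite (funext IE).
Qed.
End Parseval.

(** * The generalized Bergman space *)

Section CoefficientRepresentation.
Variables (R : realType) (d : nat) (nu : nat -> d.-tuple nat).
Hypothesis nu_bij : bijective nu.
Local Notation Cd := 'rV[Cplx R]_d.
Local Notation fct := (Cd -> Cplx R).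
Local Notation B := (@cball R d).
Local Notation m_ := (fun i => msize (nu i)).
Implicit Types (f g : fct) (a b : nat -> R[i]).

Definition represents f a := psummable nu a /\
  forall z, unit_ball z -> f z = csum (fun i => a i * mon (nu i) (rtup z)).

Lemma ball_sum (z : Cd) : unit_ball z -> \sum_j normc (tnth (rtup z) j) ^+ 2 < 1.
Proof. by rewrite /unit_ball /= sqnorm_rtup. Qed.

Lemma represents_csummable f a z : represents f a -> unit_ball z ->
  csummable (fun i => a i * mon (nu i) (rtup z)).
Proof. by move=> [pa _] /ball_sum; exact: psummable_csummable. Qed.

Lemma holomorphic_represents f : holomorphic f -> exists a, represents f a.
Proof. by move=> /(holomorphic_expansion nu_bij)[a pa fa]; exists a. Qed.

Lemma represents_holomorphic f a : represents f a -> holomorphic f.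
Proof. by move=> [pa fa] z zB; have [_ /(_ z zB)[]] := psummable_derivative pa fa. Qed.

Lemma represents_euler f a : represents f a -> represents (eulerN f) (euler_coef nu a).
Proof.
move=> [pa fa]; have [pe H] := psummable_derivative pa fa.
by split=> // z zB; have [] := H z zB.
Qed.

Lemma psummableD c a b : psummable nu a -> psummable nu b -> psummable nu (fun i => c * a i + b i).
Proof.
move=> pa pb rho rb; have [A HA] := pa _ rb; have [A' HA'] := pb _ rb.
exists (normc c * A + A') => n.
apply: (@le_trans _ _ (normc c * (\sum_(i < n) normc (a i) * mon (nu i) rho) +
    \sum_(i < n) normc (b i) * mon (nu i) rho)).
  rewrite mulr_sumr -big_split/=; apply: ler_sum => i _; rewrite mulrA -mulrDl ler_wpM2r//.
    by apply: ltW; apply: mon_gt0; exact: rb.1.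
  by apply: le_trans (le_normcD _ _) _; rewrite Normc.normcM.
by apply: lerD; [rewrite ler_wpM2l ?normc_ge0|].
Qed.

Lemma represents_linear c f g a b : represents f a -> represents g b ->
  represents (c *: f + g) (fun i => c * a i + b i).
Proof.
move=> fa gb; split; first by apply: psummableD; [exact: fa.1|exact: gb.1].
move=> z zB; have sa := represents_csummable fa zB; have sb := represents_csummable gb zB.
have [s1 E1] := csumZ c sa; have [_ E2] := csumD s1 sb.
rewrite -[LHS]/(c * f z + g z) (fa.2 z zB) (gb.2 z zB) -E1 -E2.
by apply: eq_csum => i; rewrite mulrDl mulrA.
Qed.

Lemma eq_represents f a b : a =1 b -> represents f a -> represents f b.
Proof. by move=> /funext <-. Qed.

Lemma represents_shift (c : R) f a : represents f a ->
  represents (shiftN c f) (fun i => ((1 + (m_ i)%:R / c)%:C)%C * a i).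
Proof.
move=> fa; have := represents_linear ((c^-1)%:C)%C (represents_euler fa) fa.
rewrite addrC; apply: eq_represents => i; rewrite /euler_coef.
by rewrite rmorphD rmorph1 rmorphM rmorph_nat /=; ring.
Qed.

(** I + N / c multiplies a monomial of degree m by 1 + m / c; this is the eigenvalue of a product of
    such operators. *)
Definition shift_prod (c : nat -> R) n (m : nat) : R := \prod_(k < n) (1 + m%:R / c k).

Lemma represents_shifts (c : nat -> R) n f a : represents f a ->
  represents ((\big[(fun F G : fct -> fct => F \o G)/idfun]_(k < n) shiftN (c k)) f)
    (fun i => ((shift_prod c n (m_ i))%:C)%C * a i).
Proof.
move=> fa; elim: n c => [|n IH] c.
  rewrite big_ord0; apply: eq_represents fa => i.
  by rewrite /shift_prod big_ord0 rmorph1 mul1r.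
rewrite big_ord_recl /=.
have := represents_shift (c 0%N) (IH (fun k => c k.+1)).
apply: eq_represents => i; rewrite mulrA -rmorphM; congr (_ * _).
by rewrite /shift_prod big_ord_recl.
Qed.

Lemma represents_iter_euler f a k : represents f a ->
  represents (iter k (@eulerN R d) f) (fun i => (m_ i)%:R ^+ k * a i).
Proof.
move=> fa; elim: k => [|k IH]; first by apply: eq_represents fa => i; rewrite expr0 mul1r.
apply: eq_represents (represents_euler IH) => i.
by rewrite /euler_coef exprS mulrA.
Qed.

Lemma represents_cvec f a u : represents f a -> B u -> f (cvec u) = monseries nu a u.
Proof.
move=> [_ fa] uB; rewrite (fa _ uB); apply: eq_csum => i.
by rewrite /nmon cvec_zvec trowK.
Qed.

Lemma represents_eq f g a : represents f a -> represents g a ->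
  forall z, unit_ball z -> f z = g z.
Proof. by move=> [_ fa] [_ ga] z zB; rewrite fa// ga. Qed.

Section SquareIntegrable.
Variable sg : R.
Hypothesis dsg : d%:R < sg.
Local Notation w := (wt nu sg).
Local Notation dens := (@mu_density R d sg).

Lemma represents_HL2 f a C : represents f a ->
  (forall n, \sum_(i < n) normc (a i) ^+ 2 * w i <= C) -> HL2 sg f.
Proof.
move=> fa aC; have [m1 m2] := cmeas_pseries fa.1.
have E u : u \in B -> monseries nu a u = f (cvec u) by move=> /set_mem uB;
  rewrite (represents_cvec fa).
split; first exact: represents_holomorphic fa.
- by apply: eq_measurable_fun m1 => u uB; rewrite E.
- by apply: eq_measurable_fun m2 => u uB; rewrite E.
apply: eq_integrable (series_square_integrable nu_bij dsg fa.1 aC) => //.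
  exact: measurable_cball.
by move=> u uB; rewrite E.
Qed.

Lemma HL2_coef_bound f a : represents f a -> HL2 sg f ->
  exists C, forall n, \sum_(i < n) normc (a i) ^+ 2 * w i <= C.
Proof.
move=> fa [_ _ _ ifn].
have H : (@tau R d).-integrable B (fun u => (dens u * normc (monseries nu a u) ^+ 2)%:E).
  apply: eq_integrable ifn => //; first exact: measurable_cball.
  by move=> u /set_mem uB; rewrite (represents_cvec fa).
eexists; exact: (coef_bound nu_bij dsg fa.1 H).
Qed.

Lemma HL2_inner_represents f g a b C1 C2 : represents f a -> represents g b ->
  (forall n, \sum_(i < n) normc (a i) ^+ 2 * w i <= C1) ->
  (forall n, \sum_(i < n) normc (b i) ^+ 2 * w i <= C2) ->
  csummable (fun i => (a i)^*%C * b i * ((w i)%:C)%C) /\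
  HL2_inner sg f g = csum (fun i => (a i)^*%C * b i * ((w i)%:C)%C).
Proof.
move=> fa gb aC bC; have [s E] := parseval nu_bij dsg fa.1 gb.1 aC bC; split=> //.
rewrite -E; apply: eq_cint => u /set_mem uB.
by rewrite (represents_cvec fa)// (represents_cvec gb).
Qed.
End SquareIntegrable.
End CoefficientRepresentation.

(** * Eigenvalues of A and B on monomials *)

Section ShiftProducts.
Variables (R : realType) (lam : R) (n : nat).
Hypothesis lam0 : 0 < lam.
Implicit Types m : nat.

Definition shiftA m := shift_prod (fun k => lam + n%:R + k%:R) n m.
Definition shiftB m := shift_prod (fun k => lam + k%:R) n m.

Lemma shift_prod_ge1 (c : nat -> R) m : (forall k, 0 < c k) -> 1 <= shift_prod c n m.
Proof.
move=> c0; rewrite /shift_prod; elim/big_ind: _ => //.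
  by move=> x y x1 y1; rewrite -[1]mulr1 ler_pM.
by move=> k _; rewrite lerDl divr_ge0// ltW.
Qed.

Lemma shiftA_ge1 m : 1 <= shiftA m.
Proof. by apply: shift_prod_ge1 => k; rewrite -addrA ltr_wpDr// addr_ge0. Qed.

Lemma shiftB_ge1 m : 1 <= shiftB m.
Proof. by apply: shift_prod_ge1 => k; rewrite ltr_wpDr. Qed.

(** Together A and B run through lam, ..., lam + 2n - 1, so the product is (lam + m)_(2n) /
    (lam)_(2n). Splitting (lam)_(m + 2n) after m or after 2n factors rewrites it. *)
Lemma shiftAB m : shiftA m * shiftB m = poch (lam + (2 * n)%:R) m / poch lam m.
Proof.
have pochE (x : R) k : (forall j : 'I_k, x + j%:R != 0) ->
    shift_prod (fun j => x + j%:R) k m = poch (x + m%:R) k / poch x k.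
  move=> x0; rewrite /shift_prod /poch -prodf_div; apply: eq_bigr => j _.
  by field; exact: x0.
have x0 (x : R) j : 0 < x -> x + (j%:R : R) != 0 by move=> xp; rewrite gt_eqF// ltr_wpDr.
have ln : 0 < lam + n%:R by rewrite ltr_wpDr.
rewrite /shiftA /shiftB !pochE; [|by move=> j; exact: x0|by move=> j; exact: x0].
have p1 := poch_gt0 n ln; have p2 := poch_gt0 n lam0; have p3 := poch_gt0 m lam0.
have E1 : poch lam (n + n) = poch lam n * poch (lam + n%:R) n by rewrite pochD.
have E2 : poch (lam + m%:R) (n + n) = poch (lam + m%:R) n * poch (lam + n%:R + m%:R) n.
  by rewrite pochD addrAC.
have E3 : poch lam m * poch (lam + m%:R) (n + n) = poch lam (n + n) * poch (lam + (2 * n)%:R) m.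
  by rewrite -pochD addnC pochD mul2n addnn.
have E4 : poch lam m * (poch (lam + n%:R + m%:R) n * poch (lam + m%:R) n) =
    poch (lam + (2 * n)%:R) m * (poch (lam + n%:R) n * poch lam n).
  by rewrite [in LHS](mulrC (poch _ n)) -E2 E3 E1 mulrC; congr (_ * _); rewrite mulrC.
rewrite mulf_div; apply/eqP.
have nz1 : poch (lam + n%:R) n * poch lam n != 0 by rewrite gt_eqF// mulr_gt0.
have nz2 : poch lam m != 0 by rewrite gt_eqF.
by rewrite (eqr_div _ _ nz1 nz2) [X in X == _]mulrC E4.
Qed.

(** The right side is free of n: this is the independence of the inner product from the choice of n,
    read on coefficients. *)
Lemma weight_identity d (al : d.-tuple nat) :
  shiftA (msize al) * shiftB (msize al) * (kappa (lam + (2 * n)%:R) al)^-1 = (kappa lam al)^-1.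
Proof.
have p1 := poch_gt0 (msize al) lam0.
have p2 : 0 < poch (lam + (2 * n)%:R) (msize al) by apply: poch_gt0; rewrite ltr_wpDr.
rewrite shiftAB /kappa !invf_div; field.
by rewrite !gt_eqF.
Qed.

(** [cstA] and [cstB] are crude constants comparing the eigenvalues of A and B with powers of the
    degree; their values matter only through being finite and nonnegative. *)
Definition cstA : R := (1 + lam^-1) ^+ (2 * n).
Definition cstB : R := (lam + (2 * n)%:R + 1) ^+ (2 * n).

(** The conditions on f and N^n f control weights of order 1 + m^(2n); this makes them control the
    product of the eigenvalues of A and B. *)
Lemma shiftB_le m : shiftA m <= shiftB m /\ shiftB m ^+ 2 <= cstA * (1 + m%:R ^+ (2 * n)).
Proof.
split.
  apply: ler_prod => k _; rewrite addr_ge0 ?divr_ge0//= ?addr_ge0// ?(ltW lam0)//.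
  rewrite lerD2l ler_wpM2l// lef_pV2 ?posrE; last 2 first.
  - by rewrite -addrA ltr_wpDr// addr_ge0.
  - by rewrite ltr_wpDr.
  by rewrite lerD2r lerDl.
have H : shiftB m <= (1 + m%:R / lam) ^+ n.
  rewrite -[n in X in _ <= X]card_ord -prodr_const; apply: ler_prod => k _.
  rewrite addr_ge0 ?divr_ge0//= ?addr_ge0// ?(ltW lam0)//.
  rewrite lerD2l ler_wpM2l// lef_pV2 ?posrE ?lerDl// ltr_wpDr//.
have l1 : 0 <= lam^-1 by rewrite invr_ge0 ltW.
apply: (@le_trans _ _ ((1 + m%:R / lam) ^+ (2 * n))).
  rewrite mulnC exprM lerXn2r// nnegrE ?exprn_ge0//; first by have := shiftB_ge1 m; lra.
  by rewrite addr_ge0// mulr_ge0.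
(* For m >= 1 the base 1 + m / lam is at most (1 + 1 / lam) m; degree 0 is separate. *)
rewrite /cstA; case: m {H} => [|m].
  by rewrite mul0r addr0 expr1n mulr_ege1// ?exprn_ege1 ?lerDl// exprn_ge0.
apply: (@le_trans _ _ ((1 + lam^-1) ^+ (2 * n) * m.+1%:R ^+ (2 * n))); last first.
  by rewrite ler_wpM2l ?lerDr// exprn_ge0// addr_ge0.
rewrite -exprMn lerXn2r// ?nnegrE ?addr_ge0 ?mulr_ge0 ?addr_ge0//.
by rewrite mulrDl mul1r mulrC lerD2r ler1n.
Qed.

(** Each factor 1 + m / x with x <= c is at least (1 + m) / c, and c = lam + 2n + 1 lies above all
    the shifts. It gives the direction opposite to [shiftB_le]: a bound for the norm of lam puts N^k
    f in the space of lam + 2n. *)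
Lemma pow_le_shiftAB m k : (k <= n)%N -> (m%:R ^+ k) ^+ 2 <= cstB * (shiftA m * shiftB m).
Proof.
move=> kn; pose c := lam + (2 * n)%:R + 1.
have c1 : 1 <= c by rewrite /c lerDr addr_ge0// ltW.
have c0 : 0 < c by lra.
have Hs (x : R) : 0 < x -> x <= c -> (1 + m%:R) / c <= 1 + m%:R / x.
  move=> x0 xc; apply: (@le_trans _ _ (1 + m%:R / c)).
    by rewrite mulrDl mul1r lerD2r invf_le1.
  by rewrite lerD2l ler_wpM2l// lef_pV2 ?posrE.
have HP (s : nat -> R) : (forall j : 'I_n, 0 < s j <= c) -> ((1 + m%:R) / c) ^+ n <=
  shift_prod s n m.
  move=> sH; rewrite -[n in X in X <= _]card_ord -prodr_const; apply: ler_prod => j _.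
  have /andP[s0 sc] := sH j; rewrite Hs// andbT; apply: divr_ge0; [exact: addr_ge0|exact: ltW].
have HA : ((1 + m%:R) / c) ^+ n <= shiftA m.
  apply: HP => j; rewrite -!addrA ltr_wpDr ?addr_ge0//= /c -addrA lerD2l.
  have : (j%:R : R) <= n%:R by rewrite ler_nat ltnW.
  by rewrite natrM; lra.
have HB : ((1 + m%:R) / c) ^+ n <= shiftB m.
  apply: HP => j; rewrite ltr_wpDr//= /c -addrA lerD2l.
  have : (j%:R : R) <= n%:R by rewrite ler_nat ltnW.
  by rewrite natrM; have : 0 <= n%:R :> R by []; lra.
have q0 : 0 <= (1 + m%:R) / c by rewrite divr_ge0 ?addr_ge0// ltW.
have := ler_pM (exprn_ge0 n q0) (exprn_ge0 n q0) HA HB.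
rewrite -exprD addnn -mul2n expr_div_n ler_pdivrMr ?exprn_gt0// mulrC => /(le_trans _); apply.
rewrite -exprM; apply: (@le_trans _ _ ((1 + m%:R) ^+ (k * 2))).
  by rewrite lerXn2r ?nnegrE ?addr_ge0// lerDr.
by rewrite ler_weXn2l ?lerDl// mulnC leq_mul2l.
Qed.
End ShiftProducts.

(** * Finite Cauchy-Schwarz inequalities *)

Section WeightedCauchySchwarz.
Variable R : realType.

(** Lagrange's identity: twice the defect is the sum of the squares of x_i y_j - x_j y_i. *)
Lemma cauchy_schwarz_sum I (s : seq I) (x y : I -> R) :
  (\sum_(i <- s) x i * y i) ^+ 2 <= (\sum_(i <- s) x i ^+ 2) * (\sum_(i <- s) y i ^+ 2).
Proof.
pose X := \sum_(i <- s) x i ^+ 2; pose Y := \sum_(i <- s) y i ^+ 2.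
pose P := \sum_(i <- s) x i * y i.
have H : 0 <= \sum_(i <- s) \sum_(j <- s) (x i * y j - x j * y i) ^+ 2.
  by apply: sumr_ge0 => i _; apply: sumr_ge0 => j _; exact: sqr_ge0.
have E : \sum_(i <- s) \sum_(j <- s) (x i * y j - x j * y i) ^+ 2 = 2 * (X * Y - P ^+ 2).
  transitivity (\sum_(i <- s) (x i ^+ 2 * Y + y i ^+ 2 * X - 2 * (x i * y i) * P)).
    apply: eq_bigr => i _; rewrite /X /Y /P !mulr_sumr -big_split/= -sumrB.
    by apply: eq_bigr => j _; ring.
  by rewrite sumrB big_split/= -!mulr_suml -mulr_sumr -/X -/Y -/P; ring.
by move: H; rewrite E pmulr_rge0// subr_ge0.
Qed.

Lemma weighted_cauchy_schwarz I (s : seq I) (k : I -> R) (x y : I -> R[i]) :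
  (forall i, 0 < k i) ->
  normc (\sum_(i <- s) x i * y i) ^+ 2 <=
  (\sum_(i <- s) normc (x i) ^+ 2 / k i) * (\sum_(i <- s) k i * normc (y i) ^+ 2).
Proof.
move=> k0.
have q0 i : Num.sqrt (k i) != 0 by rewrite gt_eqF// sqrtr_gt0.
apply: (@le_trans _ _ ((\sum_(i <- s) (normc (x i) / Num.sqrt (k i)) *
  (Num.sqrt (k i) * normc (y i))) ^+ 2)).
  rewrite lerXn2r ?nnegrE ?normc_ge0//.
    by apply: sumr_ge0 => i _; rewrite mulr_ge0// ?divr_ge0 ?mulr_ge0 ?normc_ge0 ?sqrtr_ge0.
  apply: le_trans (normc_sum _ _ _) _; apply: ler_sum => i _.
  by rewrite Normc.normcM mulrA divfK.
apply: le_trans (cauchy_schwarz_sum _ _ _) _.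
rewrite le_eqVlt; apply/orP; left; apply/eqP; congr (_ * _); apply: eq_bigr => i _.
  by rewrite expr_div_n sqr_sqrtr// ltW.
by rewrite exprMn sqr_sqrtr// ltW.
Qed.
End WeightedCauchySchwarz.

Lemma mon_sqr (F : comNzRingType) d (al : d.-tuple nat) (s : d.-tuple F) :
  mon al s ^+ 2 = mon al [tuple tnth s j ^+ 2 | j < d].
Proof.
by rewrite -prodrXl; apply: eq_bigr => j _; rewrite tnth_mktuple -!exprM mulnC.
Qed.

(** * The space as a weighted space of coefficient sequences *)

Section BergmanSpace.
Variables (R : realType) (d : nat) (lam : R) (n : nat) (nu : nat -> d.-tuple nat).
Hypothesis nu_bij : bijective nu.
Hypothesis lam0 : 0 < lam.
Local Notation sg := (lam + (2 * n)%:R).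
Hypothesis dsg : d%:R < sg.
Local Notation H := (bergman d lam n).
Local Notation B := (@cball R d).
Local Notation Cd := 'rV[Cplx R]_d.
Local Notation fct := (Cd -> Cplx R).
Local Notation kap := (fun i => kappa lam (nu i)).
Local Notation mi := (fun i => msize (nu i)).
Local Notation w := (wt nu sg).
Local Notation cA := (shiftA lam n).
Local Notation cB := (shiftB lam n).
Implicit Types (f g h : H) (a b : nat -> R[i]) (C : R) (z : Cd).

(** Finiteness of the norm of H(B^d, lam) on coefficients, as a bound on all partial sums:
    [bergman_l2] and [bergman_make] show that it characterizes the space. *)
Definition l2bound a C := forall N, \sum_(i < N) normc (a i) ^+ 2 / kap i <= C.

Let kap0 i : 0 < kap i. Proof. exact: kappa_gt0. Qed.

Lemma bergman_vanish f z : ~ unit_ball z -> f z = 0.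
Proof. by case: f => f /= /asboolP[f0 _]; exact: f0. Qed.

Lemma bergman_HL2 f k : (k <= n)%N -> HL2 sg (iter k (@eulerN R d) f).
Proof. by case: f => f /= /asboolP[_]; apply. Qed.

Lemma bergman_ext f g : (forall z, unit_ball z -> f z = g z) -> f = g.
Proof.
move=> fg; apply: val_inj; apply/funext => z /=.
by have [/fg//|zB] := pselect (unit_ball z); rewrite !bergman_vanish.
Qed.

Lemma bergman_cmeas f : cmeas B (fun u => f (cvec u)).
Proof. by have [] := bergman_HL2 f (leq0n n). Qed.

Lemma bergman_represents f : exists a, represents nu f a.
Proof. by apply: (holomorphic_represents nu_bij); have [] := bergman_HL2 f (leq0n n). Qed.

Lemma wtE i : cA (mi i) * cB (mi i) * w i = (kap i)^-1.
Proof. exact: weight_identity. Qed.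

(** The conditions for k = 0 and k = n add up to the weight 1 + m^(2n), which dominates the product
    of the eigenvalues of A and B. *)
Lemma bergman_l2 f a : represents nu f a -> exists C, l2bound a C.
Proof.
move=> fa; have [C0 H0] := HL2_coef_bound nu_bij dsg fa (bergman_HL2 f (leq0n n)).
have [C1 H1] := HL2_coef_bound nu_bij dsg (represents_iter_euler n fa) (bergman_HL2 f (leqnn n)).
exists (cstA lam n * (C0 + C1)) => N.
apply: (@le_trans _ _ (cstA lam n * (\sum_(i < N) normc (a i) ^+ 2 * w i +
    \sum_(i < N) normc ((mi i)%:R ^+ n * a i) ^+ 2 * w i))); last first.
  by rewrite ler_wpM2l ?lerD// exprn_ge0// addr_ge0// invr_ge0 ltW.
rewrite -big_split mulr_sumr/=; apply: ler_sum => i _.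
rewrite Normc.normcM normcX normc_nat exprMn -exprM [(n * 2)%N]mulnC.
have [AB BB] := shiftB_le n lam0 (mi i).
have A1 := shiftA_ge1 n lam0 (mi i).
have w0 : 0 <= w i by exact: wt_ge0.
rewrite -wtE.
have : cA (mi i) * cB (mi i) <= cstA lam n * (1 + (mi i)%:R ^+ (2 * n)).
  apply: le_trans BB; rewrite expr2 ler_wpM2r//; lra.
have q0 := mulr_ge0 (sqr_ge0 (normc (a i))) w0.
by move=> /(ler_wpM2l q0); congr (_ <= _); ring.
Qed.

Lemma l2bound_iter_euler a C k : (k <= n)%N -> l2bound a C ->
  forall N, \sum_(i < N) normc ((mi i)%:R ^+ k * a i) ^+ 2 * w i <= cstB lam n * C.
Proof.
move=> kn aC N; apply: (@le_trans _ _ (cstB lam n * \sum_(i < N) normc (a i) ^+ 2 / kap i)).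
  rewrite mulr_sumr; apply: ler_sum => i _; rewrite Normc.normcM normcX normc_nat exprMn -wtE.
  have q0 := mulr_ge0 (sqr_ge0 (normc (a i))) (wt_ge0 nu dsg i).
  by have := ler_wpM2l q0 (pow_le_shiftAB lam0 (mi i) kn); congr (_ <= _); ring.
by rewrite ler_wpM2l// exprn_ge0// !addr_ge0// ltW.
Qed.

Lemma kappa_mon_le z N : unit_ball z ->
  \sum_(i < N) kap i * normc (mon (nu i) (rtup z)) ^+ 2 <= (1 - sqnorm z) `^ (- lam).
Proof.
move=> zB; have E : sqnorm z = \sum_j tnth [tuple tnth (nmod (rtup z)) j ^+ 2 | j < d] j.
  by rewrite sqnorm_rtup; apply: eq_bigr => j _; rewrite !tnth_mktuple.
rewrite E; under eq_bigr do rewrite normc_mon mon_sqr.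
apply: sum_kappa_le => //; first exact: bij_inj.
  by move=> j; rewrite !tnth_mktuple sqr_ge0.
by rewrite -E.
Qed.

(** From t m <= t^2 / k + k m^2 with k = kappa_i: the first terms sum to at most C, the second ones
    to at most the kernel at rho. *)
Lemma l2bound_psummable a C : l2bound a C -> psummable nu a.
Proof.
move=> aC rho [rho0 rho1]; pose x := [tuple tnth rho j ^+ 2 | j < d].
have xE : \sum_j tnth x j = \sum_j tnth rho j ^+ 2 by apply: eq_bigr => j _; rewrite tnth_mktuple.
exists (C + (1 - \sum_j tnth x j) `^ (- lam)) => N.
apply: (@le_trans _ _ (\sum_(i < N) normc (a i) ^+ 2 / kap i + \sum_(i < N) kap i * mon (nu i) x)).
  rewrite -big_split; apply: ler_sum => i _ /=.
  rewrite -mon_sqr; set m := mon _ rho; have m0 : 0 < m by exact: mon_gt0.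
  have k0 := kap0 i; set k := kap i in k0 *; set t := normc (a i).
  have t0 : 0 <= t by exact: normc_ge0.
  have -> : t * m = (t / k) * (k * m) by field; rewrite gt_eqF.
  have -> : t ^+ 2 / k = (t / k) ^+ 2 * k by field; rewrite gt_eqF.
  set u := t / k; have u0 : 0 <= u by rewrite divr_ge0// ltW.
  have := sqr_ge0 (u - m); have := mulr_ge0 u0 (ltW m0) => um sq.
  have -> : u * (k * m) = k * (u * m) by ring.
  have -> : u ^+ 2 * k + k * m ^+ 2 = k * (u ^+ 2 + m ^+ 2) by ring.
  by rewrite ler_wpM2l ?(ltW k0)//; nra.
apply: lerD; first exact: aC.
apply: sum_kappa_le => //; first exact: bij_inj.
  by move=> j; rewrite tnth_mktuple sqr_ge0.
by rewrite xE.
Qed.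

(** Elements are produced from coefficients alone, which stands in for completeness. The function is
    set to 0 off the ball, as the carrier demands. *)
Lemma bergman_make a C : l2bound a C -> exists f : H, represents nu f a.
Proof.
move=> aC; have pa := l2bound_psummable aC.
pose F : fct := fun z => if `[< unit_ball z >] then csum (fun i => a i * mon (nu i) (rtup z)) else
  0.
have Fa : represents nu F a by split=> // z zB; rewrite /F asboolT.
have HF : F \in bergman_pred lam n.
  apply/asboolP; split=> [z zB|k kn]; first by rewrite /F asboolF.
  apply: (represents_HL2 nu_bij dsg (represents_iter_euler k Fa)).
  exact: (l2bound_iter_euler kn aC).
by exists (Bergman HF).
Qed.

(** Parseval needs Af and Bg separately in the space of lam + 2n. With alpha and beta the
    eigenvalues of A and B, this follows from alpha^2 <= alpha beta and beta^2 <= const alpha beta;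
    the product alpha beta then turns the weights into those of lam. *)
Lemma bergman_ip_csum f g a b : represents nu f a -> represents nu g b ->
  csummable (fun i => (a i)^*%C * b i * (((kap i)^-1)%:C)%C) /\
  bergman_ip f g = csum (fun i => (a i)^*%C * b i * (((kap i)^-1)%:C)%C).
Proof.
move=> fa gb; have [C1 aC] := bergman_l2 fa; have [C2 bC] := bergman_l2 gb.
have HA := represents_shifts (fun k => lam + n%:R + k%:R) n fa.
have HB := represents_shifts (fun k => lam + k%:R) n gb.
have K0 : 0 <= cstA lam n * (1 + cstB lam n).
  have l1 : 0 <= lam^-1 by rewrite invr_ge0 ltW.
  by rewrite mulr_ge0 ?addr_ge0 ?exprn_ge0 ?addr_ge0// ltW.
have wa N : \sum_(i < N) normc (((cA (mi i))%:C)%C * a i) ^+ 2 * w i <= C1.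
  apply: le_trans (aC N); apply: ler_sum => i _.
  have A1 := shiftA_ge1 n lam0 (mi i); have [AB _] := shiftB_le n lam0 (mi i).
  have w0 : 0 <= w i by exact: wt_ge0.
  rewrite Normc.normcM normc_real ger0_norm; last lra.
  rewrite -wtE exprMn.
  have q0 := mulr_ge0 (sqr_ge0 (normc (a i))) w0.
  have : cA (mi i) ^+ 2 <= cA (mi i) * cB (mi i) by rewrite expr2 ler_wpM2l//; lra.
  by move=> /(ler_wpM2l q0); congr (_ <= _); ring.
have wb N : \sum_(i < N) normc (((cB (mi i))%:C)%C * b i) ^+ 2 * w i <=
    cstA lam n * (1 + cstB lam n) * C2.
  apply: le_trans (ler_wpM2l K0 (bC N)); rewrite mulr_sumr; apply: ler_sum => i _.
  have A1 := shiftA_ge1 n lam0 (mi i); have B1 := shiftB_ge1 n lam0 (mi i).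
  have [AB BB] := shiftB_le n lam0 (mi i).
  have w0 : 0 <= w i by exact: wt_ge0.
  rewrite Normc.normcM normc_real ger0_norm; last lra.
  rewrite -wtE exprMn.
  have q0 := mulr_ge0 (sqr_ge0 (normc (b i))) w0.
  have : cB (mi i) ^+ 2 <= cstA lam n * (1 + cstB lam n) * (cA (mi i) * cB (mi i)).
    apply: le_trans BB _; rewrite -mulrA ler_wpM2l//.
      by rewrite exprn_ge0// addr_ge0// invr_ge0 ltW.
    have P1 := pow_le_shiftAB lam0 (mi i) (leqnn n); rewrite mulrDl mul1r lerD//.
      by rewrite -[1]mulr1 ler_pM.
    by rewrite mulnC exprM.
  by move=> /(ler_wpM2l q0); congr (_ <= _); ring.
have [s E] := HL2_inner_represents nu_bij dsg HA HB wa wb.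
have Ei i : (((cA (mi i))%:C)%C * a i)^*%C * (((cB (mi i))%:C)%C * b i) * ((w i)%:C)%C =
    (a i)^*%C * b i * (((kap i)^-1)%:C)%C.
  by rewrite -wtE; case: (a i) (b i) => [p q] [p' q'] /=; apply: complexP => /=; ring.
split; last by rewrite -(eq_csum Ei) -E.
by move: s; under eq_fun do rewrite Ei.
Qed.
Local Notation ip := (@bergman_ip R d lam n).
Local Notation nrm := (ip_norm ip).

Lemma bergman_norm f a : represents nu f a ->
  ip f f = ((nrm f ^+ 2)%:C)%C /\
  (\sum_(i < N) normc (a i) ^+ 2 / kap i @[N --> \oo] --> nrm f ^+ 2).
Proof.
move=> fa; have [s E] := bergman_ip_csum fa fa.
have := csum_partial s; rewrite -E.
have Ei N : \sum_(i < N) (a i)^*%C * a i * (((kap i)^-1)%:C)%C =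
    ((\sum_(i < N) normc (a i) ^+ 2 / kap i)%:C)%C.
  by rewrite rmorph_sum; apply: eq_bigr => i _ /=; rewrite cnormsq -rmorphM.
under eq_fun do rewrite Ei.
move=> [cr ci]; have I0 : cIm (ip f f) = 0.
  by apply/esym; apply: (cvg_unique _ _ ci) => //; exact: cvg_cst.
have p0 : 0 <= cRe (ip f f).
  rewrite -(cvg_lim _ cr)//; apply: limr_ge; first exact: cvgP cr.
  by apply: nearW => N; apply: sumr_ge0 => i _; rewrite divr_ge0 ?sqr_ge0// ltW.
have nE : nrm f ^+ 2 = cRe (ip f f) by rewrite sqr_sqrtr.
by rewrite nE; split=> //; apply: complexP.
Qed.

Lemma bergman_norm_bound f a : represents nu f a -> l2bound a (nrm f ^+ 2).
Proof.
move=> fa N; have [_ cv] := bergman_norm fa.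
have nd : nondecreasing_seq (fun N => \sum_(i < N) normc (a i) ^+ 2 / kap i).
  by apply/nondecreasing_seqP => m; rewrite big_ord_recr/= lerDl divr_ge0 ?sqr_ge0// ltW.
by have := nondecreasing_cvgn_le nd (cvgP _ cv) N; rewrite (cvg_lim _ cv).
Qed.

Lemma bergman_norm_le f a C : represents nu f a -> l2bound a C -> nrm f ^+ 2 <= C.
Proof.
move=> fa aC; have [_ cv] := bergman_norm fa.
rewrite -(cvg_lim _ cv)//; apply: limr_le; first exact: cvgP cv.
exact: nearW.
Qed.

Lemma bergman_ip_linear f g h (c : Cplx R) : ip f (c *: g + h) = c * ip f g + ip f h.
Proof.
have [a fa] := bergman_represents f; have [b gb] := bergman_represents g.
have [b' hb] := bergman_represents h.
have [s1 ->] := bergman_ip_csum fa gb; have [s2 ->] := bergman_ip_csum fa hb.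
have [_ ->] := bergman_ip_csum fa (represents_linear c gb hb : represents nu (c *: g + h : H) _).
have [s3 <-] := csumZ c s1; have [_ <-] := csumD s3 s2.
by apply: eq_csum => i; ring.
Qed.

Lemma bergman_ip_conj f g : ip g f = (ip f g)^*%C.
Proof.
have [a fa] := bergman_represents f; have [b gb] := bergman_represents g.
have [s1 ->] := bergman_ip_csum fa gb; have [s2 ->] := bergman_ip_csum gb fa.
apply: (ccvg_unique (csum_partial s2)); have := ccvgJ (csum_partial s1).
congr ccvg; apply/funext => N; rewrite rmorph_sum; apply: eq_bigr => i _ /=.
by case: (a i) (b i) => [p q] [p' q'] /=; apply: complexP => /=; ring.
Qed.

Lemma bergman_ip_sum f I (s : seq I) (c : I -> Cplx R) (g : I -> H) :
  ip f (\sum_(j <- s) c j *: g j) = \sum_(j <- s) c j * ip f (g j).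
Proof.
elim: s => [|j s IH]; last by rewrite !big_cons bergman_ip_linear IH.
(* Linearity at -1 * 0 + 0 gives that the pairing with 0 vanishes. *)
rewrite !big_nil; have := bergman_ip_linear f 0 0 (-1).
by rewrite addr0 scaleN1r oppr0 mulN1r addNr.
Qed.

Lemma orthonormal_norm (e : nat -> H) J (c : nat -> Cplx R) :
  (forall i j, ip (e i) (e j) = (i == j)%:R) ->
  nrm (\sum_(j < J) c j *: e j) ^+ 2 = \sum_(j < J) normc (c j) ^+ 2.
Proof.
move=> on; set h := \sum_(j < J) _.
have he (j : 'I_J) : ip h (e j) = (c j)^*%C.
  rewrite bergman_ip_conj bergman_ip_sum (bigD1 j)//= on eqxx mulr1 big1 ?addr0// => k kj.
  by rewrite on eq_sym -val_eqE/= in kj *; rewrite (negbTE kj) mulr0.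
have [a ha] := bergman_represents h; have [E _] := bergman_norm ha.
have : ip h h = ((\sum_(j < J) normc (c j) ^+ 2)%:C)%C.
  rewrite {2}/h bergman_ip_sum rmorph_sum; apply: eq_bigr => j _ /=.
  by rewrite he mulrC cnormsq.
by rewrite E => -[].
Qed.

(** The bound is uniform in N, so the Taylor polynomials of an element form a dominated family in
    [operator_form]. *)
Lemma l2bound_partial a C z N : l2bound a C -> unit_ball z ->
  normc (\sum_(i < N) a i * mon (nu i) (rtup z)) ^+ 2 <= C * (1 - sqnorm z) `^ (- lam).
Proof.
move=> aC zB; apply: le_trans (weighted_cauchy_schwarz _ (fun i : 'I_N => a i)
  (fun i : 'I_N => mon (nu i) (rtup z)) (fun i : 'I_N => kap0 i)) _.
apply: ler_pM; [| |exact: aC|exact: kappa_mon_le].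
  by apply: sumr_ge0 => i _; rewrite divr_ge0 ?sqr_ge0// ltW.
by apply: sumr_ge0 => i _; rewrite mulr_ge0 ?sqr_ge0// ltW.
Qed.

Lemma bergman_point f z : unit_ball z ->
  normc (f z) ^+ 2 <= nrm f ^+ 2 * (1 - sqnorm z) `^ (- lam).
Proof.
move=> zB; have [a fa] := bergman_represents f.
have K0 : 0 <= nrm f ^+ 2 * (1 - sqnorm z) `^ (- lam) by rewrite mulr_ge0 ?sqr_ge0// powR_ge0.
suff H1 : normc (f z) <= Num.sqrt (nrm f ^+ 2 * (1 - sqnorm z) `^ (- lam)).
  by rewrite -[leRHS]sqr_sqrtr// lerXn2r ?nnegrE ?normc_ge0 ?sqrtr_ge0.
rewrite (fa.2 z zB); apply: csum_norm_le; first exact: (represents_csummable fa zB).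
move=> N; rewrite -[leLHS]ger0_norm ?normc_ge0// -sqrtr_sqr ler_sqrt//.
by apply: l2bound_partial => //; exact: bergman_norm_bound.
Qed.

Lemma bergman_sum_fun I (s : seq I) (c : I -> Cplx R) (g : I -> H) z :
  (\sum_(j <- s) c j *: g j) z = \sum_(j <- s) c j * g j z.
Proof.
elim: s => [|j s IH]; first by rewrite !big_nil.
by rewrite !big_cons -IH.
Qed.

(* The extremal function sum_j conj(e_j(z)) e_j attains the sum at z. *)
Lemma orthonormal_point (e : nat -> H) J z :
  (forall i j, ip (e i) (e j) = (i == j)%:R) -> unit_ball z ->
  \sum_(j < J) normc (e j z) ^+ 2 <= (1 - sqnorm z) `^ (- lam).
Proof.
move=> on zB; set s := \sum_(j < J) _.
have s0 : 0 <= s by apply: sumr_ge0 => j _; exact: sqr_ge0.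
have := bergman_point (\sum_(j < J) (e j z)^*%C *: e j) zB.
rewrite (orthonormal_norm J (fun j => (e j z)^*%C) on) bergman_sum_fun.
rewrite (_ : \sum_(j < J) (e j z)^*%C * e j z = (s%:C)%C); last first.
  by rewrite rmorph_sum; apply: eq_bigr => j _ /=; rewrite cnormsq.
rewrite normc_real ger0_norm//.
under eq_bigr do rewrite normc_conj.
rewrite -/s; case: (ltrgt0P s) s0 => // [s0 _|-> _ _]; last exact: powR_ge0.
by rewrite expr2 ler_pM2l.
Qed.

(** Coefficients of the normalized monomial: z^al has squared norm 1 / kappa. *)
Definition delta i (k : nat) : R[i] := if k == i then ((Num.sqrt (kap i))%:C)%C else 0.

Lemma csum_delta i b : csum (fun k => (delta i k)^*%C * b k) = ((Num.sqrt (kap i))%:C)%C * b i /\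
  csum (fun k => delta i k * b k) = ((Num.sqrt (kap i))%:C)%C * b i.
Proof.
have [_ E] := csum_single (fun k => ((Num.sqrt (kap i))%:C)%C * b k) i.
rewrite -E; split; apply: eq_csum => k; rewrite /delta; case: eqP => _.
- by congr (_ * _); apply: complexP => //=; rewrite oppr0.
- by rewrite rmorph0 mul0r.
- by [].
- by rewrite mul0r.
Qed.

Lemma monomial_system : exists e : nat -> H, forall i, represents nu (e i) (delta i).
Proof.
have D i : l2bound (delta i) 1.
  move=> N; have E k : normc (delta i k) ^+ 2 / kap k = if k == i then 1 else 0.
    rewrite /delta; case: eqP => [->|_]; last by rewrite Normc.normc0 expr0n mul0r.
    by rewrite normc_real real_normK ?num_real// sqr_sqrtr ?divff ?gt_eqF// ltW.
  under eq_bigr do rewrite E.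
  rewrite -big_mkcond/=; have [iN|Ni] := ltnP i N; first by rewrite (big_pred1 (Ordinal iN)).
  rewrite big1// => k /eqP ki; have := ltn_ord k.
  by rewrite ki ltnNge Ni.
have [e He] := choice (fun i => bergman_make (D i)).
by exists e.
Qed.

Section Monomials.
Variable e : nat -> H.
Hypothesis eE : forall i, represents nu (e i) (delta i).

Lemma monomial_value i z : unit_ball z -> e i z = ((Num.sqrt (kap i))%:C)%C * mon (nu i) (rtup z).
Proof. by move=> zB; rewrite (eE i).2// (csum_delta i _).2. Qed.

Lemma monomial_ip i f a : represents nu f a -> ip (e i) f = ((Num.sqrt (kap i))^-1%:C)%C * a i.
Proof.
move=> fa; have [_ ->] := bergman_ip_csum (eE i) fa.
under [X in csum X]eq_fun do rewrite -mulrA.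
rewrite (csum_delta i _).1 mulrCA mulrC -rmorphM; congr ((_%:C)%C * _).
have s0 : Num.sqrt (kap i) != 0 by rewrite gt_eqF// sqrtr_gt0.
by rewrite -[X in _ / X]sqr_sqrtr ?(ltW (kap0 i))//; field.
Qed.

Lemma monomial_orthonormal i j : ip (e i) (e j) = (i == j)%:R.
Proof.
rewrite (monomial_ip i (eE j)) /delta; case: eqP => [->|_]; last by rewrite mulr0.
by rewrite -rmorphM mulVf ?rmorph1// gt_eqF// sqrtr_gt0.
Qed.

Lemma represents_sum N (c : nat -> Cplx R) :
  represents nu (\sum_(i < N) c i *: e i : H) (fun k => \sum_(i < N) c i * delta i k).
Proof.
elim: N => [|N IH].
  rewrite big_ord0; have := represents_linear (-1) (eE 0) (eE 0).
  rewrite (_ : -1 *: (e 0%N : fct) + e 0%N = (0 : H)); last by rewrite scaleN1r addNr.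
  by apply: eq_represents => k; rewrite big_ord0 mulN1r addNr.
rewrite big_ord_recr/= addrC; have := represents_linear (c N) (eE N) IH.
by apply: eq_represents => k; rewrite big_ord_recr/= addrC.
Qed.

Lemma sum_delta N (c : nat -> Cplx R) k :
  \sum_(i < N) c i * delta i k = if (k < N)%N then c k * ((Num.sqrt (kap k))%:C)%C else 0.
Proof.
case: ltnP => kN.
  rewrite (bigD1 (Ordinal kN))//= /delta eqxx big1 ?addr0// => i ik.
  by case: eqP => [ki|_]; [rewrite -val_eqE/= ki eqxx in ik|rewrite mulr0].
rewrite big1// => i _; rewrite /delta; case: eqP => [ki|_]; last by rewrite mulr0.
by have := ltn_ord i; rewrite -ki ltnNge kN.
Qed.

Lemma monomial_dense f eps : 0 < eps -> exists N (c : nat -> Cplx R),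
  nrm (f - \sum_(i < N) c i *: e i) < eps.
Proof.
move=> eps0; have [a fa] := bergman_represents f.
(* Half of eps, because the tail estimate is not strict while density asks for a strict
   inequality. *)
have t0 : 0 < (eps / 2) ^+ 2 by rewrite exprn_gt0// divr_gt0.
have p0 i : 0 <= normc (a i) ^+ 2 / kap i by rewrite divr_ge0 ?sqr_ge0// ltW.
have [N HN] := @small_tail _ (fun i => normc (a i) ^+ 2 / kap i) _ _ t0 p0 (bergman_norm_bound fa).
pose c i := a i * ((Num.sqrt (kap i))^-1%:C)%C; exists N, c.
set S := \sum_(i < N) c i *: e i.
have E : -1 *: bergman_fun S + bergman_fun f = bergman_fun (f - S) by rewrite scaleN1r addrC.
have := represents_linear (-1) (represents_sum N c) fa; rewrite -/S E.
move=> /(@bergman_norm_le _ _ ((eps / 2) ^+ 2)) H1.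
have {}H1 : nrm (f - S) ^+ 2 <= (eps / 2) ^+ 2.
  apply: H1 => M; apply: le_trans (HN M); apply: ler_sum => k _.
  rewrite sum_delta; case: ltnP => kN; last by rewrite mulr0 add0r.
  have s0 : Num.sqrt (kap k) != 0 by rewrite gt_eqF// sqrtr_gt0.
  have -> : c k * ((Num.sqrt (kap k))%:C)%C =
    a k by rewrite /c -mulrA -rmorphM mulVf// rmorph1 mulr1.
  by rewrite mulN1r addNr Normc.normc0 expr0n mul0r.
have : nrm (f - S) <= eps / 2.
  by move: H1; rewrite ler_pXn2r// nnegrE ?sqrtr_ge0// divr_ge0// ltW.
by move=> /le_lt_trans; apply; rewrite ltr_pdivrMr// ltr_pMr// ltr1n.
Qed.

Lemma monomial_basis : orthonormal_basis ip e.
Proof. by split; [exact: monomial_orthonormal|exact: monomial_dense]. Qed.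

Lemma mon_normc_le1 i z : unit_ball z -> normc (mon (nu i) (rtup z)) <= 1.
Proof.
move=> zB; rewrite normc_prod; apply: prodr_ile1 => j _.
rewrite normcX exprn_ge0 ?normc_ge0//= exprn_ile1 ?normc_ge0//.
have : normc (tnth (rtup z) j) ^+ 2 <= 1.
  apply: le_trans (ltW (ball_sum zB)); rewrite (bigD1 j)//= lerDl.
  by apply: sumr_ge0 => k _; exact: sqr_ge0.
by rewrite -{1}(expr1n _ 2) ler_pXn2r// nnegrE ?normc_ge0.
Qed.

Lemma monomial_bounded i : bounded_on_ball (e i).
Proof.
exists (Num.sqrt (kap i)) => z zB; rewrite monomial_value// Normc.normcM normc_real ger0_norm
  ?sqrtr_ge0//.
by rewrite ler_piMr ?sqrtr_ge0// mon_normc_le1.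
Qed.

Lemma monomial_sum_bounded N (c : nat -> Cplx R) : bounded_on_ball (\sum_(i < N) c i *: e i : H).
Proof.
exists (\sum_(i < N) normc (c i) * Num.sqrt (kap i)) => z zB.
rewrite bergman_sum_fun; apply: le_trans (normc_sum _ _ _) _; apply: ler_sum => i _.
rewrite monomial_value// !Normc.normcM normc_real ger0_norm ?sqrtr_ge0//.
by rewrite ler_wpM2l ?normc_ge0// ler_piMr ?sqrtr_ge0// mon_normc_le1.
Qed.

End Monomials.
End BergmanSpace.

(** * Toeplitz operators *)

Section ToeplitzForm.
Variables (R : realType) (d : nat) (lam : R) (phi : 'rV[Cplx R]_d -> Cplx R).
Hypothesis hphi : in_L1_tau phi.
Local Notation Cd := 'rV[Cplx R]_d.
Local Notation fct := (Cd -> Cplx R).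
Local Notation B := (@cball R d).
Local Notation ta := (@tau R d).
Local Notation Q := (toeplitz_form lam phi).
Local Notation cl := (clam d lam).
Implicit Types (f g h : fct) (C : R).

Let mB : measurable B := @measurable_cball R d.

Definition L1n : R := \int[ta]_(u in B) normc (phi (cvec u)).
Definition fmeas f := cmeas B (fun u => f (cvec u)).

(* The product of two factors this controls is integrable against
   phi (1 - |z|^2)^lam dtau. *)
Definition growth f C := forall z, unit_ball z -> normc (f z) ^+ 2 <= C * (1 - sqnorm z) `^ (- lam).

Definition toeplitz_kernel (F : fct) (u : coords R d) : R[i] :=
  F (cvec u) * phi (cvec u) * (((1 - sqnorm (cvec u)) `^ lam)%:C)%C.

Lemma integrable_phi : ta.-integrable B (fun u => (normc (phi (cvec u)))%:E).
Proof. by apply: (integrable_normc mB (h := fun u => phi (cvec u))); exact: hphi. Qed.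

Lemma L1n_ge0 : 0 <= L1n.
Proof. by apply: Rintegral_ge0 => u _; exact: normc_ge0. Qed.

Lemma L1_normE : L1_norm_tau phi = L1n%:E.
Proof.
rewrite /L1_norm_tau /L1n /Rintegral fineK//.
exact: integrable_fin_num integrable_phi.
Qed.

Lemma powR_cancel (z : Cd) : unit_ball z -> (1 - sqnorm z) `^ lam * (1 - sqnorm z) `^ (- lam) =
  1 :> R.
Proof.
rewrite /unit_ball/= => zB; rewrite -powRD ?subrr ?powRr0//.
by rewrite eqxx subr_eq0 eq_sym lt_eqF.
Qed.

Lemma cmeas_kernel F : fmeas F -> cmeas B (toeplitz_kernel F).
Proof.
move=> mF; apply: cmeasM.
  by apply: cmeasM => //; apply: cintegrable_meas; exact: hphi.
by apply: cmeas_real; apply: measurable_funTS; exact: measurable_weight.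
Qed.

Lemma kernel_le F C u : B u ->
  normc (F (cvec u)) <= C * (1 - sqnorm (cvec u)) `^ (- lam) ->
  normc (toeplitz_kernel F u) <= C * normc (phi (cvec u)).
Proof.
move=> uB HF; rewrite !Normc.normcM normc_real ger0_norm ?powR_ge0//.
rewrite mulrAC ler_wpM2r ?normc_ge0//.
apply: le_trans (ler_wpM2r (powR_ge0 _ _) HF) _.
by rewrite -mulrA [X in _ * X]mulrC powR_cancel// mulr1.
Qed.

Lemma kernel_integral F C : fmeas F ->
  (forall z, unit_ball z -> normc (F z) <= C * (1 - sqnorm z) `^ (- lam)) ->
  cintegrable ta B (toeplitz_kernel F) /\ normc (cint ta B (toeplitz_kernel F)) <= C * L1n.
Proof.
move=> mF HF.
have ig : ta.-integrable B (EFin \o (fun u => C * normc (phi (cvec u)))).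
  by have := integrableZl mB C integrable_phi; apply: eq_integrable.
have le u : B u -> normc (toeplitz_kernel F u) <= C * normc (phi (cvec u)).
  by move=> uB; apply: kernel_le => //; exact: HF.
have ci := le_cintegrable mB (cmeas_kernel mF) ig le.
split=> //; apply: le_trans (normc_cint_le mB ci ig le) _.
by rewrite RintegralZl//; exact: integrable_phi.
Qed.

Lemma toeplitzE f g : Q f g = (cl%:C)%C * cint ta B (toeplitz_kernel (fun z => (f z)^*%C * g z)).
Proof.
congr (_ * _); apply: eq_cint => u _; rewrite /toeplitz_kernel; ring.
Qed.

Lemma growth_prod f g C D z : growth f C -> growth g D -> 0 <= C -> 0 <= D -> unit_ball z ->
  normc ((f z)^*%C * g z) <= Num.sqrt (C * D) * (1 - sqnorm z) `^ (- lam).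
Proof.
move=> gf gg C0 D0 zB; have W0 := powR_ge0 (1 - sqnorm z) (- lam).
set W := _ `^ _ in W0 *; have S0 : 0 <= Num.sqrt (C * D) * W by rewrite mulr_ge0 ?sqrtr_ge0.
rewrite -(@ler_pXn2r _ 2) ?nnegrE ?normc_ge0//.
rewrite Normc.normcM normc_conj !exprMn sqr_sqrtr ?mulr_ge0//.
rewrite [leRHS](_ : _ = (C * W) * (D * W)); last by ring.
by apply: ler_pM; rewrite ?sqr_ge0//; [exact: gf|exact: gg].
Qed.

Lemma fmeas_prod f g : fmeas f -> fmeas g -> fmeas (fun z => (f z)^*%C * g z).
Proof. by move=> mf mg; apply: cmeasM => //; exact: cmeasJ. Qed.

Lemma toeplitz_integrable f g C D : fmeas f -> fmeas g -> growth f C -> growth g D ->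
  0 <= C -> 0 <= D -> cintegrable ta B (toeplitz_kernel (fun z => (f z)^*%C * g z)).
Proof.
move=> mf mg gf gg C0 D0.
by have [] := kernel_integral (fmeas_prod mf mg) (fun z zB => growth_prod gf gg C0 D0 zB).
Qed.

Lemma toeplitz_linear (c : Cplx R) f g h C D E : fmeas f -> fmeas g -> fmeas h ->
  growth f C -> growth g D -> growth h E -> 0 <= C -> 0 <= D -> 0 <= E ->
  Q f (c *: g + h) = c * Q f g + Q f h.
Proof.
move=> mf mg mh gf gg gh C0 D0 E0; rewrite !toeplitzE.
have i1 := toeplitz_integrable mf mg gf gg C0 D0.
have i2 := toeplitz_integrable mf mh gf gh C0 E0.
rewrite mulrCA -mulrDr -(cintZ mB c i1) -(cintD mB (cintegrableZ mB c i1) i2); congr (_ * _).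
apply: eq_cint => u _; rewrite /toeplitz_kernel.
rewrite (_ : (c *: g + h) (cvec u) = c * g (cvec u) + h (cvec u))//; ring.
Qed.

Lemma toeplitz_conj_linear (c : nat -> Cplx R) (e : nat -> fct) g N (C : nat -> R) D :
  (forall i, fmeas (e i)) -> fmeas g ->
  (forall i, growth (e i) (C i)) -> growth g D -> (forall i, 0 <= C i) -> 0 <= D ->
  Q (fun z => \sum_(i < N) c i * e i z) g = \sum_(i < N) (c i)^*%C * Q (e i) g.
Proof.
move=> me mg ge gg C0 D0; rewrite toeplitzE.
have ii i := toeplitz_integrable (me i) mg (ge i) gg (C0 i) D0.
under [RHS]eq_bigr do rewrite toeplitzE mulrCA.
rewrite -mulr_sumr; congr (_ * _).
under eq_bigr => i _ do rewrite -(cintZ mB (c i)^*%C (ii i)).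
rewrite -cint_sum//; last by move=> i; exact: cintegrableZ.
apply: eq_cint => u _; rewrite /toeplitz_kernel rmorph_sum/= !mulr_suml.
by apply: eq_bigr => i _; rewrite rmorphM; ring.
Qed.

(* Duality: with S the sum on the left, S = |c_lam int F phi (1-|z|^2)^lam dtau|
   for F = sum k_i conj(Q_ij) conj(m_i) g_j, and Cauchy-Schwarz gives
   |F|^2 <= S (1-|z|^2)^(-2 lam). *)
Lemma toeplitz_duality (k : nat -> R) (mo g : nat -> fct) C (D : nat -> R) P J :
  (forall i, 0 < k i) -> (forall i, fmeas (mo i)) -> (forall j, fmeas (g j)) -> 0 <= C ->
  (forall j, 0 <= D j) -> (forall j, growth (g j) (D j)) ->
  (forall z, unit_ball z -> \sum_(i < P) k i * normc (mo i z) ^+ 2 <= (1 - sqnorm z) `^ (- lam)) ->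
  (forall z, unit_ball z -> \sum_(j < J) normc (g j z) ^+ 2 <= C * (1 - sqnorm z) `^ (- lam)) ->
  \sum_(i < P) \sum_(j < J) k i * normc (Q (mo i) (g j)) ^+ 2 <= C * (cl * L1n) ^+ 2.
Proof.
move=> k0 mmo mg C0 D0 gg Hmo Hg.
pose q i j := Q (mo i) (g j); rewrite -[X in X <= _]/(\sum_(i < P) \sum_(j < J) k i *
  normc (q i j) ^+ 2).
pose S := \sum_(p : 'I_P * 'I_J) k p.1 * normc (q p.1 p.2) ^+ 2.
rewrite [leLHS](_ : _ = S); last by rewrite pair_bigA.
have S0 : 0 <= S by apply: sumr_ge0 => p _; rewrite mulr_ge0 ?sqr_ge0// ltW.
pose x (p : 'I_P * 'I_J) := ((k p.1)%:C)%C * (q p.1 p.2)^*%C.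
pose y (p : 'I_P * 'I_J) z := (mo p.1 z)^*%C * g p.2 z.
pose F z := \sum_p x p * y p z.
(* Keeping a single term of the kernel bound controls each monomial, enough to integrate every
   product separately. *)
have gmo (i : 'I_P) : growth (mo i) (k i)^-1.
  move=> z zB; rewrite mulrC ler_pdivlMr// mulrC; apply: le_trans (Hmo z zB).
  rewrite (bigD1 i)//= lerDl; apply: sumr_ge0 => i' _.
  by rewrite mulr_ge0 ?sqr_ge0// ltW.
have ik (p : 'I_P * 'I_J) : cintegrable ta B (toeplitz_kernel (y p)).
  by apply: (toeplitz_integrable (mmo p.1) (mg p.2) (gmo p.1) (gg p.2)) => //; rewrite invr_ge0 ltW.
have mF : fmeas F.
  apply: cmeas_sum => p; apply: cmeasM; first exact: cmeas_cst.
  exact: fmeas_prod.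
have SE : (S%:C)%C = (cl%:C)%C * cint ta B (toeplitz_kernel F).
  rewrite (@eq_cint _ _ _ _ _ _ (fun u => \sum_p x p * toeplitz_kernel (y p) u)); last first.
    move=> u _; rewrite /toeplitz_kernel /F !mulr_suml; apply: eq_bigr => p _; ring.
  rewrite cint_sum//; last by move=> p; exact: cintegrableZ.
  rewrite mulr_sumr /S rmorph_sum; apply: eq_bigr => p _.
  have QE : (cl%:C)%C * cint ta B (toeplitz_kernel (y p)) = q p.1 p.2 by rewrite -toeplitzE.
  rewrite (cintZ mB (x p) (ik p)) [RHS]mulrCA [X in _ = _ * X]QE /x -mulrA cnormsq.
  by rewrite -rmorphM.
have FB z : unit_ball z -> normc (F z) <= Num.sqrt (S * C) * (1 - sqnorm z) `^ (- lam).
  move=> zB; have W0 : 0 <= (1 - sqnorm z) `^ (- lam) by exact: powR_ge0.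
  rewrite -(@ler_pXn2r _ 2) ?nnegrE ?normc_ge0 ?mulr_ge0 ?sqrtr_ge0//.
  apply: le_trans (weighted_cauchy_schwarz _ x (fun p => y p z) (fun p : 'I_P * 'I_J => k0 p.1)) _.
  rewrite exprMn sqr_sqrtr ?mulr_ge0// -mulrA.
  have -> : \sum_(p : 'I_P * 'I_J) normc (x p) ^+ 2 / k p.1 = S.
    apply: eq_bigr => p _; rewrite Normc.normcM normc_conj normc_real ger0_norm ?(ltW (k0 _))//.
    by field; rewrite gt_eqF.
  rewrite ler_wpM2l//.
  have -> : \sum_(p : 'I_P * 'I_J) k p.1 * normc (y p z) ^+ 2 =
      (\sum_(i < P) k i * normc (mo i z) ^+ 2) * (\sum_(j < J) normc (g j z) ^+ 2).
    rewrite mulr_suml; under [RHS]eq_bigr do rewrite mulr_sumr.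
    rewrite pair_bigA; apply: eq_bigr => p _ /=.
    by rewrite Normc.normcM normc_conj exprMn mulrA.
  rewrite [leRHS](_ : _ = (1 - sqnorm z) `^ (- lam) * (C * (1 - sqnorm z) `^ (- lam)));
    last by ring.
  apply: ler_pM; [| |exact: Hmo|exact: Hg].
    by apply: sumr_ge0 => i _; rewrite mulr_ge0 ?sqr_ge0// ltW.
  by apply: sumr_ge0 => j _; exact: sqr_ge0.
have [_ IB] := kernel_integral mF FB.
have : normc ((S%:C)%C) <= `|cl| * (Num.sqrt (S * C) * L1n).
  by rewrite SE Normc.normcM normc_real ler_wpM2l.
rewrite normc_real ger0_norm// => SB.
(* Squaring removes the root; one factor S then cancels, unless S = 0, where the claim is
   trivial. *)
have : S ^+ 2 <= S * (C * (cl * L1n) ^+ 2).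
  have : S ^+ 2 <= (`|cl| * (Num.sqrt (S * C) * L1n)) ^+ 2.
    by rewrite lerXn2r ?nnegrE// (le_trans S0 SB).
  rewrite !exprMn sqr_sqrtr ?mulr_ge0// real_normK ?num_real// => /le_trans; apply.
  by rewrite le_eqVlt; apply/orP; left; apply/eqP; ring.
case: (ltrgt0P S) S0 => // [S0 _|-> _ _].
  by rewrite expr2 ler_pM2l.
by rewrite mulr_ge0// sqr_ge0.
Qed.

Lemma toeplitz_cvg (f_ : nat -> fct) f g C D : (forall N, fmeas (f_ N)) -> fmeas g ->
  (forall N, growth (f_ N) C) -> growth g D -> 0 <= C -> 0 <= D ->
  (forall z, unit_ball z -> ccvg (f_ ^~ z) (f z)) ->
  ccvg (fun N => Q (f_ N) g) (Q f g).
Proof.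
move=> mf mg gf gg C0 D0 cf; rewrite toeplitzE.
under eq_fun do rewrite toeplitzE.
apply: ccvgM; first exact: ccvg_cst.
have [||||_] // := @cdominated _ _ _ ta B mB
  (fun N => toeplitz_kernel (fun z => (f_ N z)^*%C * g z))
  (toeplitz_kernel (fun z => (f z)^*%C * g z))
  (fun u => Num.sqrt (C * D) * normc (phi (cvec u))).
- by move=> N; apply: cmeas_kernel; exact: fmeas_prod.
- move=> u uB; apply: ccvgM; last exact: ccvg_cst.
  apply: ccvgM; last exact: ccvg_cst.
  by apply: ccvgM; [apply: ccvgJ; exact: cf|exact: ccvg_cst].
- by have := integrableZl mB (Num.sqrt (C * D)) integrable_phi; apply: eq_integrable.
- by move=> N u uB; apply: kernel_le => //; exact: (growth_prod (gf N) gg C0 D0 uB).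
Qed.
End ToeplitzForm.

(** * Construction, Hilbert-Schmidt bound and uniqueness of the operator *)

Section ToeplitzOperator.
Variables (R : realType) (d : nat) (lam : R) (n : nat) (nu : nat -> d.-tuple nat).
Hypothesis nu_bij : bijective nu.
Hypothesis lam0 : 0 < lam.
Hypothesis dsg : d%:R < lam + (2 * n)%:R.
Variable phi : 'rV[Cplx R]_d -> Cplx R.
Hypothesis hphi : in_L1_tau phi.
Local Notation H := (bergman d lam n).
Local Notation B := (@cball R d).
Local Notation Cd := 'rV[Cplx R]_d.
Local Notation fct := (Cd -> Cplx R).
Local Notation kap := (fun i => kappa lam (nu i)).
Local Notation Q := (toeplitz_form lam phi).
Local Notation cl := (clam d lam).
Local Notation ip := (@bergman_ip R d lam n).
Local Notation nrm := (ip_norm ip).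
Local Notation L := (L1n phi).
Implicit Types (f g h : H) (z : Cd).

Let kap0 i : 0 < kap i. Proof. exact: kappa_gt0. Qed.
Let kapV i : 0 <= (kap i)^-1. Proof. by rewrite invr_ge0 ltW. Qed.

Definition mono i : fct := fun z => mon (nu i) (rtup z).
Definition toeplitz_coef g i : R[i] := ((kap i)%:C)%C * Q (mono i) g.

Lemma fmeas_mono i : fmeas (mono i).
Proof.
apply: eq_cmeas (cmeas_nmon nu B i) => u _.
by rewrite /mono /nmon cvec_zvec trowK.
Qed.

Lemma growth_mono i : growth lam (mono i) (kap i)^-1.
Proof.
move=> z zB; rewrite mulrC ler_pdivlMr// mulrC.
apply: le_trans (kappa_mon_le nu_bij lam0 i.+1 zB); rewrite big_ord_recr/= lerDr.
by apply: sumr_ge0 => j _; rewrite mulr_ge0 ?sqr_ge0// ltW.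
Qed.

Lemma growth_bergman f : growth lam f (nrm f ^+ 2).
Proof. by move=> z; exact: (bergman_point nu_bij lam0 dsg). Qed.

Lemma fmeas_bergman f : fmeas f. Proof. exact: bergman_cmeas. Qed.

(** Used twice: a single function with C its squared norm gives boundedness of the operator, an
    orthonormal system with C = 1 gives the Hilbert-Schmidt bound. *)
Lemma toeplitz_coef_sum (g : nat -> H) C P J : 0 <= C ->
  (forall z, unit_ball z -> \sum_(j < J) normc (g j z) ^+ 2 <= C * (1 - sqnorm z) `^ (- lam)) ->
  \sum_(i < P) \sum_(j < J) normc (toeplitz_coef (g j) i) ^+ 2 / kap i <= C * (cl * L) ^+ 2.
Proof.
move=> C0 Hg; apply: le_trans (toeplitz_duality hphi (P := P) kap0 fmeas_mono
  (fun j => fmeas_bergman (g j)) C0 (fun j => sqr_ge0 _) (fun j => growth_bergman (g j)) _ Hg);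
    last first.
  by move=> z zB; exact: kappa_mon_le.
apply: ler_sum => i _; apply: ler_sum => j _.
rewrite /toeplitz_coef Normc.normcM normc_real ger0_norm ?(ltW (kap0 i))//.
rewrite le_eqVlt; apply/orP; left; apply/eqP; field.
by rewrite gt_eqF.
Qed.

Lemma toeplitz_coef_bound g : l2bound lam nu (toeplitz_coef g) (nrm g ^+ 2 * (cl * L) ^+ 2).
Proof.
move=> N; have := @toeplitz_coef_sum (fun=> g) (nrm g ^+ 2) N 1 (sqr_ge0 _).
under eq_bigr do rewrite big_ord1.
by apply => z zB; rewrite big_ord1; exact: growth_bergman.
Qed.

Lemma toeplitz_operator : exists T : H -> H, forall g, represents nu (T g) (toeplitz_coef g).
Proof.
have [T TE] := choice (fun g => bergman_make nu_bij lam0 dsg (toeplitz_coef_bound g)).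
by exists T.
Qed.

Section Operator.
Variable T : H -> H.
Hypothesis TE : forall g, represents nu (T g) (toeplitz_coef g).

Lemma operator_linear (c : Cplx R) g h : T (c *: g + h) = c *: T g + T h.
Proof.
apply: bergman_ext => z zB.
apply: (represents_eq (TE _) _ zB).
apply: eq_represents (represents_linear c (TE g) (TE h)) => i.
rewrite /toeplitz_coef.
rewrite [Q _ (c *: g + h : H)](toeplitz_linear hphi c (fmeas_mono i) (fmeas_bergman g)
  (fmeas_bergman h)
  (growth_mono i) (growth_bergman g) (growth_bergman h))//; first ring.
- exact: sqr_ge0.
- exact: sqr_ge0.
Qed.

Lemma operator_norm g : nrm (T g) <= `|cl| * L * nrm g.
Proof.
have := bergman_norm_le nu_bij lam0 dsg (TE g) (toeplitz_coef_bound g).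
have L0 := L1n_ge0 phi.
have r0 : 0 <= `|cl| * L * nrm g by apply: mulr_ge0; [exact: mulr_ge0|exact: sqrtr_ge0].
move=> /le_trans H1; rewrite -(@ler_pXn2r _ 2) ?nnegrE ?sqrtr_ge0//; apply: H1.
by rewrite !exprMn real_normK ?num_real// mulrC.
Qed.

(** Holds for all f and g. For a Taylor polynomial of f both sides are the same finite sum; the
    polynomials have a common growth bound, the weight compensates the growth, and phi in L^1 makes
    the limit dominated. *)
Lemma operator_form f g : ip f (T g) = Q f g.
Proof.
have [a fa] := bergman_represents nu_bij f.
have [s E] := bergman_ip_csum nu_bij lam0 dsg fa (TE g).
apply: (ccvg_unique (x := fun N => Q (fun z => \sum_(i < N) a i * mono i z) g)).
  have := csum_partial s; rewrite -E; congr ccvg; apply/funext => N.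
  rewrite (toeplitz_conj_linear hphi a N fmeas_mono (fmeas_bergman g) growth_mono
    (growth_bergman g))//.
    apply: eq_bigr => i _; rewrite /toeplitz_coef rmorphV ?unitfE ?gt_eqF ?ltcR//=.
    by field; rewrite gt_eqF// ltcR.
  exact: sqr_ge0.
have aC := bergman_norm_bound nu_bij lam0 dsg fa.
apply: (toeplitz_cvg hphi (C := nrm f ^+ 2) (D := nrm g ^+ 2)) => //.
- by move=> N; apply: cmeas_sum => i; apply: cmeasM; [exact: cmeas_cst|exact: fmeas_mono].
- exact: fmeas_bergman.
- by move=> N z zB; exact: (l2bound_partial nu_bij lam0 N aC zB).
- exact: growth_bergman.
- exact: sqr_ge0.
- exact: sqr_ge0.
- move=> z zB; rewrite (fa.2 z zB); apply: csum_partial.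
  exact: (represents_csummable fa zB).
Qed.

(** The sums over i and j stay finite until the bound is obtained; letting P tend to infinity then
    computes each norm of T e_j. *)
Lemma operator_partial_hs (e : nat -> H) J : (forall i j, ip (e i) (e j) = (i == j)%:R) ->
  \sum_(j < J) nrm (T (e j)) ^+ 2 <= (cl * L) ^+ 2.
Proof.
move=> on; pose S P := \sum_(j < J) \sum_(i < P) normc (toeplitz_coef (e j) i) ^+ 2 / kap i.
have cv : S P @[P --> \oo] --> \sum_(j < J) nrm (T (e j)) ^+ 2.
  by apply: cvg_big => [|j _]; [exact: add_continuous|exact:
    (bergman_norm nu_bij lam0 dsg (TE (e j))).2].
rewrite -(cvg_lim _ cv)//; apply: limr_le; first exact: cvgP cv.
apply: nearW => P; rewrite /S exchange_big/= -[leRHS]mul1r.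
apply: toeplitz_coef_sum => // z zB; rewrite mul1r.
exact: (orthonormal_point nu_bij lam0 dsg J on zB).
Qed.

Lemma operator_hs (e : nat -> H) : (forall i j, ip (e i) (e j) = (i == j)%:R) ->
  (hs_norm ip e T <= (`|cl| * L)%:E)%E.
Proof.
move=> on; have L0 := L1n_ge0 phi.
have -> : ((`|cl| * L)%:E = ((cl * L) ^+ 2)%:E `^ (2^-1))%E.
  by rewrite poweR_EFin powR12_sqrt ?sqr_ge0// sqrtr_sqr normrM (ger0_norm L0).
rewrite /hs_norm; apply: gt0_ler_poweR => //.
- by rewrite in_itv/= leey andbT; apply: nneseries_ge0 => i _ _; rewrite lee_fin sqr_ge0.
- by rewrite in_itv/= leey andbT lee_fin sqr_ge0.
apply: lime_le; first by apply: is_cvg_nneseries => i _ _; rewrite lee_fin sqr_ge0.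
apply: nearW => J; rewrite big_mkord sumEFin lee_fin.
exact: operator_partial_hs.
Qed.

(** On a bounded h the two operators have the same coefficients, by testing against the bounded
    monomials. Any g is a polynomial plus a small remainder, and boundedness of both operators and
    of evaluation at z makes the contribution of the remainder small. *)
Lemma operator_unique (S : H -> H) : bounded_operator ip S ->
  (forall f g, bounded_on_ball f -> bounded_on_ball g -> ip f (S g) = Q f g) -> T = S.
Proof.
move=> [Slin [M SM]] SQ; have [e eE] := @monomial_system _ _ _ n _ nu_bij lam0 dsg.
have bd h : bounded_on_ball h -> T h = S h.
  move=> hb; have [b Sb] := bergman_represents nu_bij (S h).
  apply: bergman_ext => z zB; apply: (represents_eq (TE h) _ zB).
  apply: eq_represents (Sb) => i.
  (* Pairing with the i-th normalized monomial reads off the i-th coefficient up to a nonzero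
     factor. *)
  have : ip (e i) (S h) = ip (e i) (T h).
    by rewrite operator_form SQ//; exact: (monomial_bounded eE).
  rewrite (monomial_ip nu_bij lam0 dsg eE i Sb) (monomial_ip nu_bij lam0 dsg eE i (TE h)).
  apply: mulfI; rewrite fmorph_eq0 invr_eq0 gt_eqF// sqrtr_gt0; exact: kap0.
apply/funext => g; apply: bergman_ext => z zB.
(* The sum of two operator bounds times the norm of the evaluation at z; M comes with no sign, hence
   its absolute value. *)
pose K := (`|cl| * L + `|M|) * Num.sqrt ((1 - sqnorm z) `^ (- lam)).
have L0 := L1n_ge0 phi.
have K0 : 0 <= K by rewrite mulr_ge0 ?sqrtr_ge0// addr_ge0// mulr_ge0.
have pt f : normc (f z) <= nrm f * Num.sqrt ((1 - sqnorm z) `^ (- lam)).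
  rewrite -(@ler_pXn2r _ 2) ?nnegrE ?normc_ge0 ?mulr_ge0 ?sqrtr_ge0//.
  have -> : (nrm f * Num.sqrt ((1 - sqnorm z) `^ (- lam))) ^+ 2 = nrm f ^+ 2 *
    (1 - sqnorm z) `^ (- lam).
    by rewrite exprMn (sqr_sqrtr (powR_ge0 _ _)).
  exact: (growth_bergman f zB).
have small eps : 0 < eps -> normc (T g z - S g z) <= K * eps.
  move=> eps0; have [N [c Nc]] := monomial_dense nu_bij lam0 dsg eE g eps0.
  set h := \sum_(i < N) _ in Nc; set u := g - h in Nc.
  have gE : g = (1 : Cplx R) *: u + h by rewrite scale1r subrK.
  have hb : bounded_on_ball h := monomial_sum_bounded eE N c.
  have -> : T g z - S g z = T u z - S u z.
    have -> : T g = T u + S h by rewrite {1}gE operator_linear scale1r (bd _ hb).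
    have -> : S g = S u + S h by rewrite {1}gE Slin scale1r.
    rewrite -[(T u + S h : H) z]/(T u z + S h z) -[(S u + S h : H) z]/(S u z + S h z); ring.
  apply: (@le_trans _ _ (normc (T u z) + normc (S u z))).
    by rewrite -[normc (S u z)]normcN; exact: le_normcD.
  have s0 := sqrtr_ge0 ((1 - sqnorm z) `^ (- lam)).
  rewrite /K mulrAC; apply: (@le_trans _ _ ((nrm (T u) + nrm (S u)) *
    Num.sqrt ((1 - sqnorm z) `^ (- lam)))).
    by rewrite mulrDl lerD.
  rewrite ler_wpM2r//; have u0 : 0 <= nrm u by exact: sqrtr_ge0.
  apply: (@le_trans _ _ ((`|cl| * L + `|M|) * nrm u)).
    rewrite mulrDl; apply: lerD; first exact: operator_norm.
    by apply: le_trans (SM u) _; rewrite ler_wpM2r// ler_norm.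
  by rewrite ler_wpM2l ?(ltW Nc)// addr_ge0// mulr_ge0.
apply/eqP; rewrite -subr_eq0 -normc_eq0E; apply: contraT => x0.
have {}x0 : 0 < normc (T g z - S g z) by rewrite lt_neqAle eq_sym x0 normc_ge0.
have K1 : 0 < K + 1 by lra.
(* For x the modulus of the difference, this eps would give x <= x / 2. *)
have := small (normc (T g z - S g z) / (K + 1) / 2) _.
rewrite !divr_gt0// => /(_ isT).
set x := normc _ in x0 *; have -> : K * (x / (K + 1) / 2) = x * (K / (K + 1) / 2) by ring.
rewrite -[leLHS]mulr1 ler_pM2l//.
have : K / (K + 1) <= 1 by rewrite ler_pdivrMr// mul1r; lra.
by move=> ? ?; exfalso; lra.
Qed.
End Operator.
End ToeplitzOperator.

Theorem theorem13 (R : realType) (d : nat) (hd : (1 <= d)%N)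
    (lam : R) (hlam : 0 < lam)
    (n : nat) (hn : d%:R < lam + (2 * n)%:R)
    (phi : 'rV[Cplx R]_d -> Cplx R) (hphi : in_L1_tau phi) :
  exists T : bergman d lam n -> bergman d lam n,
    unique
      (fun S : bergman d lam n -> bergman d lam n =>
         hilbert_schmidt (@bergman_ip R d lam n) S /\
         (forall f g : bergman d lam n,
            bounded_on_ball f -> bounded_on_ball g ->
            bergman_ip f (S g) = toeplitz_form lam phi f g)) T /\
    (forall e : nat -> bergman d lam n,
       orthonormal_basis (@bergman_ip R d lam n) e ->
       (hs_norm (@bergman_ip R d lam n) e T
          <= `|clam d lam|%:E * L1_norm_tau phi)%E).
Proof.
have [nu nu_bij] := @multi_index_enum d hd.
have [T TE] := @toeplitz_operator _ _ _ n _ nu_bij hlam hn _ hphi.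
have L1E := L1_normE hphi.
have THS e : orthonormal_basis (@bergman_ip R d lam n) e ->
    (hs_norm (@bergman_ip R d lam n) e T <= `|clam d lam|%:E * L1_norm_tau phi)%E.
  by move=> [on _]; rewrite L1E -EFinM; exact: (operator_hs nu_bij hlam hn hphi TE on).
exists T; split; last exact: THS.
split; last by move=> S [[Sb _] SQ]; exact: (operator_unique nu_bij hlam hn hphi TE Sb SQ).
split; last by move=> f g _ _; exact: (operator_form nu_bij hlam hn hphi TE).
split; first split.
- exact: (operator_linear nu_bij hlam hn hphi TE).
- exists (`|clam d lam| * L1n phi) => g; exact: (operator_norm nu_bij hlam hn hphi TE).
(* [hilbert_schmidt] asks for one basis with finite norm, and the normalized monomials provide
   it. *)
have [e eE] := @monomial_system _ _ _ n _ nu_bij hlam hn.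
have eB := monomial_basis nu_bij hlam hn eE.
exists e => //; apply: le_lt_trans (THS e eB) _.
by rewrite L1E -EFinM ltry.
Qed.
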